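(* Consider the spatial functional linear regression model, the data, the estimators $\widehat\beta,\widehat\beta_0$ and the predictions $\widehat Y_{\mathbf{i}_0},Y^*_{\mathbf{i}_0}$ at a non-visited site $\mathbf{i}_0\in\mathbb{Z}^d$ described in the context, with $p=p_n\to\infty$ and $\rho=\rho_n$ as $n\to\infty$. Assume: (1) $\beta$ is $m$-times differentiable and $\beta^{(m)}\in L^2([0,1])$. (2) There exist $\kappa\in(0,1)$, $\delta_1>0$, $C_1>0$ such that for any $(t,s)\in[0,1]^2$, $\mathbb{P}(|X(t)-X(s)|\le C_1|t-s|^\kappa)\ge 1-\delta_1$. (3) There are $C_2>0$ and $q\in(0,1)$ such that for all $r\in\mathbb{N}^*$ there is an $r$-dimensional linear subspace $\mathcal{L}_r$ of $L^2([0,1])$ with $\mathbb{E}\big(\inf_{f\in\mathcal{L}_r}\sup_t|X(t)-f(t)|^2\big)\le C_2r^{-2q}$. (4) There is $0<C_3<\infty$ such that for all $j,\ell\in\mathbb{N}^*$, $$\mathrm{Var}\Big(\frac1{n^d}\sum_{i=1}^{n^d}\langle X_{\mathbf{i}_i}-\mathbb{E}(X),\zeta_j\rangle\langle X_{\mathbf{i}_i}-\mathbb{E}(X),\zeta_\ell\rangle\Big)\le\frac{C_3}{n^d}\mathbb{E}\big(\langle X-\mathbb{E}(X),\zeta_j\rangle^2\big)\mathbb{E}\big(\langle X-\mathbb{E}(X),\zeta_\ell\rangle^2\big).$$ (5) $\{\epsilon_{\mathbf{i}}\}$ is a strictly stationary random field, polynomially mixing, independent of $\{X_{\mathbf{i}}\}$,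 with $\sup_{\mathbf{i}}|\epsilon_{\mathbf{i}}|<M_1$ a.s. for some $M_1>0$. (6) $\{(X_{\mathbf{i}},Y_{\mathbf{i}})\}$ is a strictly stationary and polynomially mixing random field. (7) There is $M_2>0$ such that $\|X_{\mathbf{i}}\|<M_2$ a.s. for all $\mathbf{i}\in\mathbb{Z}^d$. (8) $X$ is an isotropic process such that for all $t,u\in[0,1]$, $\mathrm{Cov}(X_{\mathbf{i}_i}(t),X_{\mathbf{i}_j}(u))=g(|t-u|)\,\varPsi(\delta(\{\mathbf{i}_i\},\{\mathbf{i}_j\}))$ and $\varPsi(0)=1$, where $g$ is a positive function and $\varPsi$ is a known $\mathbb{R}_+$-valued decreasing function with $\sum_{t=1}^\infty t^{d-1}\varPsi(t)<\infty$. (9) The non-visited site satisfies $\delta(\{\mathbf{i}_0\},\{\mathbf{i}_1,\dots,\mathbf{i}_{n^d}\})\ge\lfloor n^{2d/\theta}\rfloor$. (10) The mixing coefficients in (5) and (6) satisfy $\alpha_{1,\infty}(u)=O(u^{-\theta})$ with $\theta>d$, where $\theta$ is the same as in (9). (11) $\rho>n^{-2md}$, and the eigenvalues $\lambda_{x,1}\ge\dots\ge\lambda_{x,p}\ge0$ of $\frac1{n^dp}\mathbf{X}^T\mathbf{X}$ satisfy $\sum_{j=r+1}^p\lambda_{x,j}\le C\,r^{-2q}$ with $C>0$ and $r:=\lfloor\rho^{-1/(2m+2q+1)}\rfloor$. (12) $n^dp^{-2\kappa}=O(1)$, $\rho\to0$ and $1/(n^d\rho)\to0$ as $n,p\to\infty$.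 (13) $\sum_{j\ge1}\lambda_j^{1/4}<\infty$, $2q>1$, and $\rho\sim n^{-d(2m+2q+1)/(2m+2q+2)}$. If $p$ is chosen sufficiently large compared to $n^d$ (that is, there is a sequence $(P_n)$ such that the conclusion holds whenever $p=p_n\ge P_n$ for all $n$), then $$\mathbb{E}\left((\widehat{Y}_{\mathbf{i}_0}-Y^*_{\mathbf{i}_0})^2\,\middle|\,\widehat\beta_0,\widehat\beta\right)=O_p\left(n^{-d/(2m+2q+2)}\right).$$
   Context: Model: $d\ge1$, $Y_{\mathbf{i}}=\beta_0+\int_0^1\beta(t)X_{\mathbf{i}}(t)\,dt+\epsilon_{\mathbf{i}}$, $\mathbf{i}\in\mathbb{Z}^d$, where $Y_{\mathbf{i}}$ is real-valued, $X_{\mathbf{i}}$ is a square integrable random function on $I=[0,1]$, $\beta_0$ is a constant, $\beta$ is the unknown slope function, and $(\epsilon_{\mathbf{i}})$ is a centered random field with variance $\sigma_\epsilon^2>0$. All $(X_{\mathbf{i}},Y_{\mathbf{i}})$ have the same distribution as a pair $(X,Y)$. $\|\cdot\|$ and $\langle\cdot,\cdot\rangle$ are the usual norm and inner product of $L^2([0,1])$. Data: for $n\in\mathbb{N}^*$, the sites of $\{1,\dots,n\}^d$ are listed in lexicographic order as $\mathbf{i}_1,\dots,\mathbf{i}_{n^d}$; $(X_{\mathbf{i}_i},Y_{\mathbf{i}_i})$, $1\le i\le n^d$, are observed, each $X_{\mathbf{i}_i}$ at the points $t_j=j/p$, $j=1,\dots,p$. Set $\overline{Y}=n^{-d}\sum_i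 Y_{\mathbf{i}_i}$, $\overline{X}=n^{-d}\sum_iX_{\mathbf{i}_i}$, $\mathbf{Y}=(Y_{\mathbf{i}_1}-\overline{Y},\dots,Y_{\mathbf{i}_{n^d}}-\overline{Y})^T$, and let $\mathbf{X}$ be the $n^d\times p$ matrix with $(i,j)$ entry $X_{\mathbf{i}_i}(t_j)-\overline{X}(t_j)$. Estimators: let $m\ge1$ be an integer, and let $D_1,\dots,D_p$ be a basis of the $p$-dimensional space $NS^m(t_1,\dots,t_p)$ of natural splines of order $2m$ with knots $t_1,\dots,t_p$. Put $\mathbf{D}(t)=(D_1(t),\dots,D_p(t))^T$, and let $\mathbf{D}$ be the $p\times p$ matrix with $(j,i)$ entry $D_i(t_j)$. Let $\mathbf{P}_m$ be the orthogonal projection matrix of $\mathbb{R}^p$ onto $\{(\sum_{l=1}^m\theta_l t_j^{l-1})_{1\le j\le p}:\theta\in\mathbb{R}^m\}$, and $$\mathbf{A}_m=\mathbf{P}_m+p\,\mathbf{D}(\mathbf{D}^T\mathbf{D})^{-1}\Big[\int_0^1\mathbf{D}^{(m)}(t)\mathbf{D}^{(m)}(t)^T\,dt\Big](\mathbf{D}^T\mathbf{D})^{-1}\mathbf{D}^T .$$ For a smoothing parameter $\rho>0$, $$\widehat{\boldsymbol{\beta}}=\frac1{n^d}\Big(\frac1{n^dp}\mathbf{X}^T\mathbf{X}+\rho\mathbf{A}_m\Big)^{-1}\mathbf{X}^T\mathbf{Y},\qquad \widehat\beta(t)=\mathbf{D}(t)^T(\mathbf{D}^T\mathbf{D})^{-1}\mathbf{D}^T\widehat{\boldsymbol\beta},\qquad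 \widehat\beta_0=\overline{Y}-\langle\widehat\beta,\overline{X}\rangle.$$ Predictions: $\mathbf{i}_0\in\mathbb{Z}^d$ is a non-visited site, with $(X_{\mathbf{i}_0},Y_{\mathbf{i}_0})$ distributed as $(X,Y)$, and $\widehat Y_{\mathbf{i}_0}=\widehat\beta_0+\langle\widehat\beta,X_{\mathbf{i}_0}\rangle$, $Y^*_{\mathbf{i}_0}=\beta_0+\langle\beta,X_{\mathbf{i}_0}\rangle$. Covariance operator: $\Gamma u=\mathbb{E}(\langle u,X-\mathbb{E}(X)\rangle(X-\mathbb{E}(X)))$ on $L^2([0,1])$; $\{\zeta_j\}_{j\ge1}$ is a complete orthonormal system of eigenfunctions of $\Gamma$, $\zeta_j$ being associated with the $j$-th largest eigenvalue $\lambda_j$. Mixing: for sub-$\sigma$-algebras $\mathcal{U},\mathcal{V}$, $\alpha(\mathcal{U},\mathcal{V})=\sup\{|\mathbb{P}(A\cap B)-\mathbb{P}(A)\mathbb{P}(B)|:A\in\mathcal{U},B\in\mathcal{V}\}$. For a random field $(Z_{\mathbf{i}})_{\mathbf{i}\in\mathbb{Z}^d}$, $$\alpha_{1,\infty}(u)=\sup\{\alpha(\sigma(Z_{\mathbf{i}}),\sigma(Z_{\mathbf{j}};\mathbf{j}\in\Lambda)):\mathbf{i}\in\mathbb{Z}^d,\ \Lambda\subset\mathbb{Z}^d,\ \delta(\Lambda,\{\mathbf{i}\})\ge u\},$$ where $\delta(\Gamma_1,\Gamma_2)=\min\{\|\mathbf{i}-\mathbf{j}\|_2:\mathbf{i}\in\Gamma_1,\mathbf{j}\in\Gamma_2\}$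 with $\|\cdot\|_2$ the Euclidean norm. The field is polynomially mixing if $\alpha_{1,\infty}(u)=O(u^{-\theta})$ for some $\theta>0$. $\lfloor x\rfloor$ is the integer part of $x$. *)

(* Defs.v *)
From HB Require Import structures.
From mathcomp Require Import all_boot all_order all_algebra.
From mathcomp Require Import all_classical all_reals all_analysis.
(* not exported by all_analysis: the Borel sigma-algebra on [\bar R] *)
From mathcomp Require Import measurable_realfun.

Set Implicit Arguments.
Unset Strict Implicit.
Unset Printing Implicit Defensive.

Import Order.TTheory GRing.Theory Num.Theory.
Import numFieldNormedType.Exports.

Local Open Scope classical_set_scope.
Local Open Scope ring_scope.

(** Elements are represented by functions [R -> R], of which only the values on
    [0,1] matter. *)
Section L2.
Context {R : realType}.
Implicit Types (f g : R -> R).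

Local Notation mu := (@lebesgue_measure R).

Definition in_L2 f := (f \_ `[0, 1]%classic) \in Lfun mu 2%:E.

Definition ip f g : R := \int[mu]_(t in `[0, 1]) (f t * g t).

(** Extended-real valued, so that [L2norm f < M%:E] forces the norm to be
    finite. *)
Definition L2norm f : \bar R := Lnorm mu 2%:E (EFin \o (f \_ `[0, 1]%classic)).

Definition ae_eq01 f g := {ae mu, forall t, t \in `[0, 1] -> f t = g t}.

Definition lin_comb r (e : 'I_r -> R -> R) (c : 'I_r -> R) : R -> R :=
  fun t => \sum_(k < r) c k * e k t.

(** [r]-dimensional linear subspaces of L^2([0,1]); the elements carry
    pointwise values, since suprema over all points of [0,1] of their distance
    to a process are taken below. *)
Definition L2_subspace_dim r (L : set (R -> R)) :=
  exists e : 'I_r -> R -> R,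
    [/\ forall k, in_L2 (e k),
        forall c, ae_eq01 (lin_comb e c) (cst 0) -> forall k, c k = 0 &
        L = range (lin_comb e)].

Definition complete_orthonormal (zeta : nat -> R -> R) :=
  [/\ forall j, in_L2 (zeta j),
      forall j k, ip (zeta j) (zeta k) = (j == k)%:R &
      forall f, in_L2 f -> (forall j, ip f (zeta j) = 0) ->
        ae_eq01 f (cst 0)].

(** Derivative on the closed interval [0,1], one-sided at the endpoints. *)
Definition derivative01 f f' :=
  forall t, t \in `[0, 1] ->
    (fun s => (f s - f t) / (s - t)) @ within `[0, 1]%classic t^' --> f' t.

Definition is_nth_derivative01 m f fm :=
  exists b : nat -> R -> R,
    [/\ forall t, t \in `[0, 1] -> b 0%N t = f t,
        forall k, (k < m)%N -> derivative01 (b k) (b k.+1) &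
        forall t, t \in `[0, 1] -> b m t = fm t].

End L2.

Section sites.
Context {R : realType} {d : nat}.

Definition site := 'rV[int]_d.

Definition dist2 (i j : site) : R :=
  Num.sqrt (\sum_(c < d) ((i 0 c - j 0 c)%:~R ^+ 2)).

(** The infimum is a minimum as soon as both sets are nonempty. *)
Definition delta (G1 G2 : set site) : R :=
  inf [set dist2 i j | i in G1 & j in G2].

(** The [k]-th site of {1..n}^d in lexicographic order, [k] counted from 0:
    its coordinates minus one are the base-[n] digits of [k], the most
    significant digit coming first. *)
Definition lex_site n (k : 'I_(n ^ d)) : site :=
  \row_(c < d) ((k %/ n ^ (d.-1 - c)) %% n).+1%:Z.

Definition grid n : set site := range (@lex_site n).

End sites.
Arguments site : clear implicits.

(** A random element is given by a family [Z : K -> Omega -> R] of real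
    coordinates, and a random field by [Z : site d -> K -> Omega -> R]; the
    sigma-algebras and laws are those generated by the coordinates. *)
Section fields.
Context {dO : measure_display} {Omega : measurableType dO} {R : realType}.
Variable P : probability Omega R.

Definition sigma_of {I : Type} (D : set I) (f : I -> Omega -> R) :
    set (set Omega) :=
  <<s \bigcup_(i in D) preimage_set_system setT (f i) measurable >>.

Definition same_law {K : Type} (U V : K -> Omega -> R) :=
  forall (r : nat) (k : 'I_r -> K) (B : 'I_r -> set R),
    (forall a, measurable (B a)) ->
    P [set w | forall a, B a (U (k a) w)] =
    P [set w | forall a, B a (V (k a) w)].

Definition indep_sigma (U V : set (set Omega)) :=
  forall A B, U A -> V B -> P (A `&` B) = (P A * P B)%E.

Definition alpha_mix (U V : set (set Omega)) : \bar R :=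
  ereal_sup [set `|P (A `&` B) - P A * P B|%E | A in U & B in V].

Context {d : nat} {K : Type}.
Implicit Type Z : site d -> K -> Omega -> R.

Definition sigma_field Z (L : set (site d)) : set (set Omega) :=
  sigma_of (L `*` setT) (fun ik : site d * K => Z ik.1 ik.2).

Definition strictly_stationary Z :=
  forall h : site d,
    same_law (fun ik : site d * K => Z (ik.1 + h) ik.2)
             (fun ik => Z ik.1 ik.2).

Definition alpha_1oo Z (u : R) : \bar R :=
  ereal_sup [set a | exists (i : site d) (L : set (site d)),
    u <= delta L [set i] /\
    a = alpha_mix (sigma_field Z [set i]) (sigma_field Z L)].

Definition mixing_rate Z (theta : R) :=
  exists C : R,
    \forall u \near +oo, (alpha_1oo Z u <= (C * u `^ (- theta))%:E)%E.

Definition polynomially_mixing Z := exists2 theta : R, 0 < theta &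
  mixing_rate Z theta.

(** [Z] is a version of the conditional expectation of the nonnegative random
    variable [W] given the sub-sigma-algebra [G]; by Radon-Nikodym versions
    always exist, without any integrability condition, since infinite values
    are allowed. *)
Definition cond_exp_version (G : set (set Omega)) (W Z : Omega -> \bar R) :=
  [/\ forall B : set (\bar R), measurable B -> G (Z @^-1` B),
      forall w, (0 <= Z w)%E &
      forall A, G A -> (\int[P]_(w in A) Z w = \int[P]_(w in A) W w)%E].

Definition bigO_p (Z : nat -> Omega -> \bar R) (a : nat -> R) :=
  forall e : R, 0 < e -> exists2 M : R, 0 < M &
    \forall n \near \oo,
      (P [set w | ((M * a n)%:E < `|Z n w|)%E] <= e%:E)%E.

End fields.

Section random_functions.
Context {dO : measure_display} {Omega : measurableType dO} {R : realType}.
Variable P : probability Omega R.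
Implicit Type X : Omega -> R -> R.

Definition unit_interval := {t : R | 0 <= t <= 1}.

Definition random_function X :=
  measurable_fun ([set: Omega] `*` (`[0, 1]%classic : set R))
    (fun wt => X wt.1 wt.2) /\
  {ae P, forall w, in_L2 (X w)}.

Definition fun_coord X (t : unit_interval) : Omega -> R := X ^~ (val t).

(** The random element [(X, Y)], or [(f, c)] for a random function together
    with a real random variable. *)
Definition pair_coord X (Y : Omega -> R) (c : option unit_interval) :
    Omega -> R :=
  if c is Some t then fun_coord X t else Y.

Definition mean_fun X (t : R) : R := fine ('E_P[X ^~ t])%E.

Definition centered X (m : R -> R) (w : Omega) (t : R) : R := X w t - m t.

Definition cov_op X (u : R -> R) (s : R) : R :=
  let Xc := centered X (mean_fun X) in
  fine ('E_P[fun w => (ip u (Xc w) * Xc w s)%R])%E.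

(** [lam j] is the [(j+1)]-st largest eigenvalue of the covariance operator of
    [X], with multiplicity, [zeta j] being an associated eigenfunction. *)
Definition cov_eigensystem X (lam : nat -> R) (zeta : nat -> R -> R) :=
  [/\ complete_orthonormal zeta,
      forall j, lam j.+1 <= lam j &
      forall j, ae_eq01 (cov_op X (zeta j)) (fun s => lam j * zeta j s)].

Definition sup_dist2 X (L : set (R -> R)) (w : Omega) : \bar R :=
  ereal_inf [set ereal_sup [set (`|X w t - f t| ^+ 2)%:E | t in `[0, 1]%classic]
            | f in L].

End random_functions.

Section splines.
Context {R : realType}.

Definition knot p j : R := j%:R / p%:R.

(** Natural splines of order [2m] with knots t_1, ..., t_p: splines of degree
    [2m-1], of class C^(2m-2), that are polynomials of degree less than [m]
    on either side of [t_1, t_p]. *)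
Definition natural_spline m p (f : R -> R) :=
  [/\ forall k, (k < (2 * m).-2)%N -> forall t : R, derivable (derive1n k f) t 1,
      forall k, (k <= (2 * m).-2)%N -> continuous (derive1n k f),
      forall j, (0 < j < p)%N -> exists2 q : {poly R}, (size q <= 2 * m)%N &
        forall t, knot p j <= t <= knot p j.+1 -> f t = q.[t],
      exists2 q : {poly R}, (size q <= m)%N &
        forall t, t <= knot p 1 -> f t = q.[t] &
      exists2 q : {poly R}, (size q <= m)%N &
        forall t, knot p p <= t -> f t = q.[t]].

Definition natural_spline_basis m p (D : 'I_p -> R -> R) :=
  [/\ forall i, natural_spline m p (D i),
      forall c, (forall t, lin_comb D c t = 0) -> forall i, c i = 0 &
      forall f, natural_spline m p f ->
        exists c, forall t, f t = lin_comb D c t].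

Definition basis_vec p (D : 'I_p -> R -> R) (t : R) : 'cV[R]_p :=
  \col_i D i t.

Definition basis_mx p (D : 'I_p -> R -> R) : 'M[R]_p :=
  \matrix_(j, i) D i (knot p j.+1).

(** The orthogonal projection of R^p onto the polynomials of degree less than
    [m] sampled at the knots.  [proj_mx] acts on row vectors, hence the
    transposition. *)
Definition poly_proj_mx m p : 'M[R]_p :=
  let V : 'M[R]_(m, p) := \matrix_(l < m, j < p) knot p j.+1 ^+ l in
  (proj_mx <<V>>%MS (orthomx idfun 1%:M V))^T.

Definition energy_mx m p (D : 'I_p -> R -> R) : 'M[R]_p :=
  \matrix_(i, j) ip (derive1n m (D i)) (derive1n m (D j)).

Definition penalty_mx m p (D : 'I_p -> R -> R) : 'M[R]_p :=
  let B := basis_mx D in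
  poly_proj_mx m p +
  p%:R *: (B *m invmx (B^T *m B) *m energy_mx m D *m invmx (B^T *m B) *m B^T).

End splines.

Section estimators.
Context {R : realType} {d : nat}.
(** One realization of the field [(X_i, Y_i)]. *)
Variables (X : site d -> R -> R) (Y : site d -> R) (n : nat).

Definition Ybar : R := (n ^ d)%:R^-1 * \sum_(k < n ^ d) Y (lex_site k).

Definition Xbar (t : R) : R :=
  (n ^ d)%:R^-1 * \sum_(k < n ^ d) X (lex_site k) t.

Definition Yvec : 'cV[R]_(n ^ d) := \col_k (Y (lex_site k) - Ybar).

Definition Xmx p : 'M[R]_(n ^ d, p) :=
  \matrix_(k, j) (X (lex_site k) (knot p j.+1) - Xbar (knot p j.+1)).

Definition gram_mx p : 'M[R]_p :=
  ((n ^ d)%:R * p%:R)^-1 *: ((Xmx p)^T *m Xmx p).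

Variables (m p : nat) (rho : R) (D : 'I_p -> R -> R).

Definition beta_hat_vec : 'cV[R]_p :=
  (n ^ d)%:R^-1 *:
    (invmx (gram_mx p + rho *: penalty_mx m D) *m (Xmx p)^T *m Yvec).

Definition beta_hat (t : R) : R :=
  let B := basis_mx D in
  ((basis_vec D t)^T *m invmx (B^T *m B) *m B^T *m beta_hat_vec) 0 0.

Definition beta0_hat : R := Ybar - ip beta_hat Xbar.

Definition prediction (x : R -> R) : R := beta0_hat + ip beta_hat x.

End estimators.

(** Multiplicities are counted through the characteristic polynomial. *)
Definition ordered_eigenvalues {R : realType} p (S : 'M[R]_p)
    (l : 'I_p -> R) :=
  (forall i j : 'I_p, (i <= j)%N -> l j <= l i) /\
  char_poly S = \prod_(j < p) ('X - (l j)%:P).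

(* Main.v *)
Require Import Defs.
From HB Require Import structures.
From mathcomp Require Import all_boot all_order all_algebra.
From mathcomp Require Import all_classical all_reals all_analysis.
From mathcomp Require Import measurable_realfun ring lra zify.

Set Implicit Arguments.
Unset Strict Implicit.
Unset Printing Implicit Defensive.

Import Order.TTheory GRing.Theory Num.Theory.
Import numFieldNormedType.Exports.

Local Open Scope classical_set_scope.
Local Open Scope ring_scope.

(** Write [N] for the number [n ^ d] of sites and [b] for [1 / (N * rho)]. The
    assumption on the smoothing parameter makes [b] of the order of the announced
    rate, and the theorem follows from two facts: the slope error is [O_p(b)] in the
    norm that matters for prediction, and this norm passes to the prediction error
    at a site so remote that its curve is almost independent of the data.

    The slope error. Let [w] be the difference between the vector [bhat] of estimated
    values at the knots and the values of [beta] there, and let [w_a] be the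
    coefficients of the corresponding step function on the eigenfunctions of the
    covariance operator. The quantity to be bounded is
      [Theta = \sum_(a < J) lam a * w_a ^+ 2 + rho * penalty w]   ([theta_of])
    where [J] is the integer part of [sqrt N]. The normal equation of the penalised
    least squares, tested against [w] ([energy_identity]), gives an inequality for
    [Theta] ([basic_inequality], [realization_bound]) as long as the empirical second
    moments of the first [J] scores are close to the eigenvalues. The terms of this
    inequality have the following sizes.
    - The noise is independent of the curves and its covariances are summable over
      the grid ([noise_cov_sum]). It contributes [1 / N] times the effective dimension
      [\sum_a lam a / (lam a + rho)], which is [O(rho ^ (- 1 / 2))] because the fourth
      roots of the eigenvalues are summable ([E_noise_energy], [effdim_le]).
    - For the same reason the scores of index at least [J] have a total variance
      [O(J ^ (- 3))], which is negligible against [rho * b = 1 / N] ([trace_tail]).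
    - The deviation of the empirical second moments is controlled by the assumption
      on their variances and by the effective dimension ([E_score_deviation]).
    - The penalty of the sampled slope [beta] is bounded: the penalty matrix is the
      energy of the interpolating natural spline plus a projection, and natural
      splines minimise the energy among interpolants ([energy_min], [penalty_le]).
      Since [beta] is differentiable [m] times with a derivative that is merely square
      integrable, the integrations by parts rely on a fundamental theorem of calculus
      for discontinuous derivatives ([ftc_deriv_on]).
    - The discretisation errors are negligible for a large number [p] of knots. For
      the curves this is the continuity at 0 of the covariance function, which holds
      for every jointly measurable stationary process because translations are
      continuous in the mean square ([cov_continuous0], [step_error]); for the slope,
      it is uniform continuity ([slope_step_error]); for the estimated spline, its
      distance to a step function is controlled by the penalty ([spline_eval_step]).
    By Markov's inequality, [Theta <= K * b] holds with a probability close to 1 when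
    [K] is large ([theta_tail]).

    The prediction error. A natural spline interpolates its values at the knots
    ([spline_eval_knot]), so that the event [Theta <= K * b] belongs to the
    sigma-algebra of the estimators. The conditional expectation is therefore
    [O_p(b)] as soon as the squared prediction error has an integral [O(b)] on this
    event ([cond_markov]). Up to the averages of the curves and of the noise over the
    grid, which are [O(N ^ (- 1 / 2))] in the mean square, and up to discretisation and
    truncation errors, the prediction error is the sum over [a < J] of [w_a] times the
    score of index [a] of the new curve. For an independent curve its mean square would
    be [\sum_(a < J) lam a * w_a ^+ 2 <= K * b]. The new site is at a distance
    at which the mixing coefficient is [O(N ^ (- 2))] ([far_site_mixing]); on the event
    the products [w_a * w_b] are bounded by [K * b / rho], the scores of the discretised
    curve are bounded after clipping, and there are at most [N] pairs of indices.
    Since [1 / rho = O(N)], replacing independence by mixing costs [O(b)] ([mix_E],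
    [prediction_error_bound]). *)

(** * Square integrable functions and orthonormal systems *)

Lemma sum_CS (R : realType) (I : Type) (r : seq I) (a b : I -> R) :
  (\sum_(i <- r) a i * b i) ^+ 2 <=
  (\sum_(i <- r) a i ^+ 2) * (\sum_(i <- r) b i ^+ 2).
Proof.
elim: r => [|i r IH]; first by rewrite !big_nil; lra.
rewrite !big_cons.
set A := \sum_(j <- r) a j ^+ 2 in IH *; set B := \sum_(j <- r) b j ^+ 2 in IH *.
set C := \sum_(j <- r) a j * b j in IH *.
have A0 : 0 <= A by apply: sumr_ge0 => ? _; exact: sqr_ge0.
have B0 : 0 <= B by apply: sumr_ge0 => ? _; exact: sqr_ge0.
suff H : 2 * (a i * b i) * C <= a i ^+ 2 * B + A * b i ^+ 2 by nra.
apply: le_trans (ler_norm _) _.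
rewrite -ler_sqr ?nnegrE; [|exact: normr_ge0|by rewrite addr_ge0// mulr_ge0// sqr_ge0].
rewrite -normrX ger0_norm ?sqr_ge0//.
rewrite !exprMn.
have h := ler_wpM2l (mulr_ge0 (sqr_ge0 (a i)) (sqr_ge0 (b i))) IH.
apply: (@le_trans _ _ (4 * ((a i ^+ 2 * b i ^+ 2) * (A * B)))); first lra.
have := sqr_ge0 (a i ^+ 2 * B - A * b i ^+ 2).
rewrite (_ : (a i ^+ 2 * B - A * b i ^+ 2) ^+ 2 = (a i ^+ 2 * B + A * b i ^+ 2) ^+ 2 - 4 * ((a i ^+ 2 * b i ^+ 2) * (A * B))); last by ring.
lra.
Qed.

Section L2_theory.
Context d (T : measurableType d) (R : realType).
Variables (mu : {measure set T -> \bar R}) (D : set T).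
Hypothesis mD : measurable D.
Implicit Types f g h : T -> R.

Definition itg f := mu.-integrable D (EFin \o f).

Lemma itg_meas f : itg f -> measurable_fun D f.
Proof. by move=> /measurable_int /measurable_EFinP. Qed.

Lemma itgD f g : itg f -> itg g -> itg (fun x => f x + g x).
Proof. by move=> hf hg; exact: (integrableD mD hf hg). Qed.

Lemma itgB f g : itg f -> itg g -> itg (fun x => f x - g x).
Proof. by move=> hf hg; exact: (integrableB mD hf hg). Qed.

Lemma itgZ k f : itg f -> itg (fun x => k * f x).
Proof. by move=> hf; exact: (integrableZl mD k hf). Qed.

Lemma itg0 : itg (fun=> 0).
Proof. exact: integrable0. Qed.

Lemma itg_sum (I : Type) (s : seq I) (P : pred I) (F : I -> T -> R) :
  (forall i, P i -> itg (F i)) -> itg (fun x => \sum_(i <- s | P i) F i x).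
Proof.
move=> hF; elim: s => [|i s IH].
  by rewrite (_ : (fun _ => _) = fun=> 0) ?itg0//; apply/funext => x; rewrite big_nil.
case Pi : (P i).
  rewrite (_ : (fun _ => _) = fun x => F i x + \sum_(i <- s | P i) F i x).
    by apply: itgD => //; exact: hF.
  by apply/funext => x; rewrite big_cons Pi.
rewrite (_ : (fun _ => _) = fun x => \sum_(i <- s | P i) F i x)//.
by apply/funext => x; rewrite big_cons Pi.
Qed.

Lemma itg_le f g : measurable_fun D f -> (forall x, D x -> `|f x| <= g x) ->
  itg g -> itg f.
Proof.
move=> mf fg ig; apply: (le_integrable mD _ _ ig); first exact/measurable_EFinP.
by move=> x Dx; rewrite /= lee_fin (le_trans (fg x Dx))// ler_norm.
Qed.

Lemma itg_abs f : itg f -> itg (fun x => `|f x|).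
Proof. exact: integrable_norm. Qed.

Lemma eq_itg f g : (forall x, D x -> f x = g x) -> itg f -> itg g.
Proof.
by move=> fg; apply: eq_integrable => // x /set_mem Dx; rewrite /= fg.
Qed.

Definition rint f : R := \int[mu]_(x in D) f x.

Lemma rintD f g : itg f -> itg g -> rint (fun x => f x + g x) = rint f + rint g.
Proof. by move=> hf hg; exact: RintegralD. Qed.

Lemma rintB f g : itg f -> itg g -> rint (fun x => f x - g x) = rint f - rint g.
Proof. by move=> hf hg; exact: RintegralB. Qed.

Lemma rintZ k f : itg f -> rint (fun x => k * f x) = k * rint f.
Proof. by move=> hf; exact: RintegralZl. Qed.

Lemma rint0 : rint (fun=> 0) = 0.
Proof. by rewrite /rint Rintegral_cst// mul0r. Qed.

Lemma eq_rint f g : (forall x, D x -> f x = g x) -> rint f = rint g.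
Proof. by move=> fg; apply: eq_Rintegral => x /set_mem Dx; exact: fg. Qed.

Lemma rint_sum (I : Type) (s : seq I) (P : pred I) (F : I -> T -> R) :
  (forall i, P i -> itg (F i)) ->
  rint (fun x => \sum_(i <- s | P i) F i x) = \sum_(i <- s | P i) rint (F i).
Proof.
move=> hF; elim: s => [|i s IH].
  by rewrite big_nil -[RHS]rint0; apply: eq_rint => x _; rewrite big_nil.
rewrite big_cons; case Pi : (P i).
  rewrite -IH -rintD; [|exact: hF|exact: itg_sum].
  by apply: eq_rint => x _; rewrite big_cons Pi.
by rewrite -IH; apply: eq_rint => x _; rewrite big_cons Pi.
Qed.

Lemma le_rint f g : itg f -> itg g -> (forall x, D x -> f x <= g x) ->
  rint f <= rint g.
Proof. by move=> hf hg; exact: le_Rintegral. Qed.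

Lemma rint_ge0 f : (forall x, D x -> 0 <= f x) -> 0 <= rint f.
Proof. exact: Rintegral_ge0. Qed.

Lemma le_abs_rint f : itg f -> `|rint f| <= rint (fun x => `|f x|).
Proof. exact: le_normr_Rintegral. Qed.

Lemma EFin_rint f : itg f -> (rint f)%:E = (\int[mu]_(x in D) (f x)%:E)%E.
Proof. by move=> hf; rewrite /rint /Rintegral fineK//; exact: integrable_fin_num. Qed.

Lemma ae_eq_rint f g : measurable_fun D f -> measurable_fun D g ->
  {ae mu, forall x, D x -> f x = g x} -> rint f = rint g.
Proof.
move=> mf mg fg; congr fine; apply: ae_eq_integral => //.
- exact/measurable_EFinP.
- exact/measurable_EFinP.
- by apply: filterS fg => x h Dx /=; rewrite h.
Qed.

Lemma ae_itg f g : measurable_fun D f -> measurable_fun D g ->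
  {ae mu, forall x, D x -> f x = g x} -> itg f -> itg g.
Proof.
move=> mf mg fg /integrableP[_ hf]; apply/integrableP; split.
  exact/measurable_EFinP.
rewrite (ae_eq_integral (abse \o (EFin \o f)))//.
- by apply: measurableT_comp => //; exact/measurable_EFinP.
- by apply: measurableT_comp => //; exact/measurable_EFinP.
- by apply: filterS fg => x h Dx /=; rewrite h.
Qed.

(** Functions are not taken modulo null sets, so that the values of a curve at the
    knots keep a meaning. *)
Definition dot f g : R := rint (fun x => f x * g x).

Definition sqi f := measurable_fun D f /\ itg (fun x => f x ^+ 2).

Lemma sqiM_itg f g : sqi f -> sqi g -> itg (fun x => f x * g x).
Proof.
move=> [mf hf] [mg hg]; apply: itg_le (itgD hf hg).
  exact: measurable_funM.
move=> x _; rewrite ler_norml.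
have := sqr_ge0 (f x - g x); have := sqr_ge0 (f x + g x).
have := sqr_ge0 (f x); have := sqr_ge0 (g x).
by move=> *; apply/andP; split; nra.
Qed.

Lemma sqiZ k f : sqi f -> sqi (fun x => k * f x).
Proof.
move=> [mf hf]; split; first exact: measurable_funM.
by apply: eq_itg (itgZ (k ^+ 2) hf) => x _; rewrite exprMn.
Qed.

Lemma sqiD f g : sqi f -> sqi g -> sqi (fun x => f x + g x).
Proof.
move=> sf sg; move: (sf) (sg) => [mf hf] [mg hg]; split.
  exact: measurable_funD.
apply: eq_itg (itgD (itgD hf hg) (itgZ 2 (sqiM_itg sf sg))) => x _.
by ring.
Qed.

Lemma sqiN f : sqi f -> sqi (fun x => - f x).
Proof. by move=> /(sqiZ (-1)); under [X in sqi X]eq_fun do rewrite mulN1r. Qed.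

Lemma sqiB f g : sqi f -> sqi g -> sqi (fun x => f x - g x).
Proof. by move=> hf /sqiN; exact: sqiD. Qed.

Lemma sqi0 : sqi (fun=> 0).
Proof.
by split => //; apply: eq_itg itg0 => x _; rewrite expr0n.
Qed.

Lemma sqi_sum (I : Type) (s : seq I) (F : I -> T -> R) :
  (forall i, sqi (F i)) -> sqi (fun x => \sum_(i <- s) F i x).
Proof.
move=> hF; elim: s => [|i s IH].
  rewrite (_ : (fun _ => _) = fun=> 0); first exact: sqi0.
  by apply/funext => x; rewrite big_nil.
rewrite (_ : (fun _ => _) = fun x => F i x + \sum_(i <- s) F i x).
  exact: sqiD.
by apply/funext => x; rewrite big_cons.
Qed.

Lemma eq_sqi f g : (forall x, D x -> f x = g x) -> sqi f -> sqi g.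
Proof.
move=> fg [mf hf]; split.
  by apply: eq_measurable_fun mf => x /set_mem Dx; rewrite fg.
by apply: eq_itg hf => x Dx; rewrite fg.
Qed.

Lemma dotC f g : dot f g = dot g f.
Proof. by apply: eq_rint => x _; rewrite mulrC. Qed.

Lemma eq_dot f g f' g' : (forall x, D x -> f x = f' x) ->
  (forall x, D x -> g x = g' x) -> dot f g = dot f' g'.
Proof. by move=> ff gg; apply: eq_rint => x Dx; rewrite ff// gg. Qed.

Lemma dotDl f g h : sqi f -> sqi g -> sqi h ->
  dot (fun x => f x + g x) h = dot f h + dot g h.
Proof.
move=> hf hg hh; rewrite /dot -rintD; [|exact: sqiM_itg..].
by apply: eq_rint => x _; rewrite mulrDl.
Qed.

Lemma dotBl f g h : sqi f -> sqi g -> sqi h ->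
  dot (fun x => f x - g x) h = dot f h - dot g h.
Proof.
move=> hf hg hh; rewrite /dot -rintB; [|exact: sqiM_itg..].
by apply: eq_rint => x _; rewrite mulrBl.
Qed.

Lemma dotZl k f h : sqi f -> sqi h -> dot (fun x => k * f x) h = k * dot f h.
Proof.
move=> hf hh; rewrite /dot -rintZ; [|exact: sqiM_itg].
by apply: eq_rint => x _; rewrite mulrA.
Qed.

Lemma dot_suml (I : Type) (s : seq I) (F : I -> T -> R) h :
  (forall i, sqi (F i)) -> sqi h ->
  dot (fun x => \sum_(i <- s) F i x) h = \sum_(i <- s) dot (F i) h.
Proof.
move=> hF hh; rewrite /dot -rint_sum; [|by move=> i _; exact: sqiM_itg].
by apply: eq_rint => x _; rewrite mulr_suml.
Qed.

Lemma dotDr f g h : sqi f -> sqi g -> sqi h ->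
  dot h (fun x => f x + g x) = dot h f + dot h g.
Proof. by move=> *; rewrite dotC dotDl// !(dotC h). Qed.

Lemma dotBr f g h : sqi f -> sqi g -> sqi h ->
  dot h (fun x => f x - g x) = dot h f - dot h g.
Proof. by move=> *; rewrite dotC dotBl// !(dotC h). Qed.

Lemma dotZr k f h : sqi f -> sqi h -> dot h (fun x => k * f x) = k * dot h f.
Proof. by move=> *; rewrite dotC dotZl// (dotC h). Qed.

Lemma dot_sumr (I : Type) (s : seq I) (F : I -> T -> R) h :
  (forall i, sqi (F i)) -> sqi h ->
  dot h (fun x => \sum_(i <- s) F i x) = \sum_(i <- s) dot h (F i).
Proof. by move=> *; rewrite dotC dot_suml//; apply: eq_bigr => i _; rewrite dotC. Qed.

Lemma dot_ge0 f : 0 <= dot f f.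
Proof. by apply: rint_ge0 => x _; rewrite -expr2 sqr_ge0. Qed.

Lemma CS f g : sqi f -> sqi g -> (dot f g) ^+ 2 <= dot f f * dot g g.
Proof.
move=> hf hg.
have key s t : 0 <= s ^+ 2 * dot f f + 2 * s * t * dot f g + t ^+ 2 * dot g g.
  have := dot_ge0 (fun x => s * f x + t * g x).
  rewrite dotDl ?dotDr ?dotZl ?dotZr//; try by [exact: sqiZ|apply: sqiD; exact: sqiZ].
  by rewrite (dotC g f); nra.
have f0 := dot_ge0 f; have g0 := dot_ge0 g.
have [fp|] := ltP 0 (dot f f).
  have := key (- dot f g) (dot f f).
  rewrite (_ : _ + _ + _ = dot f f * (dot f f * dot g g - dot f g ^+ 2)); last by ring.
  by rewrite pmulr_rge0// subr_ge0.
move=> fn; have {fn f0} f0 : dot f f = 0 by apply/le_anti/andP.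
have [->|c0] := eqVneq (dot f g) 0; first by rewrite f0 mul0r expr0n.
have := key (- (dot g g + 1) / (2 * dot f g)) 1.
rewrite f0 (_ : _ + _ + _ = -1); first by move=> ?; exfalso; lra.
by field.
Qed.

Section orthonormal.
Variable e : nat -> T -> R.
Hypothesis se : forall j, sqi (e j).
Hypothesis one : forall j k, dot (e j) (e k) = (j == k)%:R.

Definition oproj f J x := \sum_(a < J) dot f (e a) * e a x.
(** The squared norm of the component of [f] orthogonal to the first [J] functions,
    by Bessel's identity. *)
Definition resid f J := dot f f - \sum_(a < J) dot f (e a) ^+ 2.

Lemma sqi_oproj f J : sqi (oproj f J).
Proof. by apply: sqi_sum => a; exact: sqiZ. Qed.

Lemma dot_oproj f g J : sqi g ->
  dot (oproj f J) g = \sum_(a < J) dot f (e a) * dot g (e a).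
Proof.
move=> hg; rewrite /oproj dot_suml//; last by move=> a; exact: sqiZ.
by apply: eq_bigr => a _; rewrite dotZl// (dotC g).
Qed.

Lemma dot_oproj_e f J (a : nat) :
  dot (oproj f J) (e a) = if (a < J)%N then dot f (e a) else 0.
Proof.
rewrite dot_oproj//; case: ifPn => aJ.
  rewrite (bigD1 (Ordinal aJ))//= big1 ?addr0 ?one ?eqxx ?mulr1// => i ia.
  rewrite one (_ : (a == i) = false) ?mulr0//.
  by apply/negP => /eqP ai; move/negP: ia; apply; apply/eqP/val_inj.
rewrite big1// => i _; rewrite one (_ : (a == i) = false) ?mulr0//.
by apply/negP => /eqP ai; move: aJ; rewrite ai ltn_ord.
Qed.

Lemma residE f J K : sqi f -> (J <= K)%N ->
  dot (fun x => oproj f K x - oproj f J x) (fun x => oproj f K x - oproj f J x) =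
  resid f J - resid f K.
Proof.
move=> hf JK; have pJ := sqi_oproj f J; have pK := sqi_oproj f K.
have H A B : (A <= B)%N ->
  dot (oproj f A) (oproj f B) = \sum_(a < A) dot f (e a) ^+ 2.
  move=> AB; rewrite dot_oproj//; last exact: sqi_oproj.
  by apply: eq_bigr => a _; rewrite dot_oproj_e (leq_trans (ltn_ord a) AB).
rewrite dotBl ?dotBr//; try exact: sqiB.
rewrite (dotC (oproj f K) (oproj f J)) !H// /resid; lra.
Qed.

Lemma resid_sub f J : sqi f ->
  dot (fun x => f x - oproj f J x) (fun x => f x - oproj f J x) = resid f J.
Proof.
move=> hf; have pJ := sqi_oproj f J.
rewrite dotBl ?dotBr//; try exact: sqiB.
rewrite (dotC f) !dot_oproj// (_ : \sum_(a < J) dot f (e a) * dot (oproj f J) (e a) =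
  \sum_(a < J) dot f (e a) * dot f (e a)).
  by rewrite /resid; under [in RHS]eq_bigr do rewrite expr2; lra.
by apply: eq_bigr => a _; rewrite dot_oproj_e ltn_ord.
Qed.

Lemma resid_ge0 f J : sqi f -> 0 <= resid f J.
Proof. by move=> hf; rewrite -resid_sub// dot_ge0. Qed.

(** Cauchy-Schwarz inequality for the components of [f] and [g] orthogonal to the
    first [J] functions of the system. *)
Lemma resid_CS f g J : sqi f -> sqi g ->
  (dot f g - \sum_(a < J) dot f (e a) * dot g (e a)) ^+ 2 <=
  resid f J * dot g g.
Proof.
move=> hf hg; rewrite -dot_oproj// -dotBl//; last exact: sqi_oproj.
by rewrite -resid_sub//; apply: CS => //; apply: sqiB => //; exact: sqi_oproj.
Qed.

Lemma resid_decr f J K : sqi f -> (J <= K)%N -> resid f K <= resid f J.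
Proof. by move=> hf JK; rewrite -subr_ge0 -residE// dot_ge0. Qed.

Lemma rint_dct (h : nat -> T -> R) (f g : T -> R) :
  (forall n, measurable_fun D (h n)) -> measurable_fun D f ->
  {ae mu, forall x, D x -> h ^~ x @ \oo --> f x} ->
  itg g -> {ae mu, forall x n, D x -> `|h n x| <= g x} ->
  itg f /\ (fun n => rint (h n)) @ \oo --> rint f.
Proof.
move=> mh mf hf ig hg.
have [] := @dominated_convergence _ _ _ mu D mD (fun n => EFin \o h n) (EFin \o f)
  (EFin \o g).
- by move=> n; exact/measurable_EFinP.
- exact/measurable_EFinP.
- by apply: filterS hf => x hx Dx; apply: cvg_EFin; [exact: nearW|exact: hx].
- exact: ig.
- by apply: filterS hg => x hx n Dx /=; rewrite lee_fin hx.
move=> i1 _ c; split => //.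
apply: fine_cvg; move: c; rewrite /rint /Rintegral fineK//.
exact: integrable_fin_num.
Qed.

Section completeness.
Hypothesis complete : forall f, sqi f -> (forall j, dot f (e j) = 0) ->
  {ae mu, forall x, D x -> f x = 0}.

Lemma resid_fast f : sqi f -> exists J : nat -> nat,
  [/\ {homo J : m n / (m <= n)%N}, forall k, (k <= J k)%N &
  forall k K, (J k <= K)%N -> resid f (J k) - resid f K <= 4 ^- k].
Proof.
move=> hf.
have cv : cvgn (resid f).
  apply: nonincreasing_is_cvgn; first by move=> m n; exact: resid_decr.
  by exists 0 => _ [n _ <-]; exact: resid_ge0.
have /choice[N hN] : forall k, exists N, forall K, (N <= K)%N ->
    resid f K - limn (resid f) <= 4 ^- k.
  move=> k; have k0 : (0 < 4 ^- k :> R) by rewrite invr_gt0 exprn_gt0.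
  have /cvgrPdist_le /(_ _ k0)[N _ hN] := cv; exists N => K NK.
  by have := hN K NK; rewrite distrC; exact/le_trans/ler_norm.
have lim_le K : limn (resid f) <= resid f K.
  apply: nonincreasing_cvgn_ge => // m n; exact: resid_decr.
exists (fun k => (\max_(i < k.+1) N i + k)%N); split.
- move=> m n mn; apply: leq_add => //; apply/bigmax_leqP => i _.
  exact: (leq_bigmax (widen_ord (mn : (m.+1 <= n.+1)%N) i)).
- by move=> k; exact: leq_addl.
move=> k K hK.
have : resid f (\max_(i < k.+1) N i + k) - limn (resid f) <= 4 ^- k.
  by apply: hN; rewrite (leq_trans _ (leq_addr _ _))//; exact: (leq_bigmax (@ord_max k)).
have := lim_le K; lra.
Qed.

Lemma sum_half n : \sum_(k < n) (2 ^- k : R) <= 2.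
Proof.
suff -> : \sum_(k < n) (2 ^- k : R) = 2 - 2 * 2 ^- n.
  by rewrite lerBlDr lerDl mulr_ge0// invr_ge0 exprn_ge0.
elim: n => [|n IH]; first by rewrite big_ord0 expr0 invr1; lra.
by rewrite big_ord_recr/= IH exprS; field; rewrite expf_neq0.
Qed.

(** Riesz-Fischer: along a fast subsequence, the partial sums of the Fourier
    series converge almost everywhere under an integrable bound, and the limit
    of the remainders is orthogonal to the whole system. *)
Lemma resid_subseq0 f : sqi f -> exists2 J : nat -> nat,
  {homo J : m n / (m <= n)%N} & (fun k => resid f (J k)) @ \oo --> 0.
Proof.
move=> hf; have [J [homoJ leJ hJ]] := resid_fast hf; exists J => //.
pose S k := oproj f (J k).
have sS k : sqi (S k) by exact: sqi_oproj.
pose dk k x := S k.+1 x - S k x.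
have sdk k : sqi (dk k) by exact: sqiB.
have dk2 k : dot (dk k) (dk k) <= 4 ^- k.
  rewrite residE//; last exact: homoJ.
  exact/hJ/homoJ.
pose a k x : R := 2 ^+ k * dk k x ^+ 2.
have a0 k x : 0 <= a k x by rewrite mulr_ge0 ?sqr_ge0// exprn_ge0.
have ia k : itg (a k) by apply: itgZ; have [] := sdk k.
pose H x := (\sum_(k <oo) (a k x)%:E)%E.
have mH : measurable_fun D H.
  apply: (@ge0_emeasurable_sum _ _ _ _ (fun k x => (a k x)%:E) xpredT).
    by move=> k x _ _; rewrite lee_fin.
  by move=> k _; exact: measurable_int (ia k).
have H0 x : (0 <= H x)%E by apply: nneseries_ge0 => k _ _; rewrite lee_fin.
have iH : mu.-integrable D H.
  apply/integrableP; split => //.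
  rewrite (eq_integral H); last by move=> x _; rewrite gee0_abs.
  rewrite integral_nneseries//.
  - apply: (@le_lt_trans _ _ 2%:E); last exact: ltry.
    apply: lime_le.
      by apply: is_cvg_nneseries => k _ _; apply: integral_ge0 => x _; rewrite lee_fin.
    apply: nearW => n; rewrite big_mkord.
    rewrite (eq_bigr (fun k : 'I_n => (rint (a k))%:E)); last first.
      by move=> k _; rewrite EFin_rint.
    rewrite sumEFin lee_fin; apply: le_trans (sum_half n).
    apply: ler_sum => k _; rewrite /a rintZ; last by have [] := sdk k.
    have -> : rint (fun x => dk k x ^+ 2) = dot (dk k) (dk k).
      by apply: eq_rint => x _; rewrite expr2.
    apply: le_trans (ler_wpM2l _ (dk2 k)) _; first by rewrite exprn_ge0.
    by rewrite (_ : 4 = 2 * 2 :> R) ?exprMn; [rewrite invfM mulrA divff ?mul1r ?expf_neq0|ring].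
  - by move=> k; exact: measurable_int (ia k).
  - by move=> k x _; rewrite lee_fin.
pose H' x := fine (H x).
have aeH : {ae mu, forall x, D x -> H x \is a fin_num} by exact: integrable_ae.
have iH' : itg H'.
  have mH' : measurable_fun D H' by exact: measurableT_comp.
  apply/integrableP; split; first exact/measurable_EFinP.
  rewrite (ae_eq_integral (abse \o H))//.
  - by move/integrableP : iH => [].
  - by apply: measurableT_comp => //; exact/measurable_EFinP.
  - exact: measurableT_comp.
  - by apply: filterS aeH => x hx Dx /=; rewrite -[in RHS](fineK (hx Dx)).
have part x n : H x \is a fin_num -> \sum_(k < n) a k x <= H' x.
  move=> fx; rewrite -lee_fin /H' fineK//.
  rewrite -sumEFin -(big_mkord xpredT (fun k => (a k x)%:E)).
  by apply: nneseries_lim_ge => k _ _; rewrite lee_fin.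
have tel n x : S n x - S 0%N x = \sum_(k < n) dk k x.
  by rewrite -(big_mkord xpredT (fun k => dk k x)) telescope_sumr.
pose h n x := f x - S n x.
have sh n : sqi (h n) by exact: sqiB.
pose r x := fine (limn_esup (fun n => (h n x)%:E)).
have mr : measurable_fun D r.
  apply: measurableT_comp => //; apply: measurable_fun_limn_esup => n.
  by apply/measurable_EFinP; have [] := sh n.
have cvh : {ae mu, forall x, D x -> h ^~ x @ \oo --> r x}.
  apply: filterS aeH => x + Dx => /(_ Dx) fx.
  suff ch : cvgn (h ^~ x).
    have [l hl] : exists l : R, h ^~ x @ \oo --> l by exists (limn (h ^~ x)).
    rewrite (_ : r x = l)//.
    have hl' : (fun n => (h n x)%:E) @ \oo --> l%:E by apply: cvg_EFin => //; exact: nearW.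
    rewrite /r is_cvg_limn_esupE; first by rewrite (cvg_lim _ hl').
    by apply/cvg_ex; exists l%:E.
  have cs : cvgn (series (dk ^~ x)).
    apply: normed_cvg; apply: nondecreasing_is_cvgn.
      by apply: nondecreasing_series => k _ _; exact: normr_ge0.
    exists (2 + H' x) => _ [n _ <-].
    rewrite /normed_series_of seriesEord/=.
    apply: le_trans (lerD (sum_half n) (part x n fx)).
    rewrite -big_split/=; apply: ler_sum => k _; rewrite /a.
    have k0 : 0 < 2 ^+ k :> R by rewrite exprn_gt0.
    have ki0 : 0 < 2 ^- k :> R by rewrite invr_gt0.
    have ki : 2 ^+ k * 2 ^- k = 1 :> R by rewrite divff// expf_neq0.
    rewrite -(real_normK (num_real (dk k x))).
    move: (normr_ge0 (dk k x)); set t := `|_| => t0.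
    have := sqr_ge0 (2 ^+ k * t - 1).
    have : 0 <= 2 ^- k * (2 ^+ k * t - 1) ^+ 2 by rewrite mulr_ge0 ?sqr_ge0// ltW.
    rewrite (_ : 2 ^- k * (2 ^+ k * t - 1) ^+ 2 =
      (2 ^+ k * 2 ^- k) * 2 ^+ k * t ^+ 2 - 2 * (2 ^+ k * 2 ^- k) * t + 2 ^- k); last by ring.
    by rewrite ki !mul1r mulr1; lra.
  rewrite (_ : h ^~ x = (fun n => (f x - S 0%N x) - series (dk ^~ x) n)).
    by apply: is_cvgB => //; exact: is_cvg_cst.
  by apply/funext => n; rewrite seriesEord/= -tel /h; ring.
pose W x := 2 * h 0%N x ^+ 2 + 4 * H' x.
have iW : itg W by apply: itgD; apply: itgZ => //; have [] := sh 0%N.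
have dom : {ae mu, forall x n, D x -> `|h n x ^+ 2| <= W x}.
  apply: filterS aeH => x + n Dx => /(_ Dx) fx.
  rewrite ger0_norm ?sqr_ge0//.
  have : (S n x - S 0%N x) ^+ 2 <= 2 * H' x.
    rewrite tel.
    have -> : \sum_(k < n) dk k x = \sum_(k < n) (Num.sqrt (2 ^- k)) * (Num.sqrt (2 ^+ k) * dk k x).
      apply: eq_bigr => k _; rewrite mulrA -sqrtrM ?invr_ge0 ?exprn_ge0//.
      by rewrite mulVf ?sqrtr1 ?mul1r// expf_neq0.
    apply: le_trans (sum_CS _ _ _) _.
    apply: ler_pM; [by apply: sumr_ge0 => *; exact: sqr_ge0..| |].
      apply: le_trans (sum_half n); apply: ler_sum => k _.
      by rewrite sqr_sqrtr// invr_ge0 exprn_ge0.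
    apply: le_trans (part x n fx); apply: ler_sum => k _.
    by rewrite exprMn sqr_sqrtr// exprn_ge0.
  rewrite /W /h => hS.
  have := sqr_ge0 (f x - S 0%N x + (S n x - S 0%N x)).
  set u := f x - S 0%N x; set v := S n x - S 0%N x in hS *.
  rewrite (_ : f x - S n x = u - v); last by rewrite /u /v; ring.
  by move=> hh; nra.
have cv2 : {ae mu, forall x, D x -> (fun n => h n x ^+ 2) @ \oo --> r x ^+ 2}.
  apply: filterS cvh => x hx Dx.
  by under eq_fun do rewrite expr2; rewrite expr2; apply: cvgM; exact: hx.
have [ir cvr] := rint_dct (fun n => measurable_funX 2 (proj1 (sh n)))
  (measurable_funX 2 mr) cv2 iW dom.
have sr : sqi r by split.
have r0 : {ae mu, forall x, D x -> r x = 0}.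
  apply: complete => // j.
  have [] := @rint_dct (fun n x => h n x * e j x) (fun x => r x * e j x)
    (fun x => W x + e j x ^+ 2).
  - by move=> n; apply: measurable_funM; [have [] := sh n|have [] := se j].
  - by apply: measurable_funM => //; have [] := se j.
  - by apply: filterS cvh => x hx Dx; apply: cvgM; [exact: hx|exact: cvg_cst].
  - by apply: itgD => //; have [] := se j.
  - apply: filterS dom => x hx n Dx; have := hx n Dx.
    rewrite ger0_norm ?sqr_ge0// normrM => hh.
    rewrite -(real_normK (num_real (h n x))) in hh.
    rewrite -(real_normK (num_real (e j x))).
    have := sqr_ge0 (`|h n x| - `|e j x|); have := normr_ge0 (h n x).
    have := normr_ge0 (e j x); nra.
  move=> _ cj; rewrite /dot -(cvg_lim _ cj)//; apply/cvg_lim => //; apply: cvg_near_cst.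
  near=> n.
  rewrite -/(dot (h n) (e j)) /h dotBl// dot_oproj_e.
  rewrite ifT ?subrr// (leq_trans _ (leJ n))//.
  by near: n; exact: nbhs_infty_gt.
have := cvr; rewrite (_ : rint (fun x => r x ^+ 2) = 0).
  apply: cvg_trans; rewrite (_ : (fun k => resid f (J k)) =
    (fun n => rint (fun x => h n x ^+ 2)))//.
  apply/funext => n; rewrite -resid_sub//; exact: eq_rint.
rewrite -[RHS]rint0; apply: ae_eq_rint => //; first exact: measurable_funX.
by apply: filterS r0 => x hx Dx; rewrite hx// expr0n.
Unshelve. all: by end_near. Qed.

(** The residuals decrease with the number of functions, so that a subsequence
    decides their limit. *)
Lemma resid_to0 f : sqi f -> forall z, 0 < z ->
  exists J0, forall J, (J0 <= J)%N -> resid f J <= z.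
Proof.
move=> hf z z0; have [J _ /cvgrPdist_le/(_ _ z0)[k _ hk]] := resid_subseq0 hf.
exists (J k) => K /(resid_decr hf) /le_trans; apply.
have := hk k (leqnn k); rewrite /= sub0r normrN; apply: le_trans.
exact: ler_norm.
Qed.

End completeness.

End orthonormal.

End L2_theory.

(** * The fundamental theorem of calculus for an integrable derivative *)

Section derivative_on_segment.
Variable R : realType.
Implicit Types (F G f g : R -> R) (a b x s t z dl : R).
Notation mu := (@lebesgue_measure R).

(** Increments are taken inside the segment: at the end points the derivative is
    one-sided. *)
Definition deriv_on a b F f := forall t, a <= t <= b -> forall z : R, 0 < z ->
  exists2 dl : R, 0 < dl & forall s, a <= s <= b -> `|s - t| < dl ->
    `|F s - F t - f t * (s - t)| <= z * `|s - t|.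

Lemma deriv_on_sub a b a' b' F f : a <= a' -> b' <= b ->
  deriv_on a b F f -> deriv_on a' b' F f.
Proof.
move=> aa bb h t /andP[at' tb] z z0.
have [|dl dl0 hd] := h t _ z z0; first by rewrite (le_trans aa)//= (le_trans tb).
by exists dl => // s /andP[as' sb]; apply: hd; rewrite (le_trans aa)//= (le_trans sb).
Qed.

Lemma eq_deriv_on a b F f G g : (forall t, a <= t <= b -> F t = G t) ->
  (forall t, a <= t <= b -> f t = g t) -> deriv_on a b F f -> deriv_on a b G g.
Proof.
move=> FG fg h t tab z z0; have [dl dl0 hd] := h t tab z z0.
by exists dl => // s sab st; rewrite -!FG// -fg//; exact: hd.
Qed.

Lemma deriv_onD a b F f G g : deriv_on a b F f -> deriv_on a b G g ->
  deriv_on a b (fun t => F t + G t) (fun t => f t + g t).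
Proof.
move=> hf hg t tab z z0; have z2 : 0 < z / 2 by rewrite divr_gt0.
have [d1 d10 h1] := hf t tab _ z2; have [d2 d20 h2] := hg t tab _ z2.
exists (Num.min d1 d2); first by rewrite lt_min d10.
move=> s sab; rewrite lt_min => /andP[s1 s2].
have := lerD (h1 s sab s1) (h2 s sab s2).
rewrite -mulrDl -splitr; apply: le_trans.
by rewrite (_ : _ + _ - _ - _ = (F s - F t - f t * (s - t)) + (G s - G t - g t * (s - t)));
  [exact: ler_normD|ring].
Qed.

Lemma deriv_onZ a b k F f : deriv_on a b F f ->
  deriv_on a b (fun t => k * F t) (fun t => k * f t).
Proof.
move=> hf t tab z z0; have k0 : 0 < `|k| + 1 by rewrite ltr_wpDl.
have [d1 d10 h1] := hf t tab (z / (`|k| + 1)) (divr_gt0 z0 k0).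
exists d1 => // s sab st.
rewrite (_ : _ - _ - _ = k * (F s - F t - f t * (s - t))); last by ring.
rewrite normrM; apply: le_trans (ler_wpM2l (normr_ge0 _) (h1 s sab st)) _.
rewrite mulrA ler_wpM2r// mulrA ler_pdivrMr// mulrC ler_wpM2l ?ltW// ltrDl; exact: ltr01.
Qed.

Lemma deriv_onN a b F f : deriv_on a b F f ->
  deriv_on a b (fun t => - F t) (fun t => - f t).
Proof. by move=> /(deriv_onZ (-1)); apply: eq_deriv_on => t _; rewrite mulN1r. Qed.

Lemma deriv_onB a b F f G g : deriv_on a b F f -> deriv_on a b G g ->
  deriv_on a b (fun t => F t - G t) (fun t => f t - g t).
Proof. by move=> hf /deriv_onN; exact: deriv_onD. Qed.

Lemma deriv_on_cst a b k : deriv_on a b (fun=> k) (fun=> 0).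
Proof.
move=> t _ z z0; exists 1 => // s _ _.
by rewrite subrr mul0r subr0 normr0 mulr_ge0// ltW.
Qed.

Lemma deriv_on_id a b : deriv_on a b id (fun=> 1).
Proof.
move=> t _ z z0; exists 1 => // s _ _.
by rewrite mul1r subrr normr0 mulr_ge0// ltW.
Qed.

Lemma deriv_on_lip a b F f t : deriv_on a b F f -> a <= t <= b ->
  exists2 dl : R, 0 < dl & forall s, a <= s <= b -> `|s - t| < dl ->
    `|F s - F t| <= (`|f t| + 1) * `|s - t|.
Proof.
move=> hf tab; have [dl dl0 h] := hf t tab 1 ltr01; exists dl => // s sab st.
have := h s sab st; rewrite mul1r => h1.
rewrite (_ : F s - F t = (F s - F t - f t * (s - t)) + f t * (s - t)); last by ring.
by apply: le_trans (ler_normD _ _) _; rewrite normrM mulrDl mul1r addrC lerD2l.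
Qed.

Lemma deriv_on_cont a b F f t : deriv_on a b F f -> a <= t <= b ->
  forall z : R, 0 < z -> exists2 dl : R, 0 < dl &
    forall s, a <= s <= b -> `|s - t| < dl -> `|F s - F t| <= z.
Proof.
move=> hf tab z z0; have [dl dl0 h] := deriv_on_lip hf tab.
have k0 : 0 < `|f t| + 1 by rewrite ltr_wpDl.
exists (Num.min dl (z / (`|f t| + 1))); first by rewrite lt_min dl0 divr_gt0.
move=> s sab; rewrite lt_min => /andP[s1 s2].
apply: le_trans (h s sab s1) _.
by rewrite mulrC -ler_pdivlMr// ltW.
Qed.

Lemma deriv_onM a b F f G g : deriv_on a b F f -> deriv_on a b G g ->
  deriv_on a b (fun t => F t * G t) (fun t => f t * G t + F t * g t).
Proof.
move=> hf hg t tab z z0.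
have z3 : 0 < z / 3 by rewrite divr_gt0.
have kG : 0 < `|G t| + 1 by rewrite ltr_wpDl.
have kF : 0 < `|F t| + 1 by rewrite ltr_wpDl.
have kf : 0 < `|f t| + 1 by rewrite ltr_wpDl.
have [d1 d10 h1] := hf t tab (z / 3 / (`|G t| + 1)) (divr_gt0 z3 kG).
have [d2 d20 h2] := hg t tab (z / 3 / (`|F t| + 1)) (divr_gt0 z3 kF).
have [d3 d30 h3] := deriv_on_lip hf tab.
have [d4 d40 h4] := deriv_on_cont hg tab (divr_gt0 z3 kf).
exists (Num.min (Num.min d1 d2) (Num.min d3 d4)); first by rewrite !lt_min d10 d20 d30.
move=> s sab; rewrite !lt_min => /andP[/andP[s1 s2] /andP[s3 s4]].
rewrite (_ : _ - _ - _ = (F s - F t - f t * (s - t)) * G t +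
  F t * (G s - G t - g t * (s - t)) + (F s - F t) * (G s - G t)); last by ring.
rewrite (_ : z = z / 3 + z / 3 + z / 3); last by field.
rewrite 2!(mulrDl _ _ `|s - t|).
have frac (u v : R) : 0 < u -> v < u -> 0 <= v -> z / 3 / u * v <= z / 3.
  move=> u0 vu v0; rewrite mulrAC ler_pdivrMr// ler_wpM2l ?ltW//.
have lt1 (u : R) : `|u| < `|u| + 1 by rewrite ltrDl.
apply: le_trans (ler_normD _ _) _; apply: lerD.
  apply: le_trans (ler_normD _ _) _; apply: lerD; rewrite normrM.
    apply: le_trans (ler_wpM2r (normr_ge0 _) (h1 s sab s1)) _.
    by rewrite mulrAC ler_wpM2r// frac.
  apply: le_trans (ler_wpM2l (normr_ge0 _) (h2 s sab s2)) _.
  by rewrite mulrA ler_wpM2r// mulrC frac.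
rewrite normrM; apply: le_trans (ler_pM _ _ (h3 s sab s3) (h4 s sab s4)) _ => //.
by rewrite mulrAC ler_wpM2r// mulrCA divff ?mulr1// gt_eqF.
Qed.

Lemma deriv_on_horner a b (p : {poly R}) :
  deriv_on a b (fun t => p.[t]) (fun t => p^`().[t]).
Proof.
elim/poly_ind: p => [|p c IH].
  by apply: eq_deriv_on (@deriv_on_cst a b 0) => t _; rewrite ?deriv0 ?horner0.
apply: eq_deriv_on (deriv_onD (deriv_onM IH (@deriv_on_id a b)) (@deriv_on_cst a b c)) => t _.
  by rewrite hornerMXaddC.
by rewrite derivD derivC addr0 derivM derivX mulr1 !hornerE.
Qed.

Lemma deriv_on_sum a b (I : Type) (r : seq I) (F f : I -> R -> R) :
  (forall i, deriv_on a b (F i) (f i)) ->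
  deriv_on a b (fun t => \sum_(i <- r) F i t) (fun t => \sum_(i <- r) f i t).
Proof.
move=> hF; elim: r => [|i r IH].
  by apply: eq_deriv_on (@deriv_on_cst a b 0) => t _; rewrite big_nil.
by apply: eq_deriv_on (deriv_onD (hF i) IH) => t _; rewrite big_cons.
Qed.

(** The points up to which [H] stays above [H a] form a segment: it contains its
    supremum because [H] does not jump down there, and the supremum is [b] because
    [H] does not drop immediately to the right of a point. *)
Lemma right_growing_le a b (H : R -> R) : a <= b ->
  (forall x, a <= x < b -> exists2 dl : R, 0 < dl &
    forall s, x <= s <= b -> s < x + dl -> H x <= H s) ->
  (forall x, a < x <= b -> forall z : R, 0 < z -> exists2 dl : R, 0 < dl &
    forall s, a <= s <= x -> x - dl < s -> H s - z <= H x) ->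
  H a <= H b.
Proof.
move=> ab right left.
pose S := [set x | a <= x <= b /\ forall y, a <= y <= x -> H a <= H y].
have Sa : S a.
  by split; [rewrite lexx|move=> y /andP[ay ya]; rewrite (_ : y = a)//; apply/le_anti/andP].
have hS : has_sup S by split; [exists a|exists b => x [/andP[]]].
pose c := sup S.
have ac : a <= c by apply: sup_ubound => //; case: hS.
have cb : c <= b by apply: ge_sup; [exists a|move=> x [/andP[]]].
have below y : a <= y < c -> H a <= H y.
  move=> /andP[ay yc].
  have [|x [xab hx] xc] := @sup_adherent _ S (c - y) _ hS; first by rewrite subr_gt0.
  by apply: hx; rewrite ay/= ltW//; move: xc; rewrite -/c; lra.
have Hc : H a <= H c.
  have [->//|cna] := eqVneq c a.
  have {}ac : a < c by rewrite lt_neqAle eq_sym cna.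
  apply/ler_addgt0Pr => z z0.
  have [|dl dl0 hl] := left c _ z z0; first by rewrite ac.
  pose s := Num.max a (c - dl / 2).
  have [sa sc] : a <= s /\ s < c.
    by rewrite /s le_max lexx/= gt_max ac/=; split => //; lra.
  have : H s - z <= H c.
    apply: hl; first by rewrite sa ltW.
    by rewrite /s lt_max; apply/orP; right; lra.
  by have := below s; rewrite sa sc => /(_ isT); lra.
have [<-//|cnb] := eqVneq c b.
have {}cb : c < b by rewrite lt_neqAle cnb.
have [|dl dl0 hr] := right c; first by rewrite ac.
pose s := Num.min b (c + dl / 2).
have cs : c < s by rewrite /s lt_min cb/=; lra.
have : S s.
  split; first by rewrite (le_trans ac (ltW cs))/= /s ge_min lexx.
  move=> y /andP[ay ys].
  have [yc|cy] := ltP y c; first by apply: below; rewrite ay.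
  apply: le_trans Hc (hr y _ _).
    by rewrite cy/= (le_trans ys)// /s ge_min lexx.
  by apply: le_lt_trans ys _; rewrite /s gt_min; apply/orP; right; lra.
move=> /(sup_ubound (proj2 hS)); rewrite -/c; lra.
Qed.

Lemma itg_cont_seg a b f : continuous f -> itg mu `[a, b]%classic f.
Proof.
move=> cf; apply: continuous_compact_integrable; first exact: segment_compact.
exact: continuous_subspaceT.
Qed.

Lemma itg_cst_seg a b z : itg mu `[a, b]%classic (fun=> z).
Proof. by apply: itg_cont_seg; exact: cst_continuous. Qed.

Lemma rint_itv_add (f : R -> R) a b c : a <= b -> b <= c ->
  itg mu `[a, c]%classic f ->
  rint mu `[a, c]%classic f = rint mu `[a, b]%classic f + rint mu `[b, c]%classic f.
Proof.
move=> ab bc hf.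
have E : `[a, c]%classic = `[a, b]%classic `|` `]b, c]%classic :> set R.
  by rewrite -(@itv_bndbnd_setU _ _ (BLeft a) (BRight b) (BRight c)).
rewrite /rint {1}E Rintegral_setU//; last 2 first.
- by rewrite -E.
- apply/disj_setPRL => x /=; rewrite !in_itv/= => /andP[bx _]; apply/negP.
  by rewrite negb_and -!ltNge bx orbT.
congr (_ + _); rewrite Rintegral_itv_obnd_cbnd//.
apply: integrableS hf => //.
by rewrite E; exact: subsetUr.
Qed.

Lemma rint_cst_seg a b z : a <= b -> rint mu `[a, b]%classic (fun=> z) = z * (b - a).
Proof.
move=> ab; rewrite /rint Rintegral_cst//= lebesgue_measure_itv/= lte_fin.
by case: ltgtP ab => //= -> _; rewrite subrr.
Qed.

Lemma rint_near_cst s t (h : R -> R) k z : s <= t -> itg mu `[s, t]%classic h ->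
  (forall x, s <= x <= t -> `|h x - k| <= z) ->
  `|rint mu `[s, t]%classic h - k * (t - s)| <= z * (t - s).
Proof.
move=> st ih hk; rewrite -(rint_cst_seg k)// -rintB//; last exact: itg_cst_seg.
have ik : itg mu `[s, t]%classic (fun x => h x - k) by apply: itgB => //; exact: itg_cst_seg.
apply: le_trans (le_abs_rint _ ik) _ => //.
rewrite -(rint_cst_seg z)//; apply: le_rint => //; first exact: itg_abs.
exact: itg_cst_seg.
Qed.

Lemma primitive_deriv_on a b (h : R -> R) : continuous h ->
  deriv_on a b (fun x => rint mu `[a, x]%classic h) h.
Proof.
move=> ch t /andP[at_ tb] z z0.
have /cvgrPdist_le/(_ z z0)/nbhs_ballP[dl /= dl0 hd] := ch t.
exists dl => // s /andP[as_ sb] std.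
have near_t x : `|x - t| < dl -> `|h x - h t| <= z.
  by move=> xt; rewrite distrC; apply: hd; rewrite /ball/= distrC.
have := itg_cont_seg _ _ ch => ih.
have [st|/ltW ts] := leP s t.
  rewrite (rint_itv_add as_ st)//.
  rewrite (_ : _ - _ - _ = - (rint mu `[s, t]%classic h - h t * (t - s))); last by ring.
  rewrite normrN (ler0_norm (_ : s - t <= 0)) ?subr_le0// opprB.
  apply: rint_near_cst => // x /andP[sx xt]; apply: near_t.
  by move: std; rewrite !ler0_norm ?subr_le0//; lra.
rewrite (rint_itv_add at_ ts)//.
rewrite (_ : _ - _ - _ = rint mu `[t, s]%classic h - h t * (s - t)); last by ring.
rewrite (ger0_norm (_ : 0 <= s - t)) ?subr_ge0//.
apply: rint_near_cst => // x /andP[tx xs]; apply: near_t.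
by move: std; rewrite !ger0_norm ?subr_ge0//; lra.
Qed.

Section lsc_majorant.
Variables (a b : R) (phi : R -> R).
Hypothesis ab : a <= b.
Hypothesis phi0 : forall t, 0 <= phi t.
Hypothesis iphi : itg mu `[a, b]%classic phi.
Local Notation I := (`[a, b]%classic : set R).

(** Vitali-Caratheodory theorem: each level set [k * z <= phi < (k + 1) * z] is
    enlarged to an open set of nearly the same measure, and the majorant adds up the
    values [(k + 1) * z] on these open sets. *)
Lemma lsc_majorant z : 0 < z -> exists u : R -> \bar R,
  [/\ measurable_fun I u, forall t, (0 <= u t)%E,
    forall t, I t -> exists c : R, [/\ phi t < c & exists2 dl : R, 0 < dl &
      forall s, `|s - t| < dl -> (c%:E <= u s)%E] &
    (\int[mu]_(t in I) u t <= (rint mu I phi + z * (b - a + 2))%:E)%E].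
Proof.
move=> z0.
pose c (k : nat) : R := k.+1%:R * z.
have c0 k : 0 < c k by rewrite mulr_gt0.
have ci0 k (A : set R) t : 0 <= c k * \1_A t by rewrite mulr_ge0// ltW.
pose E k := I `&` (phi @^-1` `[k%:R * z, k.+1%:R * z[%classic).
have mphi := itg_meas iphi.
have mE k : measurable (E k) by exact: mphi.
have muI : (mu I = (b - a)%:E)%E by rewrite lebesgue_measure_itv/= lte_fin; case: ltgtP ab => // ->; rewrite subrr.
have /choice[U hU] : forall k, exists U : set R,
    [/\ open U, E k `<=` U & (mu (U `\` E k) < ((2 ^- k) / k.+1%:R)%:E)%E].
  move=> k; apply: lebesgue_regularity_outer; [by []| |by rewrite divr_gt0// invr_gt0 exprn_gt0].
  apply: (@le_lt_trans _ _ (mu I)); last by rewrite muI ltry.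
  apply: le_measure; last exact: subIsetl.
    by apply/mem_set; exact: mE.
  by apply/mem_set; exact: measurable_itv.
have mU k : measurable (U k) by apply: open_measurable; have [] := hU k.
pose u t := (\sum_(k <oo) (c k * \1_(U k) t)%:E)%E.
have u0 t : (0 <= u t)%E.
  by apply: nneseries_ge0 => k _ _; rewrite lee_fin ci0.
have mterm (A : set R) k : measurable A -> measurable_fun I (fun t => (c k * \1_A t)%:E).
  by move=> mA; apply/measurable_EFinP; apply: measurable_funM => //.
exists u; split => //.
- apply: (@ge0_emeasurable_sum _ _ _ _ (fun k t => (c k * \1_(U k) t)%:E) xpredT) => //.
    by move=> k t _ _; rewrite lee_fin ci0.
  by move=> k _; exact: mterm.
- move=> t It; pose k := Num.truncn (phi t / z).
  have Ekt : E k t.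
    split => //=; rewrite in_itv/= -ler_pdivlMr// -ltr_pdivrMr//.
    by rewrite truncn_le ?divr_ge0 ?phi0 ?(ltW z0)//= truncnS_gt.
  exists (c k); split; first by move: Ekt => [_ /=]; rewrite in_itv/= => /andP[].
  have [oU EU _] := hU k.
  have : nbhs t (U k) by apply: open_nbhs_nbhs; split => //; exact: EU.
  move=> /nbhs_ballP[dl /= dl0 hdl]; exists dl => // s st.
  apply: (@le_trans _ _ (\sum_(0 <= i < k.+1) (c i * \1_(U i) s)%:E)%E).
    rewrite big_nat_recr//= indicE mem_set; last by apply: hdl; rewrite /ball/= distrC.
    rewrite mulr1 leeDr//; by apply: sume_ge0 => i _; rewrite lee_fin ci0.
  by apply: (@nneseries_lim_ge _ (fun i => (c i * \1_(U i) s)%:E) xpredT) => i _ _; rewrite lee_fin ci0.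
- pose v t := (\sum_(k <oo) (c k * \1_(U k `\` E k) t)%:E)%E.
  have v0 t : (0 <= v t)%E.
    by apply: nneseries_ge0 => k _ _; rewrite lee_fin ci0.
  have mv : measurable_fun I v.
    apply: (@ge0_emeasurable_sum _ _ _ _ (fun k t => (c k * \1_(U k `\` E k) t)%:E) xpredT) => //.
      by move=> k t _ _; rewrite lee_fin ci0.
    by move=> k _; apply: mterm; exact: measurableD.
  have uv t : I t -> (u t <= (phi t + z)%:E + v t)%E.
    move=> It; pose k := Num.truncn (phi t / z).
    have ck : c k <= phi t + z.
      rewrite /c -natr1 mulrDl mul1r lerD2r -ler_pdivlMr//.
      by rewrite truncn_le ?divr_ge0 ?phi0 ?(ltW z0).
    apply: lime_le.
      by apply: is_cvg_nneseries => i _ _; rewrite lee_fin ci0.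
    apply: nearW => n.
    apply: (@le_trans _ _ ((phi t + z)%:E + \sum_(0 <= i < n) (c i * \1_(U i `\` E i) t)%:E)%E); last first.
      by rewrite leeD2l//; apply: (@nneseries_lim_ge _ (fun i => (c i * \1_(U i `\` E i) t)%:E) xpredT) => i _ _; rewrite lee_fin ci0.
    rewrite !sumEFin -EFinD lee_fin.
    apply: (@le_trans _ _ (\sum_(0 <= i < n) ((i == k)%:R * c k + c i * \1_(U i `\` E i) t))).
      apply: ler_sum => i _; case: eqVneq => [->|ik].
        rewrite mul1r ler_wpDr ?ci0// ler_piMr ?(ltW (c0 k))//.
      rewrite mul0r add0r ler_wpM2l ?(ltW (c0 _))// !indicE.
      have Ei : ~ E i t.
        move=> [_ /=]; rewrite in_itv/= -ler_pdivlMr// -ltr_pdivrMr// => /truncn_def.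
        by rewrite -/k => ki; rewrite ki eqxx in ik.
      by rewrite in_setD (memNset Ei) andbT.
    rewrite big_split/= lerD2r.
    apply: (le_trans _ ck); case: (ltnP k n) => kn.
      rewrite (bigD1_seq k) ?mem_index_iota ?iota_uniq//= eqxx mul1r big1 ?addr0//.
      by move=> i /negPf ->; rewrite mul0r.
    rewrite big_nat_cond big1 ?(ltW (c0 k))// => i /andP[/andP[_ ni] _].
    by rewrite ltn_eqF ?mul0r// (leq_trans ni).
  have ipz : itg mu I (fun t => phi t + z).
    by apply: itgD => //; exact: itg_cst_seg.
  have intv : (\int[mu]_(t in I) v t <= (z * 2)%:E)%E.
    rewrite integral_nneseries//.
    - apply: lime_le.
        by apply: is_cvg_nneseries => k _ _; apply: integral_ge0 => x _; rewrite lee_fin ci0.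
      apply: nearW => n; rewrite big_mkord.
      apply: (@le_trans _ _ (\sum_(k < n) (z * 2 ^- k)%:E)%E); last first.
        by rewrite sumEFin lee_fin -mulr_sumr ler_wpM2l ?(ltW z0)// sum_half.
      apply: lee_sum => k _.
      under eq_integral do rewrite EFinM.
      have mUE : measurable (U k `\` E k) by exact: measurableD.
      rewrite ge0_integralZl//; last 2 first.
        by apply/measurable_EFinP.
        by rewrite lee_fin ltW.
      rewrite integral_indic//.
      have : (mu ((U k `\` E k) `&` I) <= (2 ^- k / k.+1%:R)%:E)%E.
        have [_ _ /ltW] := hU k; apply: le_trans.
        apply: le_measure; last exact: subIsetl.
          by apply/mem_set; exact: measurableI.
        by apply/mem_set.
      move=> h; apply: le_trans (lee_wpmul2l _ h) _; first by rewrite lee_fin ltW.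
      rewrite -EFinM lee_fin /c le_eqVlt; apply/orP; left; apply/eqP.
      by field; rewrite expf_neq0//= addrC natr1 pnatr_eq0.
    - by move=> k; apply: mterm; exact: measurableD.
    - by move=> k x _; rewrite lee_fin ci0.
  have mu_ : measurable_fun I u.
    apply: (@ge0_emeasurable_sum _ _ _ _ (fun k t => (c k * \1_(U k) t)%:E) xpredT) => //.
      by move=> k t _ _; rewrite lee_fin ci0.
    by move=> k _; exact: mterm.
  have pz0 t : 0 <= phi t + z by rewrite addr_ge0 ?phi0 ?(ltW z0).
  have mpz : measurable_fun I (fun t => (phi t + z)%:E).
    by apply/measurable_EFinP; exact: itg_meas ipz.
  apply: (@le_trans _ _ (\int[mu]_(t in I) ((phi t + z)%:E + v t))%E).
    by apply: ge0_le_integral => //; exact: emeasurable_funD.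
  rewrite ge0_integralD//; last by move=> t _; rewrite lee_fin.
  have Epz := @EFin_rint _ _ _ mu I (measurable_itv _) _ ipz.
  rewrite -Epz rintD//; last exact: itg_cst_seg.
  rewrite rint_cst_seg//.
  apply: le_trans (leeD2l _ intv) _; rewrite -EFinD lee_fin; lra.
Qed.

End lsc_majorant.

(** Near each point the majorant of [lsc_majorant] exceeds the slope of [F], so that
    its integral minus [F] satisfies the hypotheses of [right_growing_le]. *)
Lemma deriv_on_upper a b F f : a <= b -> deriv_on a b F f ->
  itg mu `[a, b]%classic f -> F b - F a <= rint mu `[a, b]%classic (fun t => `|f t|).
Proof.
move=> ab hF hf.
apply/ler_addgt0Pr => e e0.
have k0 : 0 < b - a + 2 by lra.
have [u [mu_ u0 hu intu]] := @lsc_majorant a b (fun t => `|f t|) ab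
  (fun t => normr_ge0 _) (itg_abs hf) (e / (b - a + 2)) (divr_gt0 e0 k0).
rewrite mulfVK ?gt_eqF// in intu.
pose G x := fine (\int[mu]_(t in `[a, x]) u t)%E.
have sub x y : a <= x -> y <= b -> `[x, y]%classic `<=` (`[a, b]%classic : set R).
  by move=> ax yb t /=; rewrite !in_itv/= => /andP[xt ty]; rewrite (le_trans ax)// (le_trans ty).
have mS x y : a <= x -> y <= b -> measurable_fun (`[x, y]%classic : set R) u.
  by move=> ax yb; apply: measurable_funS mu_ => //; exact: sub.
have finG x : x <= b -> (\int[mu]_(t in `[a, x]) u t)%E \is a fin_num.
  move=> xb; rewrite ge0_fin_numE; last by apply: integral_ge0.
  apply: (@le_lt_trans _ _ (\int[mu]_(t in `[a, b]) u t)%E); last exact: le_lt_trans intu (ltry _).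
  by apply: ge0_subset_integral => //; exact: sub.
have Gadd x s c : a <= x -> x <= s -> s <= b -> 0 <= c ->
    (forall t, x < t <= s -> (c%:E <= u t)%E) -> G x + c * (s - x) <= G s.
  move=> ax xs sb c0 hc; rewrite -lee_fin EFinD /G !fineK ?finG ?(le_trans xs)//.
  have E : `[a, s]%classic = `[a, x]%classic `|` `]x, s]%classic :> set R.
    by rewrite -(@itv_bndbnd_setU _ _ (BLeft a) (BRight x) (BRight s)).
  rewrite E ge0_integral_setU//; last 2 first.
  - by rewrite -E; exact: mS.
  - apply/disj_setPRL => t /=; rewrite !in_itv/= => /andP[xt _]; apply/negP.
    by rewrite negb_and -!ltNge xt orbT.
  rewrite leeD2l//.
  apply: (@le_trans _ _ (\int[mu]_(t in `]x, s]) c%:E)%E).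
    rewrite integral_cst//= lebesgue_measure_itv/= lte_fin.
    move: xs; rewrite le_eqVlt => /predU1P[->|xs]; first by rewrite ltxx subrr mulr0 mule0.
    by rewrite xs -EFinB -EFinM.
  apply: ge0_le_integral => //.
  - by apply: measurable_funS (mS a s _ _) => //; rewrite E; exact: subsetUr.
have : (fun x => G x - F x) a <= (fun x => G x - F x) b.
  apply: (@right_growing_le a b (fun x => G x - F x)) => //= x.
    move=> /andP[ax xb].
    have xab : a <= x <= b by rewrite ax ltW.
    have [|c [fc [d1 d10 h1]]] := hu x; first by rewrite /= in_itv/=.
    have [|d2 d20 h2] := hF x xab (c - `|f x|); first by rewrite subr_gt0.
    exists (Num.min d1 d2); first by rewrite lt_min d10.
    move=> s /andP[xs sb] sd.
    have sxd : `|s - x| < Num.min d1 d2 by rewrite ger0_norm ?subr_ge0// ltrBlDl.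
    move: sxd; rewrite lt_min => /andP[s1 s2].
    have c0 : 0 <= c by apply: le_trans (ltW fc).
    have := Gadd x s c ax xs sb c0; rewrite -/(G x) => hG.
    have {}hG : G x + c * (s - x) <= G s.
      apply: hG => t /andP[xt ts]; apply: h1; rewrite gtr0_norm ?subr_gt0//.
      by move: s1; rewrite ger0_norm ?subr_ge0//; lra.
    have := h2 s; rewrite sb (le_trans ax xs) => /(_ isT s2).
    rewrite (ger0_norm (_ : 0 <= s - x)) ?subr_ge0// => h3.
    have := le_trans (ler_norm _) h3.
    have := ler_norm (f x); have : 0 <= s - x by rewrite subr_ge0.
    by move=> *; nra.
  move=> /andP[ax xb] z z0.
  have xab : a <= x <= b by rewrite (ltW ax).
  have [dl dl0 hd] := deriv_on_cont hF xab z0.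
  exists dl => // s /andP[as_ sx] sd.
  have := hd s; rewrite as_ (le_trans sx xb) => /(_ isT).
  have -> : `|s - x| < dl by rewrite ler0_norm ?subr_le0//; lra.
  rewrite distrC => /(_ isT) /(le_trans (ler_norm _)).
  have := Gadd s x 0 as_ sx xb (lexx _) (fun t _ => u0 t).
  by rewrite mul0r addr0; lra.
rewrite /=.
have -> : G a = 0 by rewrite /G set_itv1 integral_set1.
have : G b <= rint mu `[a, b]%classic (fun t => `|f t|) + e.
  by rewrite -lee_fin /G fineK ?finG.
lra.
Qed.

Lemma deriv_on_abs a b F f : a <= b -> deriv_on a b F f ->
  itg mu `[a, b]%classic f -> `|F b - F a| <= rint mu `[a, b]%classic (fun t => `|f t|).
Proof.
move=> ab hF hf; rewrite ler_norml deriv_on_upper// andbT.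
have := deriv_on_upper ab (deriv_onN hF); rewrite lerNl => h.
have {}h := h _.
rewrite (_ : - (F b - F a) = - F b - - F a); last by ring.
apply: le_trans (h _) _; first by rewrite -[X in itg _ _ X]/(fun t => - f t); apply: eq_itg (itgZ _ (-1) hf) => // t _; rewrite mulN1r.
by rewrite le_eqVlt; apply/orP; left; apply/eqP; apply: eq_rint => t _; rewrite normrN.
Qed.

(** Fundamental theorem of calculus for functions that are differentiable
    everywhere with an integrable, possibly discontinuous, derivative: the
    inequality above is applied to the difference with a primitive of a
    continuous function close to the derivative. *)
Lemma ftc_deriv_on a b F f : a <= b -> deriv_on a b F f ->
  itg mu `[a, b]%classic f -> rint mu `[a, b]%classic f = F b - F a.
Proof.
move=> ab hF hf.
have muI : (mu `[a, b]%classic < +oo)%E by rewrite lebesgue_measure_itv/= lte_fin; case: ifP => _; rewrite ?ltry// -EFinD ltry.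
have [//|g_ [cg ig /fine_cvgP[_ lg]]] := approximation_continuous_integrable _ muI hf.
apply/eqP; rewrite -subr_eq0 -normr_le0; apply/ler_addgt0Pr => e e0; rewrite add0r.
have e2 : 0 < e / 2 by rewrite divr_gt0.
have /cvgrPdist_le/(_ _ e2)[n _ hn] := lg.
pose h := g_ n.
have dist : rint mu `[a, b]%classic (fun t => `|f t - h t|) <= e / 2.
  have := hn n (leqnn n); rewrite /= sub0r normrN; apply: le_trans.
  by apply: le_trans (ler_norm _).
pose Hh x := rint mu `[a, x]%classic h.
have dH := @primitive_deriv_on a b h (cg n).
have h1 := deriv_on_abs ab (deriv_onB hF dH) (itgB _ hf (ig n)).
have h2 : `|rint mu `[a, b]%classic f - rint mu `[a, b]%classic h| <= e / 2.
  rewrite -rintB//; last exact: ig.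
  apply: le_trans dist; apply: le_abs_rint => //; apply: itgB => //; exact: ig.
have Haa : rint mu `[a, a]%classic h = 0.
  by rewrite /rint set_itv1 Rintegral_set1.
rewrite Haa subr0 in h1.
have {h1}h1 := le_trans (h1 _) dist.
rewrite (_ : rint mu `[a, b]%classic f - (F b - F a) =
  (rint mu `[a, b]%classic f - rint mu `[a, b]%classic h) -
  (F b - rint mu `[a, b]%classic h - F a)); last by ring.
apply: le_trans (ler_normB _ _) _.
by have := lerD h2 (h1 _); rewrite -splitr; apply.
Qed.

End derivative_on_segment.

(** * Natural splines as piecewise polynomials *)

Section segments.
Variable R : realType.
Implicit Types (a b c s t : R) (f g h H : R -> R).
Notation mu := (@lebesgue_measure R).

Lemma itgS_seg a b a' b' f : a <= a' -> b' <= b ->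
  itg mu `[a, b]%classic f -> itg mu `[a', b']%classic f.
Proof.
move=> aa bb; apply: integrableS => // t /=; rewrite !in_itv/= => /andP[h1 h2].
by rewrite (le_trans aa)// (le_trans h2).
Qed.

Lemma itg_cat a b c f : a <= b -> b <= c ->
  itg mu `[a, b]%classic f -> itg mu `[b, c]%classic f -> itg mu `[a, c]%classic f.
Proof.
move=> ab bc /integrableP[m1 i1] /integrableP[m2 i2].
have E : `[a, c]%classic = `[a, b]%classic `|` `[b, c]%classic :> set R.
  apply/seteqP; split=> t /=; rewrite !in_itv/=.
    move=> /andP[at_ tc]; case: (leP t b) => tb; [left; rewrite at_//|right; rewrite tc ltW//].
  move=> [/andP[h1 h2]|/andP[h1 h2]].
    by rewrite h1 (le_trans h2).
  by rewrite h2 (le_trans ab).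
have mU : measurable_fun (`[a, c]%classic : set R) (EFin \o f).
  by rewrite E; apply/measurable_funU.
apply/integrableP; split => //.
have mabs : measurable_fun (`[a, c]%classic : set R) (abse \o (EFin \o f)) by exact: measurableT_comp.
rewrite -(_ : `[a, b] `|` `]b, c] = `[a, c]%classic :> set R)%classic; last first.
  by rewrite -(@itv_bndbnd_setU _ _ (BLeft a) (BRight b) (BRight c)).
rewrite ge0_integral_setU//; last 2 first.
- by rewrite -(@itv_bndbnd_setU _ _ (BLeft a) (BRight b) (BRight c)).
- apply/disj_setPRL => t /=; rewrite !in_itv/= => /andP[bt _]; apply/negP.
  by rewrite negb_and -!ltNge bt orbT.
apply: lte_add_pinfty => //; apply: le_lt_trans i2.
apply: ge0_subset_integral => //; first exact: measurableT_comp.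
by move=> t /=; rewrite !in_itv/= => /andP[/ltW -> ->].
Qed.

Lemma seg_congr a b g h : a < b -> (forall t, a < t < b -> h t = g t) ->
  itg mu `[a, b]%classic g ->
  itg mu `[a, b]%classic h /\ rint mu `[a, b]%classic h = rint mu `[a, b]%classic g.
Proof.
move=> ab gh ig; have mg := itg_meas ig.
have mh : measurable_fun (`[a, b]%classic : set R) h.
  apply: (@eq_measurable_fun _ _ _ _ _
    (fun t => g t + (h a - g a) * \1_[set a] t + (h b - g b) * \1_[set b] t)).
    move=> t; rewrite inE/= in_itv/= => /andP[]; rewrite !indicE !in_set1.
    rewrite le_eqVlt => /predU1P[<-|at_].
      by rewrite eqxx (lt_eqF ab) mulr1 mulr0 => _; lra.
    rewrite (gt_eqF at_) le_eqVlt => /predU1P[->|tb].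
      by rewrite eqxx mulr1 mulr0; lra.
    by rewrite (lt_eqF tb) (_ : false%:R = 0 :> R)// !mulr0 !addr0 gh// at_.
  by apply: measurable_funD; [apply: measurable_funD => //|]; apply: measurable_funM.
have ae : {ae mu, forall t, `[a, b]%classic t -> g t = h t}.
  exists [set a; b]; split => //.
    exact: measurableU.
    by apply: countable_lebesgue_measure0; apply: finite_set_countable; exact: finite_set2.
  move=> t /=; rewrite in_itv/= => /not_implyP[/andP[at_ tb] gt].
  move: at_; rewrite le_eqVlt => /predU1P[->|at_]; first by left.
  move: tb; rewrite le_eqVlt => /predU1P[->|tb]; first by right.
  by exfalso; apply: gt; rewrite gh// at_.
split; first exact: ae_itg ae ig.
by apply/esym; apply: ae_eq_rint.
Qed.

Lemma itg_horner a b (q : {poly R}) : itg mu `[a, b]%classic (fun t => q.[t]).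
Proof. by apply: itg_cont_seg; exact: continuous_horner. Qed.

Lemma sqi_horner a b (q : {poly R}) : sqi mu `[a, b]%classic (fun t => q.[t]).
Proof.
split; first by exact: itg_meas (itg_horner a b q).
apply: eq_itg (itg_horner a b (q * q)) => // t _.
by rewrite hornerM expr2.
Qed.

Lemma sqiS_seg a b a' b' f : a <= a' -> b' <= b ->
  sqi mu `[a, b]%classic f -> sqi mu `[a', b']%classic f.
Proof.
move=> aa bb [mf hf]; split; last exact: itgS_seg hf.
apply: measurable_funS mf => // t /=; rewrite !in_itv/= => /andP[h1 h2].
by rewrite (le_trans aa)// (le_trans h2).
Qed.

End segments.

Section knots.
Variables (R : realType) (p : nat).
Hypothesis p0 : (0 < p)%N.
Local Notation kn := (@knot R p).
Notation mu := (@lebesgue_measure R).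
Implicit Types (s t : R) (f g h H : R -> R).

Let pR : (0 : R) < p%:R. Proof. by rewrite ltr0n. Qed.

Lemma knot0 : kn 0 = 0. Proof. by rewrite /knot mul0r. Qed.
Lemma knot_last : kn p = 1. Proof. by rewrite /knot divff// gt_eqF. Qed.
Lemma knot_le i j : (kn i <= kn j) = (i <= j)%N.
Proof. by rewrite /knot ler_pdivrMr// divfK ?gt_eqF// ler_nat. Qed.
Lemma knot_lt i j : (kn i < kn j) = (i < j)%N.
Proof. by rewrite /knot ltr_pdivrMr// divfK ?gt_eqF// ltr_nat. Qed.
Lemma knot_ge0 j : 0 <= kn j. Proof. by rewrite -knot0 knot_le. Qed.
Lemma knot_le1 j : (j <= p)%N -> kn j <= 1. Proof. by rewrite -knot_last knot_le. Qed.
Lemma knot_diff j : kn j.+1 - kn j = p%:R^-1.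
Proof. by rewrite /knot -mulrBl -natr1 addrC addKr mul1r. Qed.

Lemma pieces_itg h (g : nat -> R -> R) :
  (forall j t, (j < p)%N -> kn j < t < kn j.+1 -> h t = g j t) ->
  (forall j, (j < p)%N -> itg mu `[kn j, kn j.+1]%classic (g j)) ->
  itg mu `[0, 1]%classic h /\
  rint mu `[0, 1]%classic h = \sum_(j < p) rint mu `[kn j, kn j.+1]%classic (g j).
Proof.
move=> hg ig.
suff H n : (n <= p)%N -> itg mu `[0, kn n]%classic h /\
    rint mu `[0, kn n]%classic h = \sum_(j < n) rint mu `[kn j, kn j.+1]%classic (g j).
  by have := H p (leqnn p); rewrite knot_last.
elim: n => [_|n IH np].
  rewrite big_ord0 knot0 /rint set_itv1 Rintegral_set1; split => //.
  apply/integrableP; split; first exact: measurable_fun_set1.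
  by rewrite integral_set1 ltry.
have [i1 e1] := IH (ltnW np).
have nn : kn n < kn n.+1 by rewrite knot_lt.
have [i2 e2] := seg_congr nn (fun t => hg n t np) (ig n np).
have i3 := itg_cat (knot_ge0 n) (ltW nn) i1 i2.
by split => //; rewrite (rint_itv_add (knot_ge0 n) (ltW nn) i3) e1 e2 big_ord_recr.
Qed.

Lemma knot_locate t : 0 <= t < 1 -> exists2 j, (j < p)%N & kn j <= t < kn j.+1.
Proof.
move=> /andP[t0 t1]; exists (Num.truncn (t * p%:R)).
  by rewrite truncn_lt_nat; [rewrite gtr_pMl|rewrite mulr_ge0// ltW].
by rewrite /knot ler_pdivrMr// ltr_pdivlMr// truncn_itv// mulr_ge0// ltW.
Qed.

Lemma pieces_ftc H h (g : nat -> R -> R) :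
  (forall j t, (j < p)%N -> kn j < t < kn j.+1 -> h t = g j t) ->
  (forall j, (j < p)%N -> itg mu `[kn j, kn j.+1]%classic (g j)) ->
  (forall j, (j < p)%N -> deriv_on (kn j) (kn j.+1) H (g j)) ->
  forall s t, 0 <= s -> s <= t -> t <= 1 -> rint mu `[s, t]%classic h = H t - H s.
Proof.
move=> hg ig dH; have [ih _] := pieces_itg hg ig.
have loc j t : (j < p)%N -> kn j <= t <= kn j.+1 ->
    rint mu `[kn j, t]%classic h = H t - H (kn j).
  move=> jp /andP[]; rewrite le_eqVlt => /predU1P[<-|jt] tj.
    by rewrite /rint set_itv1 Rintegral_set1 subrr.
  rewrite -(ftc_deriv_on (ltW jt) (deriv_on_sub (lexx _) tj (dH j jp))).
    apply: (proj2 (seg_congr jt _ _)).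
      by move=> u /andP[ju ut]; apply: hg => //; rewrite ju (lt_le_trans ut).
    by apply: itgS_seg (ig j jp).
  by apply: itgS_seg (ig j jp).
have knots n : (n <= p)%N -> rint mu `[0, kn n]%classic h = H (kn n) - H 0.
  elim: n => [_|n IH np]; first by rewrite knot0 /rint set_itv1 Rintegral_set1 subrr.
  have nn : kn n <= kn n.+1 by rewrite knot_le.
  rewrite (rint_itv_add (knot_ge0 n) nn); last by apply: itgS_seg ih => //; exact: knot_le1.
  by rewrite IH ?(ltnW np)// loc ?nn ?lexx//; ring.
have zero t : 0 <= t <= 1 -> rint mu `[0, t]%classic h = H t - H 0.
  move=> /andP[t0]; rewrite le_eqVlt => /predU1P[->|t1]; first by rewrite -knot_last knots.
  have [|j jp /andP[jt tj]] := @knot_locate t; first by rewrite t0.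
  rewrite (rint_itv_add (knot_ge0 j) jt); last by apply: itgS_seg ih => //; exact: ltW.
  by rewrite knots ?(ltnW jp)// loc ?jt ?(ltW tj)//; ring.
move=> s t s0 st t1.
have := rint_itv_add s0 st (itgS_seg (lexx 0) t1 ih).
rewrite !zero ?s0 ?t1 ?(le_trans s0 st) ?(le_trans st t1)//; lra.
Qed.

End knots.

Section lagrange.
Variable R : realType.
Implicit Types (s t : R) (q : {poly R}).

Lemma prod_lip (I : Type) (r : seq I) (P : pred I) (a b : I -> R) (z : R) :
  (forall i, P i -> `|a i| <= 1) -> (forall i, P i -> `|b i| <= 1) ->
  (forall i, P i -> `|a i - b i| <= z) -> 0 <= z ->
  `|\prod_(i <- r | P i) a i - \prod_(i <- r | P i) b i| <= (size r)%:R * z.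
Proof.
move=> ha hb hab z0.
have le1 (c : I -> R) (r' : seq I) : (forall i, P i -> `|c i| <= 1) -> `|\prod_(i <- r' | P i) c i| <= 1.
  move=> hc; rewrite normr_prod; elim: r' => [|i r' IH]; first by rewrite big_nil.
  rewrite big_cons; case: ifP => // Pi; rewrite -[leRHS]mulr1.
  apply: ler_pM => //; [exact: prodr_ge0|exact: hc].
elim: r => [|i r IH]; first by rewrite !big_nil subrr normr0 mul0r.
rewrite !big_cons /= -natr1 mulrDl mul1r; case: ifP => Pi; last by rewrite ler_wpDr.
set A := \prod_(j <- r | P j) a j in IH *; set B := \prod_(j <- r | P j) b j in IH *.
rewrite (_ : a i * A - b i * B = a i * (A - B) + (a i - b i) * B); last by ring.
apply: le_trans (ler_normD _ _) _; rewrite !normrM; apply: lerD.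
  by apply: le_trans IH; rewrite -[leRHS]mul1r; apply: ler_wpM2r => //; exact: ha.
by rewrite -[leRHS]mulr1; apply: ler_pM => //; [exact: hab|exact: le1].
Qed.

Definition lagrange_cst m : R := (m ^ 2)%:R * (m%:R * (2 * m)%:R ^+ m) ^+ 2.

Lemma lagrange_cst_ge0 m : 0 <= lagrange_cst m.
Proof. by rewrite mulr_ge0// sqr_ge0. Qed.

(** Polynomials of bounded degree are Lipschitz with a constant controlled by
    their values at the knots, uniformly in the number of knots: by Lagrange
    interpolation at [m] knots that are at least [1 / (2 * m)] apart. *)
Lemma poly_knots_lip m p q s t : (0 < m)%N -> (m <= p)%N -> (size q <= m)%N ->
  0 <= s <= 1 -> 0 <= t <= 1 ->
  (q.[t] - q.[s]) ^+ 2 <=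
  lagrange_cst m * (t - s) ^+ 2 * \sum_(j < p) q.[knot p j.+1] ^+ 2.
Proof.
move=> m0 mp sq s01 t01.
have p0 : (0 < p)%N by rewrite (leq_trans m0).
pose e := (p %/ m)%N.
have e0 : (0 < e)%N by rewrite divn_gt0.
have pe : (p <= 2 * m * e)%N.
  have := ltn_ceil p m0; rewrite -/e => /ltnW; move: e0; nia.
have ep : (m * e <= p)%N by rewrite mulnC leq_trunc_div.
pose x (i : 'I_m) : R := knot p (i.+1 * e).
have ix (i : 'I_m) : (i.+1 * e <= p)%N.
  by apply: leq_trans ep; rewrite leq_mul2r ltn_ord orbT.
have x01 i : 0 <= x i <= 1 by rewrite knot_ge0//= knot_le1.
have gap i l : i != l -> (2 * m)%:R^-1 <= `|x i - x l|.
  move=> il.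
  have step (k k' : nat) : (k < k')%N -> (2 * m)%:R^-1 <= knot p (k'.+1 * e) - knot p (k.+1 * e) :> R.
    move=> kk; rewrite /knot -mulrBl ler_pdivlMr ?ltr0n// ler_pdivrMl ?ltr0n ?muln_gt0//.
    rewrite -natrB; last by rewrite leq_mul2r ltnS (ltnW kk) orbT.
    rewrite -natrM ler_nat (leq_trans pe)// -mulnBl leq_mul2l muln_eq0/=.
    by rewrite leq_pmull ?orbT// subSS subn_gt0.
  have [/step h|/step h|/val_inj ile] := ltngtP i l.
  - by rewrite distrC; apply: le_trans h (ler_norm _).
  - by apply: le_trans h (ler_norm _).
  - by rewrite ile eqxx in il.
have xneq i l : i != l -> x i - x l != 0.
  move=> /gap h; rewrite -normr_gt0; apply: lt_le_trans h.
  by rewrite invr_gt0 ltr0n muln_gt0.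
pose L i : {poly R} := \prod_(l < m | l != i) ((x i - x l)^-1 *: ('X - (x l)%:P)).
have LE i u : (L i).[u] = \prod_(l < m | l != i) (u - x l) * \prod_(l < m | l != i) (x i - x l)^-1.
  rewrite /L horner_prod -big_split/=; apply: eq_bigr => l _.
  by rewrite hornerZ hornerXsubC mulrC.
have sL i : (size (L i) <= m)%N.
  rewrite /L scaler_prod; apply: leq_trans (size_scale_leq _ _) _.
  rewrite -big_filter size_prod_XsubC size_filter -sum1_count.
  rewrite (eq_bigl (fun l => l \in predC1 i))// sum1_card cardC1 card_ord.
  by rewrite prednK.
have Lx i l : (L i).[x l] = (i == l)%:R.
  rewrite LE; case: eqVneq => [<-|il].
    by rewrite -big_split/= big1// => l' l'i; rewrite divff// xneq// eq_sym.
  by rewrite (bigD1 l) ?(eq_sym l)//= subrr mul0r mul0r.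
have qE : q = \sum_(i < m) q.[x i] *: L i.
  apply/eqP; rewrite -subr_eq0; apply/eqP.
  apply: (@roots_geq_poly_eq0 _ _ [seq x i | i <- enum 'I_m]).
  - apply/allP => _ /mapP[l _ ->]; rewrite /root hornerD hornerN horner_sum.
    rewrite (bigD1 l)//= hornerZ Lx eqxx mulr1 big1 ?addr0 ?subrr// => i il.
    by rewrite hornerZ Lx (negPf il) mulr0.
  - rewrite map_inj_uniq ?enum_uniq// => i l; apply: contra_eq => /xneq.
    by rewrite subr_eq0.
  - rewrite size_map size_enum_ord (leq_trans (size_polyD _ _))// size_polyN geq_max sq/=.
    apply: leq_trans (size_sum _ _ _) _; apply/bigmax_leqP => i _.
    exact: leq_trans (size_scale_leq _ _) (sL i).
have unit (u v : R) : 0 <= u <= 1 -> 0 <= v <= 1 -> `|u - v| <= 1.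
  by move=> /andP[? ?] /andP[? ?]; rewrite ler_norml; lra.
have x1 u i : 0 <= u <= 1 -> `|u - x i| <= 1 by move=> u01; exact: unit.
have Llip i : ((L i).[t] - (L i).[s]) ^+ 2 <= (m%:R * (2 * m)%:R ^+ m) ^+ 2 * (t - s) ^+ 2.
  rewrite -(real_normK (num_real (t - s))) -exprMn -[leLHS]real_normK ?num_real//.
  rewrite ler_sqr ?nnegrE ?mulr_ge0// !LE -mulrBl normrM mulrAC.
  apply: ler_pM => //.
    have -> : (m%:R : R) = (size (index_enum 'I_m))%:R by rewrite -sum1_size sum1_card card_ord.
    apply: prod_lip => // [l _|l _|l _]; rewrite ?x1//.
    by rewrite (_ : t - x l - (s - x l) = t - s)//; ring.
  rewrite normr_prod.
  apply: (@le_trans _ _ (\prod_(l < m) (2 * m)%:R)); last by rewrite prodr_const card_ord.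
  rewrite big_mkcond; apply: ler_prod => l _; case: ifP => il.
    rewrite normr_ge0/= normfV -[leRHS]invrK lef_pV2 ?posrE ?normr_gt0 ?invr_gt0 ?ltr0n ?muln_gt0//.
      by rewrite gap// eq_sym.
    by rewrite xneq// eq_sym.
  by rewrite ler01/= ler1n muln_gt0.
rewrite (_ : q.[t] - q.[s] = \sum_(i < m) q.[x i] * ((L i).[t] - (L i).[s])); last first.
  rewrite [in LHS]qE !horner_sum -sumrB; apply: eq_bigr => i _.
  by rewrite !hornerZ mulrBr.
apply: le_trans (sum_CS _ _ _) _.
set S := \sum_(j < p) _.
have qS i : q.[x i] ^+ 2 <= S.
  have jp : ((i.+1 * e).-1 < p)%N by rewrite prednK ?muln_gt0// ix.
  rewrite /S (bigD1 (Ordinal jp))//= prednK ?muln_gt0// lerDl.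
  by apply: sumr_ge0 => *; exact: sqr_ge0.
have S0 : 0 <= S by apply: sumr_ge0 => *; exact: sqr_ge0.
rewrite /lagrange_cst natrX.
apply: (@le_trans _ _ ((m%:R * S) * (m%:R * ((m%:R * (2 * m)%:R ^+ m) ^+ 2 * (t - s) ^+ 2)))).
  apply: ler_pM; [by apply: sumr_ge0 => *; exact: sqr_ge0..| |].
    by apply: le_trans (ler_sum _ (fun i _ => qS i)) _; rewrite sumr_const card_ord mulr_natl.
  rewrite [leRHS](_ : _ = \sum_(i < m) ((m%:R * (2 * m)%:R ^+ m) ^+ 2 * (t - s) ^+ 2)).
    by apply: ler_sum => i _; exact: Llip.
  by rewrite sumr_const card_ord mulr_natl.
by rewrite le_eqVlt; apply/orP; left; apply/eqP; ring.
Qed.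

End lagrange.

Section spline_pieces.
Variables (R : realType) (m p : nat).
Hypothesis m0 : (0 < m)%N.
Hypothesis mp : (m <= p)%N.
Local Notation kn := (@knot R p).
Notation mu := (@lebesgue_measure R).
Implicit Types (s t : R) (q : nat -> {poly R}).

Let p0 : (0 < p)%N. Proof. exact: leq_trans mp. Qed.

(** The polynomial pieces of a natural spline, from the left of the first
    knot ([q 0]) to the right of the last one ([q p]). *)
Definition spieces q :=
  [/\ forall j, (j <= p)%N -> (size (q j) <= 2 * m)%N, (size (q 0%N) <= m)%N,
      (size (q p) <= m)%N &
      forall j k, (j < p)%N -> (k <= (2 * m).-2)%N ->
        (q j)^`(k).[kn j.+1] = (q j.+1)^`(k).[kn j.+1]].

(** The [k]-th derivative of the spline on [0,1]; at a knot the piece on the right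
    is used. *)
Definition pw q k t := (q (Num.truncn (t * p%:R)))^`(k).[t].

Lemma pw_oo q k j t : kn j <= t < kn j.+1 -> pw q k t = (q j)^`(k).[t].
Proof.
move=> jt; rewrite /pw (truncn_def (n := j))//.
by rewrite -ler_pdivrMr ?ltr0n// -ltr_pdivlMr ?ltr0n.
Qed.

Lemma pw_knot q k j : pw q k (kn j) = (q j)^`(k).[kn j].
Proof. by apply: pw_oo; rewrite lexx knot_lt ?ltnSn. Qed.

Lemma pw_cc q k j t : spieces q -> (j < p)%N -> (k <= (2 * m).-2)%N ->
  kn j <= t <= kn j.+1 -> pw q k t = (q j)^`(k).[t].
Proof.
move=> [_ _ _ hq] jp km /andP[jt]; rewrite le_eqVlt => /predU1P[->|tj].
  by rewrite pw_knot hq.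
by apply: pw_oo; rewrite jt.
Qed.

Definition energy q q' : R :=
  \sum_(j < p) rint mu `[kn j, kn j.+1]%classic (fun t => (q j)^`(m).[t] * (q' j)^`(m).[t]).

Lemma sqi_pw q k : sqi mu `[0, 1]%classic (pw q k).
Proof.
have [i1 _] := @pieces_itg _ _ p0 (pw q k) (fun j t => (q j)^`(k).[t])
  (fun j t jp jt => pw_oo _ _ (let: conj a b := andP jt in introT andP (conj (ltW a) b)))
  (fun j jp => itg_horner _ _ _).
split; first exact: itg_meas i1.
apply: (proj1 (@pieces_itg _ _ p0 _ (fun j t => (q j)^`(k).[t] * (q j)^`(k).[t]) _ _)).
  by move=> j t jp /andP[/ltW jt tj]; rewrite expr2 (pw_oo _ _ (j := j)) ?jt.
by move=> j jp; under [X in itg _ _ X]eq_fun do rewrite -hornerM; exact: itg_horner.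
Qed.

Lemma energy_pw q q' : energy q q' = dot mu `[0, 1]%classic (pw q m) (pw q' m).
Proof.
apply/esym; apply: (proj2 (@pieces_itg _ _ p0 _ (fun j t => (q j)^`(m).[t] * (q' j)^`(m).[t]) _ _)).
  by move=> j t jp /andP[/ltW jt tj]; rewrite !(pw_oo _ _ (j := j)) ?jt.
by move=> j jp; under [X in itg _ _ X]eq_fun do rewrite -hornerM; exact: itg_horner.
Qed.

Section orthogonality.
Variables (q : nat -> {poly R}) (b : nat -> R -> R).
Hypothesis hq : spieces q.
Hypothesis hb : forall k, (k < m)%N -> deriv_on 0 1 (b k) (b k.+1).
Hypothesis sb : sqi mu `[0, 1]%classic (b m).
Hypothesis qb : forall j, (0 < j <= p)%N -> b 0%N (kn j) = (q j).[kn j].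

(** Iterated integration by parts in one stroke: on each piece, the product of
    [(q j)^`(m)] with the [m]-th derivative of the interpolation error has this
    primitive. *)
Let Psi j t := \sum_(k < m)
  ((-1) ^+ k * (q j)^`(m + k).[t]) * (b (m.-1 - k) t - (q j)^`(m.-1 - k).[t]).

Let dPsi j : (j < p)%N -> deriv_on (kn j) (kn j.+1) (Psi j)
  (fun t => (q j)^`(m).[t] * (b m t - (q j)^`(m).[t])).
Proof.
move=> jp; have [sq _ _ _] := hq.
pose T (k : nat) t := (-1) ^+ k * (q j)^`(m + k).[t] * (b (m - k)%N t - (q j)^`(m - k).[t]).
have dk (k : 'I_m) : deriv_on (kn j) (kn j.+1)
  (fun t => ((-1) ^+ k * (q j)^`(m + k).[t]) * (b (m.-1 - k) t - (q j)^`(m.-1 - k).[t]))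
  (fun t => T k t - T k.+1 t).
  have km := ltn_ord k.
  have e1 : (m - k = (m.-1 - k).+1)%N by lia.
  have e2 : (m - k.+1 = m.-1 - k)%N by lia.
  have db : deriv_on (kn j) (kn j.+1) (b (m.-1 - k)%N) (b (m - k)%N).
    rewrite e1; apply: deriv_on_sub (hb _); rewrite ?knot_ge0 ?knot_le1//; lia.
  have D1 := deriv_onZ ((-1) ^+ k) (@deriv_on_horner R (kn j) (kn j.+1) (q j)^`(m + k)).
  have D2 := deriv_onB db (@deriv_on_horner R (kn j) (kn j.+1) (q j)^`(m.-1 - k)).
  apply: (eq_deriv_on _ _ (deriv_onM D1 D2)) => t _ //.
  rewrite /T e2 exprS addnS -!derivnS -e1; ring.
apply: eq_deriv_on (deriv_on_sum (index_enum 'I_m) dk) => t _ //.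
rewrite -(big_mkord xpredT (fun k => T k t - T k.+1 t)).
rewrite (eq_bigr (fun k => - (T k.+1 t - T k t))); last by move=> k _; rewrite opprB.
rewrite sumrN (telescope_sumr (fun k => T k t))// opprB.
have -> : T m t = 0.
  by rewrite /T derivn_poly0 ?horner0 ?mulr0 ?mul0r// addnn -mul2n sq// ltnW.
by rewrite subr0 /T expr0 mul1r addn0 subn0.
Qed.

Let Psi_int j : (j < p)%N ->
  rint mu `[kn j, kn j.+1]%classic (fun t => (q j)^`(m).[t] * (b m t - (q j)^`(m).[t])) =
  Psi j (kn j.+1) - Psi j (kn j).
Proof.
move=> jp; apply: ftc_deriv_on (dPsi jp) _; first by rewrite knot_le.
apply: sqiM_itg => //; first exact: sqi_horner.
by apply: sqiB => //; [apply: sqiS_seg sb; rewrite ?knot_ge0 ?knot_le1|exact: sqi_horner].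
Qed.

Let Psi_match j : (j < p)%N -> Psi j (kn j.+1) = Psi j.+1 (kn j.+1).
Proof.
move=> jp; have [sq _ _ hm] := hq.
apply: eq_bigr => k _; have km := ltn_ord k.
have [kl|kl] := ltnP k m.-1.
  by rewrite !hm//; lia.
rewrite (_ : m.-1 - k = 0)%N; last by lia.
have z1 : b 0%N (kn j.+1) - (q j.+1)^`(0).[kn j.+1] = 0 by rewrite qb ?jp// derivn0 subrr.
by rewrite (hm j 0%N)// z1 !mulr0.
Qed.

(** The primitives [Psi j] agree at the knots, and vanish at both ends where the
    pieces have degree less than [m]: their increments telescope to 0. *)
Lemma orthogonality : \sum_(j < p)
  rint mu `[kn j, kn j.+1]%classic (fun t => (q j)^`(m).[t] * (b m t - (q j)^`(m).[t])) = 0.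
Proof.
have [_ s0 sp _] := hq.
have Psi0 j : (size (q j) <= m)%N -> forall t, Psi j t = 0.
  move=> sj t; rewrite /Psi big1// => k _.
  by rewrite derivn_poly0 ?(leq_trans sj) ?leq_addr// horner0 mulr0 mul0r.
transitivity (\sum_(0 <= j < p) (Psi j.+1 (kn j.+1) - Psi j (kn j))).
  by rewrite big_mkord; apply: eq_bigr => j _; rewrite Psi_int// Psi_match.
by rewrite (telescope_sumr (fun j => Psi j (kn j)))// !Psi0// subrr.
Qed.

(** By [orthogonality], the energy of an interpolant is that of the spline plus the
    energy of the difference. *)
Lemma energy_min : energy q q <= dot mu `[0, 1]%classic (b m) (b m).
Proof.
have sq j : sqi mu `[kn j, kn j.+1]%classic (fun t => (q j)^`(m).[t]) by exact: sqi_horner.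
have sbj j : (j < p)%N -> sqi mu `[kn j, kn j.+1]%classic (b m).
  by move=> jp; apply: sqiS_seg sb; rewrite ?knot_ge0 ?knot_le1.
have -> : dot mu `[0, 1]%classic (b m) (b m) =
    \sum_(j < p) rint mu `[kn j, kn j.+1]%classic (fun t => b m t * b m t).
  apply: (proj2 (@pieces_itg _ _ p0 _ (fun j t => b m t * b m t) _ _)) => //.
  by move=> j jp; apply: sqiM_itg => //; exact: sbj.
rewrite -subr_ge0 /energy -sumrB.
rewrite -[leRHS]subr0 -[X in _ - X](mulr0 2) -[X in 2 * X]orthogonality mulr_sumr -sumrB.
apply: sumr_ge0 => j _; have jp := ltn_ord j.
pose Q t := (q j)^`(m).[t].
have sQ : sqi mu `[kn j, kn j.+1]%classic Q by exact: sqi_horner.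
have sB := sbj j jp.
have sBQ : sqi mu `[kn j, kn j.+1]%classic (fun t => b m t - Q t) by exact: sqiB.
have := dot_ge0 mu `[kn j, kn j.+1]%classic (fun t => b m t - Q t).
rewrite dotBl// !dotBr//.
have : dot mu `[kn j, kn j.+1]%classic Q (fun t => b m t - Q t) =
  dot mu `[kn j, kn j.+1]%classic Q (b m) - dot mu `[kn j, kn j.+1]%classic Q Q.
  by rewrite dotBr.
rewrite (dotC mu _ (b m) Q) /dot /Q => ->.
lra.
Qed.

End orthogonality.

Section remainder.
Variable q : nat -> {poly R}.
Hypothesis hq : spieces q.

(** Remainder of the Taylor expansion at 0, where the spline coincides with the
    polynomial [q 0]. *)
Definition srem k t := pw q k t - (q 0%N)^`(k).[t].

Lemma srem_int k s t : (k < m)%N -> 0 <= s -> s <= t -> t <= 1 ->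
  rint mu `[s, t]%classic (srem k.+1) = srem k t - srem k s.
Proof.
move=> km; apply: (@pieces_ftc R p p0 (srem k) (srem k.+1)
  (fun j t => (q j)^`(k.+1).[t] - (q 0%N)^`(k.+1).[t])).
- by move=> j u jp /andP[/ltW ju uj]; rewrite /srem (pw_oo _ _ (j := j)) ?ju.
- by move=> j jp; apply: itgB => //; exact: itg_horner.
- move=> j jp; have km2 : (k <= (2 * m).-2)%N by lia.
  apply: (@eq_deriv_on _ _ _ (fun u => (q j)^`(k).[u] - (q 0%N)^`(k).[u])
    (fun u => (q j)^`(k.+1).[u] - (q 0%N)^`(k.+1).[u])).
  + by move=> u uj; rewrite /srem (pw_cc hq (j := j)).
  + by [].
  + by rewrite !derivnS; apply: deriv_onB; exact: deriv_on_horner.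
Qed.

Lemma srem0 k : srem k 0 = 0.
Proof. by rewrite /srem; have := pw_knot q k 0; rewrite knot0 => ->; rewrite subrr. Qed.

Lemma energy_ge0 q' : 0 <= energy q' q'.
Proof. by rewrite energy_pw dot_ge0. Qed.

Lemma srem_top t : srem m t = pw q m t.
Proof. by have [_ s0 _ _] := hq; rewrite /srem [X in X.[t]](derivn_poly0 s0) horner0 subr0. Qed.

Lemma srem_lip i s t : (i < m)%N -> 0 <= s -> s <= t -> t <= 1 ->
  (srem (m.-1 - i) t - srem (m.-1 - i) s) ^+ 2 <= (t - s) * energy q q.
Proof.
move=> im s0 st t1; elim: i im s t s0 st t1 => [_|i IH im] s t s0 st t1.
  rewrite subn0 -srem_int ?prednK//.
  have sT : sqi mu `[0, 1]%classic (srem m).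
    by apply: (eq_sqi _ _ (sqi_pw q m)) => // u _; rewrite srem_top.
  have sS : sqi mu `[s, t]%classic (srem m) by apply: sqiS_seg sT.
  have s1 : sqi mu `[s, t]%classic (fun=> 1).
    by apply: (eq_sqi _ _ (sqi_horner s t 1)) => // u _; rewrite hornerC.
  have := @CS _ _ _ mu _ (measurable_itv _) _ _ s1 sS.
  rewrite (_ : dot mu _ (fun=> 1) (srem m) = rint mu `[s, t]%classic (srem m)); last first.
    by apply: eq_rint => u _; rewrite mul1r.
  rewrite (_ : dot mu _ (fun=> 1) (fun=> 1) = t - s); last first.
    by rewrite /dot mulr1 rint_cst_seg// mul1r.
  move/le_trans; apply; rewrite ler_wpM2l ?subr_ge0// energy_pw.
  have i1 : itg mu `[0, 1]%classic (fun u => srem m u * srem m u) by exact: sqiM_itg.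
  rewrite (_ : dot mu _ (pw q m) (pw q m) = dot mu `[0, 1]%classic (srem m) (srem m)); last first.
    by apply: eq_dot => u _; rewrite srem_top.
  rewrite /dot (rint_itv_add s0 (le_trans st t1) i1).
  rewrite (rint_itv_add st t1 (itgS_seg s0 (lexx 1) i1)).
  have pos a b : 0 <= rint mu `[a, b]%classic (fun u => srem m u * srem m u).
    by apply: rint_ge0 => u _; rewrite -expr2 sqr_ge0.
  by rewrite -[leLHS]add0r; apply: lerD => //; rewrite -[leLHS]addr0; apply: lerD.
set k := (m.-1 - i.+1)%N.
have kS : (m.-1 - i = k.+1)%N by rewrite /k; lia.
have km : (k < m)%N by rewrite /k; lia.
rewrite -srem_int//.
set E := energy q q; have E0 : 0 <= E by exact: energy_ge0.
have bd u : s <= u <= t -> `|srem k.+1 u - 0| <= Num.sqrt E.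
  move=> /andP[su ut]; rewrite subr0 -[leLHS](sqrtr_sqr) //; apply: ler_wsqrtr.
  have := IH (ltnW im) 0 u (lexx 0) (le_trans s0 su) (le_trans ut t1).
  rewrite kS srem0 subr0 => /le_trans; apply; rewrite subr0 ler_piMl//.
  exact: le_trans ut t1.
have is_ : itg mu `[s, t]%classic (srem k.+1).
  apply: (itgS_seg s0 t1); apply: itgB => //; last exact: itg_horner.
  have h3 : sqi mu `[0, 1]%classic (fun=> 1 : R).
    by apply: (eq_sqi _ _ (sqi_horner 0 1 1)) => // u _; rewrite hornerC.
  have h4 : itg mu `[0, 1]%classic (fun u => pw q k.+1 u * 1) by apply: sqiM_itg => //; exact: sqi_pw.
  by apply: eq_itg h4 => // u _; rewrite mulr1.
have := rint_near_cst st is_ bd; rewrite mul0r subr0 => h.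
apply: (@le_trans _ _ ((Num.sqrt E * (t - s)) ^+ 2)).
  rewrite -(real_normK (num_real (rint _ _ _))) ler_sqr ?nnegrE//.
  by rewrite mulr_ge0 ?sqrtr_ge0 ?subr_ge0.
rewrite exprMn sqr_sqrtr// mulrC expr2 -mulrA ler_wpM2l ?subr_ge0//.
by rewrite ler_piMl//; lra.
Qed.

Lemma srem_lip0 k s t : (k < m)%N -> 0 <= s -> s <= t -> t <= 1 ->
  (srem k t - srem k s) ^+ 2 <= (t - s) * energy q q.
Proof.
move=> km; rewrite (_ : k = m.-1 - (m.-1 - k))%N; last by lia.
by apply: srem_lip; lia.
Qed.

Lemma srem_bound k t : (k < m)%N -> 0 <= t <= 1 -> (srem k t) ^+ 2 <= energy q q.
Proof.
move=> km /andP[t0 t1]; have := srem_lip0 km (lexx 0) t0 t1.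
rewrite srem0 !subr0 => /le_trans; apply.
by rewrite ler_piMl// energy_ge0.
Qed.

Definition step_cst : R := 2 + 4 * lagrange_cst R m.

(** The Taylor remainder is Hoelder continuous of exponent 1/2 with a constant given
    by the energy; the polynomial part is handled by [poly_knots_lip], its values at
    the knots being those of the spline minus the remainder. *)
Lemma spline_step j t : (j < p)%N -> kn j <= t <= kn j.+1 ->
  (pw q 0 t - pw q 0 (kn j.+1)) ^+ 2 <=
  step_cst / p%:R * (p%:R^-1 * \sum_(i < p) (pw q 0 (kn i.+1)) ^+ 2 + energy q q).
Proof.
move=> jp /andP[jt tj]; set E := energy q q; have E0 : 0 <= E by exact: energy_ge0.
set x := kn j.+1; have x1 : x <= 1 by exact: knot_le1.
have t0 : 0 <= t by apply: le_trans jt; exact: knot_ge0.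
have x0 := le_trans t0 tj.
have [_ s0 _ _] := hq.
have pwE u : pw q 0 u = srem 0 u + (q 0%N).[u] by rewrite /srem derivn0 subrK.
set V := \sum_(i < p) _.
have V0 : 0 <= V by apply: sumr_ge0 => *; exact: sqr_ge0.
have pR : 0 < p%:R :> R by rewrite ltr0n.
have xt : x - t <= p%:R^-1 by rewrite -(@knot_diff R p j); rewrite -/x; lra.
have h1 : (srem 0 x - srem 0 t) ^+ 2 <= p%:R^-1 * E.
  by apply: le_trans (srem_lip0 m0 t0 tj x1) _; rewrite ler_wpM2r.
have h2 := poly_knots_lip m0 mp s0 (introT andP (conj t0 (le_trans tj x1)))
  (introT andP (conj x0 x1)).
have h3 : \sum_(i < p) (q 0%N).[kn i.+1] ^+ 2 <= 2 * V + 2 * (p%:R * E).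
  rewrite (_ : 2 * V = \sum_(i < p) 2 * pw q 0 (kn i.+1) ^+ 2); last by rewrite mulr_sumr.
  have -> : 2 * (p%:R * E) = \sum_(i < p) (2 * E) by rewrite sumr_const card_ord -mulr_natl; ring.
  rewrite -big_split/=; apply: ler_sum => i _; rewrite pwE.
  have i01 : 0 <= kn i.+1 <= 1 by rewrite knot_ge0 ?knot_le1.
  have := srem_bound m0 i01; rewrite -/E.
  have := sqr_ge0 (2 * srem 0 (kn i.+1) + (q 0%N).[kn i.+1]).
  by nra.
set L := lagrange_cst R m in h2 *; have L0 : 0 <= L by exact: lagrange_cst_ge0.
have xt2 : (x - t) ^+ 2 <= p%:R^-1 ^+ 2.
  by rewrite ler_sqr ?nnegrE ?subr_ge0// invr_ge0 ltW.
have h4 : ((q 0%N).[x] - (q 0%N).[t]) ^+ 2 <= L * p%:R^-1 ^+ 2 * (2 * V + 2 * (p%:R * E)).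
  apply: le_trans h2 _; apply: ler_pM => //.
  - by rewrite mulr_ge0// sqr_ge0.
  - by apply: sumr_ge0 => *; exact: sqr_ge0.
  - by rewrite ler_wpM2l.
rewrite !pwE.
apply: (@le_trans _ _ (2 * (p%:R^-1 * E) + 2 * (L * p%:R^-1 ^+ 2 * (2 * V + 2 * (p%:R * E))))).
  have := sqr_ge0 ((srem 0 x - srem 0 t) - ((q 0%N).[x] - (q 0%N).[t])).
  set a := srem 0 x in h1 *; set b := srem 0 t in h1 *.
  set c := (q 0%N).[x] in h4 *; set d := (q 0%N).[t] in h4 *.
  nra.
rewrite /step_cst -/L.
rewrite (_ : L * p%:R^-1 ^+ 2 * (2 * V + 2 * (p%:R * E)) =
  2 * L * p%:R^-1 * (p%:R^-1 * V + E)); last by field; rewrite gt_eqF.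
have : 0 <= p%:R^-1 * (p%:R^-1 * V) by rewrite !mulr_ge0// invr_ge0 ltW.
nra.
Qed.

End remainder.

Lemma knots_poly0 (r : {poly R}) : (size r <= m)%N ->
  (forall j, (j < p)%N -> r.[kn j.+1] = 0) -> r = 0.
Proof.
move=> sr r0; apply: (@roots_geq_poly_eq0 _ _ [seq kn j.+1 | j : 'I_p]).
- by apply/allP => _ /mapP[j _ ->]; rewrite /root r0.
- rewrite map_inj_uniq ?enum_uniq// => i j /eqP.
  by rewrite eq_le !knot_le// -eqn_leq eqSS => /eqP/val_inj.
- by rewrite size_map size_enum_ord (leq_trans sr).
Qed.

(** Compared with the null interpolant in [energy_min], the spline has no energy: it
    is a polynomial of degree less than [m] with at least [m] zeros. *)
Lemma spline_unique q : spieces q -> (forall j, (0 < j <= p)%N -> (q j).[kn j] = 0) ->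
  [/\ q 0%N = 0, q p = 0 & forall t, 0 <= t <= 1 -> pw q 0 t = 0].
Proof.
move=> hq q0; have [_ s0 sp _] := hq.
have E0 : energy q q = 0.
  apply/le_anti; rewrite energy_ge0// andbT.
  have := @energy_min q (fun _ _ => 0) hq (fun k _ => @deriv_on_cst R 0 1 0)
    (sqi0 mu (measurable_itv _)) (fun j jp => esym (q0 j jp)).
  rewrite (_ : dot mu _ _ _ = 0)//.
  transitivity (rint mu `[0, 1]%classic (fun=> 0 : R)); last by rewrite rint0.
  by apply: eq_rint => u _; rewrite mul0r.
have r0 k t : (k < m)%N -> 0 <= t <= 1 -> pw q k t = (q 0%N)^`(k).[t].
  move=> km t01; have := srem_bound hq km t01; rewrite E0 => h.
  apply/eqP; rewrite -subr_eq0 -sqrf_eq0; apply/eqP/le_anti.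
  by rewrite h sqr_ge0.
have qz : q 0%N = 0.
  apply: knots_poly0 => // j jp.
  have := @r0 0%N (kn j.+1) m0; rewrite knot_ge0 ?knot_le1// => /(_ isT).
  by rewrite pw_knot !derivn0 q0.
split => //.
- apply: knots_poly0 => // j jp.
  rewrite (_ : kn j.+1 = 1 + (kn j.+1 - 1)); last by ring.
  rewrite nderiv_taylor; last exact: mulrC.
  rewrite big1// => i _; have im : (i < m)%N by rewrite (leq_trans (ltn_ord i)).
  have := r0 i 1 im; rewrite ler01 lexx => /(_ isT).
  rewrite qz derivnC; have <- := knot_last R p0.
  rewrite pw_knot; case: ifP => _; rewrite horner0 nderivn_def hornerMn => /eqP.
    by rewrite mulrn_eq0 eqn0Ngt fact_gt0/= => /eqP ->; rewrite mul0r.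
  by rewrite mulrn_eq0 eqn0Ngt fact_gt0/= => /eqP ->; rewrite mul0r.
- by move=> t t01; rewrite r0// qz derivn0 horner0.
Qed.

End spline_pieces.

(** * The basis of natural splines and the penalty matrix *)

Section spline_to_pieces.
Variable R : realType.
Implicit Types (s t a b c : R) (f g F G : R -> R).

Lemma derive1n_open a b f (r : {poly R}) : (forall t, a < t < b -> f t = r.[t]) ->
  forall k t, a < t < b -> derive1n k f t = r^`(k).[t].
Proof.
move=> fr; elim=> [|k IH] t tab; first by rewrite derivn0 /derive1n/= fr.
rewrite derivnS derivE /derive1n iterS -/(derive1n k f) !derive1E.
apply: near_eq_derive; near=> s; apply: IH.
have : s \in `]a, b[ by near: s; apply: near_in_itvoo; rewrite in_itv.
by rewrite in_itv.
Unshelve. all: by end_near. Qed.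

Lemma cont_eq_right F G c e : 0 < e -> {for c, continuous F} -> {for c, continuous G} ->
  (forall t, c < t < c + e -> F t = G t) -> F c = G c.
Proof.
move=> e0 cF cG FG; apply/eqP; rewrite -subr_eq0 -normr_le0.
apply/ler_addgt0Pr => z z0; rewrite add0r.
have z2 : 0 < z / 2 by rewrite divr_gt0.
have /cvgrPdist_le/(_ _ z2)/nbhs_ballP[d1 /= d10 h1] := cF.
have /cvgrPdist_le/(_ _ z2)/nbhs_ballP[d2 /= d20 h2] := cG.
pose dl := Num.min e (Num.min d1 d2) / 2.
have dl0 : 0 < dl by rewrite divr_gt0// !lt_min e0 d10.
have dle : dl < e by rewrite /dl ltr_pdivrMr// (le_lt_trans (_ : _ <= e))// ?ge_min ?lexx// ltr_pMr// ltr1n.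
have dl1 : dl < d1 by rewrite /dl ltr_pdivrMr// (le_lt_trans (_ : _ <= d1))// ?ge_min ?lexx ?orbT// ltr_pMr// ltr1n.
have dl2 : dl < d2 by rewrite /dl ltr_pdivrMr// (le_lt_trans (_ : _ <= d2))// ?ge_min ?lexx ?orbT// ltr_pMr// ltr1n.
have b1 : ball c d1 (c + dl) by rewrite /ball/= opprD addNKr normrN gtr0_norm.
have b2 : ball c d2 (c + dl) by rewrite /ball/= opprD addNKr normrN gtr0_norm.
have FGE : F (c + dl) = G (c + dl) by apply: FG; rewrite ltrDl dl0 ltrD2l.
have := h1 _ b1; have := h2 _ b2; rewrite /= FGE => u1 u2.
rewrite (_ : F c - G c = (F c - G (c + dl)) - (G c - G (c + dl))); last by ring.
by apply: le_trans (ler_normB _ _) _; rewrite [leRHS]splitr lerD.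
Qed.

Lemma cont_eq_left F G c e : 0 < e -> {for c, continuous F} -> {for c, continuous G} ->
  (forall t, c - e < t < c -> F t = G t) -> F c = G c.
Proof.
move=> e0 cF cG FG.
have cN (H : R -> R) : {for c, continuous H} -> {for - c, continuous (fun t => H (- t))}.
  move=> cH; apply: (@continuous_comp _ _ _ -%R H); first exact: opp_continuous.
  by rewrite opprK.
rewrite -[c]opprK; apply: (@cont_eq_right (fun t => F (- t)) (fun t => G (- t)) (- c) e) => //;
  [exact: cN|exact: cN|].
by move=> t /andP[t1 t2]; apply: FG; lra.
Qed.

Variables (m p : nat).
Hypotheses (m0 : (0 < m)%N) (mp : (m <= p)%N).
Local Notation kn := (@knot R p).
Let p0 : (0 < p)%N. Proof. exact: leq_trans mp. Qed.

(** The derivatives up to the order [2 * m - 2] are continuous, so that at a knot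
    they are the limits of the derivatives of both adjacent pieces. *)
Lemma natural_spline_pieces f : natural_spline m p f -> exists q,
  [/\ spieces m p q,
      forall t, 0 <= t <= 1 -> f t = pw p q 0 t,
      forall j t, (j < p)%N -> kn j < t < kn j.+1 -> derive1n m f t = (q j)^`(m).[t],
      forall t, t <= kn 1 -> f t = (q 0%N).[t] & forall t, 1 <= t -> f t = (q p).[t]].
Proof.
move=> [_ cf mid [ql sl fl] [qr sr fr]].
have /choice[qm hqm] : forall j, exists q : {poly R}, (0 < j < p)%N ->
    (size q <= 2 * m)%N /\ forall t, kn j <= t <= kn j.+1 -> f t = q.[t].
  move=> j; case jp : (0 < j < p)%N; last by exists 0.
  by have [q sq fq] := mid j jp; exists q.
pose q j := if j == 0%N then ql else if j == p then qr else qm j.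
have q0E : q 0%N = ql by rewrite /q eqxx.
have qpE : q p = qr by rewrite /q gtn_eqF// eqxx.
have piece j t : (j < p)%N -> kn j <= t <= kn j.+1 -> f t = (q j).[t].
  move=> jp; case: (posnP j) => [->|j0].
    by rewrite q0E => /andP[_ t1]; exact: fl.
  rewrite /q gtn_eqF// (ltn_eqF jp) => tj.
  by have [|_] := hqm j; [rewrite j0|apply].
have right t : 1 <= t -> f t = (q p).[t].
  by move=> t1; rewrite qpE fr// knot_last.
have d_in k j t : (j < p)%N -> kn j < t < kn j.+1 -> derive1n k f t = (q j)^`(k).[t].
  move=> jp; apply: derive1n_open => u /andP[/ltW ju /ltW uj].
  by apply: piece => //; rewrite ju.
have contP (r : {poly R}) c : {for c, continuous (fun t => r.[t])}.
  exact: continuous_horner.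
have fin j k : (j < p)%N -> (k <= (2 * m).-2)%N ->
    derive1n k f (kn j.+1) = (q j)^`(k).[kn j.+1].
  move=> jp km; have hlt : 0 < kn j.+1 - kn j by rewrite knot_diff// invr_gt0 ltr0n.
  apply: (cont_eq_left hlt (cf k km _) (contP _ _)) => t tj.
  by apply: d_in => //; move: tj; rewrite opprB addrC subrK.
have fst j k : (0 < j <= p)%N -> (k <= (2 * m).-2)%N ->
    derive1n k f (kn j) = (q j)^`(k).[kn j].
  move=> /andP[j0]; rewrite leq_eqVlt => /predU1P[->|jp] km.
    apply: (cont_eq_right ltr01 (cf k km _) (contP _ _)) => t; rewrite knot_last//.
    by apply: derive1n_open => u /andP[/ltW u1 _]; exact: right.
  have hlt : 0 < kn j.+1 - kn j by rewrite knot_diff// invr_gt0 ltr0n.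
  apply: (cont_eq_right hlt (cf k km _) (contP _ _)) => t tj.
  by apply: d_in => //; move: tj; rewrite addrC subrK.
have sp_ : spieces m p q.
  split.
  - move=> j jp; rewrite /q; case: eqP => [_|j0]; first by rewrite (leq_trans sl)// leq_pmull.
    case: eqP => [_|jp']; first by rewrite (leq_trans sr)// leq_pmull.
    by have [|] := hqm j => //; lia.
  - by rewrite q0E.
  - by rewrite qpE.
  - by move=> j k jp km; rewrite -fin// fst// jp.
exists q; split => //.
- move=> t /andP[t0]; rewrite le_eqVlt => /predU1P[->|t1].
    by rewrite -(knot_last R p0) (pw_knot m0 mp) derivn0 right ?knot_last.
  have [|j jp /andP[jt tj]] := @knot_locate R p p0 t; first by rewrite t0.
  by rewrite (@pw_oo R m p m0 mp q 0 j t) ?jt// derivn0 (piece j)// jt ltW.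
- by move=> j t; exact: d_in.
Qed.

End spline_to_pieces.

Section quadratic_forms.
Variables (R : realType) (p : nat).
Implicit Types (A : 'M[R]_p) (x y v : 'cV[R]_p).

Definition qf A x y : R := (x^T *m A *m y) 0 0.

Lemma qfE A x y : qf A x y = \sum_i \sum_j x i 0 * A i j * y j 0.
Proof.
rewrite /qf -mulmxA mxE; apply: eq_bigr => i _; rewrite !mxE mulr_sumr.
by apply: eq_bigr => j _; rewrite mulrA.
Qed.

Lemma qfDl A x x' y : qf A (x + x') y = qf A x y + qf A x' y.
Proof. by rewrite /qf linearD/= !mulmxDl mxE. Qed.
Lemma qfDr A x y y' : qf A x (y + y') = qf A x y + qf A x y'.
Proof. by rewrite /qf !mulmxDr mxE. Qed.
Lemma qfZl A k x y : qf A (k *: x) y = k * qf A x y.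
Proof. by rewrite /qf linearZ/= -!scalemxAl mxE. Qed.
Lemma qfZr A k x y : qf A x (k *: y) = k * qf A x y.
Proof. by rewrite /qf -!scalemxAr mxE. Qed.
Lemma qfNr A x y : qf A x (- y) = - qf A x y.
Proof. by rewrite -scaleN1r qfZr mulN1r. Qed.
Lemma qfBr A x y y' : qf A x (y - y') = qf A x y - qf A x y'.
Proof. by rewrite qfDr qfNr. Qed.
Lemma qfBl A x x' y : qf A (x - x') y = qf A x y - qf A x' y.
Proof. by rewrite qfDl -scaleN1r qfZl mulN1r. Qed.
Lemma qf_sym A x y : A^T = A -> qf A x y = qf A y x.
Proof.
move=> sA; rewrite !qfE exchange_big/=; apply: eq_bigr => i _; apply: eq_bigr => j _.
have -> : A j i = A i j by rewrite -[in LHS]sA mxE.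
by rewrite [LHS]mulrC mulrA [y i 0 * _ * _]mulrAC mulrAC.
Qed.
Lemma qf_addA A A' x y : qf (A + A') x y = qf A x y + qf A' x y.
Proof. by rewrite /qf mulmxDr mulmxDl mxE. Qed.
Lemma qf_scaleA k A x y : qf (k *: A) x y = k * qf A x y.
Proof. by rewrite /qf -scalemxAr -scalemxAl mxE. Qed.
Lemma qf1 x : qf 1%:M x x = \sum_i x i 0 ^+ 2.
Proof.
by rewrite /qf mulmx1 mxE; apply: eq_bigr => i _; rewrite mxE expr2.
Qed.

Lemma qf_CS A x y : A^T = A -> (forall z, 0 <= qf A z z) ->
  qf A x y ^+ 2 <= qf A x x * qf A y y.
Proof.
move=> sA pA.
have key s t : 0 <= s ^+ 2 * qf A x x + 2 * s * t * qf A x y + t ^+ 2 * qf A y y.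
  have := pA (s *: x + t *: y).
  rewrite !(qfDl, qfDr, qfZl, qfZr) (qf_sym y x sA); nra.
have := pA x; rewrite le_eqVlt => /predU1P[x0|x0].
  have [->|c0] := eqVneq (qf A x y) 0; first by rewrite -x0 mul0r expr0n.
  have := key (- (qf A y y + 1) / (2 * qf A x y)) 1.
  rewrite -x0 (_ : _ + _ + _ = -1); first by rewrite oppr_ge0 ler10.
  by field.
have := key (- qf A x y) (qf A x x).
rewrite (_ : _ + _ + _ = qf A x x * (qf A x x * qf A y y - qf A x y ^+ 2)); last by ring.
by rewrite pmulr_rge0// subr_ge0.
Qed.

Lemma qf_pos_unit A : (forall x, x != 0 -> 0 < qf A x x) -> A \in unitmx.
Proof.
move=> pA; rewrite -unitmx_tr -row_free_unit -kermx_eq0; apply/eqP/row_matrixP => i.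
rewrite row0; set u := row i _.
have uA : u *m A^T = 0 by rewrite /u -row_mul mulmx_ker row0.
apply/eqP/negPn/negP => u0.
have := pA u^T; rewrite trmx_eq0 u0 => /(_ isT).
rewrite /qf trmxK -mulmxA.
have -> : A *m u^T = 0 by rewrite -[LHS]trmxK trmx_mul trmxK uA trmx0.
by rewrite mulmx0 mxE ltxx.
Qed.

End quadratic_forms.

Section poly_projection.
Variables (R : realType) (m p : nat).
Let V : 'M[R]_(m, p) := \matrix_(l < m, j < p) knot p j.+1 ^+ l.
Let W := <<V>>%MS.
Let O := orthomx idfun 1%:M V.
Let Q := proj_mx W O.

Let OP k (u : 'M[R]_(k, p)) : (u <= O)%MS = (u *m V^T == 0).
Proof. by rewrite /O /orthomx mul1mx sub_kermx map_mx_id. Qed.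

Let WO k l (u : 'M[R]_(k, p)) (w : 'M[R]_(l, p)) : (u <= W)%MS -> (w <= O)%MS -> u *m w^T = 0.
Proof.
rewrite genmxE OP => /submxP[D ->] /eqP wV.
by rewrite -mulmxA -[V *m _]trmxK trmx_mul trmxK wV trmx0 mulmx0.
Qed.

Let cap0 : (W :&: O = 0)%MS.
Proof.
apply/eqP; rewrite -submx0; apply/rV_subP => u; rewrite sub_capmx => /andP[uW uO].
have := WO uW uO => /matrixP/(_ 0 0); rewrite !mxE => /eqP; rewrite psumr_eq0; last first.
  by move=> i _; rewrite mxE -expr2 sqr_ge0.
move=> /allP h; rewrite submx0; apply/eqP/rowP => i; rewrite mxE.
by have := h i (mem_index_enum _); rewrite mxE -expr2 sqrf_eq0 => /eqP.
Qed.

Let full k (u : 'M[R]_(k, p)) : (u <= W + O)%MS.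
Proof.
apply: submx_full; rewrite /row_full mxrank_disjoint_sum//.
rewrite /W genmxE /O /orthomx mul1mx map_mx_id// mxrank_ker mxrank_tr.
by rewrite subnKC// rank_leq_col.
Qed.

Let QW : (Q <= W)%MS. Proof. by rewrite -[Q]mul1mx proj_mx_sub. Qed.
Let QO : (1%:M - Q <= O)%MS.
Proof. by have := @proj_mx_compl_sub _ _ _ W O 1%:M (full _); rewrite mul1mx. Qed.

Let Q_sym : Q^T = Q.
Proof.
have E : Q = Q *m Q^T.
  have := WO QW QO; rewrite linearB/= trmx1 mulmxBr mulmx1 => /eqP.
  by rewrite subr_eq0 => /eqP.
by rewrite E trmx_mul trmxK -E.
Qed.

Lemma poly_proj_sym : (poly_proj_mx m p : 'M[R]_p)^T = poly_proj_mx m p.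
Proof. by rewrite /poly_proj_mx -/V -/W -/O -/Q trmxK Q_sym. Qed.

Lemma poly_proj_idem : poly_proj_mx m p *m poly_proj_mx m p = poly_proj_mx m p :> 'M[R]_p.
Proof. by rewrite /poly_proj_mx -/V -/W -/O -/Q -trmx_mul proj_mx_proj. Qed.

Lemma poly_proj_poly (q : {poly R}) : (size q <= m)%N ->
  poly_proj_mx m p *m (\col_(j < p) q.[knot p j.+1]) = \col_(j < p) q.[knot p j.+1].
Proof.
move=> sq; rewrite /poly_proj_mx -/V; set x := \col_j _.
rewrite -[LHS]trmxK trmx_mul trmxK proj_mx_id ?trmxK//.
rewrite genmxE; apply/submxP; exists (\row_(l < m) q`_l).
apply/rowP => j; rewrite !mxE (horner_coef_wide _ sq).
by apply: eq_bigr => l _; rewrite !mxE.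
Qed.

Local Notation P := (poly_proj_mx m p : 'M[R]_p).

Lemma qf_poly_proj (x : 'cV[R]_p) : qf P x x = \sum_i (P *m x) i 0 ^+ 2.
Proof.
rewrite -qf1 /qf mulmx1 trmx_mul poly_proj_sym.
by rewrite -[in RHS]mulmxA (mulmxA P) poly_proj_idem mulmxA.
Qed.

(** Pythagoras' theorem for the orthogonal projection. *)
Lemma poly_proj_pyth (x : 'cV[R]_p) :
  \sum_i x i 0 ^+ 2 = qf P x x + \sum_i (x - P *m x) i 0 ^+ 2.
Proof.
rewrite -[in LHS]qf1 -qf1 qfBl !qfBr.
have -> : qf 1%:M x (P *m x) = qf P x x by rewrite /qf mulmx1 mulmxA.
have -> : qf 1%:M (P *m x) x = qf P x x by rewrite /qf mulmx1 trmx_mul poly_proj_sym.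
have -> : qf 1%:M (P *m x) (P *m x) = qf P x x by rewrite qf1 -qf_poly_proj.
by ring.
Qed.

Lemma qf_poly_proj_ge0 (x : 'cV[R]_p) : 0 <= qf P x x.
Proof. by rewrite qf_poly_proj sumr_ge0// => i _; exact: sqr_ge0. Qed.

(** The distance from [x] to the polynomials is the distance from [r] to them, hence
    at most the norm of [r]. *)
Lemma poly_proj_dist (x r : 'cV[R]_p) (q : {poly R}) : (size q <= m)%N ->
  x = (\col_(j < p) q.[knot p j.+1]) + r ->
  \sum_i x i 0 ^+ 2 <= qf P x x + \sum_i r i 0 ^+ 2.
Proof.
move=> sq xE; rewrite poly_proj_pyth lerD2l xE mulmxDr poly_proj_poly//.
rewrite (_ : _ - _ = r - P *m r); last by rewrite opprD addrACA subrr add0r.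
by rewrite [leRHS]poly_proj_pyth lerDr qf_poly_proj_ge0.
Qed.

End poly_projection.

Section penalty.
Variables (R : realType) (m p : nat) (D : 'I_p -> R -> R).
Hypotheses (m0 : (0 < m)%N) (mp : (m <= p)%N) (hD : natural_spline_basis m D).
Notation mu := (@lebesgue_measure R).
Local Notation kn := (@knot R p).
Local Notation B := (basis_mx D).
Local Notation A := (penalty_mx m D).
Implicit Types (c v u : 'cV[R]_p).
Let p0 : (0 < p)%N. Proof. exact: leq_trans mp. Qed.

Let qexP : exists q : 'I_p -> nat -> {poly R}, forall i,
   [/\ spieces m p (q i),
      forall t, 0 <= t <= 1 -> D i t = pw p (q i) 0 t,
      forall j t, (j < p)%N -> kn j < t < kn j.+1 -> derive1n m (D i) t = (q i j)^`(m).[t],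
      forall t, t <= kn 1 -> D i t = (q i 0%N).[t] & forall t, 1 <= t -> D i t = (q i p).[t]].
Proof.
have [ns _ _] := hD.
have /choice[q hq] := fun i => natural_spline_pieces m0 mp (ns i).
by exists q.
Qed.

Let q0 := projT1 (cid qexP).
Let q0P := projT2 (cid qexP).

Let qc c (j : nat) : {poly R} := \sum_i c i 0 *: q0 i j.

Let qc_derivE c j k t : (qc c j)^`(k).[t] = \sum_i c i 0 * (q0 i j)^`(k).[t].
Proof.
rewrite /qc linear_sum horner_sum; apply: eq_bigr => i _.
by rewrite /= derivnZ hornerZ.
Qed.

Let qcE c j t : (qc c j).[t] = \sum_i c i 0 * (q0 i j).[t].
Proof. by have := qc_derivE c j 0 t; rewrite derivn0 => ->; apply: eq_bigr => i _; rewrite derivn0. Qed.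

Let sp_qc c : spieces m p (qc c).
Proof.
have sz l j : (forall i, (size (q0 i j) <= l)%N) -> (size (qc c j) <= l)%N.
  move=> h; apply: (leq_trans (size_sum _ _ _)); apply/bigmax_leqP => i _.
  exact: leq_trans (size_scale_leq _ _) (h i).
split.
- by move=> j jp; apply: sz => i; have [[+ _ _ _] _ _ _ _] := q0P i; apply.
- by apply: sz => i; have [[_ + _ _] _ _ _ _] := q0P i; apply.
- by apply: sz => i; have [[_ _ + _] _ _ _ _] := q0P i; apply.
- move=> j k jp km; rewrite !qc_derivE; apply: eq_bigr => i _; congr (_ * _).
  by have [[_ _ _ +] _ _ _ _] := q0P i; apply.
Qed.

Let fc c t := \sum_i c i 0 * D i t.

Let fc_pw c t : 0 <= t <= 1 -> fc c t = pw p (qc c) 0 t.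
Proof.
move=> t01; rewrite /pw qc_derivE; apply: eq_bigr => i _; congr (_ * _).
by have [_ + _ _ _] := q0P i; apply.
Qed.

Let kn01 j : (j <= p)%N -> 0 <= kn j <= 1.
Proof. by move=> jp; rewrite (knot_ge0 _ p0) (knot_le1 _ p0). Qed.

Let Bc c (j : 'I_p) : (B *m c) j 0 = fc c (kn j.+1).
Proof. by rewrite mxE; apply: eq_bigr => i _; rewrite mxE mulrC. Qed.

Let fc_kn c j : (j <= p)%N -> fc c (kn j) = (qc c j).[kn j].
Proof. by move=> jp; rewrite fc_pw ?kn01// (pw_knot m0 mp) derivn0. Qed.

Let B_inj c : B *m c = 0 -> c = 0.
Proof.
move=> Bc0.
have z j : (0 < j <= p)%N -> (qc c j).[kn j] = 0.
  case: j => // j /= jp; rewrite -fc_kn//.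
  by have := Bc c (Ordinal jp); rewrite Bc0 mxE.
have [ql qr q01] := spline_unique m0 mp (sp_qc c) z.
have [_ li _] := hD; apply/colP => i; rewrite mxE; move: i; apply: li => t.
rewrite /lin_comb -/(fc c t).
have [t0|t0] := leP t 0.
  have -> : fc c t = (qc c 0%N).[t].
    rewrite qcE; apply: eq_bigr => i _; congr (_ * _); have [_ _ _ + _] := q0P i; apply.
    by rewrite (le_trans t0)// knot_ge0.
  by rewrite ql horner0.
have [t1|t1] := leP t 1; first by rewrite fc_pw ?q01// (ltW t0).
have -> : fc c t = (qc c p).[t].
  by rewrite qcE; apply: eq_bigr => i _; congr (_ * _); have [_ _ _ _ +] := q0P i; apply; apply: ltW.
by rewrite qr horner0.
Qed.

(** A natural spline that vanishes at all the knots is null by [spline_unique], so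
    that the independence of the basis survives sampling. *)
Lemma basis_mx_unit : B \in unitmx.
Proof.
rewrite -unitmx_tr -row_free_unit -kermx_eq0; apply/eqP/row_matrixP => i; rewrite row0.
set r := row i _; have : r *m B^T = 0 by rewrite /r -row_mul mulmx_ker row0.
move=> /(congr1 trmx); rewrite trmx_mul trmxK trmx0 => /B_inj/(congr1 trmx).
by rewrite trmxK trmx0.
Qed.

Definition spline_coef v : 'cV[R]_p := invmx (B^T *m B) *m B^T *m v.

Lemma spline_evalE v t : ((basis_vec D t)^T *m invmx (B^T *m B) *m B^T *m v) 0 0 =
  \sum_i spline_coef v i 0 * D i t.
Proof.
rewrite -!mulmxA mxE; apply: eq_bigr => i _; rewrite mulrC /spline_coef -[in RHS]mulmxA.
by congr (_ * _); rewrite !mxE.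
Qed.

Let BtB : B^T *m B \in unitmx.
Proof. by rewrite unitmx_mul unitmx_tr basis_mx_unit. Qed.

Let B_coef v : B *m spline_coef v = v.
Proof.
have Bt : B^T \in unitmx by rewrite unitmx_tr basis_mx_unit.
rewrite -[LHS](mulKmx Bt) -[in LHS](mulKmx Bt (B *m _)).
by rewrite (mulKmx Bt) [B^T *m _]mulmxA /spline_coef -(mulmxA (invmx _)) (mulKVmx BtB) (mulKmx Bt).
Qed.

(** A least squares fit of [p] values by [p] functions is exact. *)
Lemma spline_eval_knot v (j : 'I_p) : \sum_i spline_coef v i 0 * D i (kn j.+1) = v j 0.
Proof. by rewrite -[in RHS](B_coef v) Bc. Qed.

Lemma basis_continuous i : continuous (D i).
Proof. by have [ns _ _] := hD; have [_ + _ _ _] := ns i => /(_ 0%N (leq0n _)). Qed.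

Let energyE i k : energy_mx m D i k = energy m p (q0 i) (q0 k).
Proof.
rewrite mxE /ip -/(dot mu `[0, 1]%classic _ _).
apply: (proj2 (@pieces_itg _ _ p0 _ (fun j t => (q0 i j)^`(m).[t] * (q0 k j)^`(m).[t]) _ _)).
  move=> j t jp tj; have [_ _ hi _ _] := q0P i; have [_ _ hk _ _] := q0P k.
  by rewrite (hi j)// (hk j).
by move=> j jp; under [X in itg _ _ X]eq_fun do rewrite -hornerM; exact: itg_horner.
Qed.

Let qf_energy c : qf (energy_mx m D) c c = energy m p (qc c) (qc c).
Proof.
have mI : measurable (`[0, 1]%classic : set R) by exact: measurable_itv.
rewrite energy_pw// qfE.
have -> : pw p (qc c) m = (fun t => \sum_i c i 0 * pw p (q0 i) m t).
  by apply/funext => t; rewrite /pw qc_derivE.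
have s i : sqi mu `[0, 1]%classic (pw p (q0 i) m) by exact: (sqi_pw m0 mp).
have sZ i : sqi mu `[0, 1]%classic (fun t => c i 0 * pw p (q0 i) m t) by apply: sqiZ.
rewrite dot_suml//; last by apply: sqi_sum => //.
apply: eq_bigr => i _; rewrite dot_sumr//.
by apply: eq_bigr => k _; rewrite dotZl// dotZr// energyE energy_pw//; ring.
Qed.

Lemma energy_mx_sym : (energy_mx m D)^T = energy_mx m D.
Proof. by apply/matrixP => i k; rewrite !mxE /ip; under eq_Rintegral do rewrite mulrC. Qed.

Let qfA v : qf A v v = qf (poly_proj_mx m p) v v +
  p%:R * energy m p (qc (spline_coef v)) (qc (spline_coef v)).
Proof.
rewrite /penalty_mx qf_addA qf_scaleA -qf_energy; congr (_ + _ * _).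
rewrite /qf /spline_coef !trmx_mul trmxK trmx_inv trmx_mul trmxK.
by rewrite !mulmxA.
Qed.

Lemma penalty_sym : A^T = A.
Proof.
rewrite /penalty_mx linearD/= poly_proj_sym linearZ/=; congr (_ + _ *: _).
by rewrite !trmx_mul trmxK trmx_inv trmx_mul trmxK energy_mx_sym !mulmxA.
Qed.

Let qc_kn v j (jp : (j < p)%N) : pw p (qc (spline_coef v)) 0 (kn j.+1) = v (Ordinal jp) 0.
Proof. by rewrite -fc_pw ?kn01// -[in RHS](B_coef v) Bc. Qed.

(** Values at the knots are those of a polynomial plus a Taylor remainder: the
    projection controls the former and the energy the latter. *)
Lemma penalty_ge v : \sum_j v j 0 ^+ 2 <= qf A v v.
Proof.
rewrite qfA; set q := qc _.
have [_ s0 _ _] := sp_qc (spline_coef v).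
apply: (le_trans (@poly_proj_dist R m p v (\col_j srem p q 0 (kn j.+1)) (q 0%N) s0 _)).
  apply/colP => j; rewrite !mxE /srem derivn0 addrC subrK.
  by case: j => j jp /=; rewrite (qc_kn _ jp).
rewrite lerD2l; apply: (@le_trans _ _ (\sum_(j < p) energy m p q q)).
  apply: ler_sum => j _; rewrite mxE; apply: srem_bound => //; first exact: sp_qc.
  by rewrite kn01.
by rewrite sumr_const card_ord mulr_natl.
Qed.

Lemma spline_eval_step v (j : 'I_p) t : kn j <= t <= kn j.+1 ->
  (\sum_i spline_coef v i 0 * D i t - v j 0) ^+ 2 <=
  step_cst R m / p%:R * (2 / p%:R * qf A v v).
Proof.
move=> tj; have t01 : 0 <= t <= 1.
  move/andP: tj => [t1 t2]; rewrite (le_trans _ t1) ?knot_ge0//= (le_trans t2)// knot_le1//.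
set q := qc (spline_coef v).
have := @spline_step R m p m0 mp q (sp_qc _) j t (ltn_ord j) tj.
rewrite -/(fc (spline_coef v) t) fc_pw// -/q.
have -> : pw p q 0 (kn j.+1) = v j 0 by case: j tj => j jp /= _; rewrite (qc_kn _ jp).
move=> /le_trans; apply; apply: ler_wpM2l.
  by rewrite divr_ge0// /step_cst addr_ge0// mulr_ge0// lagrange_cst_ge0.
have -> : \sum_(i < p) pw p q 0 (kn i.+1) ^+ 2 = \sum_j v j 0 ^+ 2.
  by apply: eq_bigr => -[i ip] _ /=; rewrite (qc_kn _ ip).
have := penalty_ge v; have := qf_poly_proj_ge0 m v; have := qfA v; rewrite -/q.
set a := qf A v v; set b := qf _ v v; set e := energy m p q q; set s := \sum_j _ => aE b0 sa.
have p1 : 0 < p%:R :> R by rewrite ltr0n.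
have eE : e <= p%:R^-1 * a by rewrite aE mulrDr mulKf ?gt_eqF// lerDr mulr_ge0// invr_ge0 ltW.
have sE : p%:R^-1 * s <= p%:R^-1 * a by rewrite ler_wpM2l// invr_ge0 ltW.
by rewrite -mulrA mulr2n mulrDl mul1r lerD.
Qed.

(** The projection does not increase norms, and by [energy_min] the energy of the
    interpolating spline is at most that of the sampled function. *)
Lemma penalty_le u (b : nat -> R -> R) :
  (forall k, (k < m)%N -> deriv_on 0 1 (b k) (b k.+1)) -> sqi mu `[0, 1]%classic (b m) ->
  (forall j : 'I_p, b 0%N (kn j.+1) = u j 0) ->
  qf A u u <= \sum_j u j 0 ^+ 2 + p%:R * dot mu `[0, 1]%classic (b m) (b m).
Proof.
move=> hb sb bu; rewrite qfA; apply: lerD.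
  by rewrite (poly_proj_pyth m) lerDl sumr_ge0// => i _; exact: sqr_ge0.
rewrite ler_wpM2l//; apply: (energy_min m0 mp (sp_qc _) hb sb).
move=> [//|j] /= jp; rewrite (bu (Ordinal jp)) -fc_kn// -(qc_kn _ jp) fc_pw//.
exact: kn01.
Qed.

End penalty.

(** * An inequality for penalised least squares *)

Section averages.
Variables (R : realType) (N : nat).
Hypothesis N0 : (0 < N)%N.
Implicit Types (f g : 'I_N -> R).

Definition avg f : R := N%:R^-1 * \sum_k f k.

Lemma avgD f g : avg (fun k => f k + g k) = avg f + avg g.
Proof. by rewrite /avg big_split/= mulrDr. Qed.
Lemma avgZ (c : R) f : avg (fun k => c * f k) = c * avg f.
Proof. by rewrite /avg -mulr_sumr mulrCA. Qed.
Lemma avgB f g : avg (fun k => f k - g k) = avg f - avg g.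
Proof. by rewrite /avg sumrB mulrBr. Qed.
Lemma avg_cst (c : R) : avg (fun=> c) = c.
Proof. by rewrite /avg sumr_const card_ord -[c *+ N]mulr_natr mulrC mulfK// pnatr_eq0 -lt0n. Qed.
Lemma eq_avg f g : (forall k, f k = g k) -> avg f = avg g.
Proof. by move=> fg; rewrite /avg (eq_bigr _ (fun k _ => fg k)). Qed.
Lemma le_avg f g : (forall k, f k <= g k) -> avg f <= avg g.
Proof. by move=> fg; rewrite ler_wpM2l ?invr_ge0// ler_sum. Qed.
Lemma avg_ge0 f : (forall k, 0 <= f k) -> 0 <= avg f.
Proof. by move=> f0; rewrite mulr_ge0 ?invr_ge0 ?sumr_ge0. Qed.
Lemma avg_sum I (s : seq I) (F : I -> 'I_N -> R) :
  avg (fun k => \sum_(i <- s) F i k) = \sum_(i <- s) avg (F i).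
Proof. by rewrite /avg exchange_big mulr_sumr. Qed.
Lemma avg_var f : avg (fun k => (f k - avg f) ^+ 2) = avg (fun k => f k ^+ 2) - avg f ^+ 2.
Proof.
rewrite (eq_avg (g := fun k => f k ^+ 2 + ((- 2 * avg f) * f k + avg f ^+ 2))); last by move=> k; ring.
by rewrite avgD avgD avgZ avg_cst; ring.
Qed.

End averages.

(** Every cross term is absorbed into a fraction of [Th], [V] or [rQ], and the
    fractions leave a positive part of [Th] on the left. *)
Lemma basic_arith (R : realType)
    (L rQ Th R1 R2 x3 x4 x6 x7 z3 z4 y3 y4 rQU rU V A1 A2 A3 B1 B2 B3 B4 S1 S2 : R) :
  2 * x3 + 2 * x4 + x6 + x7 <= 2^-1 * Th -> z3 + z4 <= x3 + x4 ->
  A1 = L + S1 + S2 -> - x6 <= S1 -> - x7 <= S2 -> A1 / 2 - z3 <= A2 -> V = A2 - A3 -> A3 <= z4 ->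
  V + rQ + rQU = B1 + B2 + B3 - B4 -> B1 <= V / 2 + R1 / 2 -> B2 <= Th / 16 + 4 * R2 ->
  B3 <= rQ / 8 + y3 -> - B4 <= rQ / 8 + y4 -> - rQU <= rQ / 8 + 2 * rU ->
  0 <= rQ -> 0 <= L -> Th = L + rQ ->
  Th <= 8 * R1 + 64 * R2 + 16 * y3 + 16 * y4 + 32 * rU.
Proof. lra. Qed.

Section basic_inequality.
Variables (R : realType) (N J : nat).
Hypothesis N0 : (0 < N)%N.
Local Notation avg := (@avg R N).
Variables (a r e E : 'I_N -> R) (y c : 'I_N -> 'I_J -> R) (w lam : 'I_J -> R).
Variables (rho Q QU U W B M : R).
Hypotheses (rho0 : 0 < rho) (lam0 : forall i, 0 <= lam i) (U0 : 0 <= U) (W0 : 0 <= W).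
Hypothesis ident : avg (fun k => (a k - avg a) ^+ 2) + rho * Q + rho * QU =
  avg (fun k => (a k - avg a) * (r k + e k - avg e)).
Hypotheses (QU_CS : QU ^+ 2 <= Q * U) (wW : \sum_i w i ^+ 2 <= W ^+ 2) (WQ : W ^+ 2 <= Q).
Hypothesis aE : forall k, `|a k - \sum_i y k i * w i| <= E k * W.
Hypotheses (aB : `|avg a| <= B * W) (eM : forall k, `|e k| <= M).

Let nu i := avg (fun k => e k * y k i).
Let Del i l := avg (fun k => c k i * c k l) - (i == l)%:R * lam i.
Let R1 := avg (fun k => r k ^+ 2).
Let R2 := \sum_i nu i ^+ 2 / (lam i + rho).
Let R3 := avg (fun k => E k ^+ 2).
Let R4 := B ^+ 2.
Let R5 := avg e ^+ 2.
Let R6 := \sum_i \sum_l Del i l ^+ 2 / ((lam i + rho) * (lam l + rho)).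
Let R7 := \sum_i \sum_l `|avg (fun k => y k i * y k l - c k i * c k l)|.

Let Th := \sum_i lam i * w i ^+ 2 + rho * Q.
Let L := \sum_i lam i * w i ^+ 2.
Let z k := \sum_i y k i * w i.

Let lr i : 0 < lam i + rho. Proof. by rewrite ltr_wpDl. Qed.
Let Q0 : 0 <= Q. Proof. exact: le_trans (sqr_ge0 _) WQ. Qed.
Let L0 : 0 <= L. Proof. by apply: sumr_ge0 => i _; rewrite mulr_ge0// sqr_ge0. Qed.
Let rQ0 : 0 <= rho * Q. Proof. by rewrite mulr_ge0// ltW. Qed.
Let Th0 : 0 <= Th. Proof. exact: addr_ge0. Qed.

Let lw : \sum_i (lam i + rho) * w i ^+ 2 <= Th.
Proof.
under eq_bigr do rewrite mulrDl.
by rewrite big_split/= lerD2l -mulr_sumr ler_wpM2l ?(ltW rho0)// (le_trans wW).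
Qed.

Let R6_ge0 : 0 <= R6.
Proof.
by apply: sumr_ge0 => i _; apply: sumr_ge0 => l _; rewrite divr_ge0 ?sqr_ge0// mulr_ge0 ?(ltW (lr _)).
Qed.

Let quad_Del : `|\sum_i \sum_l w i * w l * Del i l| <= Num.sqrt R6 * Th.
Proof.
rewrite -(ger0_norm (mulr_ge0 (sqrtr_ge0 R6) Th0)) -ler_sqr ?nnegrE ?normr_ge0// !real_normK ?num_real//.
rewrite exprMn sqr_sqrtr//.
rewrite pair_bigA/=; under eq_bigr => il _.
  rewrite (_ : _ * _ = (Del il.1 il.2 / Num.sqrt ((lam il.1 + rho) * (lam il.2 + rho))) *
    (Num.sqrt ((lam il.1 + rho) * (lam il.2 + rho)) * (w il.1 * w il.2))); last first.
    by rewrite mulrA divfK 1?mulrC// gt_eqF// sqrtr_gt0 mulr_gt0.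
  over.
apply: (le_trans (sum_CS _ _ _)); apply: ler_pM.
- by apply: sumr_ge0 => i _; exact: sqr_ge0.
- by apply: sumr_ge0 => i _; exact: sqr_ge0.
- rewrite /R6 pair_bigA/=; apply: ler_sum => il _.
  by rewrite exprMn exprVn sqr_sqrtr// mulr_ge0 ?(ltW (lr _)).
- under eq_bigr => il _ do rewrite exprMn sqr_sqrtr ?mulr_ge0 ?(ltW (lr _))// exprMn mulrACA.
  rewrite -(pair_bigA _ (fun i l => (lam i + rho) * w i ^+ 2 * ((lam l + rho) * w l ^+ 2)))/=.
  under eq_bigr do rewrite -mulr_sumr.
  rewrite -mulr_suml -expr2 ler_sqr ?nnegrE//.
  by apply: sumr_ge0 => i _; rewrite mulr_ge0 ?sqr_ge0// (ltW (lr _)).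
Qed.

Let w_le i : `|w i| <= W.
Proof.
rewrite -ler_sqr ?nnegrE// real_normK ?num_real//; apply: le_trans wW.
by rewrite (bigD1 i)//= lerDl sumr_ge0// => j _; exact: sqr_ge0.
Qed.

Let WTh : W ^+ 2 <= Th / rho.
Proof. by rewrite ler_pdivlMr// mulrC (le_trans (_ : _ <= rho * Q)) ?ler_wpM2l ?(ltW rho0)// lerDr. Qed.

Let R7_ge0 : 0 <= R7.
Proof. by apply: sumr_ge0 => i _; apply: sumr_ge0 => l _; exact: normr_ge0. Qed.

Let quad_D : `|\sum_i \sum_l w i * w l * avg (fun k => y k i * y k l - c k i * c k l)| <= R7 / rho * Th.
Proof.
rewrite -mulrA (mulrC rho^-1); apply: (@le_trans _ _ (R7 * W ^+ 2)); last by rewrite ler_wpM2l.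
rewrite /R7 mulr_suml; apply: (le_trans (ler_norm_sum _ _ _)); apply: ler_sum => i _.
rewrite mulr_suml; apply: (le_trans (ler_norm_sum _ _ _)); apply: ler_sum => l _.
by rewrite normrM mulrC ler_wpM2l// normrM expr2 ler_pM.
Qed.

Let z_sqr : avg (fun k => z k ^+ 2) = L + \sum_i \sum_l w i * w l * Del i l +
  \sum_i \sum_l w i * w l * avg (fun k => y k i * y k l - c k i * c k l).
Proof.
have LE : L = \sum_i \sum_l w i * w l * ((i == l)%:R * lam i).
  apply: eq_bigr => i _; rewrite (bigD1 i)//= eqxx mul1r big1 ?addr0; first by ring.
  by move=> l li; rewrite eq_sym (negbTE li) mul0r mulr0.
rewrite LE -!big_split/= (eq_avg (g := fun k => \sum_i \sum_l w i * w l * (y k i * y k l))); last first.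
  move=> k; rewrite expr2 /z mulr_suml; apply: eq_bigr => i _; rewrite mulr_sumr.
  by apply: eq_bigr => l _; ring.
rewrite avg_sum; apply: eq_bigr => i _; rewrite avg_sum -!big_split/=; apply: eq_bigr => l _.
by rewrite avgZ avgB /Del; ring.
Qed.

Let z_e : avg (fun k => z k * e k) = \sum_i w i * nu i.
Proof.
rewrite (eq_avg (g := fun k => \sum_i w i * (e k * y k i))); last first.
  by move=> k; rewrite /z mulr_suml; apply: eq_bigr => i _; ring.
by rewrite avg_sum; apply: eq_bigr => i _; rewrite avgZ.
Qed.

Let R2_ge0 : 0 <= R2.
Proof. by apply: sumr_ge0 => i _; rewrite divr_ge0 ?sqr_ge0// ltW. Qed.

Let z_e_le : avg (fun k => z k * e k) <= Th / 16 + 4 * R2.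
Proof.
rewrite z_e; have : (\sum_i w i * nu i) ^+ 2 <= Th * R2.
  under eq_bigr => i _.
    rewrite (_ : _ * _ = (Num.sqrt (lam i + rho) * w i) * (nu i / Num.sqrt (lam i + rho))); last first.
      have sn : Num.sqrt (lam i + rho) != 0 by rewrite gt_eqF ?sqrtr_gt0.
      by field.
    over.
  apply: (le_trans (sum_CS _ _ _)); apply: ler_pM.
  - by apply: sumr_ge0 => i _; exact: sqr_ge0.
  - by apply: sumr_ge0 => i _; exact: sqr_ge0.
  - by apply: le_trans lw; apply: ler_sum => i _; rewrite exprMn sqr_sqrtr// ltW.
  - by apply: ler_sum => i _; rewrite exprMn exprVn sqr_sqrtr// ltW.
set s := \sum_i _; move: Th0 R2_ge0; move: (Th) (R2) s => t q s t0 q0 h.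
have : 0 <= (t / 16 - 4 * q) ^+ 2 by exact: sqr_ge0.
have h2 : 0 <= t / 16 + 4 * q by lra.
have [s0|s0] := leP s 0; first by lra.
move=> h3; rewrite -ler_sqr ?nnegrE ?(ltW s0)//; nra.
Qed.

(** The identity [ident] is the normal equation tested against the error. Its left
    side dominates a fraction of [Th] as soon as the empirical second moments of the
    scores are close to [lam], relatively to [lam + rho]. On its right side the noise
    meets the scores [y], which is estimated by the Cauchy-Schwarz inequality with
    the weights [lam + rho]; what the scores do not see of the curves, [E], is paid
    by the penalty through [W ^+ 2 <= Q]. *)
Lemma basic_inequality :
  2 * R3 / rho + 2 * R4 / rho + Num.sqrt R6 + R7 / rho <= 2^-1 ->
  Th <= 8 * R1 + 64 * R2 + 32 * M ^+ 2 * R3 / rho + 32 * R4 * R5 / rho + 32 * rho * U.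
Proof.
move=> small.
pose V := avg (fun k => (a k - avg a) ^+ 2).
have cross : avg (fun k => (a k - avg a) * (r k + e k - avg e)) =
    avg (fun k => (a k - avg a) * r k) + avg (fun k => z k * e k) +
    avg (fun k => (a k - z k) * e k) - avg a * avg e.
  rewrite (eq_avg (g := fun k => (a k - avg a) * r k + (z k * e k + ((a k - z k) * e k +
    (- avg a * e k + (- avg e * a k + avg a * avg e)))))); last by move=> k; ring.
  by rewrite !avgD !avgZ !avg_cst// -/(avg e); ring.
have c1 : avg (fun k => (a k - avg a) * r k) <= V / 2 + R1 / 2.
  rewrite /V /R1 -!mulrDl -avgD -(mulrC 2^-1) -avgZ; apply: le_avg => k.
  have : 0 <= (a k - avg a - r k) ^+ 2 by exact: sqr_ge0.
  move: (a k - avg a) (r k) => s t; lra.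
have c3 : avg (fun k => (a k - z k) * e k) <= rho * Q / 8 + 2 * M ^+ 2 * R3 / rho.
  apply: (@le_trans _ _ (avg (fun k => rho * W ^+ 2 / 8 + 2 * M ^+ 2 / rho * E k ^+ 2))).
    apply: le_avg => k; have h1 := aE k; have h2 := eM k.
    apply: (@le_trans _ _ ((E k * W) * M)).
      by apply: le_trans (ler_norm _) _; rewrite normrM ler_pM.
    have rn : rho != 0 by rewrite gt_eqF.
    rewrite -subr_ge0 (_ : _ - _ = (rho * W - 4 * M * E k) ^+ 2 / (8 * rho)); last by field.
    by rewrite divr_ge0 ?sqr_ge0// mulr_ge0// ltW.
  rewrite avgD avg_cst// avgZ -/R3 lerD//; last by rewrite mulrAC.
  by rewrite ler_wpM2r ?invr_ge0// ler_wpM2l// ltW.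
have c4 : - (avg a * avg e) <= rho * Q / 8 + 2 * R4 * R5 / rho.
  apply: (@le_trans _ _ (B * W * `|avg e|)).
    by apply: le_trans (ler_norm _) _; rewrite normrN normrM ler_wpM2r.
  apply: (@le_trans _ _ (rho * W ^+ 2 / 8 + 2 * R4 * R5 / rho)); last first.
    by rewrite lerD2r ler_wpM2r ?invr_ge0// ler_wpM2l// ltW.
  have rn : rho != 0 by rewrite gt_eqF.
  rewrite -subr_ge0 (_ : _ - _ = (rho * W - 4 * B * `|avg e|) ^+ 2 / (8 * rho)); last first.
    by rewrite /R4 /R5 -[avg e ^+ 2]real_normK ?num_real//; field.
  by rewrite divr_ge0 ?sqr_ge0// mulr_ge0// ltW.
have c5 : - QU <= Q / 8 + 2 * U.
  have : (- QU) ^+ 2 <= Q * U by rewrite sqrrN.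
  move: (- QU) Q0 U0 => s q0 u0 h.
  have : 0 <= (Q / 8 - 2 * U) ^+ 2 by exact: sqr_ge0.
  have h2 : 0 <= Q / 8 + 2 * U by lra.
  have [s0|s0] := leP s 0; first by lra.
  move=> h3; rewrite -ler_sqr ?nnegrE ?(ltW s0)//; nra.
have aa : avg (fun k => z k ^+ 2) / 2 - R3 * W ^+ 2 <= avg (fun k => a k ^+ 2).
  rewrite /R3 -(mulrC 2^-1) (mulrC (avg _)) -!avgZ -avgB; apply: le_avg => k.
  have := aE k; rewrite -/(z k) => h1.
  have : (a k - z k) ^+ 2 <= (E k * W) ^+ 2.
    rewrite -[leLHS]real_normK ?num_real// ler_sqr ?nnegrE//.
    exact: le_trans h1.
  have : 0 <= (2 * a k - z k) ^+ 2 by exact: sqr_ge0.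
  rewrite exprMn; move: (a k) (z k) (E k ^+ 2) (W ^+ 2) => *; nra.
have VE : V = avg (fun k => a k ^+ 2) - avg a ^+ 2 by rewrite /V avg_var.
have a4 : avg a ^+ 2 <= R4 * W ^+ 2.
  rewrite -[leLHS]real_normK ?num_real// /R4 -exprMn ler_sqr ?nnegrE//.
  exact: le_trans aB.
have R30 : 0 <= R3 by apply: avg_ge0 => k; exact: sqr_ge0.
have R40 : 0 <= R4 by exact: sqr_ge0.
have w34 : (R3 + R4) * W ^+ 2 <= (R3 / rho + R4 / rho) * Th.
  by rewrite -mulrDl -mulrA (mulrC rho^-1) ler_wpM2l// addr_ge0.
have qD := quad_Del; have qd := quad_D.
move: qD qd; rewrite !ler_norml => /andP[qD _] /andP[qd _].
have zz := z_e_le; move: ident; rewrite cross -/V => id.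
have rn : rho != 0 by rewrite gt_eqF.
have smT : 2 * (R3 / rho * Th) + 2 * (R4 / rho * Th) + Num.sqrt R6 * Th + R7 / rho * Th <= 2^-1 * Th.
  rewrite (_ : _ + _ = (2 * R3 / rho + 2 * R4 / rho + Num.sqrt R6 + R7 / rho) * Th); last by ring.
  by rewrite ler_wpM2r.
have c5' : - (rho * QU) <= rho * Q / 8 + 2 * (rho * U).
  have -> : rho * Q / 8 + 2 * (rho * U) = rho * (Q / 8 + 2 * U) by ring.
  by rewrite -mulrN ler_wpM2l// ltW.
have -> : 32 * M ^+ 2 * R3 / rho = 16 * (2 * M ^+ 2 * R3 / rho) by ring.
have -> : 32 * R4 * R5 / rho = 16 * (2 * R4 * R5 / rho) by ring.
rewrite mulrDl in w34; have ThE : Th = L + rho * Q by [].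
rewrite mulrDl in w34.
rewrite -[32 * rho * U]mulrA.
exact: (basic_arith smT w34 z_sqr qD qd aa VE a4 id c1 zz c3 c4 c5' rQ0 L0 ThE).
Qed.

End basic_inequality.

Section normal_equations.
Variables (R : realType) (d n m p : nat) (X : site d -> R -> R) (Y : site d -> R).
Variables (rho : R) (D : 'I_p -> R -> R).
Hypotheses (n0 : (0 < n)%N) (m0 : (0 < m)%N) (mp : (m <= p)%N).
Hypotheses (hD : natural_spline_basis m D) (rho0 : 0 < rho).
Local Notation N := (n ^ d)%N.
Local Notation A := (penalty_mx m D).
Local Notation G := (gram_mx X n p).
Local Notation Xm := (Xmx X n p).
Local Notation v := (beta_hat_vec X Y n m rho D).
Let N0 : (0 < N)%N. Proof. by rewrite expn_gt0 n0. Qed.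
Let p0 : (0 < p)%N. Proof. exact: leq_trans mp. Qed.

Lemma qf_gram x y : qf G x y = (N%:R * p%:R)^-1 * \sum_k (Xm *m x) k 0 * (Xm *m y) k 0.
Proof.
rewrite /gram_mx qf_scaleA; congr (_ * _).
rewrite /qf mulmxA -trmx_mul -mulmxA mxE; apply: eq_bigr => k _.
by rewrite !mxE.
Qed.

Lemma normal_matrix_unit : G + rho *: A \in unitmx.
Proof.
apply: qf_pos_unit => x x0; rewrite qf_addA qf_scaleA ltr_wpDl//.
  rewrite qf_gram mulr_ge0 ?invr_ge0 ?mulr_ge0// sumr_ge0// => k _.
  by rewrite -expr2 sqr_ge0.
rewrite mulr_gt0//; apply: lt_le_trans (penalty_ge m0 mp hD x).
rewrite lt_def sumr_ge0 ?andbT => [|j _]; last exact: sqr_ge0.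
apply: contra x0 => /eqP s0; apply/eqP/colP => j; rewrite mxE.
have := @psumr_eq0P R _ (fun j => true) (fun j => x j 0 ^+ 2) (fun j _ => sqr_ge0 _) s0 j isT.
by move=> /eqP; rewrite sqrf_eq0 => /eqP.
Qed.

Lemma normal_equation : (G + rho *: A) *m v = N%:R^-1 *: (Xm^T *m Yvec Y n).
Proof.
by rewrite /beta_hat_vec -scalemxAr -mulmxA mulKVmx// normal_matrix_unit.
Qed.

Variables (mu : R -> R) (u : 'cV[R]_p) (r e : 'I_N -> R).
Let w := v - u.
Definition xvec (k : 'I_N) (j : 'I_p) : R := X (lex_site k) (knot p j.+1) - mu (knot p j.+1).
(* Riemann sum for the inner product of the curve with the function sampled as [x] *)
Let ax (x : 'cV[R]_p) k := p%:R^-1 * \sum_j xvec k j * x j 0.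
Hypothesis model : forall k, Y (lex_site k) - Ybar Y n =
  ax u k - avg (ax u) + r k + (e k - avg e).

Let Xm_ax x k : (Xm *m x) k 0 = p%:R * (ax x k - avg (ax x)).
Proof.
have pn : p%:R != 0 :> R by rewrite pnatr_eq0 -lt0n.
rewrite mxE /avg -mulr_sumr [X in _ - X]mulrCA -mulrBr mulVKf//.
rewrite exchange_big mulr_sumr -sumrB; apply: eq_bigr => j _.
rewrite mxE -mulr_suml mulrA -mulrBl; congr (_ * _).
rewrite /xvec /Xbar sumrB sumr_const card_ord -[mu _ *+ _]mulr_natr mulrBr.
have Nn : (n ^ d)%:R != 0 :> R by rewrite pnatr_eq0 -lt0n.
by rewrite [X in _ = _ - (_ - X)]mulrC mulfK//; ring.
Qed.

Let axD x y k : ax (x + y) k = ax x k + ax y k.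
Proof.
rewrite /ax -mulrDr -big_split/=; congr (_ * _); apply: eq_bigr => j _.
by rewrite mxE mulrDr.
Qed.

(** The normal equation, multiplied on the left by the transpose of the error [w]. *)
Lemma energy_identity :
  avg (fun k => (ax w k - avg (ax w)) ^+ 2) + rho * (qf A w w / p%:R) + rho * (qf A w u / p%:R) =
  avg (fun k => (ax w k - avg (ax w)) * (r k + e k - avg e)).
Proof.
have pn : p%:R != 0 :> R by rewrite pnatr_eq0 -lt0n.
have Nn : (n ^ d)%:R != 0 :> R by rewrite pnatr_eq0 -lt0n.
have vE : v = w + u by rewrite /w subrK.
have := congr1 (fun x => (w^T *m x) 0 0) normal_equation.
rewrite mulmxA -/(qf (G + rho *: A) w v) -scalemxAr [RHS]mxE mulmxA -trmx_mul.
rewrite qf_addA qf_scaleA qf_gram {2}vE qfDr.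
have -> : ((Xm *m w)^T *m Yvec Y n) 0 0 =
    \sum_k (Xm *m w) k 0 * (ax u k - avg (ax u) + r k + (e k - avg e)).
  by rewrite mxE; apply: eq_bigr => k _; rewrite mxE [Yvec _ _ _ _]mxE model.
have axv k : ax v k - avg (ax v) = (ax w k - avg (ax w)) + (ax u k - avg (ax u)).
  rewrite (eq_avg (g := fun k => ax w k + ax u k)); last by move=> l; rewrite vE axD.
  by rewrite avgD {1}vE axD; ring.
under eq_bigr do rewrite !Xm_ax axv.
under [X in _ = _ * X]eq_bigr do rewrite Xm_ax.
move=> h.
have {}h : avg (fun k => (ax w k - avg (ax w)) * (ax w k - avg (ax w) + (ax u k - avg (ax u)))) +
    rho * (qf A w w / p%:R + qf A w u / p%:R) =
    avg (fun k => (ax w k - avg (ax w)) * (ax u k - avg (ax u) + r k + (e k - avg e))).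
  apply: (mulfI pn); rewrite [RHS]mulrCA [in RHS]mulr_sumr.
  under [in RHS]eq_bigr do rewrite mulrA.
  rewrite -h mulrDr; congr (_ + _).
    rewrite invfM -mulrA /avg mulrCA; congr (_ * _).
    rewrite !mulr_sumr; apply: eq_bigr => k _; field.
    exact/pn.
  by field.
move: h; rewrite mulrDr => h.
have e1 : avg (fun k => (ax w k - avg (ax w)) * (ax w k - avg (ax w) + (ax u k - avg (ax u)))) =
    avg (fun k => (ax w k - avg (ax w)) ^+ 2) + avg (fun k => (ax w k - avg (ax w)) * (ax u k - avg (ax u))).
  by rewrite -avgD; apply: eq_avg => k; ring.
have e2 : avg (fun k => (ax w k - avg (ax w)) * (ax u k - avg (ax u) + r k + (e k - avg e))) =
    avg (fun k => (ax w k - avg (ax w)) * (ax u k - avg (ax u))) +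
    avg (fun k => (ax w k - avg (ax w)) * (r k + e k - avg e)).
  by rewrite -avgD; apply: eq_avg => k; ring.
apply: (addrI (avg (fun k => (ax w k - avg (ax w)) * (ax u k - avg (ax u))))).
by rewrite -e2 -h e1; ring.
Qed.

End normal_equations.

(** * Counting the sites of the grid *)

Section grid_counting.
Variables (R : realType) (d : nat).

Lemma modn_digits n e l : (0 < n)%N ->
  (l %% n ^ e = \sum_(i < e) ((l %/ n ^ i) %% n) * n ^ i)%N.
Proof.
move=> n0; elim: e => [|e IH]; first by rewrite expn0 modn1 big_ord0.
rewrite big_ord_recr/= -IH.
rewrite {1}(divn_eq l (n ^ e)) {1}(divn_eq (l %/ n ^ e) n) mulnDl -mulnA -expnS -addnA modnMDl.
rewrite [LHS]modn_small; first exact: addnC.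
rewrite expnS.
have h1 := ltn_pmod (l %/ n ^ e) n0; have h2 : (l %% n ^ e < n ^ e)%N by rewrite ltn_pmod// expn_gt0 n0.
have : (((l %/ n ^ e) %% n).+1 * n ^ e <= n * n ^ e)%N by rewrite leq_mul2r h1 orbT.
by rewrite mulSn; lia.
Qed.

(** Digits in base [n], the most significant one first: these are the coordinates of
    a site in the lexicographic enumeration of the grid. *)
Definition digit n (l : nat) (c : 'I_d) : nat := ((l %/ n ^ (d.-1 - c)) %% n)%N.

Lemma digit_inj n (k l : 'I_(n ^ d)) : (0 < d)%N -> (forall c, digit n k c = digit n l c) -> k = l.
Proof.
move=> d0 kl; apply/val_inj => /=; have nd0 : (0 < n ^ d)%N by exact: leq_ltn_trans (ltn_ord k).
have n0 : (0 < n)%N by move: nd0; rewrite expn_gt0 gtn_eqF// orbF.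
rewrite -[LHS](modn_small (ltn_ord k)) -[RHS](modn_small (ltn_ord l)) !modn_digits//.
apply: eq_bigr => i _; congr (_ * _)%N; have := kl (rev_ord i); rewrite /digit /=.
by rewrite (_ : (d.-1 - (d - i.+1))%N = i)//; have := ltn_ord i; lia.
Qed.

(** Balls are easy to count for the sup norm, which is at most the Euclidean one. *)
Definition supdist n (k l : 'I_(n ^ d)) : nat :=
  (\max_(c < d) (digit n k c - digit n l c + (digit n l c - digit n k c)))%N.

Lemma dist2_ge_coord (i j : site d) c : `|(i 0 c - j 0 c)%:~R| <= dist2 i j :> R.
Proof.
rewrite /dist2 -sqrtr_sqr ler_wsqrtr// (bigD1 c)//= lerDl sumr_ge0// => e _.
exact: sqr_ge0.
Qed.

Lemma supdist_dist2 n (k l : 'I_(n ^ d)) :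
  (supdist k l)%:R <= dist2 (lex_site k) (lex_site l) :> R.
Proof.
case: (posnP d) => [d0|d0].
  rewrite /supdist big1 ?sqrtr_ge0// => c; suff: False by [].
  by have := ltn_ord c; rewrite [X in (_ < X)%N]d0.
have [|c E] := @bigop.eq_bigmax 'I_d (fun c => digit n k c - digit n l c + (digit n l c - digit n k c))%N.
  by rewrite card_ord.
rewrite /supdist E; apply: le_trans (dist2_ge_coord _ _ c).
rewrite !mxE -/(digit n k c) -/(digit n l c) -intr_norm [leLHS]pmulrn ler_int.
by lia.
Qed.

Lemma ball_count n (k : 'I_(n ^ d)) i : (0 < d)%N ->
  (#|[set l | supdist k l <= i]%SET| <= (2 * i).+1 ^ d)%N.
Proof.
move=> d0; pose f (l : 'I_(n ^ d)) : {ffun 'I_d -> 'I_(2 * i).+1} :=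
  [ffun c => inord (digit n l c + i - digit n k c)].
have -> : #|[set l | (supdist k l <= i)%N]%SET| = #|f @: [set l | (supdist k l <= i)%N]%SET|.
  apply/esym/card_in_imset => l l'; rewrite !inE => /bigmax_leqP hl /bigmax_leqP hl' E.
  apply: digit_inj => // c; have := congr1 (fun g : {ffun 'I_d -> 'I_(2 * i).+1} => val (g c)) E.
  have := hl c isT; have := hl' c isT; rewrite /f /= !ffunE.
  by move: (digit n k c) (digit n l c) (digit n l' c) => x y z h1 h2; rewrite !inordK; lia.
by apply: (leq_trans (max_card _)); rewrite card_ffun !card_ord.
Qed.

Lemma expr_diff_le (a b : R) e : 0 <= b -> b <= a ->
  a ^+ e.+1 - b ^+ e.+1 <= e.+1%:R * (a - b) * a ^+ e.
Proof.
move=> b0 ba; have a0 := le_trans b0 ba.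
elim: e => [|e IH]; first by rewrite !expr1 expr0 mulr1 mul1r.
rewrite exprS (exprS b) (_ : _ - _ = (a - b) * a ^+ e.+1 + b * (a ^+ e.+1 - b ^+ e.+1)); last by ring.
rewrite (_ : e.+2%:R * (a - b) * a ^+ e.+1 = (a - b) * a ^+ e.+1 + e.+1%:R * (a - b) * a ^+ e.+1); last first.
  by rewrite -[e.+2%:R]natr1; ring.
rewrite lerD2l.
apply: (@le_trans _ _ (a * (a ^+ e.+1 - b ^+ e.+1))).
  by rewrite ler_wpM2r// subr_ge0 lerXn2r// nnegrE.
by apply: le_trans (ler_wpM2l a0 IH) _; rewrite mulrCA -exprS.
Qed.

(** Summation by parts over the distance to a fixed site: the balls of radius
    [i] have at most [(2 i + 1) ^ d] sites. *)
Lemma grid_sum (phi : nat -> R) (B : R) n (k : 'I_(n ^ d)) : (0 < d)%N ->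
  (forall i, 0 <= phi i) -> (forall i, phi i.+1 <= phi i) ->
  (forall T, \sum_(1 <= t < T) t%:R ^+ d.-1 * phi t <= B) ->
  \sum_l phi (supdist k l) <= phi 0%N + 2 * d%:R * 3 ^+ d.-1 * B.
Proof.
move=> d0 phi0 phid hB.
pose C i : R := (2 * i).+1%:R ^+ d; pose ball i : {set 'I_(n ^ d)} := [set l | (supdist k l <= i)%N]%SET.
pose S T := \sum_(l in ball T) phi (supdist k l).
have cC i : #|ball i|%:R <= C i by rewrite /C -natrX ler_nat ball_count.
have step T : S T + phi T * (C T - #|ball T|%:R) <=
    phi 0%N + \sum_(1 <= i < T.+1) phi i * (C i - C i.-1).
  elim: T => [|T IH].
    rewrite big_geq// addr0 (_ : S 0%N = phi 0%N * #|ball 0%N|%:R).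
      by rewrite -mulrDr addrC subrK /C muln0 expr1n mulr1.
    rewrite /S (eq_bigr (fun=> phi 0%N)) ?sumr_const ?mulr_natr// => l.
    by rewrite inE leqn0 => /eqP ->.
  have -> : S T.+1 = S T + phi T.+1 * (#|ball T.+1|%:R - #|ball T|%:R).
    have sub : ball T \subset ball T.+1 by apply/fintype.subsetP => l; rewrite !inE => /leqW.
    rewrite {1}/S (big_setID (ball T))/= (finset.setIidPr sub) -/(S T); congr (_ + _).
    rewrite (eq_bigr (fun=> phi T.+1)) ?sumr_const; last first.
      by move=> l; rewrite !inE -ltnNge => /andP[h1 h2]; congr phi; apply/eqP; rewrite eqn_leq h1 h2.
    by rewrite -[LHS]mulr_natr cardsD (finset.setIidPr sub) natrB ?subset_leq_card.
  rewrite big_nat_recr//= (_ : _ + _ = S T + phi T.+1 * (C T - #|ball T|%:R) +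
    phi T.+1 * (C T.+1 - C T)); last by ring.
  rewrite addrA lerD2r; apply: le_trans IH; rewrite lerD2l ler_wpM2r// subr_ge0//.
have -> : \sum_l phi (supdist k l) = S n.
  apply: eq_bigl => l; rewrite inE; apply/esym/bigmax_leqP => c _.
  have n0 : (0 < n)%N.
    have := leq_ltn_trans (leq0n _) (ltn_ord k); by rewrite expn_gt0 gtn_eqF// orbF.
  have := ltn_pmod (k %/ n ^ (d.-1 - c)) n0; have := ltn_pmod (l %/ n ^ (d.-1 - c)) n0.
  rewrite /digit; move: (modn _ n) (modn _ n) => x y; lia.
apply: (@le_trans _ _ (phi 0%N + \sum_(1 <= i < n.+1) phi i * (C i - C i.-1))).
  by apply: le_trans (step n); rewrite lerDl mulr_ge0// subr_ge0.
rewrite lerD2l; apply: (@le_trans _ _ (2 * d%:R * 3 ^+ d.-1 * \sum_(1 <= t < n.+1) t%:R ^+ d.-1 * phi t)); last first.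
  by rewrite ler_wpM2l// !mulr_ge0// exprn_ge0.
rewrite mulr_sumr !big_seq; apply: ler_sum => i; rewrite mem_index_iota => /andP[i0 _].
rewrite mulrA mulrC ler_wpM2r// /C -[d in X in X - _](prednK d0) -[d in X in _ - X](prednK d0).
have i1 : (0 <= (2 * i.-1).+1%:R :> R) by [].
have i2 : ((2 * i.-1).+1%:R <= (2 * i).+1%:R :> R) by rewrite ler_nat; lia.
apply: (le_trans (expr_diff_le _ i1 i2)); rewrite prednK//.
have -> : (2 * i).+1%:R - (2 * i.-1).+1%:R = 2 :> R.
  by rewrite -natrB; [congr (_%:R); lia|lia].
rewrite (mulrC _ 2) -!mulrA ler_wpM2l// ler_wpM2l// -exprMn lerXn2r ?nnegrE ?mulr_ge0//.
by rewrite -natrM ler_nat; lia.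
Qed.

End grid_counting.

(** * Expectations, and covariances under mixing *)

Section integral_comparison.
Context d (T : measurableType d) (R : realType) (mu : {measure set T -> \bar R}) (D : set T).
Hypothesis mD : measurable D.
Implicit Types f g : T -> R.
Local Notation itg := (itg mu D).
Local Notation rint := (rint mu D).

Lemma aeS (Q Q' : T -> Prop) : {ae mu, forall x, Q x} -> (forall x, Q x -> Q' x) -> {ae mu, forall x, Q' x}.
Proof. by move=> h QQ; apply: filterS h. Qed.

Lemma aeS2 (Q Q' Q'' : T -> Prop) : {ae mu, forall x, Q x} -> {ae mu, forall x, Q' x} ->
  (forall x, Q x -> Q' x -> Q'' x) -> {ae mu, forall x, Q'' x}.
Proof. by move=> h h' QQ; apply: filterS2 h h'. Qed.

Lemma ae_le_rint f g : itg f -> itg g -> {ae mu, forall x, D x -> f x <= g x} -> rint f <= rint g.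
Proof.
move=> hf hg fg.
have mf := itg_meas hf; have mg := itg_meas hg.
have mm : measurable_fun D (fun x => Num.max (f x) (g x)) by exact: measurable_maxr.
have E : {ae mu, forall x, D x -> g x = Num.max (f x) (g x)}.
  by apply: filterS fg => x h Dx; rewrite max_r// h.
rewrite (ae_eq_rint mD mg mm E); apply: le_rint => //; first exact: ae_itg E hg.
by move=> x _; rewrite le_max lexx.
Qed.

Lemma itg_ae_le f g : measurable_fun D f -> {ae mu, forall x, D x -> `|f x| <= g x} ->
  itg g -> itg f.
Proof.
move=> mf fg ig; have mg := itg_meas ig.
have mn : measurable_fun D (fun x => `|f x|) by exact: measurableT_comp.
have mm : measurable_fun D (fun x => Num.max `|f x| (g x)) by exact: measurable_maxr.
have E : {ae mu, forall x, D x -> g x = Num.max `|f x| (g x)}.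
  by apply: filterS fg => x h Dx; rewrite max_r// h.
apply: (itg_le mD mf _ (ae_itg mD mg mm E ig)).
by move=> x _; rewrite le_max lexx.
Qed.

End integral_comparison.

Section expectation.
Context d (T : measurableType d) (R : realType) (P : probability T R).
Implicit Types (f g U V : T -> R) (A B : set T).
Local Notation itg := (itg P setT).
Local Notation E := (rint P setT).

Lemma itg_cst (c : R) : itg (fun=> c).
Proof. exact: finite_measure_integrable_cst. Qed.

Lemma E_cst (c : R) : E (fun=> c) = c.
Proof. by rewrite /rint Rintegral_cst// (_ : fine _ = 1) ?mulr1//= probability_setT. Qed.

Lemma itg_bnd f (M : R) : measurable_fun setT f -> (forall w, `|f w| <= M) -> itg f.
Proof. by move=> mf fM; apply: (itg_le measurableT mf _ (itg_cst M)). Qed.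

Lemma itg_ae_bnd f (M : R) : measurable_fun setT f -> {ae P, forall w, `|f w| <= M} -> itg f.
Proof.
move=> mf fM; apply: (itg_ae_le measurableT mf _ (itg_cst M)).
by apply: filterS fM.
Qed.

Lemma itg_indic A : measurable A -> itg (\1_A).
Proof. by move=> mA; apply: (@itg_bnd _ 1) => // w; rewrite indicE; case: (_ \in _); rewrite /= ?normr1 ?normr0. Qed.

Lemma E_indic A : measurable A -> (E (\1_A))%:E = P A.
Proof. by move=> mA; rewrite (EFin_rint measurableT) ?integral_indic ?setIT//; exact: itg_indic. Qed.

Lemma markov_E f (z : R) : itg f -> (forall w, 0 <= f w) -> 0 < z ->
  (P [set w | (z < f w)%R] <= (E f / z)%:E)%E.
Proof.
move=> hf f0 z0; have mf := itg_meas hf.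
have mA : measurable [set w | (z < f w)%R].
  rewrite (_ : [set w | _] = setT `&` f @^-1` `]z, +oo[%classic).
    by apply: mf => //; exact: measurable_itv.
  by rewrite setTI; apply/seteqP; split => w /=; rewrite in_itv/= andbT.
rewrite -E_indic// lee_fin mulrC -(rintZ measurableT)//.
apply: (le_rint measurableT) => //; [exact: itg_indic|exact: itgZ|].
move=> w _; rewrite indicE; case: (boolP (w \in _)) => [/set_mem /= zf|_] /=.
  by rewrite mulrC ler_pdivlMr// mul1r ltW.
by rewrite mulr_ge0// invr_ge0 ltW.
Qed.

(** Cauchy-Schwarz inequality against the constant 1. *)
Lemma E_sqr_le f : sqi P setT f -> itg f /\ (E f) ^+ 2 <= E (fun w => f w ^+ 2).
Proof.
move=> hf; have h1 : sqi P setT (fun=> 1 : R).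
  by split => //; under eq_fun do rewrite expr1n; exact: itg_cst.
split.
  by have := sqiM_itg measurableT hf h1; under eq_fun do rewrite mulr1.
have := CS measurableT hf h1; rewrite /dot.
under [X in X ^+ 2]eq_rint do rewrite mulr1.
by under [X in _ * X]eq_rint do rewrite mulr1; rewrite E_cst mulr1.
Qed.

Definition covar U V : R := E (fun w => U w * V w) - E U * E V.

Lemma covC U V : covar U V = covar V U.
Proof. by rewrite /covar [E U * _]mulrC; congr (_ - _); apply: eq_rint => w _; rewrite mulrC. Qed.

End expectation.

Section thresholds.
Variable R : realType.
Implicit Type x : R.

(** Rounding up by counting thresholds. *)
Lemma count_thresholds (k : nat) x : 0 <= x <= k%:R ->
  x <= \sum_(i < k) (i%:R < x)%R%:R <= x + 1.
Proof.
move=> /andP[x0 xk]; apply/andP; split.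
  elim: k xk => [|k IH] xk; first by rewrite big_ord0.
  rewrite big_ord_recr/=; have [xk'|kx] := leP x k%:R; first by rewrite (le_trans (IH xk'))// lerDl.
  rewrite (eq_bigr (fun=> 1)) ?sumr_const ?card_ord -?natr1 ?natr1//.
  by move=> i _; rewrite (le_lt_trans _ kx)// ler_nat ltnW.
elim: k {xk} => [|k IH]; first by rewrite big_ord0 addr_ge0.
rewrite big_ord_recr/=; have [xk'|kx] := leP x k%:R; first by rewrite addr0.
apply: (@le_trans _ _ (k%:R + 1)); last by rewrite lerD2r ltW.
rewrite lerD2r -[leRHS]mulr1n -[k in leRHS]card_ord -[leRHS]/(_ *+ _).
rewrite -[leRHS](_ : \sum_(i < k) 1 = _); last by rewrite sumr_const.
by apply: ler_sum => i _; case: (_ < _).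
Qed.

End thresholds.

Section covariance_inequality.
Context d (T : measurableType d) (R : realType) (P : probability T R).
Implicit Types (U V : T -> R).
Local Notation itg := (itg P setT).
Local Notation E := (rint P setT).
Local Notation cov := (covar P).

Let above U (c : R) : set T := [set w | c < U w].

Let mabove U c : measurable_fun setT U -> measurable (above U c).
Proof.
move=> mU; rewrite (_ : above U c = setT `&` U @^-1` `]c, +oo[%classic).
  by apply: mU => //; exact: measurable_itv.
by rewrite setTI; apply/seteqP; split => w /=; rewrite in_itv/= andbT.
Qed.

Let cov_slice U V (al : R) : measurable_fun setT U -> measurable_fun setT V ->
  (forall w, 0 <= U w <= 1) -> (forall w, 0 <= V w <= 1) ->
  (forall c, `|cov (\1_(above U c)) V| <= al) -> `|cov U V| <= al.
Proof.
move=> mU mV U01 V01 h; apply/ler_addgt0Pr => e e0.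
have [k ke] : exists k, 2 / k.+1%:R <= e.
  exists (Num.truncn (2 / e)); rewrite ler_pdivrMr// mulrC -ler_pdivrMr// ltW//.
  exact: truncnS_gt.
pose Uk w : R := \sum_(i < k.+1) k.+1%:R^-1 * \1_(above U (i%:R / k.+1%:R)) w.
have k0 : 0 < k.+1%:R :> R by [].
have Ukb w : U w <= Uk w <= U w + k.+1%:R^-1.
  have := @count_thresholds R k.+1 (k.+1%:R * U w).
  have /andP[u0 u1] := U01 w; rewrite mulr_ge0//= ler_piMr// => /(_ isT).
  rewrite /Uk -mulr_sumr (eq_bigr (fun i : 'I_k.+1 => \1_(above U (i%:R / k.+1%:R)) w)).
    have kn : k.+1%:R != 0 :> R by rewrite gt_eqF.
    move=> /andP[h1 h2]; rewrite -(ler_pM2l k0) mulVKf// h1/=.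
    by rewrite -(ler_pM2l k0) mulVKf// mulrDr mulfV.
  move=> i _; rewrite indicE /above; congr (_%:R).
  rewrite (_ : (w \in _) = (i%:R / k.+1%:R < U w)); first by rewrite ltr_pdivrMr// mulrC.
  by apply/idP/idP => [/set_mem//|h']; apply/mem_set.
have mI c : measurable (above U c) by exact: mabove.
have mUk : measurable_fun setT Uk.
  by apply: measurable_sum => i; apply: measurable_funM => //; exact: measurable_indic.
have b1 (f : T -> R) : measurable_fun setT f -> (forall w, 0 <= f w <= 1) -> itg f.
  move=> mf f01; apply: (@itg_bnd _ _ _ _ _ 1 mf) => w; have /andP[f0 f1] := f01 w.
  by rewrite ger0_norm.
have bV (f : T -> R) : itg f -> itg (fun w => f w * V w).
  move=> hf; apply: (itg_le measurableT _ _ (itg_abs hf)).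
    by apply: measurable_funM => //; exact: itg_meas hf.
  move=> w _; have /andP[v0 v1] := V01 w; by rewrite normrM (ger0_norm v0) ler_piMr.
have iI c : itg (\1_(above U c)) by exact: itg_indic.
have iU := b1 U mU U01; have iV := b1 V mV V01.
have iUk : itg Uk by apply: itg_sum => // i _; apply: itgZ.
have c1 : `|cov Uk V| <= al.
  have -> : cov Uk V = \sum_(i < k.+1) k.+1%:R^-1 * cov (\1_(above U (i%:R / k.+1%:R))) V.
    rewrite /covar.
    rewrite (eq_rint P (g := fun w => \sum_(i < k.+1) k.+1%:R^-1 * (\1_(above U (i%:R / k.+1%:R)) w * V w))).
      rewrite !rint_sum//; [|by move=> i _; apply: itgZ|by move=> i _; apply: itgZ => //; exact: bV].
      rewrite mulr_suml -sumrB; apply: eq_bigr => i _.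
      by rewrite !rintZ//; [rewrite -mulrA mulrBr|exact: bV].
    by move=> w _; rewrite /Uk mulr_suml; apply: eq_bigr => i _; rewrite mulrA.
  apply: (le_trans (ler_norm_sum _ _ _)); apply: (@le_trans _ _ (\sum_(i < k.+1) k.+1%:R^-1 * al)).
    by apply: ler_sum => i _; rewrite normrM ger0_norm ?invr_ge0// ler_wpM2l// invr_ge0.
  by rewrite sumr_const card_ord -[leLHS]mulr_natl mulrA mulfV ?mul1r// gt_eqF.
pose Dk w := Uk w - U w.
have Db w : 0 <= Dk w <= k.+1%:R^-1.
  by have /andP[h1 h2] := Ukb w; rewrite subr_ge0 h1/= lerBlDl.
have iD : itg Dk by exact: itgB.
have c2 : `|cov Dk V| <= 2 / k.+1%:R.
  apply: (le_trans (ler_normB _ _)); rewrite mulr_natl mulr2n; apply: lerD.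
    rewrite ger0_norm; last first.
      by apply: rint_ge0 => w _; have /andP[? _] := Db w; have /andP[? _] := V01 w; rewrite mulr_ge0.
    rewrite -[leRHS](@E_cst _ _ _ P); apply: le_rint => //; [exact: bV|exact: itg_cst|].
    move=> w _; have /andP[? ?] := Db w; have /andP[? ?] := V01 w.
    by apply: le_trans (_ : _ <= Dk w) _ => //; rewrite ler_piMr.
  have EV0 : 0 <= E V by apply: rint_ge0 => w _; have /andP[] := V01 w.
  have EV1 : E V <= 1.
    by rewrite -[leRHS](@E_cst _ _ _ P); apply: le_rint => //; [exact: itg_cst|move=> w _; have /andP[] := V01 w].
  have ED0 : 0 <= E Dk by apply: rint_ge0 => w _; have /andP[] := Db w.
  have ED1 : E Dk <= k.+1%:R^-1.
    by rewrite -[leRHS](@E_cst _ _ _ P); apply: le_rint => //; [exact: itg_cst|move=> w _; have /andP[] := Db w].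
  by rewrite ger0_norm ?mulr_ge0// (le_trans (ler_piMr _ _)).
have -> : cov U V = cov Uk V - cov Dk V.
  rewrite /covar rintB//.
  rewrite [X in _ = _ - (X - _)](eq_rint P (g := fun w => Uk w * V w - U w * V w)).
    by rewrite rintB//; [ring|exact: bV|exact: bV].
  by move=> w _; rewrite /Dk mulrBl.
by apply: (le_trans (ler_normB _ _)); rewrite lerD// (le_trans c2).
Qed.

Let cov_slice2 U V (al : R) : measurable_fun setT U -> measurable_fun setT V ->
  (forall w, 0 <= U w <= 1) -> (forall w, 0 <= V w <= 1) ->
  (forall b c, `|P (above U b `&` above V c) - P (above U b) * P (above V c)| <= al%:E)%E ->
  `|cov U V| <= al.
Proof.
move=> mU mV U01 V01 h; apply: cov_slice => // b; rewrite covC; apply: cov_slice => //.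
- exact/measurable_indic/mabove.
- by move=> w; rewrite indicE; case: (_ \in _); rewrite /= ler01 lexx.
move=> c; rewrite covC /covar.
have mA := mabove b mU; have mB := mabove c mV.
rewrite (eq_rint P (g := \1_(above U b `&` above V c))); last by move=> w _; rewrite indicI.
rewrite -lee_fin; have := h b c.
have mAB := measurableI _ _ mA mB.
by rewrite -(E_indic P mAB) -(E_indic P mA) -(E_indic P mB).
Qed.

(** Bounded variables are, after an affine change, uniform limits of averages of
    indicators of their upper level sets, for which the hypothesis is the bound on
    the covariance. *)
Lemma cov_ineq U V (al a b : R) : measurable_fun setT U -> measurable_fun setT V ->
  0 < a -> 0 < b -> (forall w, `|U w| <= a) -> (forall w, `|V w| <= b) ->
  (forall x y, `|P ([set w | (x < U w)%R] `&` [set w | (y < V w)%R]) -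
     P [set w | (x < U w)%R] * P [set w | (y < V w)%R]| <= al%:E)%E ->
  `|E (fun w => U w * V w) - E U * E V| <= 4 * al * a * b.
Proof.
move=> mU mV a0 b0 Ua Vb h; rewrite -/(cov U V).
pose nm (c : R) (f : T -> R) w := (2 * c)^-1 * (f w + c).
have nmP (c : R) (f : T -> R) : 0 < c -> measurable_fun setT f -> (forall w, `|f w| <= c) ->
    [/\ measurable_fun setT (nm c f), (forall w, 0 <= nm c f w <= 1),
        itg f, E (nm c f) = (2 * c)^-1 * (E f + c) &
        forall x, above (nm c f) x = above f (2 * c * x - c)].
  move=> c0 mf fc; have if_ := itg_bnd P mf fc.
  have c20 : 0 < 2 * c by rewrite mulr_gt0.
  split => //.
  - by apply: measurable_funM => //; exact: measurable_funD.
  - move=> w; have := fc w; rewrite ler_norml /nm => /andP[f1 f2].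
    by rewrite mulr_ge0 ?invr_ge0 ?(ltW c20)//= ?(mulrC _^-1) ?ler_pdivrMr//; lra.
  - rewrite rintZ//; last by apply: itgD => //; exact: itg_cst.
    by rewrite rintD ?E_cst//; exact: itg_cst.
  - by move=> x; apply/seteqP; split => w; rewrite /above /nm /= [_^-1 * _]mulrC ltr_pdivlMr// ltrBlDr mulrC.
have [mU' U01 iU EU' aU] := nmP a U a0 mU Ua.
have [mV' V01 iV EV' aV] := nmP b V b0 mV Vb.
have iUV : itg (fun w => U w * V w).
  apply: (@itg_bnd _ _ _ _ _ (a * b)); first exact: measurable_funM.
  by move=> w; rewrite normrM ler_pM.
have := @cov_slice2 _ _ al mU' mV' U01 V01.
have -> : cov (nm a U) (nm b V) = (4 * a * b)^-1 * cov U V.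
  rewrite /covar EU' EV'.
  rewrite (eq_rint P (g := fun w => (4 * a * b)^-1 * (U w * V w + (b * U w + (a * V w + a * b))))).
    have i1 := itg_cst P (a * b); have i2 := itgD measurableT (itgZ measurableT a iV) i1.
    have i3 := itgD measurableT (itgZ measurableT b iU) i2.
    rewrite rintZ//; last exact: itgD.
    rewrite rintD// rintD//; last exact: itgZ.
    rewrite rintD//; last exact: itgZ.
    rewrite E_cst !rintZ//; move: (E U) (E V) (E _) => x y z.
    by field; rewrite !gt_eqF.
  by move=> w _; rewrite /nm; field; rewrite !gt_eqF.
have ab0 : 0 < 4 * a * b by rewrite !mulr_gt0.
rewrite normrM gtr0_norm ?invr_gt0// mulrC ler_pdivrMr// => H.
rewrite (_ : 4 * al * a * b = al * (4 * a * b)); last by ring.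
by apply: H => x y; rewrite aU aV; exact: h.
Qed.

End covariance_inequality.

(** Rectangles form a pi-system that generates the Borel sets of the plane. *)
Section law_transfer.
Context d (T : measurableType d) (R : realType) (P : probability T R).
Variables (U V U' V' : T -> R).
Hypotheses (mU : measurable_fun setT U) (mV : measurable_fun setT V).
Hypotheses (mU' : measurable_fun setT U') (mV' : measurable_fun setT V').
Hypothesis rect : forall A B : set R, measurable A -> measurable B ->
  P [set w | A (U w) /\ B (V w)] = P [set w | A (U' w) /\ B (V' w)].

Let phi w := (U w, V w).
Let psi w := (U' w, V' w).
Let mphi : measurable_fun setT phi. Proof. exact: measurable_fun_pair. Qed.
Let mpsi : measurable_fun setT psi. Proof. exact: measurable_fun_pair. Qed.
Let mphi_mixin := isMeasurableFun.Build _ _ _ _ _ mphi.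
Let mphi_pack : {mfun _ >-> _} := HB.pack phi mphi_mixin.
Let mpsi_mixin := isMeasurableFun.Build _ _ _ _ _ mpsi.
Let mpsi_pack : {mfun _ >-> _} := HB.pack psi mpsi_mixin.

Let law_eq (A : set (R * R)) : measurable A -> pushforward P phi A = pushforward P psi A.
Proof.
move=> mA; apply: (@measure_unique _ _ _ [set A `*` B | A in measurable & B in measurable]
   (fun=> setT) _ _ _ _ (pushforward P mphi_pack) (pushforward P mpsi_pack)) => //.
- exact: measurable_prod_measurableType.
- move=> _ _ [A1 mA1 [A2 mA2 <-]] [B1 mB1 [B2 mB2 <-]].
  exists (A1 `&` B1); first exact: measurableI.
  by exists (A2 `&` B2); [exact: measurableI|rewrite setXI].
- by move=> _; exists setT => //; exists setT => //; rewrite setXTT.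
- by rewrite bigcup_const.
- by move=> _ [A1 mA1 [A2 mA2 <-]]; exact: rect.
- by move=> _; rewrite /= /pushforward preimage_setT probability_setT ltry.
Qed.

Let ge0_law (f : R * R -> \bar R) : measurable_fun setT f -> (forall x, (0 <= f x)%E) ->
  (\int[P]_w f (U w, V w) = \int[P]_w f (U' w, V' w))%E.
Proof.
move=> mf f0.
have := @ge0_integral_pushforward _ _ _ _ _ _ mphi P setT f measurableT mf (fun x _ => f0 x).
have := @ge0_integral_pushforward _ _ _ _ _ _ mpsi P setT f measurableT mf (fun x _ => f0 x).
rewrite !preimage_setT => <- <-; apply: eq_measure_integral => A mA _; exact: law_eq.
Qed.

Lemma law_E (f : R * R -> R) : measurable_fun setT f ->
  rint P setT (fun w => f (U w, V w)) = rint P setT (fun w => f (U' w, V' w)) /\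
  (itg P setT (fun w => f (U w, V w)) -> itg P setT (fun w => f (U' w, V' w))).
Proof.
move=> mf; have mEf : measurable_fun setT (EFin \o f) by exact/measurable_EFinP.
split.
  rewrite /rint /Rintegral integralE [in RHS]integralE; congr (fine (_ - _)).
    by apply: etrans (etrans _ (@ge0_law _ (measurable_funepos mEf) (fun x => funepos_ge0 _ _))) _; apply: eq_integral => w _; rewrite !funeposE.
  by apply: etrans (etrans _ (@ge0_law _ (measurable_funeneg mEf) (fun x => funeneg_ge0 _ _))) _; apply: eq_integral => w _; rewrite !funenegE.
move=> /integrableP[_ h]; apply/integrableP; split.
  by apply/measurable_EFinP; exact: (measurableT_comp mf).
rewrite -(ge0_law (f := fun x => `|(f x)%:E|%E))//.
exact: measurableT_comp.
Qed.

End law_transfer.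

(** * Mean square continuity of translations *)

Section translation.
Variable R : realType.
Notation mu := (@lebesgue_measure R).
Implicit Types (f g h : R -> R) (s t a b c : R).

Section shift.
Variable s : R.
Let phi : measurableTypeR R -> measurableTypeR R := fun t => t + s.
Let mphi : measurable_fun setT phi.
Proof. by apply: measurable_funD. Qed.
Let mphi_mixin := isMeasurableFun.Build _ _ _ _ _ mphi.
Let mphi_pack : {mfun _ >-> _} := HB.pack phi mphi_mixin.

Let shift_invariant A : measurable A -> mu A = pushforward mu phi A.
Proof.
apply: (@lebesgue_measure_unique R (pushforward mu mphi_pack)) => _ [[a b] _ <-].
rewrite /= /pushforward (_ : phi @^-1` _ = `]a - s, b - s]%classic).
  by rewrite !lebesgue_measure_itv/= !lte_fin ltrBlDr subrK; case: ifP => // _; rewrite !EFinN -!EFinD; congr EFin; ring.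
by apply/seteqP; split => t /=; rewrite !in_itv/= /phi ltrBlDr lerBrDr.
Qed.

Lemma integral_shift a b (F : R -> \bar R) : measurable_fun `[a + s, b + s]%classic F ->
  (forall t, (0 <= F t)%E) ->
  (\int[mu]_(t in `[a, b]) F (t + s)%R = \int[mu]_(t in `[(a + s)%R, (b + s)%R]) F t)%E.
Proof.
move=> mF F0.
have := @ge0_integral_pushforward _ _ _ _ R phi mphi mu `[a + s, b + s]%classic F
  (measurable_itv _) mF (fun x _ => F0 x).
rewrite (_ : phi @^-1` _ = `[a, b]%classic) => [<-|].
  by apply: eq_measure_integral => A mA _; exact/esym/shift_invariant.
by apply/seteqP; split => t /=; rewrite !in_itv/= /phi lerD2r lerD2r.
Qed.

End shift.

Local Notation half := (2^-1 : R).

Lemma itg_shift s F : 0 <= s <= half -> itg mu `[0, 1]%classic F ->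
  itg mu `[0, half]%classic (fun t => F (t + s)).
Proof.
move=> /andP[s0 s1] iF.
have iF' : itg mu `[0 + s, half + s]%classic F by apply: itgS_seg iF; lra.
have mF := itg_meas iF'.
move: iF' => /integrableP[_ h]; apply/integrableP; split.
  apply/measurable_EFinP; apply: (@measurable_comp _ _ _ _ _ _ `[0 + s, half + s]%classic F) => //.
    by move=> _ [t + <-] /=; rewrite !in_itv/= !lerD2r.
  by apply: measurable_funTS; apply: measurable_funD.
rewrite (integral_shift (F := fun t => `|(F t)%:E|%E))//.
by apply: measurableT_comp => //; exact/measurable_EFinP.
Qed.

Lemma rint_shift_le s F : 0 <= s <= half -> itg mu `[0, 1]%classic F -> (forall t, 0 <= F t) ->
  rint mu `[0, half]%classic (fun t => F (t + s)) <= rint mu `[0, 1]%classic F.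
Proof.
move=> sh iF F0; have i1 := itg_shift sh iF; move/andP: sh => [s0 s1].
rewrite -lee_fin !EFin_rint//.
have iF' : itg mu `[0 + s, half + s]%classic F by apply: itgS_seg iF; lra.
rewrite (integral_shift (F := fun t => (F t)%:E))//; last by apply/measurable_EFinP; exact: itg_meas iF'.
apply: ge0_subset_integral => //; [by apply/measurable_EFinP; exact: itg_meas iF|by move=> t _; rewrite lee_fin|].
by move=> t /=; rewrite !in_itv/= => /andP[t1 t2]; apply/andP; split; lra.
Qed.

Definition clip (M x : R) : R := Num.max (- M) (Num.min x M).

Lemma clip_le M x : 0 <= M -> `|clip M x| <= M.
Proof.
move=> M0; rewrite ler_norml /clip le_max lexx/= ge_max ge_min lexx orbT andbT; lra.
Qed.

Lemma clip_id M x : `|x| <= M -> clip M x = x.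
Proof. by rewrite ler_norml => /andP[x1 x2]; rewrite /clip min_l// max_r. Qed.

Lemma clip_lip M x y : `|clip M x - clip M y| <= `|x - y|.
Proof.
rewrite /clip /Num.max /Num.min; do ! case: ifP;
  rewrite ?ler_norml => *; rewrite -?real_ler_normr ?num_real//;
  have := ler_norm (x - y); have := ler_norm (y - x); rewrite (distrC y x); 
  rewrite ?ler_norml; try (apply/andP; split); lra.
Qed.

Lemma clip_rest M x : 0 <= M -> `|x - clip M x| <= `|x|.
Proof.
move=> M0; have [xM|Mx] := leP `|x| M; first by rewrite clip_id// subrr normr0.
rewrite /clip; have [x0|x0] := leP 0 x.
  rewrite ger0_norm// in Mx; rewrite min_r ?(ltW Mx)// max_r; last by lra.
  by rewrite !ger0_norm; lra.
rewrite ltr0_norm// in Mx; rewrite min_l; last by lra.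
by rewrite max_l ?opprK ?ler0_norm; lra.
Qed.

Lemma clip_continuous M : continuous (clip M).
Proof.
move=> x; apply/cvgrPdist_le => z z0; near=> y; apply: (le_trans (clip_lip _ _ _)).
by near: y; exact: cvgr_dist_le.
Unshelve. all: by end_near. Qed.

Lemma clip_measurable d (T : measurableType d) (D : set T) M (f : T -> R) : measurable D ->
  measurable_fun D f -> measurable_fun D (fun w => clip M (f w)).
Proof.
by move=> mD mf; apply: measurable_maxr => //; exact: measurable_minr.
Qed.

Lemma sqr_sum5 (a b c e z : R) :
  (a + b + c + e + z) ^+ 2 <= 5 * a ^+ 2 + 5 * b ^+ 2 + 5 * c ^+ 2 + 5 * e ^+ 2 + 5 * z ^+ 2.
Proof.
rewrite -subr_ge0 (_ : _ - _ = (a - b) ^+ 2 + (a - c) ^+ 2 + (a - e) ^+ 2 + (a - z) ^+ 2 +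
  (b - c) ^+ 2 + (b - e) ^+ 2 + (b - z) ^+ 2 + (c - e) ^+ 2 + (c - z) ^+ 2 + (e - z) ^+ 2); last by ring.
by rewrite !addr_ge0// sqr_ge0.
Qed.

(** Integrating over [[0, 1/2]] only avoids extending [f] outside [[0, 1]]. The function
    is truncated, then approximated in mean by a continuous function bounded by the
    same constant, to which dominated convergence applies. *)
Lemma L2_translation f (s : nat -> R) : sqi mu `[0, 1]%classic f ->
  (forall k, 0 <= s k <= half) -> s @ \oo --> (0 : R) ->
  forall z : R, 0 < z -> exists K, forall k, (K <= k)%N ->
    rint mu `[0, half]%classic (fun t => (f (t + s k) - f t) ^+ 2) <= z.
Proof.
move=> sf sh s0 z z0; pose I : set R := `[0, 1]%classic; pose J : set R := `[0, half]%classic.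
have mI : measurable (I : set (measurableTypeR R)) by exact: measurable_itv.
have mJ : measurable (J : set (measurableTypeR R)) by exact: measurable_itv.
have [mf if2] := sf.
have z40 : 0 < z / 40 by rewrite divr_gt0.
have [M M0 hM] : exists2 M : R, 0 < M & rint mu I (fun t => (f t - clip M (f t)) ^+ 2) <= z / 40.
  have [||||_ c] := @rint_dct _ _ _ mu I mI (fun n t => (f t - clip n.+1%:R (f t)) ^+ 2) (fun=> 0)
     (fun t => f t ^+ 2) _ _ _ if2.
  - by move=> n; apply: measurable_funX; apply: measurable_funB => //; exact: clip_measurable.
  - exact: measurable_cst.
  - apply: aeW => t It; apply: cvg_near_cst; exists (Num.truncn `|f t|) => // n /= nt.
    rewrite clip_id ?subrr ?expr0n//; apply: ltW; apply: lt_le_trans (truncnS_gt _) _.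
    by rewrite ler_nat ltnS.
  - apply: aeW => t n It; rewrite ger0_norm ?sqr_ge0//.
    rewrite -[leLHS]real_normK ?num_real// -[leRHS]real_normK ?num_real// ler_sqr ?nnegrE//.
    exact: clip_rest.
  have /cvgrPdist_le/(_ _ z40)[n _ /(_ n (leqnn n))] := c.
  rewrite rint0// sub0r normrN ger0_norm => [hn|]; first by exists n.+1%:R.
  by apply: rint_ge0 => t _; exact: sqr_ge0.
pose fM t := clip M (f t).
have iM : itg mu I fM.
  apply: (itg_le mI (g := fun=> M)); first exact: clip_measurable.
    by move=> t _; exact/clip_le/ltW.
  exact: itg_cst_seg.
have z4M : 0 < z / (80 * M) by rewrite divr_gt0// mulr_gt0.
have [h [ch hb ih hz]] : exists h, [/\ continuous h, forall t, `|h t| <= M, itg mu I h &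
    rint mu I (fun t => `|fM t - h t|) <= z / (80 * M)].
  have [|g [cg ig cvg]] := @approximation_continuous_integrable R I fM mI _ iM.
    by have := @lebesgue_measure_itv R `[0, 1]; rewrite /= lte_fin ltr01 -EFinD => E; rewrite [X in (X < _)%E]E ltry.
  have /fine_cvgP[_ /cvgrPdist_le/(_ _ z4M)[n _ /(_ n (leqnn n))]] := cvg.
  rewrite sub0r normrN => hn; exists (fun t => clip M (g n t)).
  have mg : measurable_fun I (fun t => clip M (g n t)).
    by apply: clip_measurable => //; apply: measurable_funTS; exact: continuous_measurable_fun.
  have ih : itg mu I (fun t => clip M (g n t)).
    apply: (itg_le mI mg (g := fun=> M)) => //; last exact: itg_cst_seg.
    by move=> t _; exact/clip_le/ltW.
  split => //.
  - by move=> t; apply: continuous_comp; [exact: cg|exact: clip_continuous].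
  - by move=> t; exact/clip_le/ltW.
  - apply: le_trans hn; rewrite ger0_norm ?fine_ge0 ?integral_ge0//.
    apply: (le_rint mI); first exact: (itg_abs (itgB mI iM ih)).
      exact: (itg_abs (itgB mI iM (ig n))).
    move=> t _; have E : clip M (fM t) = fM t by apply: clip_id; apply: clip_le; exact: ltW.
    by rewrite -[in leLHS]E clip_lip.
have [K hK] : exists K, forall k, (K <= k)%N -> rint mu J (fun t => (h (t + s k) - h t) ^+ 2) <= z / 40.
  have mh : measurable_fun setT h by exact: continuous_measurable_fun.
  have [|||||_ c] := @rint_dct _ _ _ mu J mJ (fun n t => (h (t + s n) - h t) ^+ 2) (fun=> 0)
     (fun t => (2 * M) ^+ 2).
  - move=> n; apply: measurable_funTS; apply: measurable_funX; apply: measurable_funB => //.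
    by apply: measurableT_comp => //; apply: measurable_funD.
  - exact: measurable_cst.
  - apply: aeW => t It; rewrite -[X in _ --> X](_ : (h (t + 0) - h t) ^+ 2 = _); last by rewrite addr0 subrr expr0n.
    apply: (@cvg_comp _ _ _ _ (fun x : R => x ^+ 2)); last exact: exprn_continuous.
    apply: cvgB; last exact: cvg_cst.
    apply: (@cvg_comp _ _ _ _ h); last exact: ch.
    by apply: cvgD => //; exact: cvg_cst.
  - exact: itg_cst_seg.
  - apply: aeW => t n It; rewrite ger0_norm ?sqr_ge0// -[leLHS]real_normK ?num_real// ler_sqr ?nnegrE ?mulr_ge0 ?(ltW M0)//.
    by apply: le_trans (ler_normB _ _) _; rewrite mulr_natl mulr2n lerD.
  have /cvgrPdist_le/(_ _ z40)[K _ hK] := c; exists K => k Kk.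
  have := hK k Kk; rewrite rint0// sub0r normrN ger0_norm//.
  by apply: rint_ge0 => t _; exact: sqr_ge0.
exists K => k Kk.
pose A t := (f t - fM t) ^+ 2; pose B t := (fM t - h t) ^+ 2.
have mfM : measurable_fun I fM by exact: itg_meas iM.
have smM : sqi mu I fM.
  split => //; apply: (itg_le mI (g := fun=> M ^+ 2)); first exact: measurable_funX.
    move=> t _; rewrite ger0_norm ?sqr_ge0// -[leLHS]real_normK ?num_real// ler_sqr ?nnegrE ?(ltW M0)//.
    exact/clip_le/ltW.
  exact: itg_cst_seg.
have shh : sqi mu I h.
  split; first exact: itg_meas ih.
  apply: (itg_le mI (g := fun=> M ^+ 2)); first by apply: measurable_funX; exact: itg_meas ih.
    by move=> t _; rewrite ger0_norm ?sqr_ge0// -[leLHS]real_normK ?num_real// ler_sqr ?nnegrE ?(ltW M0).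
  exact: itg_cst_seg.
have iA : itg mu I A by have [] := sqiB mI sf smM.
have iB : itg mu I B by have [] := sqiB mI smM shh.
have A0 t : 0 <= A t by exact: sqr_ge0.
have B0 t : 0 <= B t by exact: sqr_ge0.
have Bz : rint mu I B <= z / 40.
  apply: (@le_trans _ _ (2 * M * rint mu I (fun t => `|fM t - h t|))).
    have iab := itg_abs (itgB mI iM ih).
    rewrite -(rintZ mI)//; apply: (le_rint mI) => //; first exact: itgZ.
    move=> t _; rewrite /B -[leLHS]real_normK ?num_real// expr2 ler_wpM2r//.
    by apply: le_trans (ler_normB _ _) _; rewrite mulr_natl mulr2n lerD// clip_le// ltW.
  have M20 : 0 <= 2 * M by rewrite mulr_ge0// ltW.
  apply: (le_trans (ler_wpM2l M20 hz)).
  have Mn : M != 0 by rewrite gt_eqF.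
  by rewrite (_ : 2 * M * (z / (80 * M)) = z / 40)//; field.
have skh := sh k.
have iAs := itg_shift skh iA; have iBs := itg_shift skh iB.
have sub (F : R -> R) : itg mu I F -> itg mu J F by apply: itgS_seg; rewrite ?lexx// invf_le1// ler1n.
have subI F : itg mu I F -> (forall t, 0 <= F t) -> rint mu J F <= rint mu I F.
  move=> iF F0; have iJ := sub _ iF; rewrite -lee_fin !EFin_rint//.
  apply: ge0_subset_integral => //; [by apply/measurable_EFinP; exact: itg_meas iF|by move=> t _; rewrite lee_fin|].
  by move=> t; rewrite /I /J /= !in_itv/= => /andP[t1 t2]; apply/andP; split; lra.
have iH : itg mu J (fun t => (h (t + s k) - h t) ^+ 2).
  have mh : measurable_fun setT h by exact: continuous_measurable_fun.
  apply: (itg_le mJ (g := fun=> (2 * M) ^+ 2)); last exact: itg_cst_seg.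
    apply: measurable_funTS; apply: measurable_funX; apply: measurable_funB => //.
    by apply: measurableT_comp => //; apply: measurable_funD.
  move=> t _; rewrite ger0_norm ?sqr_ge0// -[leLHS]real_normK ?num_real// ler_sqr ?nnegrE ?mulr_ge0 ?(ltW M0)//.
  by apply: le_trans (ler_normB _ _) _; rewrite mulr_natl mulr2n lerD.
pose G t := 5 * A (t + s k) + (5 * B (t + s k) + (5 * (h (t + s k) - h t) ^+ 2 + (5 * B t + 5 * A t))).
have iJA := sub _ iA; have iJB := sub _ iB.
have i1 := itgD mJ (itgZ mJ 5 iJB) (itgZ mJ 5 iJA).
have i2 := itgD mJ (itgZ mJ 5 iH) i1.
have i3 := itgD mJ (itgZ mJ 5 iBs) i2.
have iG : itg mu J G by exact: (itgD mJ (itgZ mJ 5 iAs) i3).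
have LG t : (f (t + s k) - f t) ^+ 2 <= G t.
  rewrite (_ : f _ - f t = (f (t + s k) - fM (t + s k)) + (fM (t + s k) - h (t + s k)) +
    (h (t + s k) - h t) + - (fM t - h t) + - (f t - fM t)); last by ring.
  apply: (le_trans (sqr_sum5 _ _ _ _ _)); rewrite !sqrrN /G /A /B; lra.
have if1 : itg mu I f.
  have s1 : sqi mu I (fun=> 1) by split; [exact: measurable_cst|exact: itg_cst_seg].
  by have := sqiM_itg mI sf s1; under eq_fun do rewrite mulr1.
have iL : itg mu J (fun t => (f (t + s k) - f t) ^+ 2).
  apply: (itg_le mJ _ _ iG); last by move=> t _; rewrite ger0_norm ?sqr_ge0.
  apply: measurable_funX; apply: measurable_funB; first exact: itg_meas (itg_shift skh if1).
  exact: itg_meas (sub _ if1).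
apply: (le_trans (le_rint mJ iL iG (fun t _ => LG t))).
rewrite rintD//; last exact: itgZ.
rewrite rintD//; last exact: itgZ.
rewrite rintD//; last exact: itgZ.
rewrite rintD//; [|exact: itgZ|exact: itgZ].
rewrite !rintZ//.
have := rint_shift_le skh iA A0; have := rint_shift_le skh iB B0.
have := subI _ iA A0; have := subI _ iB B0; have := hK k Kk.
move: hM; move: Bz.
rewrite -[rint mu I (fun t => (f t - _) ^+ 2)]/(rint mu I A).
move: (rint mu J A) (rint mu J B) (rint mu I A) (rint mu I B) (rint mu J _) (rint mu J _) (rint mu J _) => *.
lra.
Qed.

End translation.

(** * Jointly measurable random functions *)

Section random_functions.
Context dO (Omega : measurableType dO) (R : realType) (P : probability Omega R).
Notation mu := (@lebesgue_measure R).
Local Notation I := (`[0, 1]%classic : set R).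
Local Notation E := (rint P setT).
Implicit Types (U V : Omega -> R -> R) (phi psi : R -> R).

(** Joint measurability in the random element and in [t]. *)
Definition jm U := measurable_fun ([set: Omega] `*` (I : set (measurableTypeR R)))
  (fun wt : Omega * measurableTypeR R => U wt.1 wt.2).

Let mI : measurable (I : set (measurableTypeR R)). Proof. exact: measurable_itv. Qed.
Let mTI : measurable ([set: Omega] `*` (I : set (measurableTypeR R))).
Proof. exact: measurableX. Qed.

Let pf U : Omega * measurableTypeR R -> \bar R :=
  (fun wt => (U wt.1 wt.2)%:E) \_ (setT `*` (I : set (measurableTypeR R))).

Let pfE U w t : pf U (w, t) = (fun t => (U w t)%:E) \_ I t.
Proof. by rewrite /pf /patch in_setX in_setT. Qed.

Let mpf U : jm U -> measurable_fun setT (pf U).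
Proof.
move=> mU; rewrite /pf; apply/(measurable_restrictT _ mTI).
by apply: (measurableT_comp (f := EFin)) => //; exact: mU.
Qed.

Let pf_int U w : (\int[mu]_(t in I) (U w t)%:E = \int[mu]_t pf U (w, t))%E.
Proof. by rewrite integral_mkcond; apply: eq_integral => t _; rewrite pfE. Qed.

Let pf_in U t : I t -> forall w, pf U (w, t) = (U w t)%:E.
Proof. by move=> It w; rewrite pfE patchT// mem_set. Qed.

Let pf_out U t : ~ I t -> forall w, pf U (w, t) = 0%E.
Proof. by move=> It w; rewrite pfE patchC// mem_set. Qed.

Lemma jm_sec U w : jm U -> measurable_fun (I : set (measurableTypeR R)) (U w).
Proof.
move=> mU; apply: (measurable_comp (F := setT `*` (I : set (measurableTypeR R)))
  (g := fun t => (w, t)) (f := fun wt : Omega * measurableTypeR R => U wt.1 wt.2)) => //.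
  by move=> _ [t It <-].
exact/measurable_funTS/measurable_fun_pair.
Qed.

Lemma jm_at U t : I t -> jm U -> measurable_fun setT (U ^~ t).
Proof.
move=> It mU; apply: (measurable_comp (F := setT `*` (I : set (measurableTypeR R)))
  (g := fun w => (w, t)) (f := fun wt : Omega * measurableTypeR R => U wt.1 wt.2)) => //.
  by move=> _ [w _ <-].
Qed.

Lemma jmB U V : jm U -> jm V -> jm (fun w t => U w t - V w t).
Proof. exact: measurable_funB. Qed.
Lemma jmM U V : jm U -> jm V -> jm (fun w t => U w t * V w t).
Proof. exact: measurable_funM. Qed.
Lemma jm_abs U : jm U -> jm (fun w t => `|U w t|).
Proof. by move=> mU; rewrite /jm; apply: measurableT_comp. Qed.
Lemma jm_sum (J : Type) (s : seq J) (F : J -> Omega -> R -> R) :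
  (forall j, jm (F j)) -> jm (fun w t => \sum_(j <- s) F j w t).
Proof.
move=> h; by apply: measurable_sum.
Qed.
Lemma jm_t phi : measurable_fun (I : set (measurableTypeR R)) phi -> jm (fun=> phi).
Proof.
move=> mphi; apply: (measurable_comp (F := (I : set (measurableTypeR R))) (f := phi)) => //.
  by move=> _ [[w t] [_ It] <-].
exact: measurable_funTS.
Qed.
Lemma jm_w (f : Omega -> R) : measurable_fun setT f -> jm (fun w _ => f w).
Proof. by move=> mf; apply: measurable_funTS; exact: measurableT_comp. Qed.

(** The positive and negative parts are integrated separately, since the integral of
    [U w] may be undefined. *)
Lemma jm_int U : jm U -> measurable_fun setT (fun w => rint mu I (U w)).
Proof.
move=> mU; rewrite /rint /Rintegral; apply: (measurableT_comp (f := fine)) => //.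
under eq_fun => w do rewrite pf_int integralE.
apply: emeasurable_funB.
  rewrite (_ : (fun w => _) = fubini_F mu (pf U)^\+%E).
    by apply: measurable_fun_fubini_tonelli_F => //; exact: (measurable_funepos (mpf mU)).
  by apply/funext => w; apply: eq_integral => t _; rewrite /= !funeposE.
rewrite (_ : (fun w => _) = fubini_F mu (pf U)^\-%E).
  by apply: measurable_fun_fubini_tonelli_F => //; exact: (measurable_funeneg (mpf mU)).
by apply/funext => w; apply: eq_integral => t _; rewrite /= !funenegE.
Qed.

Lemma jm_mean U : jm U -> measurable_fun (I : set (measurableTypeR R)) (fun t => E (U ^~ t)).
Proof.
move=> mU; suff : measurable_fun setT (fun t => fine (\int[P]_w pf U (w, t))%E).
  move=> /(measurable_funTS (D := (I : set (measurableTypeR R)))).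
  apply: eq_measurable_fun => t /set_mem It; rewrite /rint /Rintegral; congr fine.
  by apply: eq_integral => w _; rewrite pf_in.
apply: (measurableT_comp (f := fine)) => //.
under eq_fun => w do rewrite integralE.
apply: emeasurable_funB.
  rewrite (_ : (fun w => _) = fubini_G P (pf U)^\+%E).
    by apply: measurable_fun_fubini_tonelli_G => //; exact: (measurable_funepos (mpf mU)).
  by apply/funext => t; apply: eq_integral => w _; rewrite /= !funeposE.
rewrite (_ : (fun w => _) = fubini_G P (pf U)^\-%E).
  by apply: measurable_fun_fubini_tonelli_G => //; exact: (measurable_funeneg (mpf mU)).
by apply/funext => t; apply: eq_integral => w _; rewrite /= !funenegE.
Qed.

Lemma random_fubini U : jm U -> (forall t, I t -> itg P setT (U ^~ t)) ->
  itg mu I (fun t => E (fun w => `|U w t|)) ->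
  [/\ {ae P, forall w, itg mu I (U w)}, itg P setT (fun w => rint mu I (U w)),
      itg mu I (fun t => E (U ^~ t)) &
      E (fun w => rint mu I (U w)) = rint mu I (fun t => E (U ^~ t))].
Proof.
move=> mU iU ib.
have mp := mpf mU.
have ip : (P \x mu)%E.-integrable setT (pf U).
  apply/integrable21ltyP => //.
  rewrite (_ : (\int[mu]_y _)%E = (\int[mu]_y ((fun t => (E (fun w => `|U w t|))%:E) \_ I) y)%E).
    rewrite -integral_mkcond; have /integrableP[_] := ib; apply: le_lt_trans.
    apply: ge0_le_integral => //.
    - by move=> t _; rewrite lee_fin rint_ge0.
    - by apply/measurable_EFinP; exact: itg_meas ib.
    - by apply: measurableT_comp => //; apply/measurable_EFinP; exact: itg_meas ib.
    - by move=> t _ /=; rewrite lee_fin ler_norm.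
  apply: eq_integral => t _; have [It|It] := pselect (I t); last first.
    by rewrite patchC ?mem_set// integral0_eq// => w _; rewrite pf_out// abse0.
  rewrite patchT ?mem_set// (EFin_rint measurableT); last exact/itg_abs/iU.
  by apply: eq_integral => w _; rewrite pf_in.
have aeI : {ae P, forall w, itg mu I (U w)}.
  apply: filterS (ae_integrable1 ip) => w h; rewrite /itg integrable_mkcond//.
  by apply: eq_integrable h => // t _; rewrite pfE.
have iF := integrable_fubini_F ip.
have finF : {ae P, forall w, setT w -> fubini_F mu (pf U) w = (rint mu I (U w))%:E}.
  by apply: filterS aeI => w h _; rewrite (EFin_rint mI)// pf_int.
have mr : measurable_fun setT (fun w => rint mu I (U w)) by exact: jm_int.
have mr' : measurable_fun setT (EFin \o (fun w => rint mu I (U w))) by exact/measurable_EFinP.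
have iE : itg P setT (fun w => rint mu I (U w)).
  have /integrableP[mF hF] := iF; apply/integrableP; split => //.
  apply: le_lt_trans hF; rewrite (ae_eq_integral (abse \o fubini_F mu (pf U)))//.
  - by apply: measurableT_comp => //; exact/measurable_EFinP.
  - by apply: measurableT_comp.
  - by apply: filterS finF => w h _ /=; rewrite h.
have GE t : fubini_G P (pf U) t = ((fun t => (E (U ^~ t))%:E) \_ I) t.
  rewrite /fubini_G; have [It|It] := pselect (I t); last first.
    by rewrite patchC ?mem_set// integral0_eq// => w _; rewrite pf_out.
  rewrite patchT ?mem_set// (EFin_rint measurableT); last exact: iU.
  by apply: eq_integral => w _; rewrite pf_in.
have iG : itg mu I (fun t => E (U ^~ t)).
  apply: (itg_le mI (jm_mean mU) _ ib) => t It.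
  by apply: (le_abs_rint measurableT); exact: iU.
split => //.
apply/EFin_inj; rewrite (EFin_rint measurableT)// (EFin_rint mI)//.
rewrite [RHS]integral_mkcond (eq_integral _ _ (fun t _ => esym (GE t))) -(Fubini ip).
apply: ae_eq_integral => //; first exact: measurable_fubini_F ip.
by apply: filterS finF => w h _; rewrite -h.
Qed.

(** A bound on the second moments, uniform in [t], justifies the exchanges of
    expectation and integral over [[0, 1]]. *)
Definition l2p U (B : R) := [/\ 0 <= B, jm U &
  forall t, I t -> sqi P setT (U ^~ t) /\ E (fun w => U w t ^+ 2) <= B].

Lemma l2p_norm U B : l2p U B ->
  [/\ {ae P, forall w, sqi mu I (U w)}, itg P setT (fun w => dot mu I (U w) (U w)) &
      E (fun w => dot mu I (U w) (U w)) = rint mu I (fun t => E (fun w => U w t ^+ 2))].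
Proof.
move=> [B0 mU hU].
have mU2 : jm (fun w t => U w t ^+ 2) by exact: measurable_funX.
have [||ae1 i1 _ e1] := random_fubini mU2.
- by move=> t It; have [[_ ?] _] := hU t It.
- apply: (itg_le mI (g := fun=> B)); last exact: itg_cst_seg.
    apply: (jm_mean (U := fun w t => `|U w t ^+ 2|)).
    exact: jm_abs.
  move=> t It; rewrite ger0_norm ?rint_ge0//.
  under eq_rint => w _ do rewrite ger0_norm ?sqr_ge0//.
  by have [_] := hU t It.
split => //.
by apply: filterS ae1 => w h; split => //; exact: jm_sec.
Qed.

Lemma l2p_normB U B : l2p U B -> E (fun w => dot mu I (U w) (U w)) <= B.
Proof.
move=> hU; have [ae1 i1 ->] := l2p_norm hU; have [B0 mU h] := hU.
rewrite -[leRHS](_ : rint mu I (fun=> B) = B); last first.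
  by rewrite rint_cst_seg ?ler01// subr0 mulr1.
apply: (le_rint mI) => [||t It]; last by have [] := h t It.
  apply: (itg_le mI (g := fun=> B)); last exact: itg_cst_seg.
    by apply: (jm_mean (U := fun w t => U w t ^+ 2)); exact: measurable_funX.
  move=> t It; rewrite ger0_norm; first by have [] := h t It.
  by apply: rint_ge0 => w _; exact: sqr_ge0.
exact: itg_cst_seg.
Qed.

Lemma l2p_dot U B phi : l2p U B -> sqi mu I phi ->
  sqi P setT (fun w => dot mu I (U w) phi) /\
  E (fun w => dot mu I (U w) phi ^+ 2) <= B * dot mu I phi phi.
Proof.
move=> hU sphi; have [ae1 i1 _] := l2p_norm hU; have [B0 mU h] := hU.
have md : measurable_fun setT (fun w => dot mu I (U w) phi).
  by apply: (jm_int (U := fun w t => U w t * phi t)); apply: jmM => //; apply: jm_t; case: sphi.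
have iN := itgZ measurableT (dot mu I phi phi) i1.
have aeb : {ae P, forall w, setT w -> `|dot mu I (U w) phi ^+ 2| <= dot mu I phi phi * dot mu I (U w) (U w)}.
  by apply: filterS ae1 => w sw _; rewrite ger0_norm ?sqr_ge0// [leRHS]mulrC CS.
have i2 : itg P setT (fun w => dot mu I (U w) phi ^+ 2).
  by apply: (itg_ae_le measurableT _ aeb iN); exact: measurable_funX.
split; first by [].
apply: (@le_trans _ _ (E (fun w => dot mu I phi phi * dot mu I (U w) (U w)))).
  apply: (ae_le_rint measurableT i2 iN).
  by apply: filterS aeb => w b _; apply: le_trans (b _); rewrite ?ler_norm.
rewrite rintZ// mulrC ler_wpM2r ?dot_ge0//; exact: l2p_normB hU.
Qed.

Lemma E_dotM U B phi (f : Omega -> R) : l2p U B -> sqi mu I phi -> sqi P setT f ->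
  E (fun w => dot mu I (U w) phi * f w) =
  rint mu I (fun t => phi t * E (fun w => U w t * f w)).
Proof.
move=> [B0 mU h] sphi sf; have [mf if2] := sf; have [mphi _] := sphi.
have mF : jm (fun w t => f w * (phi t * U w t)).
  by apply: jmM; [exact: jm_w|apply: jmM => //; exact: jm_t].
have iUf t : I t -> itg P setT (fun w => U w t * f w).
  by move=> It; apply: (sqiM_itg measurableT) => //; have [] := h t It.
pose c := Num.sqrt (B * E (fun w => f w ^+ 2)).
have bnd t : I t -> E (fun w => `|U w t * f w|) <= c.
  move=> It; have [sU UB] := h t It.
  have sa (g : Omega -> R) : sqi P setT g -> sqi P setT (fun w => `|g w|).
    move=> [mg ig]; split; first exact: measurableT_comp.
    by apply: (eq_itg measurableT _ ig) => w _; rewrite real_normK ?num_real.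
  rewrite -[leLHS]ger0_norm ?rint_ge0// -sqrtr_sqr ler_wsqrtr//.
  have := CS measurableT (sa _ sU) (sa _ sf).
  rewrite /dot; under [X in X ^+ 2]eq_rint do rewrite -normrM.
  move=> /le_trans; apply; apply: ler_pM; rewrite ?rint_ge0//.
  - by under eq_rint do rewrite -expr2 real_normK ?num_real//.
  - by under eq_rint do rewrite -expr2 real_normK ?num_real//.
have [||_ _ _ e] := random_fubini mF.
- move=> t It; apply: (eq_itg measurableT _ (itgZ measurableT (phi t) (iUf t It))) => w _; ring.
- apply: (itg_le mI (g := fun t => c * `|phi t|)).
  + apply: (jm_mean (U := fun w t => `|f w * (phi t * U w t)|)).
    exact: jm_abs.
  + move=> t It; rewrite ger0_norm ?rint_ge0//.
    rewrite (eq_rint P (g := fun w => `|phi t| * `|U w t * f w|)); last first.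
      by move=> w _; rewrite -normrM; congr `|_|; ring.
    rewrite rintZ//; last exact/itg_abs/iUf.
    by rewrite mulrC ler_wpM2r// bnd.
  + apply: itgZ => //; apply: itg_abs.
    have s1 : sqi mu I (fun=> 1) by split; [exact: measurable_cst|exact: itg_cst_seg].
    by apply: (eq_itg mI _ (sqiM_itg mI sphi s1)) => t _; rewrite mulr1.
transitivity (E (fun w => rint mu I (fun t => f w * (phi t * U w t)))).
  apply: ae_eq_rint => //.
  - apply: measurable_funM => //; apply: (jm_int (U := fun w t => U w t * phi t)).
    by apply: jmM => //; exact: jm_t.
  - exact: jm_int.
  - have [ae1 _ _] := l2p_norm (And3 B0 mU h).
    apply: filterS ae1 => w sw _; rewrite /dot mulrC -(rintZ mI); last exact: sqiM_itg.
    by apply: eq_rint => t _; rewrite [phi t * _]mulrC.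
rewrite e; apply: eq_rint => t It; rewrite -(rintZ measurableT); last exact: iUf.
by apply: eq_rint => w _; ring.
Qed.

End random_functions.

(** * Step functions and stationary random functions *)

Section step_functions.
Variables (R : realType) (p : nat).
Hypothesis p0 : (0 < p)%N.
Notation mu := (@lebesgue_measure R).
Local Notation I := (`[0, 1]%classic : set R).
Local Notation kn := (@knot R p).
Implicit Types (a b : 'I_p -> R) (s t c : R) (f h : R -> R).
Let mI : measurable (I : set (measurableTypeR R)). Proof. exact: measurable_itv. Qed.

(** The cells are open on the left because the sampling points are their right end
    points. *)
Definition step a t : R := \sum_(j < p) a j * \1_(`]kn j, kn j.+1]%classic : set R) t.

Let cell (j i : 'I_p) t : kn j < t <= kn j.+1 ->
  \1_(`]kn i, kn i.+1]%classic : set R) t = (i == j)%:R :> R.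
Proof.
move=> /andP[jt tj]; rewrite indicE; case: eqP => [->|ij].
  by rewrite mem_set//= in_itv/= jt.
rewrite memNset// /= in_itv/= => /andP[it ti]; apply: ij; apply/val_inj/eqP.
have h1 := lt_le_trans it tj; have h2 := lt_le_trans jt ti.
rewrite (knot_lt R p0) ltnS in h1; rewrite (knot_lt R p0) ltnS in h2.
by rewrite eqn_leq h1 h2.
Qed.

Lemma step_in a (j : 'I_p) t : kn j < t <= kn j.+1 -> step a t = a j.
Proof.
move=> jt; rewrite /step (bigD1 j)//= (cell j jt) eqxx mulr1 big1 ?addr0// => i ij.
by rewrite (cell i jt) (negbTE ij) mulr0.
Qed.

Lemma cell_locate t : 0 < t <= 1 -> exists j : 'I_p, kn j < t <= kn j.+1.
Proof.
move=> /andP[t0 t1]; have ex : exists j, t <= kn j by exists p; rewrite knot_last.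
have [[|j] tj jm] := ex_minnP ex; first by move: tj; rewrite knot0 leNgt t0.
have jp : (j < p)%N by apply: jm; rewrite knot_last.
exists (Ordinal jp) => /=; rewrite tj andbT ltNge; apply/negP => /jm; rewrite ltnn//.
Qed.

Lemma ae_pos : {ae mu, forall t, I t -> 0 < t}.
Proof.
exists [set 0 : R]; split; [exact: measurable_set1|exact: lebesgue_measure_set1|].
move=> t /=; rewrite in_itv/= => h; apply/eqP/negPn/negP => t0; apply: h => /andP[t1 _].
by rewrite lt_def t0.
Qed.

Lemma rint_cells_le h c : itg mu I h ->
  (forall (j : 'I_p) t, kn j < t <= kn j.+1 -> h t <= c) -> rint mu I h <= c.
Proof.
move=> ih hc; rewrite -[leRHS](_ : rint mu I (fun=> c) = c); last first.
  by rewrite rint_cst_seg ?ler01// subr0 mulr1.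
apply: (ae_le_rint mI ih); first exact: itg_cst_seg.
apply: (aeS ae_pos) => t h0 It; have t0 := h0 It.
have [|j jt] := @cell_locate t; last exact: hc jt.
by rewrite t0/=; move: It; rewrite /= in_itv/= => /andP[].
Qed.

Lemma sqi_indic (A : set (measurableTypeR R)) : measurable A -> sqi mu I (\1_A).
Proof.
move=> mA; split; first exact: measurable_indic.
apply: (itg_le mI (g := fun=> 1)); last exact: itg_cst_seg.
  by apply: measurable_funX; exact: measurable_indic.
by move=> t _; rewrite indicE; case: (_ \in _); rewrite /= ?expr1n ?expr0n ?normr1 ?normr0.
Qed.

Lemma sqi_step a : sqi mu I (step a).
Proof.
by apply: (sqi_sum mI) => j; apply: (sqiZ mI); apply: sqi_indic; exact: measurable_itv.
Qed.

Lemma dot_step a b : dot mu I (step a) (step b) = p%:R^-1 * \sum_j a j * b j.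
Proof.
have := @pieces_itg R p p0 (fun t => step a t * step b t)
  (fun j => fun=> (if insub j is Some i then a i * b i else 0)).
case => [j t jp /andP[jt tj]|j jp|_].
- by rewrite insubT !(@step_in _ (Ordinal jp)) /= ?jt ?(ltW tj).
- exact: itg_cst_seg.
rewrite /dot => ->; rewrite mulr_sumr; apply: eq_bigr => j _.
by rewrite valK rint_cst_seg ?(knot_le R p0)// (knot_diff R p) mulrC.
Qed.

Lemma stepB a b t : step (fun j => a j - b j) t = step a t - step b t.
Proof. by rewrite /step -sumrB; apply: eq_bigr => j _; rewrite mulrBl. Qed.

Lemma dot_step_le f a c : sqi mu I f ->
  (forall (j : 'I_p) t, kn j < t <= kn j.+1 -> (f t - a j) ^+ 2 <= c) ->
  dot mu I (fun t => f t - step a t) (fun t => f t - step a t) <= c.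
Proof.
move=> sf hc; have s := sqiB mI sf (sqi_step a).
apply: rint_cells_le; first exact: sqiM_itg.
by move=> j t jt; rewrite (step_in _ jt) -expr2; exact: hc jt.
Qed.

Lemma dot_suml_step a (f : R -> R) : sqi mu I f ->
  dot mu I (step a) f = \sum_j a j * dot mu I (\1_(`]kn j, kn j.+1]%classic : set R)) f.
Proof.
move=> sf; rewrite /step dot_suml//.
  apply: eq_bigr => j _; rewrite dotZl//; apply: sqi_indic; exact: measurable_itv.
by move=> j; apply: (sqiZ mI); apply: sqi_indic; exact: measurable_itv.
Qed.

End step_functions.

Section stationary.
Context dO (Omega : measurableType dO) (R : realType) (P : probability Omega R).
Notation mu := (@lebesgue_measure R).
Local Notation I := (`[0, 1]%classic : set R).
Local Notation E := (rint P setT).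
Variables (U : Omega -> R -> R) (g : R -> R) (lam : nat -> R) (zeta : nat -> R -> R).
Hypotheses (g0 : 0 <= g 0) (mU : jm U).
Hypothesis sU : forall t, I t -> sqi P setT (U ^~ t).
Hypothesis hK : forall t u, I t -> I u -> E (fun w => U w t * U w u) = g `|t - u|.
Hypothesis sz : forall a, sqi mu I (zeta a).
Hypothesis one : forall a b, dot mu I (zeta a) (zeta b) = (a == b)%:R.
Hypothesis complete : forall f, sqi mu I f -> (forall a, dot mu I f (zeta a) = 0) ->
  {ae mu, forall t, I t -> f t = 0}.
Hypothesis eig : forall a, {ae mu, forall t, I t ->
  rint mu I (fun u => zeta a u * g `|t - u|) = lam a * zeta a t}.
Let mI : measurable (I : set (measurableTypeR R)). Proof. exact: measurable_itv. Qed.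

Lemma var_at t : I t -> E (fun w => U w t ^+ 2) = g 0.
Proof. by move=> It; under eq_rint do rewrite expr2; rewrite hK// subrr normr0. Qed.

Lemma l2pU : l2p P U (g 0).
Proof. by split => // t It; split; [exact: sU|rewrite var_at]. Qed.

Lemma E_scores a b : E (fun w => dot mu I (U w) (zeta a) * dot mu I (U w) (zeta b)) =
  (a == b)%:R * lam b.
Proof.
have [sb _] := l2p_dot l2pU (sz b).
rewrite (E_dotM l2pU (sz a) sb) -one mulrC -(dotZr mI)//.
apply: (ae_eq_rint mI).
- apply: measurable_funM; first by have [] := sz a.
  apply: (jm_mean P (U := fun w t => U w t * dot mu I (U w) (zeta b))).
  by apply: jmM => //; apply: jm_w; have [] := sb.
- apply: measurable_funM; first by have [] := sz a.
  by have [] := sqiZ mI (lam b) (sz b).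
- apply: (aeS (eig b)) => t h It; rewrite -h//; congr (_ * _).
  rewrite (eq_rint P (g := fun w => dot mu I (U w) (zeta b) * U w t)); last first.
    by move=> w _; rewrite mulrC.
  rewrite (E_dotM l2pU (sz b) (sU It)); apply: eq_rint => u Iu; congr (_ * _).
  by rewrite hK// distrC.
Qed.

Lemma E_score2 a : E (fun w => dot mu I (U w) (zeta a) ^+ 2) = lam a.
Proof. by under eq_rint do rewrite expr2; rewrite E_scores eqxx mul1r. Qed.

Lemma lam_ge0 a : 0 <= lam a.
Proof. by rewrite -E_score2; apply: rint_ge0 => w _; exact: sqr_ge0. Qed.

Lemma E_normsq : itg P setT (fun w => dot mu I (U w) (U w)) /\ E (fun w => dot mu I (U w) (U w)) = g 0.
Proof.
have [_ i1 ->] := l2p_norm l2pU; split => //.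
rewrite (eq_rint mu (g := fun=> g 0)); first by rewrite rint_cst_seg ?ler01// subr0 mulr1.
by move=> t It; rewrite var_at.
Qed.

Lemma E_resid J : itg P setT (fun w => resid mu I zeta (U w) J) /\
  E (fun w => resid mu I zeta (U w) J) = g 0 - \sum_(a < J) lam a.
Proof.
have [i1 e1] := E_normsq.
have i2 a : itg P setT (fun w => dot mu I (U w) (zeta a) ^+ 2).
  by have [[_ ?] _] := l2p_dot l2pU (sz a).
have i3 : itg P setT (fun w => \sum_(a < J) dot mu I (U w) (zeta a) ^+ 2) by apply: itg_sum.
split; first exact: itgB.
rewrite /resid rintB// e1 rint_sum//; congr (_ - _).
by apply: eq_bigr => a _; rewrite E_score2.
Qed.

Lemma aeU : {ae P, forall w, sqi mu I (U w)}.
Proof. by have [] := l2p_norm l2pU. Qed.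

Lemma E_resid_ge0 J : 0 <= g 0 - \sum_(a < J) lam a.
Proof.
have [i1 <-] := E_resid J; apply: (@le_trans _ _ (rint P setT (fun=> 0))); first by rewrite rint0.
apply: (ae_le_rint measurableT _ i1); first exact: itg0.
by apply: (aeS aeU) => w sw _; exact: resid_ge0.
Qed.

(** Parseval's identity for almost every path, then dominated convergence. *)
Lemma trace_lam : (fun J => g 0 - \sum_(a < J) lam a) @ \oo --> (0 : R).
Proof.
have [i1 _] := E_normsq.
have [|||||_ c] := @rint_dct _ _ _ P setT measurableT (fun J w => resid mu I zeta (U w) J) (fun=> 0)
   (fun w => dot mu I (U w) (U w)).
- by move=> J; have [+ _] := E_resid J => /itg_meas.
- exact: measurable_cst.
- apply: (aeS aeU) => w sw _; apply/cvgrPdist_le => z z0.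
  have [J0 hJ] := resid_to0 mI sz one complete sw z0; exists J0 => // J /= J0J.
  by rewrite sub0r normrN ger0_norm ?hJ// resid_ge0.
- exact: i1.
- apply: (aeS aeU) => w sw J _; rewrite ger0_norm ?resid_ge0//.
  by rewrite /resid lerBlDr lerDl sumr_ge0// => a _; exact: sqr_ge0.
rewrite rint0// in c.
by under eq_fun => J do (have [_ <-] := E_resid J).
Qed.

Lemma sum_split (F : nat -> R) J n : (J <= n)%N ->
  \sum_(a < n) F a = \sum_(a < J) F a + \sum_(J <= a < n) F a.
Proof. by move=> Jn; rewrite -!(big_mkord xpredT F) -big_cat_nat. Qed.

(** The fourth roots of the eigenvalues decrease and have sum at most [S], so that
    the one of index [a] is at most [S / (a + 1)]. Three factors out of four are
    bounded in this way, and the last one is summed. *)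
Lemma trace_tail (S : R) J : (forall a, lam a.+1 <= lam a) ->
  (forall n, \sum_(a < n) lam a `^ 4^-1 <= S) ->
  g 0 - \sum_(a < J) lam a <= S ^+ 4 / J.+1%:R ^+ 3.
Proof.
move=> dec hS; pose ka a : R := lam a `^ 4^-1.
have ka0 a : 0 <= ka a by exact: powR_ge0.
have kaE a : ka a ^+ 4 = lam a.
  by rewrite /ka -powR_mulrn ?powR_ge0// -powRrM mulVf// powRr1// lam_ge0.
have S0 : 0 <= S by apply: le_trans (hS 0%N); rewrite big_ord0.
have deck a b : (a <= b)%N -> ka b <= ka a.
  move=> ab; apply: ge0_ler_powR; rewrite ?nnegrE ?lam_ge0//.
  by elim: b ab => [|b IH]; [rewrite leqn0 => /eqP ->|rewrite leq_eqVlt ltnS => /predU1P[->//|/IH]; exact: le_trans].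
have kaS a : ka a <= S / a.+1%:R.
  rewrite ler_pdivlMr// (le_trans _ (hS a.+1))// mulr_natr.
  rewrite -[leLHS](_ : \sum_(i < a.+1) ka a = _); last by rewrite sumr_const card_ord.
  by apply: ler_sum => i _; apply: deck; rewrite -ltnS.
have tail n : (J <= n)%N -> \sum_(J <= a < n) lam a <= S ^+ 4 / J.+1%:R ^+ 3.
  move=> Jn; apply: (@le_trans _ _ (\sum_(J <= a < n) (S / J.+1%:R) ^+ 3 * ka a)).
    rewrite !big_seq; apply: ler_sum => a; rewrite mem_index_iota => /andP[Ja _].
    rewrite -kaE exprSr ler_wpM2r// lerXn2r ?nnegrE ?divr_ge0//.
    by rewrite (le_trans (kaS a))// ler_wpM2l// lef_pV2 ?posrE// ler_nat.
  rewrite -mulr_sumr expr_div_n [S ^+ 4]exprSr [leRHS]mulrAC ler_wpM2l ?divr_ge0 ?exprn_ge0//.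
  apply: le_trans (hS n); rewrite (sum_split ka Jn) lerDr.
  by rewrite sumr_ge0.
suff H : forall e : R, 0 < e -> g 0 - \sum_(a < J) lam a <= S ^+ 4 / J.+1%:R ^+ 3 + e.
  by apply/ler_addgt0Pr; exact: H.
move=> e e0; have /cvgrPdist_le/(_ e e0)[n0 _ hn] := trace_lam.
have := hn (maxn n0 J) (leq_maxl _ _); rewrite /= sub0r normrN.
move=> /(le_trans (ler_norm _)); rewrite (sum_split lam (leq_maxr n0 J)).
by have := tail _ (leq_maxr n0 J); move: (\sum_(a < J) lam a) (\sum_(J <= a < _) _) (S ^+ 4 / _) => *; lra.
Qed.

(** Translations are continuous in the mean square along almost every path, by
    [L2_translation]. By dominated convergence this remains true after taking
    expectations, where the integrand becomes the variance [2 * (g 0 - g s)] of an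
    increment. *)
Lemma cov_continuous0 z : 0 < z -> exists2 s0, 0 < s0 & forall s, 0 <= s <= s0 -> 2 * (g 0 - g s) <= z.
Proof.
move=> z0; apply: contrapT => H.
have /choice[s hs] : forall k : nat, exists s, [/\ 0 <= s <= 2^-1, s <= k.+1%:R^-1 & z < 2 * (g 0 - g s)].
  move=> k; apply: contrapT => Hk; apply: H.
  exists (Num.min 2^-1 k.+1%:R^-1); first by rewrite lt_min !invr_gt0 !ltr0n.
  move=> s /andP[s0]; rewrite le_min => /andP[s1 s2].
  by rewrite leNgt; apply/negP => zs; apply: Hk; exists s; rewrite s0.
have sh k : 0 <= s k <= 2^-1 by have [] := hs k.
have scv : s @ \oo --> (0 : R).
  apply/cvgrPdist_le => e e0; exists (Num.truncn e^-1) => // k /= ke.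
  have [/andP[s0 _] s1 _] := hs k; rewrite sub0r normrN ger0_norm//.
  apply: (le_trans s1); rewrite invf_ple ?posrE// ltW//.
  by apply: lt_le_trans (truncnS_gt _) _; rewrite ler_nat ltnS.
pose J : set R := `[0, 2^-1]%classic.
have mJ : measurable (J : set (measurableTypeR R)) by exact: measurable_itv.
pose h k w := rint mu J (fun t => (U w (t + s k) - U w t) ^+ 2).
have JI t : J t -> I t by rewrite /J /= !in_itv/= => /andP[-> t2]; rewrite (le_trans t2)// invf_le1// ler1n.
have JIs k t : J t -> I (t + s k).
  by have := sh k; rewrite /J /= !in_itv/= => /andP[? ?] /andP[? ?]; apply/andP; split; lra.
pose V k (w : Omega) t := (U w (t + s k) - U w t) ^+ 2 * \1_(J) t.
have mV k : jm (V k).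
  rewrite /jm (_ : (fun _ => _) = (fun wt => (U wt.1 (wt.2 + s k) - U wt.1 wt.2) ^+ 2) \_ (setT `*` (J : set (measurableTypeR R)))); last first.
    apply/funext => -[w t]; rewrite /V /patch in_setX in_setT /= indicE.
    by case: (_ \in _); rewrite /= ?mulr1 ?mulr0.
  have mTJ : measurable ([set: Omega] `*` (J : set (measurableTypeR R))) by exact: measurableX.
  have mTI : measurable ([set: Omega] `*` (I : set (measurableTypeR R))) by exact: measurableX.
  apply/(measurable_restrict _ mTJ mTI).
  apply: measurable_funX; apply: measurable_funB.
    apply: (measurable_comp (F := setT `*` (I : set (measurableTypeR R)))
      (f := fun wt : Omega * measurableTypeR R => U wt.1 wt.2)
      (g := fun wt : Omega * measurableTypeR R => (wt.1, wt.2 + s k))) => //.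
      by move=> _ [[w t] [_ [_ Jt]] <-]; split => //; exact: JIs.
    by apply: measurable_funTS; apply: measurable_fun_pair => //; apply: measurable_funD.
  apply: measurable_funS mU; first exact: measurableX.
  by move=> [w t] [].
have Vh k w : rint mu I (V k w) = h k w.
  rewrite /h /rint /Rintegral; congr fine.
  rewrite [RHS]integral_mkcond [LHS]integral_mkcond; apply: eq_integral => t _.
  rewrite /patch; case: ifPn => [/set_mem It|/negP It].
    by rewrite /V indicE; case: (_ \in _); rewrite /= ?mulr1 ?mulr0.
  by rewrite ifF//; apply/negP => /set_mem Jt; apply/It/mem_set/JI.
have iUU t u : I t -> I u -> itg P setT (fun w => U w t * U w u).
  by move=> It Iu; apply: (sqiM_itg measurableT); exact: sU.
have inc k t : J t -> itg P setT (fun w => (U w (t + s k) - U w t) ^+ 2) /\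
    E (fun w => (U w (t + s k) - U w t) ^+ 2) = 2 * (g 0 - g (s k)).
  move=> Jt; have It := JI _ Jt; have Its := JIs k _ Jt.
  split; first by have [] := sqiB measurableT (sU Its) (sU It).
  have [_ i1] := sU Its; have [_ i2] := sU It; have i3 := iUU _ _ Its It.
  rewrite (eq_rint P (g := fun w => U w (t + s k) ^+ 2 + (U w t ^+ 2 - 2 * (U w (t + s k) * U w t)))); last first.
    by move=> w _; ring.
  have i4 := itgZ measurableT 2 i3.
  rewrite rintD//; last exact: itgB.
  rewrite rintB// rintZ// !var_at// hK// (addrC t) addrK ger0_norm; last by have /andP[] := sh k.
  by ring.
have EV k t : I t -> itg P setT (V k ^~ t) /\ E (V k ^~ t) = 2 * (g 0 - g (s k)) * \1_J t.
  move=> It; have [Jt|Jt] := pselect (J t).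
    have [i1 e1] := inc k t Jt; rewrite /V indicE mem_set//= mulr1 -e1.
    split; first by apply: (eq_itg measurableT _ i1) => w _; rewrite mulr1.
    by apply: eq_rint => w _; rewrite mulr1.
  rewrite /V indicE memNset//= mulr0; split.
    by apply: (@eq_itg _ _ _ P _ measurableT (fun=> 0)) => [w _|]; [rewrite mulr0|exact: itg0].
  by rewrite -[RHS](rint0 P measurableT); apply: eq_rint => w _; rewrite mulr0.
have iJ : itg mu I (\1_J).
  have [_ i1] := @sqi_indic R J mJ; apply: (eq_itg mI _ i1) => t _.
  by rewrite indicE; case: (_ \in _); rewrite /= ?expr1n ?expr0n.
have Eh k : itg P setT (h k) /\ E (h k) = g 0 - g (s k).
  have [||_ i1 _ e1] := @random_fubini _ _ _ P (V k) (mV k).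
  - by move=> t It; have [] := EV k t It.
  - apply: (eq_itg mI _ (itgZ mI (2 * (g 0 - g (s k))) iJ)) => t It.
    have [_ <-] := EV k t It; apply: eq_rint => w _; rewrite ger0_norm//.
    by rewrite /V mulr_ge0 ?sqr_ge0// indicE; case: (_ \in _).
  split; first by apply: (eq_itg measurableT _ i1) => w _; exact: Vh.
  rewrite (eq_rint P (fun w _ => esym (Vh k w))) e1.
  rewrite (eq_rint mu (g := fun t => 2 * (g 0 - g (s k)) * \1_J t)); last first.
    by move=> t It; have [_ ->] := EV k t It.
  rewrite rintZ//.
  have -> : rint mu I (\1_J) = 2^-1; last by field.
    apply/EFin_inj; rewrite (EFin_rint mI iJ) integral_indic// setIidl//.
    by have := @lebesgue_measure_itv R `[0, 2^-1]; rewrite /= lte_fin invr_gt0 ltr0n -EFinD subr0.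
have [i1 _] := E_normsq.
have [|||||_ c] := @rint_dct _ _ _ P setT measurableT h (fun=> 0)
   (fun w => 4 * dot mu I (U w) (U w)).
- by move=> k; have [/itg_meas] := Eh k.
- exact: measurable_cst.
- apply: (aeS aeU) => w sw _; apply/cvgrPdist_le => e e0.
  have [K hK'] := L2_translation sw sh scv e0; exists K => // k /= Kk.
  rewrite sub0r normrN ger0_norm; first exact: hK'.
  by apply: rint_ge0 => t _; exact: sqr_ge0.
- exact: itgZ.
- apply: (aeS aeU) => w sw k _; rewrite ger0_norm; last by apply: rint_ge0 => t _; exact: sqr_ge0.
  have [_ iw] := sw; have iw' := iw.
  have is_ := itg_shift (sh k) iw.
  have sub : itg mu J (fun t => U w t ^+ 2).
    by apply: itgS_seg iw; rewrite ?lexx// invf_le1// ler1n.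
  have subI : rint mu J (fun t => U w t ^+ 2) <= dot mu I (U w) (U w).
    rewrite (_ : dot mu I (U w) (U w) = rint mu I (fun t => U w t ^+ 2)); last first.
      by apply: eq_rint => t _; rewrite expr2.
    rewrite -lee_fin (EFin_rint mJ sub) (EFin_rint mI iw).
    apply: ge0_subset_integral => //; [by apply/measurable_EFinP; exact: itg_meas iw|].
    by move=> t _; rewrite lee_fin sqr_ge0.
  have shI := rint_shift_le (sh k) iw (fun t => sqr_ge0 _).
  apply: (@le_trans _ _ (rint mu J (fun t => 2 * U w (t + s k) ^+ 2 + 2 * U w t ^+ 2))).
    have i3 := itgD mJ (itgZ mJ 2 is_) (itgZ mJ 2 sub).
    have if1 : itg mu I (U w).
      have s1 : sqi mu I (fun=> 1) by split; [exact: measurable_cst|exact: itg_cst_seg].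
      by apply: (eq_itg mI _ (sqiM_itg mI sw s1)) => t _; rewrite mulr1.
    have key t : (U w (t + s k) - U w t) ^+ 2 <= 2 * U w (t + s k) ^+ 2 + 2 * U w t ^+ 2.
      rewrite -subr_ge0 (_ : _ - _ = (U w (t + s k) + U w t) ^+ 2) ?sqr_ge0//; ring.
    apply: (le_rint mJ _ i3) => //.
    apply: (itg_le mJ _ _ i3); last by move=> t _; rewrite ger0_norm ?sqr_ge0.
    apply: measurable_funX; apply: measurable_funB; first exact: itg_meas (itg_shift (sh k) if1).
    by apply: (@itg_meas _ _ _ mu); apply: itgS_seg if1; rewrite ?lexx// invf_le1// ler1n.
  rewrite rintD//; [|exact: itgZ|exact: itgZ]; rewrite !rintZ//.
  have -> : 4 * dot mu I (U w) (U w) = 2 * dot mu I (U w) (U w) + 2 * dot mu I (U w) (U w) by ring.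
  apply: lerD; rewrite ler_wpM2l//; apply: le_trans shI _.
rewrite rint0// in c.
have z20 : 0 < z / 2 by rewrite divr_gt0.
have /cvgrPdist_le/(_ _ z20)[K _ /(_ K (leqnn K))] := c.
rewrite sub0r normrN => /(le_trans (ler_norm _)); have [_ ->] := Eh K.
by have [_ _] := hs K; lra.
Qed.

(** In each cell the increments from the knot have a variance of at most [z]. *)
Lemma step_error p z : (0 < p)%N -> (forall s, 0 <= s <= p%:R^-1 -> 2 * (g 0 - g s) <= z) ->
  let x w (j : 'I_p) := U w (knot p j.+1) in
  let D w := fun t => U w t - step (x w) t in
  [/\ jm D, itg P setT (fun w => dot mu I (D w) (D w)) & E (fun w => dot mu I (D w) (D w)) <= z].
Proof.
move=> p0 hz x D.
have kI (j : 'I_p) : I (knot p j.+1) by rewrite /= in_itv/= (knot_ge0 _ p0) (knot_le1 _ p0).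
have mD : jm D.
  apply: jmB => //; rewrite /step; apply: jm_sum => j; apply: jmM.
    by apply: jm_w; exact: jm_at.
  by apply: jm_t; exact: measurable_indic.
have iUU t u : I t -> I u -> itg P setT (fun w => U w t * U w u).
  by move=> It Iu; apply: (sqiM_itg measurableT); exact: sU.
have D0 w t : ~ 0 < t -> D w t = U w t.
  move=> t0; rewrite /D /step big1 ?subr0// => j _; rewrite indicE memNset ?mulr0//= in_itv/= => /andP[jt _].
  by apply: t0; apply: le_lt_trans jt; exact: knot_ge0.
have z0 : 0 <= z by have := hz 0; rewrite lexx invr_ge0 ler0n subrr mulr0; exact.
have cellD (j : 'I_p) t : knot p j < t <= knot p j.+1 -> sqi P setT (D ^~ t) /\ E (fun w => D w t ^+ 2) <= z.
  move=> jt; have It : I t.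
    rewrite /= in_itv/=; move/andP: jt => [j1 j2].
    by rewrite (le_trans _ (ltW j1)) ?knot_ge0//= (le_trans j2)// knot_le1.
  have DE w : D w t = U w t - U w (knot p j.+1) by rewrite /D (step_in p0 (x w) jt).
  have sD := sqiB measurableT (sU It) (sU (kI j)).
  split; first by apply: (eq_sqi _ _ sD) => // w _; rewrite DE.
  rewrite (eq_rint P (g := fun w => U w t ^+ 2 + (U w (knot p j.+1) ^+ 2 - 2 * (U w t * U w (knot p j.+1))))); last first.
    by move=> w _; rewrite DE; ring.
  have [_ i1] := sU It; have [_ i2] := sU (kI j); have i3 := itgZ measurableT 2 (iUU _ _ It (kI j)).
  rewrite rintD//; last exact: itgB.
  rewrite rintB// rintZ// ?var_at//; last exact: iUU.
  rewrite hK// distrC ger0_norm; last by rewrite subr_ge0; case/andP: jt.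
  rewrite (_ : _ + _ = 2 * (g 0 - g (knot p j.+1 - t))); last by ring.
  apply: hz.
  case/andP: jt => j1 j2; rewrite subr_ge0 j2/= -(knot_diff R p j); lra.
have lD : l2p P D (z + g 0).
  split; [exact: addr_ge0|by []|move=> t It].
  have [t0|t0] := pselect (0 < t); last first.
    split; first by apply: (eq_sqi _ _ (sU It)) => // w _; rewrite D0.
    by under eq_rint => w _ do rewrite D0//; rewrite var_at// lerDr.
  have [|j jt] := @cell_locate R p p0 t.
    by rewrite t0/=; move: It; rewrite /= in_itv/= => /andP[].
  by have [s1 e1] := cellD j t jt; split => //; rewrite (le_trans e1)// lerDl.
have [_ i1 e1] := l2p_norm lD; split => //; rewrite e1.
apply: (rint_cells_le p0); last by move=> j t jt; have [] := cellD j t jt.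
apply: (itg_le mI (g := fun=> z + g 0)); last exact: itg_cst_seg.
  by apply: (jm_mean P (U := fun w t => D w t ^+ 2)); exact: measurable_funX.
move=> t It; have [_ _ /(_ t It)[_ h]] := lD; rewrite ger0_norm//.
by apply: rint_ge0 => w _; exact: sqr_ge0.
Qed.

End stationary.

(** * Measurability of the estimators *)

Section matrix_measurability.
Context d (T : measurableType d) (R : realType).

Lemma measurable_inv (f : T -> R) : measurable_fun setT f -> measurable_fun setT (fun w => (f w)^-1).
Proof.
move=> mf; rewrite (_ : (fun w => _) = (fun w => f w * (f w ^+ 2) `^ (-1))).
  apply: measurable_funM => //; apply: (measurableT_comp (measurable_powR (-1))).
  exact: measurable_funX.
apply/funext => w; rewrite powR_inv1 ?sqr_ge0//.
have [->|f0] := eqVneq (f w) 0; first by rewrite invr0 mul0r.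
by rewrite expr2 invfM mulVKf.
Qed.

Definition mmx a b (A : T -> 'M[R]_(a, b)) := forall i j, measurable_fun setT (fun w => A w i j).

Lemma mmx_cst a b (A : 'M[R]_(a, b)) : mmx (fun=> A).
Proof. by move=> i j; exact: measurable_cst. Qed.

Lemma mmxD a b (A B : T -> 'M[R]_(a, b)) : mmx A -> mmx B -> mmx (fun w => A w + B w).
Proof. by move=> hA hB i j; under eq_fun do rewrite mxE; exact: measurable_funD. Qed.

Lemma mmxZ a b (f : T -> R) (A : T -> 'M[R]_(a, b)) : measurable_fun setT f -> mmx A ->
  mmx (fun w => f w *: A w).
Proof. by move=> hf hA i j; under eq_fun do rewrite mxE; exact: measurable_funM. Qed.

Lemma mmxM a b c (A : T -> 'M[R]_(a, b)) (B : T -> 'M[R]_(b, c)) : mmx A -> mmx B ->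
  mmx (fun w => A w *m B w).
Proof.
move=> hA hB i j; under eq_fun do rewrite mxE.
by apply: measurable_sum => k; exact: measurable_funM.
Qed.

Lemma mmxT a b (A : T -> 'M[R]_(a, b)) : mmx A -> mmx (fun w => (A w)^T).
Proof. by move=> hA i j; under eq_fun do rewrite mxE; exact: hA. Qed.

Lemma measurable_det a (A : T -> 'M[R]_a) : mmx A -> measurable_fun setT (fun w => \det (A w)).
Proof.
move=> hA; rewrite /determinant; apply: measurable_sum => s; apply: measurable_funM => //.
exact: measurable_prod.
Qed.

(** Cramer's rule makes the inverse measurable. *)
Lemma mmxV a (A : T -> 'M[R]_a) : (forall w, A w \in unitmx) -> mmx A -> mmx (fun w => invmx (A w)).
Proof.
move=> uA hA i j; rewrite (_ : (fun w => _) = (fun w => (\det (A w))^-1 * cofactor (A w) j i)).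
  apply: measurable_funM; last first.
    apply: measurable_funM => //; apply: measurable_det => k l.
    by under eq_fun do rewrite !mxE; exact: hA.
  exact/measurable_inv/measurable_det.
by apply/funext => w; rewrite /invmx uA !mxE.
Qed.

End matrix_measurability.

Section estimator_measurability.
Context dT (T : measurableType dT) (R : realType) (d n m p : nat).
Variables (X : site d -> T -> R -> R) (Y : site d -> T -> R) (rho : R) (D : 'I_p -> R -> R).
Hypotheses (n0 : (0 < n)%N) (m0 : (0 < m)%N) (mp : (m <= p)%N).
Hypotheses (hD : natural_spline_basis m D) (rho0 : 0 < rho).
Hypothesis mX : forall (k : 'I_(n ^ d)) (j : 'I_p), measurable_fun setT (fun w => X (lex_site k) w (knot p j.+1)).
Hypothesis mY : forall (k : 'I_(n ^ d)), measurable_fun setT (Y (lex_site k)).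

Lemma beta_hat_vec_measurable : mmx (fun w => beta_hat_vec (X ^~ w) (Y ^~ w) n m rho D).
Proof.
have hX : mmx (fun w => Xmx (X ^~ w) n p).
  move=> k j; under eq_fun do rewrite mxE; apply: measurable_funB => //.
  by apply: measurable_funM => //; exact: measurable_sum.
have hY : mmx (fun w => Yvec (Y ^~ w) n).
  move=> k j; under eq_fun do rewrite mxE; apply: measurable_funB => //.
  by apply: measurable_funM => //; exact: measurable_sum.
apply: mmxZ => //; apply: mmxM => //; apply: mmxM; last exact: mmxT.
apply: mmxV; first by move=> w; exact: normal_matrix_unit.
apply: mmxD; last exact: mmx_cst.
by apply: mmxZ => //; apply: mmxM => //; exact: mmxT.
Qed.

End estimator_measurability.

Section prediction_measurability.
Context dO (Omega : measurableType dO) (R : realType) (d n m p : nat).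
Notation mu := (@lebesgue_measure R).
Local Notation I := (`[0, 1]%classic : set R).
Variables (X : site d -> Omega -> R -> R) (Y : site d -> Omega -> R) (rho : R) (D : 'I_p -> R -> R).
Hypotheses (n0 : (0 < n)%N) (m0 : (0 < m)%N) (mp : (m <= p)%N).
Hypotheses (hD : natural_spline_basis m D) (rho0 : 0 < rho).
Hypotheses (mX : forall i, jm (X i)) (mY : forall i, measurable_fun setT (Y i)).
Local Notation bhat w := (beta_hat (X ^~ w) (Y ^~ w) n m rho D).
Let p0 : (0 < p)%N. Proof. exact: leq_trans mp. Qed.
Let kI (j : 'I_p) : I (knot p j.+1).
Proof. by rewrite /= in_itv/= (knot_ge0 _ p0) (knot_le1 _ p0). Qed.

Lemma beta_hatE w t : bhat w t = \sum_i spline_coef D (beta_hat_vec (X ^~ w) (Y ^~ w) n m rho D) i 0 * D i t.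
Proof. by rewrite /beta_hat spline_evalE. Qed.

Let mv : mmx (fun w => beta_hat_vec (X ^~ w) (Y ^~ w) n m rho D).
Proof. by apply: beta_hat_vec_measurable => // k j; exact: jm_at. Qed.

Lemma beta_hat_jm : jm (fun w => bhat w).
Proof.
rewrite (_ : (fun w => _) = (fun w t => \sum_i spline_coef D (beta_hat_vec (X ^~ w) (Y ^~ w) n m rho D) i 0 * D i t)); last first.
  by apply/funext => w; apply/funext => t; exact: beta_hatE.
apply: (jm_sum _ (F := fun i w t => spline_coef D (beta_hat_vec (X ^~ w) (Y ^~ w) n m rho D) i 0 * D i t)) => i.
apply: jmM; last by apply: jm_t; apply: measurable_funTS; exact: (continuous_measurable_fun (basis_continuous hD (i := i))).
by apply: jm_w; apply: mmxM => //; exact: mmx_cst.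
Qed.

Lemma Xbar_jm : jm (fun w => Xbar (X ^~ w) n).
Proof.
apply: jmM; first by apply: jm_t; exact: measurable_cst.
exact: (jm_sum _ (F := fun (k : 'I_(n ^ d)) w t => X (lex_site k) w t)).
Qed.

Lemma Ybar_measurable : measurable_fun setT (fun w => Ybar (Y ^~ w) n).
Proof. by apply: measurable_funM => //; exact: measurable_sum. Qed.

Lemma beta0_hat_measurable : measurable_fun setT (fun w => beta0_hat (X ^~ w) (Y ^~ w) n m rho D).
Proof.
apply: measurable_funB; first exact: Ybar_measurable.
by apply: (jm_int (U := fun w t => bhat w t * Xbar (X ^~ w) n t)); apply: jmM; [exact: beta_hat_jm|exact: Xbar_jm].
Qed.

Lemma prediction_error_measurable i beta0 beta : measurable_fun (I : set (measurableTypeR R)) beta ->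
  measurable_fun setT (fun w => prediction (X ^~ w) (Y ^~ w) n m rho D (X i w) - (beta0 + ip beta (X i w))).
Proof.
move=> mb; apply: measurable_funB.
  apply: measurable_funD; first exact: beta0_hat_measurable.
  by apply: (jm_int (U := fun w t => bhat w t * X i w t)); apply: jmM => //; exact: beta_hat_jm.
apply: measurable_funD => //.
by apply: (jm_int (U := fun w t => beta t * X i w t)); apply: jmM => //; exact: jm_t.
Qed.

End prediction_measurability.

(** * Second-order structure of the curves of the model *)

Section Lnorm2.
Context d (T : measurableType d) (R : realType) (mu : {measure set T -> \bar R}).
Implicit Type f : T -> R.

Lemma Lnorm2E f : Lnorm mu 2%:E (EFin \o f) = poweR (\int[mu]_x ((f x) ^+ 2)%:E)%E 2^-1.
Proof.
rewrite unlock /=; congr (poweR _ _); apply: eq_integral => x _.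
by rewrite -[in RHS]real_normK ?num_real// powR_mulrn.
Qed.

Lemma Lfun2_sqi f : f \in Lfun mu 2%:E <-> sqi mu setT f.
Proof.
split=> [h|[mf i2]].
  split; last exact: Lfun2_integrable_sqr.
  by move/andP: h => [/set_mem /= ].
apply/andP; split; first exact/mem_set.
by apply/mem_set; rewrite /= /finite_norm Lnorm2E poweR_lty// -(EFin_rint measurableT i2) ltry.
Qed.

Lemma Lnorm2_lt f (M : R) : 0 <= M -> measurable_fun setT f ->
  (Lnorm mu 2%:E (EFin \o f) < M%:E)%E ->
  sqi mu setT f /\ rint mu setT (fun x => f x ^+ 2) <= M ^+ 2.
Proof.
move=> M0 mf; rewrite Lnorm2E.
have p0 : (0 <= \int[mu]_x ((f x) ^+ 2)%:E)%E by apply: integral_ge0 => x _; rewrite lee_fin sqr_ge0.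
case e : (\int[mu]_x _)%E p0 => [r| |]//; rewrite ?lee_fin => r0 h; last first.
  by move: h; rewrite poweRyr// invr_eq0.
have i2 : itg mu setT (fun x => f x ^+ 2).
  apply/integrableP; split; first by apply/measurable_EFinP; exact: measurable_funX.
  by under eq_integral => x _ do rewrite gee0_abs ?lee_fin ?sqr_ge0//; rewrite e ltry.
split => //; rewrite /rint /Rintegral e /=.
move: h; rewrite poweR_EFin lte_fin => h.
rewrite (_ : r = (r `^ 2^-1) ^+ 2); last by rewrite -powR_mulrn ?powR_ge0// -powRrM mulVf// powRr1.
by rewrite ler_sqr ?nnegrE ?powR_ge0// ltW.
Qed.

End Lnorm2.

Section restriction_to_unit.
Variable R : realType.
Notation mu := (@lebesgue_measure R).
Local Notation I := (`[0, 1]%classic : set R).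
Implicit Type f : R -> R.
Let mI : measurable (I : set (measurableTypeR R)). Proof. exact: measurable_itv. Qed.

Let sqi_patch f : sqi mu setT (f \_ I) <-> sqi mu I f.
Proof.
have E : (fun x => (f \_ I) x ^+ 2) = (fun x => f x ^+ 2) \_ I.
  by apply/funext => x; rewrite /patch; case: ifP; rewrite ?expr0n.
rewrite /sqi E; split=> -[m i].
  split; first by apply/(measurable_restrictT _ mI).
  rewrite /itg (integrable_mkcond _ mI); apply: eq_integrable i => // x _.
  by rewrite /patch /=; case: ifP.
split; first by apply/(measurable_restrictT _ mI).
move: i; rewrite /itg (integrable_mkcond _ mI); apply: eq_integrable => // x _.
by rewrite /patch /=; case: ifP.
Qed.

Lemma in_L2_sqi f : in_L2 f <-> sqi mu I f.
Proof. by rewrite /in_L2; split=> [/Lfun2_sqi/sqi_patch//|h]; apply/Lfun2_sqi/sqi_patch. Qed.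

Lemma L2norm_lt f (M : R) : 0 <= M -> measurable_fun (I : set (measurableTypeR R)) f ->
  (L2norm f < M%:E)%E -> sqi mu I f /\ dot mu I f f <= M ^+ 2.
Proof.
move=> M0 mf h.
have mp : measurable_fun setT (f \_ I) by apply/(measurable_restrictT _ mI).
have [/sqi_patch s b] := @Lnorm2_lt _ _ _ mu _ _ M0 mp h; split => //; apply: le_trans b.
rewrite le_eqVlt; apply/orP; left; apply/eqP.
rewrite /dot /rint /Rintegral; congr fine; rewrite integral_mkcond; apply: eq_integral => x _.
by rewrite /patch; case: ifP => _; rewrite ?expr2// mul0r.
Qed.

End restriction_to_unit.

Section model_moments.
Context (R : realType) (dO : measure_display) (Omega : measurableType dO) (P : probability Omega R).
Variables (d : nat) (X : site d -> Omega -> R -> R) (Y : site d -> Omega -> R).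
Variables (Xgen : Omega -> R -> R) (Ygen : Omega -> R).
Hypotheses (hX : forall i, random_function P (X i)) (hXgen : random_function P Xgen).
Hypothesis hlaw : forall i, same_law P (pair_coord (X i) (Y i)) (pair_coord Xgen Ygen).
Variables (lam : nat -> R) (zeta : nat -> R -> R).
Hypothesis hlam : cov_eigensystem P Xgen lam zeta.
Variable M2 : R.
Hypotheses (hM2 : 0 < M2) (H7 : forall i, {ae P, forall w, (L2norm (X i w) < M2%:E)%E}).
Variables g Psi : R -> R.
Hypothesis hg : forall s, s \in `[0, 1] -> 0 < g s.
Hypothesis H8a : forall i t, t \in `[0, 1] -> (X i)^~ t \in Lfun P 2%:E.
Hypothesis H8b : forall n (k l : 'I_(n ^ d)) t u, t \in `[0, 1] -> u \in `[0, 1] ->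
  covariance P ((X (lex_site k))^~ t) ((X (lex_site l))^~ u) =
  (g `|t - u| * Psi (delta [set lex_site k] [set lex_site l]))%:E.
Hypothesis H8c : Psi 0 = 1.
Notation mu := (@lebesgue_measure R).
Local Notation I := (`[0, 1]%classic : set R).
Local Notation E := (rint P setT).
Let mI : measurable (I : set (measurableTypeR R)). Proof. exact: measurable_itv. Qed.

Local Notation mn := (mean_fun P Xgen).
Local Notation Xc i := (centered (X i) mn).
Local Notation Xgc := (centered Xgen mn).

Let I01 t : I t -> 0 <= t <= 1. Proof. by rewrite /= in_itv. Qed.
Let Iin t : I t -> t \in `[0, 1]. Proof. by []. Qed.

Lemma delta1 (i j : site d) : delta [set i] [set j] = dist2 i j :> R.
Proof.
rewrite /delta (_ : [set _ | _ in _ & _ in _] = [set dist2 i j]) ?inf1//.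
by apply/seteqP; split => [_ [_ -> [_ -> <-]]//|_ ->]; exists i => //; exists j.
Qed.

Lemma dist2xx (i : site d) : dist2 i i = 0 :> R.
Proof. by rewrite /dist2 big1 ?sqrtr0// => c _; rewrite subrr expr0n. Qed.

Let jX i : jm (X i). Proof. by have [] := hX i. Qed.
Let jXg : jm Xgen. Proof. by have [] := hXgen. Qed.

Let law2 i t u (f : R * R -> R) : I t -> I u -> measurable_fun setT f ->
  E (fun w => f (X i w t, X i w u)) = E (fun w => f (Xgen w t, Xgen w u)) /\
  (itg P setT (fun w => f (X i w t, X i w u)) -> itg P setT (fun w => f (Xgen w t, Xgen w u))).
Proof.
move=> It Iu mf; apply: (law_E (U := X i ^~ t) (V := X i ^~ u) (U' := Xgen ^~ t) (V' := Xgen ^~ u)) => //;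
  try exact: jm_at.
move=> A B mA mB.
pose k (a : 'I_2) : option (@unit_interval R) :=
  if a == ord0 then Some (exist _ t (I01 It)) else Some (exist _ u (I01 Iu)).
have mAB (a : 'I_2) : measurable (if a == ord0 then A else B) by case: ifP.
have := hlaw i k mAB.
have S (Z : Omega -> R -> R) (Z' : Omega -> R) : [set w | forall a, (if a == ord0 then A else B) (pair_coord Z Z' (k a) w)] =
    [set w | A (Z w t) /\ B (Z w u)].
  apply/seteqP; split => w /= h.
    by split; [exact: (h ord0)|exact: (h (lift ord0 ord0))].
  by move=> a; rewrite /k; case: ifP => _; case: h.
by rewrite !S.
Qed.

Let sX i t : I t -> sqi P setT (X i ^~ t).
Proof. by move=> It; apply/Lfun2_sqi/H8a. Qed.

Let i0 : site d := 0.

Let sXg t : I t -> sqi P setT (Xgen ^~ t).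
Proof.
move=> It; split; first exact: jm_at.
have [_ i2] := sX i0 It.
have [_] := @law2 i0 t t (fun x => x.1 ^+ 2) It It (measurable_funX _ measurable_fst).
exact.
Qed.

Lemma mnE t : mn t = E (Xgen ^~ t).
Proof. by rewrite /mean_fun unlock. Qed.

Lemma EX i t : I t -> E (X i ^~ t) = mn t.
Proof. by move=> It; have [-> _] := @law2 i t t fst It It measurable_fst; rewrite mnE. Qed.

Lemma mn_meas : measurable_fun (I : set (measurableTypeR R)) mn.
Proof.
apply: (@eq_measurable_fun _ _ _ _ _ (fun t => E (Xgen ^~ t))); first by move=> t _; rewrite mnE.
exact: (jm_mean P (U := Xgen)).
Qed.

Lemma Xc_jm i : jm (Xc i). Proof. by apply: jmB => //; apply: jm_t; exact: mn_meas. Qed.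
Lemma Xgc_jm : jm Xgc. Proof. by apply: jmB => //; apply: jm_t; exact: mn_meas. Qed.

Let s1 c : sqi P setT (fun=> c : R).
Proof. by split => //; exact: itg_cst. Qed.

Lemma Xc_sqi i t : I t -> sqi P setT (Xc i ^~ t).
Proof. by move=> It; apply: (sqiB measurableT); [exact: sX|exact: s1]. Qed.
Lemma Xgc_sqi t : I t -> sqi P setT (Xgc ^~ t).
Proof. by move=> It; apply: (sqiB measurableT); [exact: sXg|exact: s1]. Qed.

Lemma cov_rint (U V : Omega -> R) c : covariance P U V = c%:E ->
  E (fun w => (U w - E U) * (V w - E V)) = c.
Proof. by rewrite unlock /rint /Rintegral !unlock /= => h; rewrite [LHS](congr1 fine h). Qed.

Lemma E_Xc_grid n (k l : 'I_(n ^ d)) t u : I t -> I u ->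
  E (fun w => Xc (lex_site k) w t * Xc (lex_site l) w u) =
  g `|t - u| * Psi (dist2 (lex_site k) (lex_site l)).
Proof.
move=> It Iu; have := cov_rint (H8b k l (Iin It) (Iin Iu)).
by rewrite !EX// delta1.
Qed.

Let mF t u : measurable_fun setT (fun x : R * R => (x.1 - mn t) * (x.2 - mn u)).
Proof. by apply: measurable_funM; apply: measurable_funB. Qed.

(** The generic curve has the law of the curve at the only site of the grid of side
    1, where the covariance is prescribed. *)
Lemma E_Xgc t u : I t -> I u -> E (fun w => Xgc w t * Xgc w u) = g `|t - u|.
Proof.
move=> It Iu; have k : 'I_(1 ^ d) by rewrite exp1n; exact: ord0.
have := E_Xc_grid k k It Iu; rewrite dist2xx H8c mulr1 => <-.
by have [-> _] := @law2 (lex_site k) t u _ It Iu (mF t u).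
Qed.

Lemma E_Xc i t u : I t -> I u -> E (fun w => Xc i w t * Xc i w u) = g `|t - u|.
Proof.
by move=> It Iu; rewrite -E_Xgc//; have [-> _] := @law2 i t u _ It Iu (mF t u).
Qed.

Lemma g0_gt0 : 0 < g 0. Proof. by apply: hg; rewrite in_itv/= lexx ler01. Qed.

Lemma zeta_sqi a : sqi mu I (zeta a).
Proof. by have [[h _ _] _ _] := hlam; exact/in_L2_sqi. Qed.
Lemma zeta_one a b : dot mu I (zeta a) (zeta b) = (a == b)%:R.
Proof. by have [[_ h _] _ _] := hlam; rewrite -h. Qed.
Lemma zeta_complete f : sqi mu I f -> (forall a, dot mu I f (zeta a) = 0) ->
  {ae mu, forall t, I t -> f t = 0}.
Proof. by have [[_ _ h] _ _] := hlam => /in_L2_sqi sf h0; exact: h. Qed.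
Lemma lam_decr a : lam a.+1 <= lam a.
Proof. by have [_ h _] := hlam. Qed.

Lemma cov_eig a : {ae mu, forall t, I t -> rint mu I (fun u => zeta a u * g `|t - u|) = lam a * zeta a t}.
Proof.
have [_ _ /(_ a) h] := hlam; apply: (aeS h) => t {}h It; rewrite -h//.
have lg : l2p P Xgc (g 0).
  split; [exact/ltW/g0_gt0|exact: Xgc_jm|move=> u Iu; split; first exact: Xgc_sqi].
  by under eq_rint do rewrite expr2; rewrite E_Xgc// subrr normr0.
rewrite /cov_op unlock -/(E _).
rewrite (_ : fine _ = E (fun w => dot mu I (Xgc w) (zeta a) * Xgc w t)); last first.
  rewrite /rint /Rintegral; congr fine; apply: eq_integral => w _; congr (_ * _)%:E.
  by rewrite dotC.
rewrite (E_dotM lg (zeta_sqi a) (Xgc_sqi It)); apply: eq_rint => u Iu; congr (_ * _).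
by rewrite E_Xgc// distrC.
Qed.

Let XM i : {ae P, forall w, sqi mu I (X i w) /\ dot mu I (X i w) (X i w) <= M2 ^+ 2}.
Proof. by apply: (aeS (H7 i)) => w; apply: L2norm_lt; [exact: ltW|exact: jm_sec]. Qed.

Lemma mn_sqi : sqi mu I mn.
Proof.
have lc : l2p P (Xc i0) (g 0).
  split; [exact/ltW/g0_gt0|exact: Xc_jm|move=> u Iu; split; first exact: Xc_sqi].
  by under eq_rint do rewrite expr2; rewrite E_Xc// subrr normr0.
have [ae1 _ _] := l2p_norm lc.
have : {ae P, forall w, sqi mu I mn}.
  apply: (aeS2 (XM i0) ae1) => w [sx _] sc.
  by apply: (eq_sqi _ _ (sqiB mI sx sc)) => // t _; rewrite /centered opprB addrC subrK.
move=> [N [mN N0 sub]]; apply: contrapT => ns.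
have : P setT = 0%E.
  by apply: (subset_measure0 _ mN _ N0) => // w _; apply: sub.
by rewrite probability_setT => /eqP; rewrite onee_eq0.
Qed.

(** The mean curve is square integrable, so that centring preserves an almost sure
    bound on the norms. *)
Lemma Xc_bounded : exists2 M : R, 0 < M & forall i,
  {ae P, forall w, sqi mu I (Xc i w) /\ dot mu I (Xc i w) (Xc i w) <= M ^+ 2}.
Proof.
have smn := mn_sqi.
pose K := 2 * M2 ^+ 2 + 2 * dot mu I mn mn.
have K0 : 0 < K by rewrite ltr_wpDr ?mulr_ge0 ?dot_ge0// mulr_gt0// exprn_gt0.
exists (Num.sqrt K); first by rewrite sqrtr_gt0.
move=> i; apply: (aeS (XM i)) => w [sx bx]; split; first exact: sqiB.
rewrite sqr_sqrtr ?(ltW K0)//.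
have sxm := sqiB mI sx smn.
rewrite (_ : dot _ _ _ _ = 2 * dot mu I (X i w) (X i w) + 2 * dot mu I mn mn -
  dot mu I (fun t => X i w t + mn t) (fun t => X i w t + mn t)).
  apply: (@le_trans _ _ (2 * dot mu I (X i w) (X i w) + 2 * dot mu I mn mn)).
    by rewrite lerBlDr lerDl dot_ge0.
  by rewrite lerD2r ler_wpM2l.
have sD := sqiD mI sx smn.
rewrite /centered !dotBl ?dotBr ?dotDl ?dotDr// (dotC mu I mn); ring.
Qed.

End model_moments.

(** * The estimation error for one realisation *)

Section discretised_curves.
Variables (R : realType) (p : nat).
Notation mu := (@lebesgue_measure R).
Local Notation I := (`[0, 1]%classic : set R).
Implicit Types (f : R -> R) (x : 'cV[R]_p) (zeta : nat -> R -> R).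

Definition kvals f (j : 'I_p) : R := f (knot p j.+1).
Definition knot_vec f : 'cV[R]_p := \col_j kvals f j.
Definition dist_step f : R :=
  dot mu I (fun t => f t - step (kvals f) t) (fun t => f t - step (kvals f) t).
Definition ssq x : R := p%:R^-1 * \sum_j x j 0 ^+ 2.
Definition coefs zeta x (a : nat) : R := dot mu I (step (fun j => x j 0)) (zeta a).
(** Clipping makes these variables bounded everywhere while keeping them
    functions of the observed values of the curve. *)
Definition yscore zeta M f (a : nat) : R := clip M (dot mu I (step (kvals f)) (zeta a)).

End discretised_curves.

Section one_realization.
Variables (R : realType) (d n m p J : nat) (X : site d -> R -> R) (Y : site d -> R).
Variables (rho : R) (D : 'I_p -> R -> R).
Hypotheses (n0 : (0 < n)%N) (m0 : (0 < m)%N) (mp : (m <= p)%N).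
Hypotheses (hD : natural_spline_basis m D) (rho0 : 0 < rho).
Notation mu := (@lebesgue_measure R).
Local Notation I := (`[0, 1]%classic : set R).
Local Notation N := (n ^ d)%N.
Local Notation A := (penalty_mx m D).
Local Notation kn := (@knot R p).
Implicit Types x : 'cV[R]_p.
Let mI : measurable (I : set (measurableTypeR R)). Proof. exact: measurable_itv. Qed.
Let p0 : (0 < p)%N. Proof. exact: leq_trans mp. Qed.
Let N0 : (0 < N)%N. Proof. by rewrite expn_gt0 n0. Qed.

Variables (mn beta : R -> R) (zeta : nat -> R -> R) (lam : nat -> R) (e : 'I_N -> R).
Variables (beta0 M M1 : R).
Hypotheses (smn : sqi mu I mn) (sbeta : sqi mu I beta) (M0 : 0 <= M).
Hypothesis sz : forall a, sqi mu I (zeta a).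
Hypothesis one : forall a b, dot mu I (zeta a) (zeta b) = (a == b)%:R.
Hypothesis lam0 : forall a, 0 <= lam a.
Local Notation xc k := (fun t => X (lex_site k) t - mn t).
Hypothesis sX : forall k : 'I_N, sqi mu I (xc k).
Hypothesis XM : forall k : 'I_N, dot mu I (xc k) (xc k) <= M ^+ 2.
Hypothesis model : forall k : 'I_N, Y (lex_site k) = beta0 + ip beta (X (lex_site k)) + e k.
Hypothesis eM : forall k, `|e k| <= M1.

Local Notation u := (knot_vec p beta).
Local Notation v := (beta_hat_vec X Y n m rho D).
Let w := v - u.
Local Notation xk k := (kvals (p := p) (xc k)).
(** Squared prediction risk of [x] along the first [J] eigenfunctions, plus its
    penalty. *)
Definition theta_of (x : 'cV[R]_p) : R :=
  \sum_(a < J) lam a * coefs zeta x a ^+ 2 + rho * (qf A x x / p%:R).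

Let st (x : 'cV[R]_p) := step (fun j => x j 0).
Let sst x : sqi mu I (st x). Proof. exact: sqi_step. Qed.
Let sxk (k : 'I_N) : sqi mu I (step (xk k)). Proof. exact: sqi_step. Qed.
Let sdl (k : 'I_N) : sqi mu I (fun t => xc k t - step (xk k) t).
Proof. by apply: (sqiB mI). Qed.

Let ssqE x : ssq x = dot mu I (st x) (st x).
Proof. by rewrite /st dot_step//; congr (_ * _); apply: eq_bigr => j _; rewrite expr2. Qed.
Let ssq_ge0 x : 0 <= ssq x. Proof. by rewrite ssqE dot_ge0. Qed.

Let pR : 0 < p%:R :> R. Proof. by rewrite ltr0n. Qed.

Lemma coefs_le x : \sum_(a < J) coefs zeta x a ^+ 2 <= ssq x.
Proof. by have := resid_ge0 mI sz one J (sst x); rewrite /resid subr_ge0 ssqE. Qed.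

Lemma ssq_penalty x : ssq x <= qf A x x / p%:R.
Proof. by rewrite /ssq mulrC ler_wpM2r ?invr_ge0 ?(ltW pR)// penalty_ge. Qed.

Let ax (x : 'cV[R]_p) (k : 'I_N) := p%:R^-1 * \sum_j xk k j * x j 0.
Let axE x k : ax x k = dot mu I (step (xk k)) (st x).
Proof. by rewrite /st dot_step. Qed.

Let q (k : 'I_N) := dot mu I beta (xc k) - ax u k.

Let qE (k : 'I_N) : q k = dot mu I (fun t => beta t - st u t) (xc k) + dot mu I (st u) (fun t => xc k t - step (xk k) t).
Proof.
have gen f : sqi mu I f -> dot mu I beta f - dot mu I (step (xk k)) (st u) =
    dot mu I (fun t => beta t - st u t) f + dot mu I (st u) (fun t => f t - step (xk k) t).
  by move=> sf; rewrite dotBl// dotBr// (dotC mu I (step (xk k)) (st u)); ring.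
by rewrite [LHS]/q axE; exact: (gen (xc k)).
Qed.

Let om := dot mu I (fun t => beta t - st u t) (fun t => beta t - st u t).

Let q2 (k : 'I_N) : q k ^+ 2 <= 2 * om * dot mu I (xc k) (xc k) + 2 * ssq u * dist_step p (xc k).
Proof.
have s1 := sqiB mI sbeta (sst u).
pose a := dot mu I (fun t => beta t - st u t) (xc k).
pose b := dot mu I (st u) (fun t => xc k t - step (xk k) t).
have h1 : a ^+ 2 <= om * dot mu I (xc k) (xc k) by exact: (CS mI s1 (sX k)).
have h2 : b ^+ 2 <= ssq u * dist_step p (xc k) by rewrite ssqE; exact: (CS mI (sst u) (sdl k)).
rewrite qE -/a -/b -(mulrA 2 om) -(mulrA 2 (ssq u)) -mulrDr.
apply: (@le_trans _ _ (2 * (a ^+ 2 + b ^+ 2))); last by rewrite ler_wpM2l// lerD.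
have := sqr_ge0 (a - b); lra.
Qed.

Let model' (k : 'I_N) : Y (lex_site k) - Ybar Y n =
  ax u k - avg (ax u) + (q k - avg q) + (e k - avg e).
Proof.
have sXk (l : 'I_N) : ip beta (X (lex_site l)) = dot mu I beta (xc l) + dot mu I beta mn.
  by rewrite dotBr ?subrK//; apply: (eq_sqi _ _ (sqiD mI (sX l) smn)) => // t _; rewrite subrK.
have YE l : Y (lex_site l) = (beta0 + dot mu I beta mn) + (ax u l + (q l + e l)).
  by rewrite model sXk /q; ring.
rewrite /Ybar -/(avg (fun l => Y (lex_site l))) (eq_avg YE) avgD avg_cst// !avgD YE; ring.
Qed.

Let W := Num.sqrt (ssq w).
Let W2 : W ^+ 2 = ssq w. Proof. by rewrite sqr_sqrtr. Qed.
Let c (k : 'I_N) a := dot mu I (xc k) (zeta a).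
Let dl (k : 'I_N) := Num.sqrt (dist_step p (xc k)).
Let dl2_ge0 (k : 'I_N) : 0 <= dist_step p (xc k). Proof. exact: dot_ge0. Qed.
Let z1 a : dot mu I (zeta a) (zeta a) = 1. Proof. by rewrite one eqxx. Qed.

Let sqr_le_norm (a b : R) : 0 <= b -> a ^+ 2 <= b ^+ 2 -> `|a| <= b.
Proof. by move=> b0; rewrite -(real_normK (num_real a)) ler_sqr ?nnegrE. Qed.

Let cM (k : 'I_N) a : `|c k a| <= M.
Proof.
apply: sqr_le_norm => //; apply: le_trans (XM k); apply: (le_trans (CS mI (sX k) (sz a))).
by rewrite z1 mulr1.
Qed.

Let yc (k : 'I_N) a : `|yscore p zeta M (xc k) a - c k a| <= dl k.
Proof.
rewrite /yscore -(clip_id (cM k a)); apply: (le_trans (clip_lip _ _ _)).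
rewrite distrC /c -dotBl//.
apply: sqr_le_norm; rewrite ?sqrtr_ge0// sqr_sqrtr// (le_trans (CS mI (sdl k) (sz a)))//.
by rewrite z1 mulr1.
Qed.

Let rs (k : 'I_N) := resid mu I zeta (xc k) J.
Let rs_ge0 (k : 'I_N) : 0 <= rs k. Proof. exact: resid_ge0. Qed.
Let Ek (k : 'I_N) := dl k + Num.sqrt (rs k) + Num.sqrt J%:R * dl k.

Let aE (k : 'I_N) : `|ax w k - \sum_(a < J) yscore p zeta M (xc k) a * coefs zeta w a| <= Ek k * W.
Proof.
have -> : ax w k - \sum_(a < J) yscore p zeta M (xc k) a * coefs zeta w a =
   - dot mu I (fun t => xc k t - step (xk k) t) (st w) +
   (dot mu I (xc k) (st w) - \sum_(a < J) c k a * coefs zeta w a) -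
   \sum_(a < J) (yscore p zeta M (xc k) a - c k a) * coefs zeta w a.
  have -> : \sum_(a < J) (yscore p zeta M (xc k) a - c k a) * coefs zeta w a =
      \sum_(a < J) yscore p zeta M (xc k) a * coefs zeta w a - \sum_(a < J) c k a * coefs zeta w a.
    by rewrite -sumrB; apply: eq_bigr => a _; rewrite mulrBl.
  rewrite axE dotBl//; ring.
have W0 : 0 <= W by exact: sqrtr_ge0.
have dW k' : 0 <= dl k' by exact: sqrtr_ge0.
rewrite !mulrDl; apply: (le_trans (ler_normB _ _)); apply: lerD.
  apply: (le_trans (ler_normD _ _)); apply: lerD.
    rewrite normrN; apply: sqr_le_norm; rewrite ?mulr_ge0// exprMn W2 sqr_sqrtr// ssqE.
    exact: CS.
  apply: sqr_le_norm; rewrite ?mulr_ge0// exprMn W2 sqr_sqrtr// ssqE.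
  exact: resid_CS.
apply: sqr_le_norm; rewrite ?mulr_ge0// !exprMn W2 sqr_sqrtr// (le_trans (sum_CS _ _ _))//.
apply: ler_pM; rewrite ?coefs_le//; try by apply: sumr_ge0 => a _; exact: sqr_ge0.
apply: (@le_trans _ _ (\sum_(a < J) dl k ^+ 2)); last by rewrite sumr_const card_ord -[leLHS]mulr_natl.
by apply: ler_sum => a _; rewrite -[leLHS]real_normK ?num_real// ler_sqr ?nnegrE.
Qed.

Let B := Num.sqrt (p%:R^-1 * \sum_(j < p) (avg (fun k : 'I_N => xk k j)) ^+ 2).

Let aB : `|avg (ax w)| <= B * W.
Proof.
have S0 : 0 <= p%:R^-1 * \sum_(j < p) (avg (fun k : 'I_N => xk k j)) ^+ 2.
  by rewrite mulr_ge0 ?invr_ge0 ?sumr_ge0// => j _; exact: sqr_ge0.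
have -> : avg (ax w) = p%:R^-1 * \sum_j avg (fun k : 'I_N => xk k j) * w j 0.
  rewrite avgZ avg_sum; congr (_ * _); apply: eq_bigr => j _.
  by rewrite mulrC -avgZ; apply: eq_avg => k; rewrite mulrC.
apply: sqr_le_norm; first by rewrite mulr_ge0 ?sqrtr_ge0.
rewrite [leRHS]exprMn W2 sqr_sqrtr// exprMn.
apply: (@le_trans _ _ (p%:R^-1 ^+ 2 * ((\sum_j avg (fun k : 'I_N => xk k j) ^+ 2) * \sum_j w j 0 ^+ 2))).
  by rewrite ler_wpM2l ?exprn_ge0 ?invr_ge0//; exact: sum_CS.
by rewrite /ssq expr2 mulrACA.
Qed.

Let QU_CS : (qf A w u / p%:R) ^+ 2 <= (qf A w w / p%:R) * (qf A u u / p%:R).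
Proof.
rewrite expr_div_n mulrACA -invfM -expr2 ler_wpM2r ?invr_ge0 ?exprn_ge0//.
apply: qf_CS; first exact: penalty_sym.
by move=> z; apply: le_trans (penalty_ge m0 mp hD z); rewrite sumr_ge0// => j _; exact: sqr_ge0.
Qed.

(** The scores [y] and [c] of [basic_inequality] are those of the discretised curves
    and of the curves themselves, [w] collects the coefficients of the slope error on
    the first [J] eigenfunctions, and the discretisation errors are expressed by the
    distances from the curves and from the slope to their step functions. *)
Lemma realization_bound :
  let H1 := avg (fun k : 'I_N => 2 * om * dot mu I (xc k) (xc k) + 2 * ssq u * dist_step p (xc k)) in
  let R2 := \sum_(a < J) avg (fun k : 'I_N => e k * yscore p zeta M (xc k) a) ^+ 2 / (lam a + rho) in
  let H3 := avg (fun k : 'I_N => 3 * (resid mu I zeta (xc k) J + J.+1%:R * dist_step p (xc k))) in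
  let R4 := p%:R^-1 * \sum_(j < p) (avg (fun k : 'I_N => xk k j)) ^+ 2 in
  let R5 := avg e ^+ 2 in
  let R6 := \sum_(a < J) \sum_(b < J)
    (avg (fun k : 'I_N => dot mu I (xc k) (zeta a) * dot mu I (xc k) (zeta b)) - (a == b)%:R * lam a) ^+ 2 /
    ((lam a + rho) * (lam b + rho)) in
  let H7 := J%:R ^+ 2 * (2 * M * avg (fun k : 'I_N => Num.sqrt (dist_step p (xc k)))) in
  2 * H3 / rho + 2 * R4 / rho + Num.sqrt R6 + H7 / rho <= 2^-1 ->
  theta_of w <= 8 * H1 + 64 * R2 + 32 * M1 ^+ 2 * H3 / rho + 8 * R5 + 32 * rho * (qf A u u / p%:R).
Proof.
move=> H1 R2 H3 R4 R5 R6 H7 small.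
have B2 : B ^+ 2 = R4.
  by rewrite sqr_sqrtr// mulr_ge0 ?invr_ge0 ?sumr_ge0// => j _; exact: sqr_ge0.
have R1H : avg (fun k : 'I_N => (q k - avg q) ^+ 2) <= H1.
  rewrite avg_var//; apply: (@le_trans _ _ (avg (fun k : 'I_N => q k ^+ 2))); first by rewrite lerBlDr lerDl sqr_ge0.
  by apply: le_avg => k; exact: q2.
have R3H : avg (fun k : 'I_N => Ek k ^+ 2) <= H3.
  apply: le_avg => k; have d2 : dl k ^+ 2 = dist_step p (xc k) by rewrite sqr_sqrtr.
  have r2 : Num.sqrt (rs k) ^+ 2 = rs k by rewrite sqr_sqrtr.
  have j2 : (Num.sqrt J%:R * dl k) ^+ 2 = J%:R * dist_step p (xc k) by rewrite exprMn d2 sqr_sqrtr.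
  have j3 : J.+1%:R * dist_step p (xc k) = (Num.sqrt J%:R * dl k) ^+ 2 + dl k ^+ 2.
    by rewrite j2 d2 -[J.+1%:R]natr1; ring.
  rewrite -/(rs k) -r2 j3 /Ek.
  move: (dl k) (Num.sqrt (rs k)) (Num.sqrt J%:R * _) => a b f.
  rewrite -subr_ge0 (_ : _ - _ = (a - b) ^+ 2 + (a - f) ^+ 2 + (b - f) ^+ 2); last by ring.
  by rewrite !addr_ge0 ?sqr_ge0.
have R7H : \sum_(a < J) \sum_(b < J) `|avg (fun k : 'I_N => yscore p zeta M (xc k) a * yscore p zeta M (xc k) b - c k a * c k b)| <= H7.
  apply: (@le_trans _ _ (\sum_(a < J) \sum_(b < J) 2 * M * avg dl)).
    apply: ler_sum => a _; apply: ler_sum => b _; rewrite -avgZ.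
    rewrite /avg normrM ger0_norm ?invr_ge0// ler_wpM2l ?invr_ge0//.
    apply: (le_trans (ler_norm_sum _ _ _)); apply: ler_sum => k _.
    rewrite (_ : _ - _ = yscore p zeta M (xc k) a * (yscore p zeta M (xc k) b - c k b) + (yscore p zeta M (xc k) a - c k a) * c k b); last by ring.
    apply: (le_trans (ler_normD _ _)); rewrite !normrM mulrAC mulr_natl mulr2n mulrDl lerD//.
      by rewrite mulrC ler_pM// /yscore clip_le.
    by rewrite ler_pM.
  rewrite (eq_bigr (fun=> J%:R * (2 * M * avg dl))); last by move=> a _; rewrite sumr_const card_ord -[LHS]mulr_natl.
  by rewrite sumr_const card_ord -[leLHS]mulr_natl mulrA -expr2.
have ri0 : 0 <= rho^-1 by rewrite invr_ge0 ltW.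
have dge0 : forall x y : R, x <= y -> 2 * x / rho <= 2 * y / rho by move=> x y xy; rewrite ler_wpM2r// ler_wpM2l.
have := @basic_inequality R N J N0 (ax w) (fun k => q k - avg q) e Ek (fun k (a : 'I_J) => yscore p zeta M (xc k) a)
  (fun k (a : 'I_J) => c k a) (fun a : 'I_J => coefs zeta w a) (fun a : 'I_J => lam a) rho (qf A w w / p%:R) (qf A w u / p%:R)
  (qf A u u / p%:R) W B M1 rho0 (fun i => lam0 i).
have U0 : 0 <= qf A u u / p%:R by apply: le_trans (ssq_penalty u).
have id := @energy_identity R d n m p X Y rho D n0 m0 mp hD rho0 mn u (fun k => q k - avg q) e model'.
have wW : \sum_(a < J) coefs zeta w a ^+ 2 <= W ^+ 2 by rewrite W2 coefs_le.
have WQ : W ^+ 2 <= qf A w w / p%:R by rewrite W2 ssq_penalty.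
move=> /(_ U0 (sqrtr_ge0 _) id QU_CS wW WQ aE aB eM).
rewrite B2 => bi; apply: le_trans (bi _) _.
  apply: le_trans small; rewrite lerD// ?ler_wpM2r// lerD// lerD2r; exact: dge0.
have R60 : 0 <= Num.sqrt R6 by exact: sqrtr_ge0.
have H30 : 0 <= 2 * H3 / rho.
  rewrite mulr_ge0// mulr_ge0// avg_ge0// => k; rewrite mulr_ge0// addr_ge0//; [exact: rs_ge0|by rewrite mulr_ge0].
have H70 : 0 <= H7 / rho.
  have a0 : 0 <= avg (fun k : 'I_N => Num.sqrt (dist_step p (xc k))) by apply: avg_ge0 => k; exact: sqrtr_ge0.
  apply: mulr_ge0 => //; apply: mulr_ge0; first exact: sqr_ge0.
  by apply: mulr_ge0 => //; exact: mulr_ge0.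
have R4s : R4 / rho <= 4^-1 by move: small; rewrite -!(mulrA 2); move: (R4 / rho) H30 => x; rewrite -!(mulrA 2); lra.
rewrite lerD2r !lerD//.
- by rewrite ler_wpM2l.
- by rewrite ler_wpM2r// ler_wpM2l// mulr_ge0// sqr_ge0.
- rewrite mulrAC -/R5 (_ : 8 * R5 = 32 * 4^-1 * R5); last by rewrite (_ : 32 * 4^-1 = 8 :> R)//; field.
  by rewrite ler_wpM2r ?sqr_ge0// -mulrA ler_wpM2l.
Qed.

End one_realization.

(** * Moments of the discretised curves *)

Section one_curve.
Context dO (Omega : measurableType dO) (R : realType) (P : probability Omega R).
Notation mu := (@lebesgue_measure R).
Local Notation I := (`[0, 1]%classic : set R).
Local Notation E := (rint P setT).
Variables (U : Omega -> R -> R) (g : R -> R) (lam : nat -> R) (zeta : nat -> R -> R).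
Hypotheses (g0 : 0 <= g 0) (mU : jm U).
Hypothesis sU : forall t, I t -> sqi P setT (U ^~ t).
Hypothesis hK : forall t u, I t -> I u -> E (fun w => U w t * U w u) = g `|t - u|.
Hypothesis sz : forall a, sqi mu I (zeta a).
Hypothesis one : forall a b, dot mu I (zeta a) (zeta b) = (a == b)%:R.
Hypothesis eig : forall a, {ae mu, forall t, I t ->
  rint mu I (fun u => zeta a u * g `|t - u|) = lam a * zeta a t}.
Variables (p : nat) (M z : R).
Hypotheses (p0 : (0 < p)%N) (M0 : 0 <= M) (z0 : 0 <= z).
Hypothesis UM : {ae P, forall w, sqi mu I (U w) /\ dot mu I (U w) (U w) <= M ^+ 2}.
Hypothesis pz : forall s, 0 <= s <= p%:R^-1 -> 2 * (g 0 - g s) <= z ^+ 2.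
Let mI : measurable (I : set (measurableTypeR R)). Proof. exact: measurable_itv. Qed.
Let z1 a : dot mu I (zeta a) (zeta a) = 1. Proof. by rewrite one eqxx. Qed.

Lemma E_dist_step : [/\ itg P setT (fun w => dist_step p (U w)),
  E (fun w => dist_step p (U w)) <= z ^+ 2,
  itg P setT (fun w => Num.sqrt (dist_step p (U w))) &
  E (fun w => Num.sqrt (dist_step p (U w))) <= z].
Proof.
have [_ i1 e1] := step_error g0 mU sU hK p0 pz.
have d0 w : 0 <= dist_step p (U w) by exact: dot_ge0.
have s1 : sqi P setT (fun w => Num.sqrt (dist_step p (U w))).
  split; last by apply: (eq_itg measurableT _ i1) => w _; rewrite sqr_sqrtr.
  apply: (measurableT_comp (f := @Num.sqrt R)); last exact: itg_meas i1.
  by apply: continuous_measurable_fun; exact: sqrt_continuous.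
have [i2 e2] := E_sqr_le s1; split => //.
have r0 : 0 <= E (fun w => Num.sqrt (dist_step p (U w))) by apply: rint_ge0 => w _; exact: sqrtr_ge0.
rewrite -ler_sqr ?nnegrE//.
by apply: (le_trans e2); rewrite (eq_rint P (g := fun w => dist_step p (U w)))// => w _; rewrite sqr_sqrtr.
Qed.

Lemma yscore_measurable dT (T : measurableType dT) (V : T -> R -> R) a :
  (forall j : 'I_p, measurable_fun setT (V ^~ (knot p j.+1))) ->
  measurable_fun setT (fun w => yscore p zeta M (V w) a).
Proof.
move=> mV; apply: clip_measurable => //.
under eq_fun do rewrite dot_suml_step//.
apply: measurable_sum => j; apply: measurable_funM; last exact: measurable_cst.
exact: mV.
Qed.

Lemma yscore_close f a : sqi mu I f -> dot mu I f f <= M ^+ 2 ->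
  `|yscore p zeta M f a - dot mu I f (zeta a)| <= Num.sqrt (dist_step p f).
Proof.
move=> sf fM.
have sle (x y : R) : 0 <= y -> x ^+ 2 <= y ^+ 2 -> `|x| <= y.
  by move=> y0; rewrite -(real_normK (num_real x)) ler_sqr ?nnegrE.
have cM : `|dot mu I f (zeta a)| <= M.
  by apply: sle => //; apply: le_trans fM; apply: le_trans (CS mI sf (sz a)) _; rewrite z1 mulr1.
have ss := sqi_step (kvals (p := p) f).
rewrite /yscore -(clip_id cM); apply: (le_trans (clip_lip _ _ _)).
rewrite distrC -dotBl//.
apply: sle; rewrite ?sqrtr_ge0// sqr_sqrtr ?dot_ge0// (le_trans (CS mI _ (sz a)))//; first exact: sqiB.
by rewrite z1 mulr1.
Qed.

Let kI (j : 'I_p) : I (knot p j.+1).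
Proof. by rewrite /= in_itv/= (knot_ge0 _ p0) (knot_le1 _ p0). Qed.

Lemma yscore_meas a : measurable_fun setT (fun w => yscore p zeta M (U w) a).
Proof. by apply: yscore_measurable => j; exact: jm_at. Qed.

Lemma E_yscore2 a : itg P setT (fun w => yscore p zeta M (U w) a ^+ 2) /\
  E (fun w => yscore p zeta M (U w) a ^+ 2) <= 2 * lam a + 2 * z ^+ 2.
Proof.
have [i1 e1 _ _] := E_dist_step.
have lU : l2p P U (g 0) by apply: l2pU.
have [[_ i2] _] := l2p_dot lU (sz a).
have e2 : E (fun w => dot mu I (U w) (zeta a) ^+ 2) = lam a by apply: E_score2 sU hK _ one eig _.
have i3 : itg P setT (fun w => yscore p zeta M (U w) a ^+ 2).
  apply: (@itg_bnd _ _ _ P _ (M ^+ 2)); first by apply: measurable_funX; exact: yscore_meas.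
  by move=> w; rewrite normrX lerXn2r ?nnegrE// clip_le.
split => //.
have i4 := itgZ measurableT 2 i2; have i5 := itgZ measurableT 2 i1.
apply: (@le_trans _ _ (E (fun w => 2 * dot mu I (U w) (zeta a) ^+ 2 + 2 * dist_step p (U w)))).
  apply: (ae_le_rint measurableT i3); first exact: itgD.
  apply: (aeS UM) => w [sw bw] _.
  have := yscore_close a sw bw.
  move: (yscore p zeta M (U w) a) (dot mu I (U w) (zeta a)) => y c.
  rewrite -(@ler_sqr _ _ (Num.sqrt _)) ?nnegrE ?sqrtr_ge0// sqr_sqrtr ?dot_ge0// real_normK ?num_real// => h.
  have := sqr_ge0 (y - 2 * c); move: h; move: (dist_step _ _) => D; nra.
rewrite rintD// !rintZ// e2 lerD2l ler_wpM2l//.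
Qed.

Lemma yscore_prod_close f a b : sqi mu I f -> dot mu I f f <= M ^+ 2 ->
  `|yscore p zeta M f a * yscore p zeta M f b - dot mu I f (zeta a) * dot mu I f (zeta b)| <=
  2 * M * Num.sqrt (dist_step p f).
Proof.
move=> sf fM; have ha := yscore_close a sf fM; have hb := yscore_close b sf fM.
have cM : `|dot mu I f (zeta b)| <= M.
  rewrite -ler_sqr ?nnegrE// real_normK ?num_real//; apply: le_trans fM.
  by apply: le_trans (CS mI sf (sz b)) _; rewrite z1 mulr1.
have yM : `|yscore p zeta M f a| <= M by exact: clip_le.
move: (Num.sqrt _) (yscore p zeta M f a) (yscore p zeta M f b) (dot mu I f (zeta a)) (dot mu I f (zeta b)) ha hb cM yM.
move=> s ya yb ca cb ha hb cM yM.
rewrite (_ : _ - _ = ya * (yb - cb) + (ya - ca) * cb); last by ring.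
rewrite (_ : 2 * M * s = M * s + s * M); last by ring.
by apply: (le_trans (ler_normD _ _)); rewrite !normrM lerD// ler_pM.
Qed.

Lemma E_yscore_prod a b :
  `|E (fun w => yscore p zeta M (U w) a * yscore p zeta M (U w) b) - (a == b)%:R * lam b| <= 2 * M * z.
Proof.
have [_ _ i1 e1] := E_dist_step.
have lU : l2p P U (g 0) by apply: l2pU.
have [sa _] := l2p_dot lU (sz a); have [sb _] := l2p_dot lU (sz b).
have iy : itg P setT (fun w => yscore p zeta M (U w) a * yscore p zeta M (U w) b).
  apply: (@itg_bnd _ _ _ P _ (M * M)); first by apply: measurable_funM; exact: yscore_meas.
  by move=> w; rewrite normrM ler_pM// clip_le.
have ic := sqiM_itg measurableT sa sb.
rewrite -(E_scores g0 mU sU hK sz one eig a b)// -rintB//.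
apply: (le_trans (le_abs_rint measurableT (itgB measurableT iy ic))).
apply: (@le_trans _ _ (E (fun w => 2 * M * Num.sqrt (dist_step p (U w))))); last first.
  by rewrite rintZ// ler_wpM2l// mulr_ge0.
apply: (ae_le_rint measurableT _ (itgZ measurableT _ i1)); first by apply: itg_abs => //; exact: itgB.
by apply: (aeS UM) => w [sw bw] _; exact: yscore_prod_close.
Qed.

End one_curve.

(** * Moments of averages over the grid *)

Lemma mul_le_half_sqr (R : realType) (b c : R) : b * c <= 2^-1 * b ^+ 2 + 2^-1 * c ^+ 2.
Proof. have := sqr_ge0 (b - c); lra. Qed.

Section averages_of_variables.
Context dO (Omega : measurableType dO) (R : realType) (P : probability Omega R).
Local Notation E := (rint P setT).
Variable N : nat.
Hypothesis N0 : (0 < N)%N.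
Implicit Type f : 'I_N -> Omega -> R.

Lemma E_avg f : (forall k, itg P setT (f k)) ->
  itg P setT (fun w => avg (fun k => f k w)) /\ E (fun w => avg (fun k => f k w)) = avg (fun k => E (f k)).
Proof.
move=> h; have i1 : itg P setT (fun w => \sum_k f k w) by apply: itg_sum.
split; first exact: itgZ.
by rewrite /avg rintZ// rint_sum.
Qed.

(** Only the row sums of the covariances matter, whence the rate [1 / N] when the
    covariances are summable. *)
Lemma E_avg_sqr f (C : 'I_N -> 'I_N -> R) L : (forall k, sqi P setT (f k)) ->
  (forall k l, E (fun w => f k w * f l w) <= C k l) -> (forall k, \sum_l C k l <= L) ->
  itg P setT (fun w => avg (fun k => f k w) ^+ 2) /\ E (fun w => avg (fun k => f k w) ^+ 2) <= L / N%:R.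
Proof.
move=> sf hC hL.
have i2 k l : itg P setT (fun w => f k w * f l w) by apply: sqiM_itg.
have i1 : itg P setT (fun w => \sum_k \sum_l f k w * f l w).
  by apply: itg_sum => // k _; apply: itg_sum.
have e w : avg (fun k => f k w) ^+ 2 = N%:R^-1 ^+ 2 * \sum_k \sum_l f k w * f l w.
  by rewrite /avg exprMn [X in _ * X]expr2 big_distrlr.
split; first by apply: (eq_itg measurableT _ (itgZ measurableT (N%:R^-1 ^+ 2) i1)) => w _; rewrite e.
rewrite (eq_rint P (g := fun w => N%:R^-1 ^+ 2 * \sum_k \sum_l f k w * f l w))//.
rewrite rintZ// rint_sum//; last by move=> k _; apply: itg_sum.
under eq_bigr => k _ do rewrite rint_sum//.
apply: (@le_trans _ _ (N%:R^-1 ^+ 2 * \sum_(k < N) L)).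
  rewrite ler_wpM2l ?exprn_ge0 ?invr_ge0//; apply: ler_sum => k _; apply: le_trans (hL k).
  by apply: ler_sum => l _.
rewrite sumr_const card_ord -[L *+ N]mulr_natr (_ : _ * _ = L / N%:R)//.
by field; rewrite pnatr_eq0 -lt0n.
Qed.

End averages_of_variables.

Section grid_moments.
Context dO (Omega : measurableType dO) (R : realType) (P : probability Omega R).
Notation mu := (@lebesgue_measure R).
Local Notation I := (`[0, 1]%classic : set R).
Local Notation E := (rint P setT).
Variables (N : nat) (U : 'I_N -> Omega -> R -> R) (g : R -> R) (lam : nat -> R) (zeta : nat -> R -> R).
Hypotheses (N0 : (0 < N)%N) (g0 : 0 <= g 0) (mU : forall k, jm (U k)).
Hypothesis sU : forall k t, I t -> sqi P setT (U k ^~ t).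
Hypothesis hK : forall k t u, I t -> I u -> E (fun w => U k w t * U k w u) = g `|t - u|.
Hypothesis sz : forall a, sqi mu I (zeta a).
Hypothesis one : forall a b, dot mu I (zeta a) (zeta b) = (a == b)%:R.
Hypothesis eig : forall a, {ae mu, forall t, I t ->
  rint mu I (fun u => zeta a u * g `|t - u|) = lam a * zeta a t}.
Variables (p J : nat) (M z rho : R).
Hypotheses (p0 : (0 < p)%N) (M0 : 0 <= M) (z0 : 0 <= z) (rho0 : 0 < rho).
Hypothesis UM : forall k, {ae P, forall w, sqi mu I (U k w) /\ dot mu I (U k w) (U k w) <= M ^+ 2}.
Hypothesis pz : forall s, 0 <= s <= p%:R^-1 -> 2 * (g 0 - g s) <= z ^+ 2.
Variables (psi : 'I_N -> 'I_N -> R) (L0 : R).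
Hypothesis hpsi : forall k l t, I t -> E (fun w => U k w t * U l w t) = g 0 * psi k l.
Hypothesis psi_sum : forall k, \sum_l psi k l <= L0.
Variables (e : 'I_N -> Omega -> R) (M1 L1 : R).
Hypotheses (me : forall k, measurable_fun setT (e k)) (M10 : 0 <= M1) (eM : forall k w, `|e k w| <= M1).
Hypothesis e_sum : forall k, \sum_l `|E (fun w => e k w * e l w)| <= L1.
Hypothesis indep : forall k l a,
  E (fun w => e k w * e l w * (yscore p zeta M (U k w) a * yscore p zeta M (U l w) a)) =
  E (fun w => e k w * e l w) * E (fun w => yscore p zeta M (U k w) a * yscore p zeta M (U l w) a).
Variable C3 : R.
Hypothesis hvar : forall a b,
  let f w := avg (fun k : 'I_N => dot mu I (U k w) (zeta a) * dot mu I (U k w) (zeta b)) - (a == b)%:R * lam a in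
  itg P setT (fun w => f w ^+ 2) /\ E (fun w => f w ^+ 2) <= C3 / N%:R * lam a * lam b.
Let mI : measurable (I : set (measurableTypeR R)). Proof. exact: measurable_itv. Qed.
Let kI (j : 'I_p) : I (knot p j.+1).
Proof. by rewrite /= in_itv/= (knot_ge0 _ p0) (knot_le1 _ p0). Qed.
Let k0 : 'I_N := Ordinal N0.
Let lam0 a : 0 <= lam a. Proof. by apply: (lam_ge0 g0 (mU k0) (sU k0) (hK k0) sz one eig). Qed.
Let y k a w := yscore p zeta M (U k w) a.
Let ym k a : measurable_fun setT (y k a). Proof. exact: yscore_meas. Qed.
Let yM k a w : `|y k a w| <= M. Proof. exact: clip_le. Qed.

Let avg_le_cst (f : 'I_N -> R) c : (forall k, f k <= c) -> avg f <= c.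
Proof. by move=> h; rewrite -[leRHS](avg_cst N0 c); exact: le_avg. Qed.

Lemma E_mean_curve : l2p P (fun w t => avg (fun k => U k w t)) (g 0 * L0 / N%:R).
Proof.
have h t : I t -> itg P setT (fun w => avg (fun k => U k w t) ^+ 2) /\
    E (fun w => avg (fun k => U k w t) ^+ 2) <= g 0 * L0 / N%:R.
  move=> It; apply: (E_avg_sqr N0 (f := fun k => U k ^~ t) (C := fun k l => g 0 * psi k l)) => [k|k l|k].
  - exact: sU.
  - by rewrite hpsi.
  - by rewrite -mulr_sumr ler_wpM2l.
have jmA : jm (fun w t => avg (fun k => U k w t)).
  apply: jmM; first by apply: jm_t; exact: measurable_cst.
  exact: (jm_sum _ (F := U)).
split; last 1 first.
- by move=> t It; have [i1 e1] := h t It; split => //; split => //; exact: (jm_at It jmA).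
- have I0 : I 0 by rewrite /= in_itv/= lexx ler01.
  have [_ h0] := h 0 I0; apply: le_trans h0; apply: rint_ge0 => w _; exact: sqr_ge0.
- exact: jmA.
Qed.

Definition mean_knots w : R := p%:R^-1 * \sum_(j < p) (avg (fun k => kvals (p := p) (U k w) j)) ^+ 2.

Lemma E_mean_knots : itg P setT mean_knots /\ E mean_knots <= g 0 * L0 / N%:R.
Proof.
have [B0 _ h] := E_mean_curve.
have i1 (j : 'I_p) : itg P setT (fun w => avg (fun k => kvals (p := p) (U k w) j) ^+ 2) by have [[]] := h _ (kI j).
have i2 : itg P setT (fun w => \sum_(j < p) (avg (fun k => kvals (p := p) (U k w) j)) ^+ 2) by apply: itg_sum.
split; first exact: itgZ.
rewrite /mean_knots rintZ// rint_sum// mulrC ler_pdivrMr ?ltr0n//.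
apply: (@le_trans _ _ (\sum_(j < p) g 0 * L0 / N%:R)).
  by apply: ler_sum => j _; have [] := h _ (kI j).
by rewrite sumr_const card_ord -[leLHS]mulr_natr.
Qed.

Lemma E_mean_noise : itg P setT (fun w => avg (fun k => e k w) ^+ 2) /\
  E (fun w => avg (fun k => e k w) ^+ 2) <= L1 / N%:R.
Proof.
apply: (E_avg_sqr N0 (f := e) (C := fun k l => `|E (fun w => e k w * e l w)|)) => // [k|k l].
- split => //; apply: (@itg_bnd _ _ _ P _ (M1 ^+ 2)); first exact: measurable_funX.
  by move=> w; rewrite normrX lerXn2r ?nnegrE.
- exact: ler_norm.
Qed.

(** Independence factorises the covariances of the products, and those of the noise
    are summable over the grid. *)
Lemma E_noise_score a : itg P setT (fun w => avg (fun k => e k w * y k a w) ^+ 2) /\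
  E (fun w => avg (fun k => e k w * y k a w) ^+ 2) <= L1 * (2 * lam a + 2 * z ^+ 2) / N%:R.
Proof.
have B k := E_yscore2 g0 (mU k) (sU k) (hK k) sz one eig p0 M0 z0 (UM k) pz a.
have K0 : 0 <= 2 * lam a + 2 * z ^+ 2 by rewrite addr_ge0 ?mulr_ge0 ?sqr_ge0.
apply: (E_avg_sqr N0 (f := fun k w => e k w * y k a w)
  (C := fun k l => `|E (fun w => e k w * e l w)| * (2 * lam a + 2 * z ^+ 2))) => [k|k l|k].
- have mf : measurable_fun setT (fun w => e k w * y k a w) by exact: measurable_funM.
  split => //; apply: (@itg_bnd _ _ _ P _ ((M1 * M) ^+ 2)); first exact: measurable_funX.
  by move=> w; rewrite normrX lerXn2r ?nnegrE ?mulr_ge0// normrM ler_pM.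
- rewrite (eq_rint P (g := fun w => e k w * e l w * (y k a w * y l a w))); last by move=> w _; ring.
  rewrite indep; apply: (le_trans (ler_norm _)); rewrite normrM ler_wpM2l//.
  have [ik ek] := B k; have [il el] := B l.
  have i3 : itg P setT (fun w => y k a w * y l a w).
    by apply: (sqiM_itg measurableT); split => //; exact: ym.
  apply: (le_trans (le_abs_rint measurableT i3)).
  have i4 := itgZ measurableT 2^-1 ik; have i5 := itgZ measurableT 2^-1 il.
  apply: (@le_trans _ _ (E (fun w => 2^-1 * y k a w ^+ 2 + 2^-1 * y l a w ^+ 2))).
    apply: le_rint => //; [exact: itg_abs|exact: (itgD measurableT i4 i5)|move=> w _].
    rewrite normrM -[y k a w ^+ 2]real_normK ?num_real// -[y l a w ^+ 2]real_normK ?num_real//.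
    exact: mul_le_half_sqr.
  rewrite rintD// !rintZ//; move: ek el; rewrite /y.
  move: (E (fun w => yscore p zeta M (U k w) a ^+ 2)) (E (fun w => yscore p zeta M (U l w) a ^+ 2)) (2 * lam a + _) => *; lra.
- by rewrite -mulr_suml ler_wpM2r.
Qed.

(** The effective dimension of ridge regression: the number of eigenvalues above
    [rho], up to a smooth cut-off. *)
Definition effdim : R := \sum_(a < J) lam a / (lam a + rho).

Let lr0 a : 0 < lam a + rho. Proof. exact: ltr_wpDl. Qed.

Lemma L1_ge0 : 0 <= L1. Proof. by apply: le_trans (e_sum k0); exact: sumr_ge0. Qed.

Definition noise_energy w : R := \sum_(a < J) avg (fun k => e k w * y k a w) ^+ 2 / (lam a + rho).

Lemma E_noise_energy : itg P setT noise_energy /\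
  E noise_energy <= 2 * L1 / N%:R * (effdim + J%:R * z ^+ 2 / rho).
Proof.
have i1 (a : 'I_J) : itg P setT (fun w => avg (fun k => e k w * y k a w) ^+ 2 / (lam a + rho)).
  have [i _] := E_noise_score a.
  by apply: (eq_itg measurableT _ (itgZ measurableT (lam a + rho)^-1 i)) => w _; rewrite mulrC.
split; first by apply: itg_sum.
rewrite rint_sum//.
have L10 := L1_ge0.
apply: (@le_trans _ _ (\sum_(a < J) 2 * L1 / N%:R * (lam a / (lam a + rho) + z ^+ 2 / rho))); last first.
  by rewrite -mulr_sumr big_split/= -/effdim sumr_const card_ord -[_ *+ J]mulr_natl mulrA.
apply: ler_sum => a _; have [i e1] := E_noise_score a.
rewrite (eq_rint P (g := fun w => (lam a + rho)^-1 * avg (fun k => e k w * y k a w) ^+ 2)); last first.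
  by move=> w _; rewrite mulrC.
rewrite rintZ//; apply: (@le_trans _ _ ((lam a + rho)^-1 * (L1 * (2 * lam a + 2 * z ^+ 2) / N%:R))).
  by rewrite ler_wpM2l ?invr_ge0 ?(ltW (lr0 a)).
rewrite (_ : _^-1 * _ = 2 * L1 / N%:R * (lam a / (lam a + rho) + z ^+ 2 / (lam a + rho))); last by ring.
rewrite ler_wpM2l ?mulr_ge0// lerD2l ler_wpM2l ?sqr_ge0// lef_pV2 ?posrE// lerDr//.
Qed.

Definition score_deviation w : R := \sum_(a < J) \sum_(b < J)
  (avg (fun k => dot mu I (U k w) (zeta a) * dot mu I (U k w) (zeta b)) - (a == b)%:R * lam a) ^+ 2 /
  ((lam a + rho) * (lam b + rho)).

(** The weights [lam + rho] turn the bound on the variances into the square of the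
    effective dimension. *)
Lemma E_score_deviation : itg P setT score_deviation /\ E score_deviation <= C3 / N%:R * effdim ^+ 2.
Proof.
have i1 (a b : 'I_J) : itg P setT (fun w => (avg (fun k => dot mu I (U k w) (zeta a) * dot mu I (U k w) (zeta b)) - (a == b)%:R * lam a) ^+ 2 / ((lam a + rho) * (lam b + rho))).
  have [i _] := hvar a b.
  by apply: (eq_itg measurableT _ (itgZ measurableT ((lam a + rho) * (lam b + rho))^-1 i)) => w _; rewrite mulrC.
have i2 (a : 'I_J) : itg P setT (fun w => \sum_(b < J) (avg (fun k => dot mu I (U k w) (zeta a) * dot mu I (U k w) (zeta b)) - (a == b)%:R * lam a) ^+ 2 / ((lam a + rho) * (lam b + rho))).
  by apply: itg_sum.
split; first by apply: itg_sum.
rewrite rint_sum//.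
under eq_bigr => a _ do rewrite rint_sum//.
apply: (@le_trans _ _ (\sum_(a < J) \sum_(b < J) C3 / N%:R * (lam a / (lam a + rho) * (lam b / (lam b + rho))))); last first.
  rewrite /effdim expr2 big_distrlr/= mulr_sumr; apply: ler_sum => a _; by rewrite mulr_sumr.
apply: ler_sum => a _; apply: ler_sum => b _; have [i e1] := hvar a b.
rewrite (eq_rint P (g := fun w => ((lam a + rho) * (lam b + rho))^-1 * (avg (fun k => dot mu I (U k w) (zeta a) * dot mu I (U k w) (zeta b)) - (a == b)%:R * lam a) ^+ 2)); last first.
  by move=> w _; rewrite mulrC.
rewrite rintZ//; apply: (@le_trans _ _ (((lam a + rho) * (lam b + rho))^-1 * (C3 / N%:R * lam a * lam b))).
  by rewrite ler_wpM2l// invr_ge0 mulr_ge0// ltW.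
rewrite le_eqVlt; apply/orP; left; apply/eqP; rewrite invfM; ring.
Qed.

Definition curve_remainder w : R :=
  avg (fun k => 3 * (resid mu I zeta (U k w) J + J.+1%:R * dist_step p (U k w))).

Lemma E_curve_remainder : itg P setT curve_remainder /\
  E curve_remainder <= 3 * (g 0 - \sum_(a < J) lam a + J.+1%:R * z ^+ 2).
Proof.
have h k : itg P setT (fun w => 3 * (resid mu I zeta (U k w) J + J.+1%:R * dist_step p (U k w))) /\
   E (fun w => 3 * (resid mu I zeta (U k w) J + J.+1%:R * dist_step p (U k w))) <= 3 * (g 0 - \sum_(a < J) lam a + J.+1%:R * z ^+ 2).
  have [i1 e1 _ _] := E_dist_step g0 (mU k) (sU k) (hK k) p0 z0 pz.
  have [i2 e2] := E_resid g0 (mU k) (sU k) (hK k) sz one eig J.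
  have i3 := itgZ measurableT J.+1%:R i1; have i4 := itgD measurableT i2 i3.
  split; first exact: itgZ.
  by rewrite rintZ// rintD// e2 rintZ// ler_wpM2l// lerD2l ler_wpM2l.
have [k|i ->] := @E_avg _ _ _ P N (fun k w => 3 * (resid mu I zeta (U k w) J + J.+1%:R * dist_step p (U k w))).
  by have [] := h k.
by split => //; apply: avg_le_cst => k; have [] := h k.
Qed.

Definition step_remainder w : R :=
  J%:R ^+ 2 * (2 * M * avg (fun k => Num.sqrt (dist_step p (U k w)))).

Lemma E_step_remainder : itg P setT step_remainder /\ E step_remainder <= J%:R ^+ 2 * (2 * M * z).
Proof.
have h k := E_dist_step g0 (mU k) (sU k) (hK k) p0 z0 pz.
have [k|i ei] := @E_avg _ _ _ P N (fun k w => Num.sqrt (dist_step p (U k w))).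
  by have [] := h k.
have i2 := itgZ measurableT (2 * M) i.
split; first exact: itgZ.
rewrite rintZ// rintZ// ei ler_wpM2l ?sqr_ge0// ler_wpM2l ?mulr_ge0//.
by apply: avg_le_cst => k; have [] := h k.
Qed.

Definition slope_remainder (om su : R) w : R :=
  avg (fun k => 2 * om * dot mu I (U k w) (U k w) + 2 * su * dist_step p (U k w)).

Lemma E_slope_remainder om su : 0 <= om -> 0 <= su -> itg P setT (slope_remainder om su) /\
  E (slope_remainder om su) <= 2 * om * g 0 + 2 * su * z ^+ 2.
Proof.
move=> om0 su0.
have h k : itg P setT (fun w => 2 * om * dot mu I (U k w) (U k w) + 2 * su * dist_step p (U k w)) /\
   E (fun w => 2 * om * dot mu I (U k w) (U k w) + 2 * su * dist_step p (U k w)) <= 2 * om * g 0 + 2 * su * z ^+ 2.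
  have [i1 e1 _ _] := E_dist_step g0 (mU k) (sU k) (hK k) p0 z0 pz.
  have [i2 e2] := E_normsq g0 (mU k) (sU k) (hK k).
  have i3 := itgZ measurableT (2 * su) i1; have i4 := itgZ measurableT (2 * om) i2.
  split; first exact: itgD.
  by rewrite rintD// !rintZ// e2 lerD2l ler_wpM2l// mulr_ge0.
have [k|i ->] := @E_avg _ _ _ P N (fun k w => 2 * om * dot mu I (U k w) (U k w) + 2 * su * dist_step p (U k w)).
  by have [] := h k.
by split => //; apply: avg_le_cst => k; have [] := h k.
Qed.

(** By the arithmetic-geometric inequality a term of the effective dimension is at
    most [sqrt lam / (2 * sqrt rho)], and the square roots of the eigenvalues have a
    sum of at most [S ^+ 2]. *)
Lemma effdim_le (S : R) : (forall n, \sum_(a < n) lam a `^ 4^-1 <= S) -> effdim <= S ^+ 2 / (2 * Num.sqrt rho).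
Proof.
move=> hS; pose ka a : R := lam a `^ 4^-1.
have ka0 a : 0 <= ka a by exact: powR_ge0.
have kaE a : lam a = ka a ^+ 4.
  by rewrite /ka -powR_mulrn ?powR_ge0// -powRrM mulVf// powRr1.
have S0 : 0 <= S by apply: le_trans (hS 0%N); rewrite big_ord0.
have kS a : ka a <= S.
  by apply: le_trans (hS a.+1); rewrite big_ord_recr/= lerDr; apply: sumr_ge0 => i _; exact: ka0.
have r0 : 0 < Num.sqrt rho by rewrite sqrtr_gt0.
have r2 : rho = Num.sqrt rho ^+ 2 by rewrite sqr_sqrtr ?ltW.
apply: (@le_trans _ _ (\sum_(a < J) S * ka a / (2 * Num.sqrt rho))); last first.
  by rewrite -mulr_suml -mulr_sumr expr2 ler_wpM2r ?invr_ge0 ?mulr_ge0 ?ler_wpM2l// ltW.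
apply: ler_sum => a _; apply: (@le_trans _ _ (ka a * ka a / (2 * Num.sqrt rho))); last first.
  by rewrite ler_wpM2r ?invr_ge0 ?mulr_ge0 ?ler_wpM2r// ltW.
rewrite ler_pdivrMr// mulrAC ler_pdivlMr ?mulr_gt0// kaE.
rewrite [in X in _ <= X]r2; move: (Num.sqrt rho) => r.
rewrite -subr_ge0 (_ : _ - _ = ka a ^+ 2 * (ka a ^+ 2 - r) ^+ 2); last by ring.
by rewrite mulr_ge0 ?sqr_ge0.
Qed.

End grid_moments.

(** * Mixing *)

Section p_series.
Variable R : realType.

(** By Cauchy's condensation over dyadic blocks. *)
Lemma sum_powR_le (s : R) T : 0 < s -> \sum_(1 <= t < T) t%:R `^ (- (1 + s)) <= (1 - 2 `^ (- s))^-1.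
Proof.
move=> s0; pose r : R := 2 `^ (- s).
have r0 : 0 <= r by exact: powR_ge0.
have r1 : r < 1.
  by rewrite /r powRN invf_lt1 ?powR_gt0// -[ltLHS]/((fun=> 1 : R) s) -powR1 gt0_ltr_powR ?nnegrE// ltr1n.
have dy k : \sum_(1 <= t < 2 ^ k) t%:R `^ (- (1 + s)) <= \sum_(i < k) r ^+ i.
  elim: k => [|k IH]; first by rewrite expn0 big_geq// big_ord0.
  rewrite (big_cat_nat (n := (2 ^ k)%N))//=; last by rewrite leq_exp2l.
    rewrite big_ord_recr/= lerD//.
    apply: (@le_trans _ _ (\sum_(2 ^ k <= t < 2 ^ k.+1) (2 ^ k)%:R `^ (- (1 + s)))).
      rewrite !big_seq; apply: ler_sum => t; rewrite mem_index_iota => /andP[kt _].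
      rewrite !powRN lef_pV2 ?posrE ?powR_gt0 ?ltr0n ?expn_gt0//; last by rewrite (leq_trans _ kt)// expn_gt0.
      by apply: ge0_ler_powR; rewrite ?nnegrE ?ler_nat// addr_ge0// ltW.
    rewrite sumr_const_nat (_ : (2 ^ k.+1 - 2 ^ k = 2 ^ k)%N); last by rewrite expnS; lia.
    have k0 : (2 ^ k)%:R != 0 :> R by rewrite pnatr_eq0 -lt0n expn_gt0.
    rewrite -[leLHS]mulr_natl opprD powRD; last by rewrite k0 implybT.
    rewrite powRN powRr1// mulrA mulfV// mul1r.
    by rewrite natrX -powR_mulrn// -powRrM mulrC powRrM /r powR_mulrn// powR_ge0.
  by rewrite expn_gt0.
apply: (@le_trans _ _ (\sum_(1 <= t < 2 ^ T) t%:R `^ (- (1 + s)))).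
  case: (leqP T 1) => T1; first by rewrite big_geq// sumr_ge0// => i _; exact: powR_ge0.
  rewrite [leRHS](big_cat_nat (n := T))//=; [|exact: ltnW|by rewrite ltnW// ltn_expl].
  by rewrite lerDl sumr_ge0// => i _; exact: powR_ge0.
apply: (le_trans (dy T)); rewrite -[leRHS]div1r ler_pdivlMr ?subr_gt0// mulrC.
by rewrite -opprB mulNr -subrX1 opprB lerBlDr lerDl exprn_ge0.
Qed.

End p_series.

Section coordinates.
Context dO (Omega : measurableType dO) (R : realType) (P : probability Omega R).
Variables (K : Type) (L : set K) (F : K -> Omega -> R).
Local Notation E := (rint P setT).

Definition gen_system := \bigcup_(i in L) preimage_set_system setT (F i) (@measurable _ (measurableTypeR R)).
(** Having the sigma-algebra of a subfamily as a measurable type makes the closure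
    properties of measurable functions available for it. *)
Definition sigma_space := g_sigma_algebraType gen_system.

Lemma coord_measurable i : L i -> measurable_fun (setT : set sigma_space) (F i).
Proof.
move=> Li _ B mB; apply: sub_sigma_algebra; exists i => //; exists B => //.
Qed.

Lemma sigma_of_threshold (f : Omega -> R) x : measurable_fun (setT : set sigma_space) f ->
  sigma_of L F [set w | x < f w].
Proof.
move=> mf; have := mf measurableT _ (measurable_itv `]x, +oo[).
rewrite setTI (_ : f @^-1` _ = [set w | x < f w])//.
by apply/seteqP; split=> w /=; rewrite in_itv/= andbT.
Qed.

Lemma sigma_of_sub A : (forall i, L i -> measurable_fun setT (F i)) -> sigma_of L F A -> measurable A.
Proof.
move=> mF; apply: smallest_sub; first exact: sigma_algebra_measurable.
move=> _ [i Li [B mB <-]]; exact: mF.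
Qed.

Lemma sigma_space_measurable dT (T : measurableType dT) (f : Omega -> T) :
  (forall i, L i -> measurable_fun setT (F i)) -> measurable_fun (setT : set sigma_space) f -> measurable_fun setT f.
Proof. by move=> mF mf _ B mB; apply: sigma_of_sub => //; exact: (mf measurableT). Qed.

End coordinates.

Section mixing_inequality.
Context dO (Omega : measurableType dO) (R : realType) (P : probability Omega R).
Variables (K K' : Type) (L : set K) (F : K -> Omega -> R) (L' : set K') (F' : K' -> Omega -> R).
Local Notation E := (rint P setT).
Hypotheses (mF : forall i, L i -> measurable_fun setT (F i)) (mF' : forall i, L' i -> measurable_fun setT (F' i)).
Variables (U V : Omega -> R) (a b : R).
Hypotheses (mU : measurable_fun (setT : set (sigma_space L F)) U) (mV : measurable_fun (setT : set (sigma_space L' F')) V).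
Hypotheses (a0 : 0 < a) (b0 : 0 < b) (Ua : forall w, `|U w| <= a) (Vb : forall w, `|V w| <= b).

Lemma mix_E (al : R) : (alpha_mix P (sigma_of L F) (sigma_of L' F') <= al%:E)%E ->
  `|E (fun w => U w * V w) - E U * E V| <= 4 * al * a * b.
Proof.
move=> hal; apply: cov_ineq => //; [exact: (sigma_space_measurable mF)|exact: (sigma_space_measurable mF')|].
move=> x y; apply: le_trans hal; apply: ereal_sup_ubound.
by exists [set w | x < U w]; [exact: sigma_of_threshold|exists [set w | y < V w] => //; exact: sigma_of_threshold].
Qed.

Lemma indep_E : indep_sigma P (sigma_of L F) (sigma_of L' F') -> E (fun w => U w * V w) = E U * E V.
Proof.
move=> ind; apply/eqP; rewrite -subr_eq0 -normr_le0.
have -> : 0 = 4 * 0 * a * b :> R by rewrite mulr0 !mul0r.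
apply: cov_ineq => //; [exact: (sigma_space_measurable mF)|exact: (sigma_space_measurable mF')|].
move=> x y; rewrite ind; [|exact: sigma_of_threshold..].
rewrite subee ?abse0//; apply: fin_numM; apply: fin_num_measure.
  by apply: (sigma_of_sub mF); exact: sigma_of_threshold.
by apply: (sigma_of_sub mF'); exact: sigma_of_threshold.
Qed.

End mixing_inequality.

Section field_mixing.
Context dO (Omega : measurableType dO) (R : realType) (P : probability Omega R).
Variables (d : nat) (K : Type) (Z : site d -> K -> Omega -> R).

Lemma dist2C (i j : site d) : dist2 i j = dist2 j i :> R.
Proof. by rewrite /dist2; congr Num.sqrt; apply: eq_bigr => c _; rewrite -opprB mulrNz sqrrN. Qed.

Lemma deltaC (A B : set (site d)) : delta A B = delta B A :> R.
Proof.
rewrite /delta; congr inf; apply/seteqP.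
by split => [_ [i Ai [j Bj <-]]|_ [i Ai [j Bj <-]]]; exists j => //; exists i => //; rewrite dist2C.
Qed.

Lemma alpha_bound theta : mixing_rate P Z theta -> exists C : R, 0 < C /\ exists u0 : R, 0 < u0 /\
  forall u i (L : set (site d)), u0 <= u -> u <= delta L [set i] ->
    (alpha_mix P (sigma_field Z [set i]) (sigma_field Z L) <= (C * u `^ (- theta))%:E)%E.
Proof.
move=> [C [u1 [_ h]]]; exists (`|C| + 1); split; first by rewrite ltr_wpDl.
exists (`|u1| + 1); split; first by rewrite ltr_wpDl.
move=> u i L uu ud; apply: (@le_trans _ _ (alpha_1oo P Z u)).
  by apply: ereal_sup_ubound; exists i, L.
apply: le_trans (h u _) _; first by have := ler_norm u1; lra.
rewrite lee_fin ler_wpM2r ?powR_ge0//; have := ler_norm C; lra.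
Qed.

(** The covariances are bounded by the mixing coefficients, whose decay exponent
    exceeds the dimension; [grid_sum] then compares with a convergent series. *)
Lemma noise_cov_sum theta (e : site d -> Omega -> R) (M1 : R) : (0 < d)%N -> d%:R < theta ->
  (forall i k, measurable_fun setT (Z i k)) ->
  mixing_rate P Z theta -> 0 < M1 ->
  (forall i w, `|e i w| <= M1) ->
  (forall i (L : set (site d)), L i ->
    measurable_fun (setT : set (sigma_space (L `*` setT) (fun ik : site d * K => Z ik.1 ik.2))) (e i)) ->
  (forall i, rint P setT (e i) = 0) ->
  exists L1 : R, forall n (k : 'I_(n ^ d)%N),
    \sum_(l < n ^ d) `|rint P setT (fun w => e (lex_site k) w * e (lex_site l) w)| <= L1.
Proof.
move=> d0 dth mZ /alpha_bound[C [C0 [u0 [u00 hC]]]] M10 eM me e0.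
pose A : R := M1 ^+ 2 * (1 + u0 `^ theta) + 4 * C * M1 * M1.
have th0 : 0 < theta by apply: le_lt_trans dth.
have M2 : 0 <= M1 ^+ 2 by exact: sqr_ge0.
have A1 : M1 ^+ 2 <= A.
  have : 0 <= M1 ^+ 2 * u0 `^ theta by rewrite mulr_ge0// powR_ge0.
  have : 0 <= 4 * C * M1 * M1 by rewrite !mulr_ge0// ltW.
  by rewrite /A; nra.
have A0 : 0 <= A by exact: le_trans A1.
pose phi (t : nat) : R := if t is 0 then A else A * t%:R `^ (- theta).
have phi0 t : 0 <= phi t by case: t => //= t; rewrite mulr_ge0// powR_ge0.
have tle t : (t.+1%:R : R) `^ (- theta) <= 1.
  rewrite powRN invf_le1 ?powR_gt0// -[leLHS](powRr0 t.+1%:R) ler_powR ?ler1n//; exact: ltW.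
have phid t : phi t.+1 <= phi t.
  case: t => [|t] /=; first by rewrite -[leRHS]mulr1 ler_wpM2l.
  rewrite ler_wpM2l// !powRN lef_pV2 ?posrE ?powR_gt0//.
  by apply: ge0_ler_powR; rewrite ?nnegrE ?ler_nat// ltW.
pose s := theta - d%:R; have s0 : 0 < s by rewrite subr_gt0.
have phiS T : \sum_(1 <= t < T) t%:R ^+ d.-1 * phi t <= A * (1 - 2 `^ (- s))^-1.
  apply: le_trans (ler_wpM2l A0 (sum_powR_le T s0)); rewrite mulr_sumr !big_seq.
  apply: ler_sum => -[|t]; rewrite mem_index_iota// => _ /=.
  have t0 : (t.+1%:R : R) != 0 by rewrite pnatr_eq0.
  rewrite mulrCA ler_wpM2l// -powR_mulrn// -powRD ?t0 ?implybT//.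
  rewrite (_ : d.-1%:R - theta = - (1 + s))// /s -[in - (1 + (_ - d%:R))](prednK d0) -natr1; ring.
exists (phi 0%N + 2 * d%:R * 3 ^+ d.-1 * (A * (1 - 2 `^ (- s))^-1)) => n k.
apply: le_trans (grid_sum k d0 phi0 phid phiS); apply: ler_sum => l _.
have me' i : measurable_fun setT (e i).
  by apply: (sigma_space_measurable (L := [set i] `*` setT) (F := fun ik : site d * K => Z ik.1 ik.2)) (me i _ _) => //= -[].
have triv : `|rint P setT (fun w => e (lex_site k) w * e (lex_site l) w)| <= M1 ^+ 2.
  have i1 : itg P setT (fun w => e (lex_site k) w * e (lex_site l) w).
    apply: (@itg_bnd _ _ _ P _ (M1 * M1)); first exact: measurable_funM.
    by move=> w; rewrite normrM ler_pM.
  apply: (le_trans (le_abs_rint measurableT i1)); rewrite -[leRHS](E_cst P).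
  apply: le_rint => //; [exact: itg_abs|exact: itg_cst|by move=> w _; rewrite normrM expr2 ler_pM].
have [small|big] := ltP ((supdist k l)%:R : R) u0.
  apply: (le_trans triv); rewrite /phi; case: (supdist k l) small => // t tu.
  rewrite powRN ler_pdivlMr ?powR_gt0//.
  have : (t.+1%:R : R) `^ theta <= u0 `^ theta by apply: ge0_ler_powR; rewrite ?nnegrE// ltW.
  have : 0 <= 4 * C * M1 * M1 by rewrite !mulr_ge0// ltW.
  by rewrite /A; move: (t.+1%:R `^ theta) (u0 `^ theta) => x y; nra.
have := @mix_E _ _ _ P _ _ ([set lex_site k] `*` setT) (fun ik : site d * K => Z ik.1 ik.2)
   ([set lex_site l] `*` setT) (fun ik : site d * K => Z ik.1 ik.2) (fun i _ => mZ _ _) (fun i _ => mZ _ _) (e (lex_site k)) (e (lex_site l)) M1 M1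
   (me _ _ erefl) (me _ _ erefl) M10 M10 (eM _) (eM _) _ (hC _ (lex_site k) [set lex_site l] big _).
rewrite !e0 mul0r subr0 => /(_ _)/le_trans; apply.
  rewrite (_ : delta _ _ = dist2 (lex_site l) (lex_site k)) ?delta1// dist2C; exact: supdist_dist2.
move: big; rewrite /phi; case: (supdist k l) => [|t] big.
  by have := lt_le_trans u00 big; rewrite ltxx.
rewrite (_ : 4 * _ * _ * _ = 4 * C * M1 * M1 * t.+1%:R `^ (- theta)); last by ring.
by rewrite ler_wpM2r ?powR_ge0// /A lerDr mulr_ge0// addr_ge0// powR_ge0.
Qed.

End field_mixing.

(** * Estimation and prediction errors in probability *)

Lemma ae_le_measure dO (Omega : measurableType dO) (R : realType) (P : {measure set Omega -> \bar R})
    (A B : set Omega) : measurable A -> measurable B -> {ae P, forall w, A w -> B w} -> (P A <= P B)%E.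
Proof.
move=> mA mB [N [mN N0 sub]]; apply: (@le_trans _ _ (P (B `|` N))).
  apply: le_measure; rewrite ?inE//; first exact: measurableU.
  move=> w Aw; have [|Bw] := pselect (B w); first by left.
  by right; apply: sub => /= h; exact/Bw/h.
have PN : (P N <= 0)%E by rewrite N0.
apply: (le_trans (measureU2 P mB mN)); rewrite -[leRHS]adde0; exact: leeD.
Qed.

Section error_split.
Variables (R : realType) (p J : nat) (zeta : nat -> R -> R).
Notation mu := (@lebesgue_measure R).
Local Notation I := (`[0, 1]%classic : set R).
Hypothesis sz : forall a, sqi mu I (zeta a).
Hypothesis one : forall a b, dot mu I (zeta a) (zeta b) = (a == b)%:R.
Let mI : measurable (I : set (measurableTypeR R)). Proof. exact: measurable_itv. Qed.
Let z1 a : dot mu I (zeta a) (zeta a) = 1. Proof. by rewrite one eqxx. Qed.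

Let two_sqr (a b : R) : (a + b) ^+ 2 <= 2 * a ^+ 2 + 2 * b ^+ 2.
Proof. by have := sqr_ge0 (a - b); rewrite !sqrrD mulrN sqrrN mulNrn; lra. Qed.

(** The slope error is [s + r], where [s] is the step function carried by its values
    at the knots. The inner product of [s] with the curve [x] is compared with the
    sum over the first [J] scores of the discretised curve by the Cauchy-Schwarz
    inequality; [xb] stands for the mean curve and [eb] for the mean noise. *)
Lemma error_split (s r x xb : R -> R) (M q r2 eb : R) : 0 <= M -> sqi mu I s -> sqi mu I r ->
  sqi mu I x -> sqi mu I xb -> dot mu I s s <= q -> dot mu I r r <= r2 -> dot mu I x x <= M ^+ 2 ->
  (eb + dot mu I (fun t => s t + r t) x - dot mu I (fun t => s t + r t) xb) ^+ 2 <=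
  3 * eb ^+ 2 + 6 * r2 * M ^+ 2 + 24 * q * resid mu I zeta x J + 24 * q * (J%:R * dist_step p x) +
  12 * (\sum_(a < J) dot mu I s (zeta a) * yscore p zeta M x a) ^+ 2 + 6 * (q + r2) * dot mu I xb xb.
Proof.
move=> M0 ss sr sx sxb sq rr xM.
have q0 : 0 <= q by apply: le_trans sq; exact: dot_ge0.
have r0 : 0 <= r2 by apply: le_trans rr; exact: dot_ge0.
have x0 := resid_ge0 mI sz one J sx; have d0 : 0 <= dist_step p x by exact: dot_ge0.
have sh := sqiD mI ss sr.
pose S := \sum_(a < J) dot mu I s (zeta a) * yscore p zeta M x a.
pose Cs := \sum_(a < J) dot mu I s (zeta a) * dot mu I x (zeta a).
have h1 : (dot mu I s x - Cs) ^+ 2 <= q * resid mu I zeta x J.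
  rewrite (dotC mu I s x) (_ : Cs = \sum_(a < J) dot mu I x (zeta a) * dot mu I s (zeta a)); last first.
    by apply: eq_bigr => a _; rewrite mulrC.
  by apply: (le_trans (resid_CS mI sz one J sx ss)); rewrite mulrC ler_wpM2r.
have h2 : (Cs - S) ^+ 2 <= q * (J%:R * dist_step p x).
  rewrite /Cs /S -sumrB.
  under eq_bigr do rewrite -mulrBr.
  apply: (le_trans (sum_CS _ _ _)); apply: ler_pM; try by apply: sumr_ge0 => a _; exact: sqr_ge0.
    apply: le_trans sq; have := resid_ge0 mI sz one J ss; rewrite /resid subr_ge0; exact.
  rewrite -[leRHS](_ : \sum_(a < J) dist_step p x = _); last by rewrite sumr_const card_ord -[LHS]mulr_natl.
  apply: ler_sum => a _; have := yscore_close sz one p M0 a sx xM.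
  by rewrite distrC -(@ler_sqr _ _ (Num.sqrt _)) ?nnegrE ?sqrtr_ge0// sqr_sqrtr// real_normK ?num_real.
have h3 : dot mu I r x ^+ 2 <= r2 * M ^+ 2.
  by apply: (le_trans (CS mI sr sx)); apply: ler_pM => //; exact: dot_ge0.
have h4 : dot mu I (fun t => s t + r t) xb ^+ 2 <= (2 * q + 2 * r2) * dot mu I xb xb.
  apply: (le_trans (CS mI sh sxb)); rewrite ler_wpM2r ?dot_ge0//.
  have sd := sqiB mI ss sr.
  have e1 : dot mu I (fun t => s t + r t) (fun t => s t + r t) + dot mu I (fun t => s t - r t) (fun t => s t - r t) =
      2 * dot mu I s s + 2 * dot mu I r r.
    rewrite (dotDl mI ss sr sh) (dotDr mI ss sr ss) (dotDr mI ss sr sr) (dotBl mI ss sr sd) (dotBr mI ss sr ss) (dotBr mI ss sr sr).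
    rewrite (dotC mu I r s); ring.
  have := dot_ge0 mu I (fun t => s t - r t); lra.
rewrite dotDl//; rewrite -/S; move: h4.
move: (dot mu I (fun t => s t + r t) xb) (dot mu I xb xb) => D X h4.
move: h1 h2 h3; move: (dot mu I s x) (dot mu I r x) (resid _ _ _ _ _) (J%:R * _) => a b c e h1 h2 h3.
have f1 := two_sqr (a - Cs) (Cs - S); have f2 := two_sqr ((a - Cs) + (Cs - S)) S.
have f3 := two_sqr a b.
have f4 : (eb + (a + b) - D) ^+ 2 <= 3 * eb ^+ 2 + 3 * (a + b) ^+ 2 + 3 * D ^+ 2.
  rewrite -subr_ge0 (_ : _ - _ = (eb - (a + b)) ^+ 2 + (eb + D) ^+ 2 + (a + b + D) ^+ 2); last by ring.
  by rewrite !addr_ge0 ?sqr_ge0.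
rewrite (_ : a - Cs + (Cs - S) = a - S) in f1 f2; last by ring.
rewrite subrK in f2.
move: ((eb + (a + b) - D) ^+ 2) ((a + b) ^+ 2) (eb ^+ 2) (D ^+ 2) (a ^+ 2) (b ^+ 2) ((a - S) ^+ 2) ((a - Cs) ^+ 2) ((Cs - S) ^+ 2) (S ^+ 2) f1 f2 f3 f4 h1 h2 h3 h4 => *; lra.
Qed.

End error_split.

Section sample.
Context dO (Omega : measurableType dO) (R : realType) (P : probability Omega R).
Notation mu := (@lebesgue_measure R).
Local Notation I := (`[0, 1]%classic : set R).
Local Notation E := (rint P setT).
Variables (d n m p J : nat) (X : site d -> Omega -> R -> R) (Y e : site d -> Omega -> R).
Variables (rho : R) (D : 'I_p -> R -> R) (mn beta : R -> R) (beta0 : R).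
Variables (g : R -> R) (lam : nat -> R) (zeta : nat -> R -> R) (M z M1 L0 L1 C3 : R).
Local Notation N := (n ^ d)%N.
Variable psi : 'I_N -> 'I_N -> R.
Local Notation V i := (centered (X i) mn).
Local Notation Vg := (fun k : 'I_N => V (lex_site k)).
Local Notation eg := (fun k : 'I_N => e (lex_site k)).

Hypotheses (n0 : (0 < n)%N) (m0 : (0 < m)%N) (mp : (m <= p)%N).
Hypotheses (hD : natural_spline_basis m D) (rho0 : 0 < rho).
Hypotheses (smn : sqi mu I mn) (sbeta : sqi mu I beta).
Hypotheses (mX : forall i, jm (X i)) (mY : forall i, measurable_fun setT (Y i)).
Hypotheses (g0 : 0 <= g 0).
Hypothesis sV : forall i t, I t -> sqi P setT (V i ^~ t).
Hypothesis hK : forall i t u, I t -> I u -> E (fun w => V i w t * V i w u) = g `|t - u|.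
Hypothesis sz : forall a, sqi mu I (zeta a).
Hypothesis one : forall a b, dot mu I (zeta a) (zeta b) = (a == b)%:R.
Hypothesis eig : forall a, {ae mu, forall t, I t ->
  rint mu I (fun u => zeta a u * g `|t - u|) = lam a * zeta a t}.
Hypotheses (M0 : 0 < M) (z0 : 0 <= z).
Hypothesis VM : forall i, {ae P, forall w, sqi mu I (V i w) /\ dot mu I (V i w) (V i w) <= M ^+ 2}.
Hypothesis pz : forall s, 0 <= s <= p%:R^-1 -> 2 * (g 0 - g s) <= z ^+ 2.
Hypothesis hpsi : forall k l t, I t -> E (fun w => Vg k w t * Vg l w t) = g 0 * psi k l.
Hypothesis psi_sum : forall k, \sum_l psi k l <= L0.
Hypotheses (me : forall i, measurable_fun setT (e i)) (M10 : 0 <= M1) (eM : forall i w, `|e i w| <= M1).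
Hypothesis e_sum : forall k, \sum_l `|E (fun w => eg k w * eg l w)| <= L1.
Hypothesis indep : forall k l a,
  E (fun w => eg k w * eg l w * (yscore p zeta M (Vg k w) a * yscore p zeta M (Vg l w) a)) =
  E (fun w => eg k w * eg l w) * E (fun w => yscore p zeta M (Vg k w) a * yscore p zeta M (Vg l w) a).
Hypothesis hvar : forall a b,
  let f w := avg (fun k : 'I_N => dot mu I (Vg k w) (zeta a) * dot mu I (Vg k w) (zeta b)) - (a == b)%:R * lam a in
  itg P setT (fun w => f w ^+ 2) /\ E (fun w => f w ^+ 2) <= C3 / N%:R * lam a * lam b.
Hypothesis model : forall i, {ae P, forall w, Y i w = beta0 + ip beta (X i w) + e i w}.

Let mI : measurable (I : set (measurableTypeR R)). Proof. exact: measurable_itv. Qed.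
Let p0 : (0 < p)%N. Proof. exact: leq_trans mp. Qed.
Let N0 : (0 < N)%N. Proof. by rewrite expn_gt0 n0. Qed.
Let jV i : jm (V i). Proof. by apply: jmB => //; apply: jm_t; case: smn. Qed.
Let k0 : 'I_N := Ordinal N0.
Let lam0 a : 0 <= lam a. Proof. by apply: (lam_ge0 g0 (jV 0) (@sV 0) (@hK 0) sz one eig). Qed.

Local Notation A := (penalty_mx m D).
Local Notation u := (knot_vec p beta).
Local Notation vh w := (beta_hat_vec (X ^~ w) (Y ^~ w) n m rho D).
Local Notation theta := (theta_of m J rho D zeta lam).

Section measurability.
Context dT (T : measurableType dT) (x : T -> 'cV[R]_p).
Hypothesis mx : mmx x.

Lemma coefs_measurable a : measurable_fun setT (fun w => coefs zeta (x w) a).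
Proof.
rewrite /coefs; under eq_fun do rewrite dot_suml_step//.
apply: measurable_sum => j; apply: measurable_funM; last exact: measurable_cst.
exact: mx.
Qed.

Lemma theta_measurable : measurable_fun setT (fun w => theta (x w)).
Proof.
apply: measurable_funD.
  apply: measurable_sum => a; apply: measurable_funM; first exact: measurable_cst.
  by apply: measurable_funX; exact: coefs_measurable.
apply: measurable_funM; first exact: measurable_cst.
apply: measurable_funM; last exact: measurable_cst.
exact: (mmxM (mmxM (mmxT mx) (mmx_cst _)) mx).
Qed.

End measurability.

Lemma all_sites (Q : 'I_N -> Omega -> Prop) : (forall k, {ae P, forall w, Q k w}) -> {ae P, forall w, forall k, Q k w}.
Proof. by move=> h; apply: filter_forall => k; exact: h. Qed.

Definition om : R :=
  let f t := beta t - step (fun j => u j 0) t in dot mu I f f.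
Local Notation U := (qf A u u / p%:R).

Definition trace_rest : R := g 0 - \sum_(a < J) lam a.
Local Notation T := (effdim lam J rho).
Definition main_error : R :=
  8 * (2 * om * g 0 + 2 * ssq u * z ^+ 2) + 64 * (2 * L1 / N%:R * (T + J%:R * z ^+ 2 / rho)) +
  32 * M1 ^+ 2 / rho * (3 * (trace_rest + J.+1%:R * z ^+ 2)) + 8 * (L1 / N%:R).
Definition gram_error : R :=
  2 / rho * (3 * (trace_rest + J.+1%:R * z ^+ 2)) + 2 / rho * (g 0 * L0 / N%:R) +
  rho^-1 * (J%:R ^+ 2 * (2 * M * z)).
Definition score_error : R := C3 / N%:R * T ^+ 2.

(** Markov's inequality for the terms of [realization_bound]. The levels [1 / 4] and
    [1 / 16] imply its condition, since the latter bounds the square of the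
    relative deviation of the second moments: [1 / 4 + sqrt (1 / 16) = 1 / 2]. *)
Lemma theta_tail (t : R) : 0 < t ->
  (P [set w | (t + 32 * rho * U < theta (vh w - u))%R] <= (main_error / t + (gram_error / 4^-1 + score_error / 16^-1))%:E)%E.
Proof.
move=> t0.
have om0 : 0 <= om by exact: dot_ge0.
have su0 : 0 <= ssq u by rewrite mulr_ge0 ?invr_ge0// sumr_ge0// => j _; exact: sqr_ge0.
have [i1 e1] := E_slope_remainder N0 g0 (fun k => jV (lex_site k)) (fun k => @sV (lex_site k)) (fun k => @hK (lex_site k)) p0 z0 pz om0 su0.
have [i2 e2] := E_noise_energy N0 g0 (fun k => jV (lex_site k)) (fun k => @sV (lex_site k)) (fun k => @hK (lex_site k)) sz one eig J p0 (ltW M0) z0 rho0 (fun k => VM (lex_site k)) pz (fun k => me (lex_site k)) M10 (fun k => eM (lex_site k)) e_sum indep.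
have [i3 e3] := E_curve_remainder N0 g0 (fun k => jV (lex_site k)) (fun k => @sV (lex_site k)) (fun k => @hK (lex_site k)) sz one eig J p0 z0 pz.
have [i4 e4] := E_mean_knots N0 g0 (fun k => jV (lex_site k)) (fun k => @sV (lex_site k)) p0 hpsi psi_sum.
have [i5 e5] := E_mean_noise N0 (fun k => me (lex_site k)) M10 (fun k => eM (lex_site k)) e_sum.
have [i6 e6] := E_score_deviation N0 g0 (fun k => jV (lex_site k)) (fun k => @sV (lex_site k)) (fun k => @hK (lex_site k)) sz one eig J rho0 hvar.
have [i7 e7] := E_step_remainder N0 g0 (fun k => jV (lex_site k)) (fun k => @sV (lex_site k)) (fun k => @hK (lex_site k)) J p0 (ltW M0) z0 pz.
set H1 := slope_remainder _ _ _ _ in i1 e1.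
set R2 := noise_energy _ _ _ _ _ _ _ _ in i2 e2.
set H3 := curve_remainder _ _ _ _ in i3 e3.
set R4 := mean_knots _ _ in i4 e4.
set R6 := score_deviation _ _ _ _ _ in i6 e6.
set H7 := step_remainder _ _ _ _ in i7 e7.
pose R5 w := avg (fun k => eg k w) ^+ 2.
pose G1 w := 8 * H1 w + 64 * R2 w + 32 * M1 ^+ 2 / rho * H3 w + 8 * R5 w.
pose G2 w := 2 / rho * H3 w + 2 / rho * R4 w + rho^-1 * H7 w.
have ri0 : 0 <= rho^-1 by rewrite invr_ge0 ltW.
have j1 := itgZ measurableT 8 i1; have j2 := itgZ measurableT 64 i2.
have j3 := itgZ measurableT (32 * M1 ^+ 2 / rho) i3; have j5 := itgZ measurableT 8 i5.
have j12 := itgD measurableT j1 j2; have j123 := itgD measurableT j12 j3.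
have iG1 : itg P setT G1 by exact: (itgD measurableT j123 j5).
have l3 := itgZ measurableT (2 / rho) i3; have l4 := itgZ measurableT (2 / rho) i4.
have l7 := itgZ measurableT rho^-1 i7; have l34 := itgD measurableT l3 l4.
have iG2 : itg P setT G2 by exact: (itgD measurableT l34 l7).
have eG1 : E G1 <= main_error.
  rewrite (rintD measurableT j123 j5) (rintD measurableT j12 j3) (rintD measurableT j1 j2).
  rewrite (rintZ measurableT _ i1) (rintZ measurableT _ i2) (rintZ measurableT _ i3) (rintZ measurableT _ i5) /main_error; apply: lerD; last by rewrite ler_wpM2l.
  apply: lerD; last by rewrite ler_wpM2l// !mulr_ge0// sqr_ge0.
  by apply: lerD; rewrite ler_wpM2l.
have eG2 : E G2 <= gram_error.
  rewrite (rintD measurableT l34 l7) (rintD measurableT l3 l4) (rintZ measurableT _ i3) (rintZ measurableT _ i4) (rintZ measurableT _ i7) /gram_error.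
  by apply: lerD; [apply: lerD|]; rewrite ler_wpM2l// mulr_ge0.
have d0 (f : R -> R) : 0 <= dist_step p f by exact: dot_ge0.
have H10 w : 0 <= H1 w.
  apply: avg_ge0 => k; by rewrite addr_ge0// mulr_ge0 ?dot_ge0// mulr_ge0 ?dot_ge0//.
have R20 w : 0 <= R2 w.
  by apply: sumr_ge0 => a _; rewrite mulr_ge0 ?sqr_ge0// invr_ge0 addr_ge0 ?lam0 ?(ltW rho0).
have R40 w : 0 <= R4 w by rewrite mulr_ge0 ?invr_ge0// sumr_ge0// => j _; exact: sqr_ge0.
have R60 w : 0 <= R6 w.
  apply: sumr_ge0 => a _; apply: sumr_ge0 => b _; rewrite mulr_ge0 ?sqr_ge0//.
  by rewrite invr_ge0 mulr_ge0// addr_ge0 ?lam0 ?(ltW rho0).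
have H70 w : 0 <= H7 w.
  rewrite mulr_ge0 ?sqr_ge0// mulr_ge0 ?mulr_ge0 ?(ltW M0)//.
  by apply: sumr_ge0 => k _; exact: sqrtr_ge0.
have aeVM := all_sites (fun k => VM (lex_site k)).
have H3ae : {ae P, forall w, 0 <= H3 w}.
  apply: (aeS aeVM) => w h; apply: avg_ge0 => k; rewrite mulr_ge0// addr_ge0//.
    by apply: resid_ge0 => //; have [] := h k.
  by rewrite mulr_ge0.
(* absolute values are nonnegative everywhere, and not only almost surely *)
pose p1 w := `|G1 w|; pose p2 w := `|G2 w|.
have ip1 : itg P setT p1 by exact: itg_abs.
have ip2 : itg P setT p2 by exact: itg_abs.
have ep (G : Omega -> R) : itg P setT G -> {ae P, forall w, 0 <= G w} -> E (fun w => `|G w|) = E G.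
  move=> iG G0; have ia := itg_abs iG; apply: (ae_eq_rint measurableT (itg_meas ia) (itg_meas iG)).
  by apply: (aeS G0) => w h _; rewrite ger0_norm.
have G10 : {ae P, forall w, 0 <= G1 w}.
  apply: (aeS H3ae) => w h; rewrite /G1.
  have := H10 w; have := R20 w; have : 0 <= R5 w by exact: sqr_ge0.
  have c0 : 0 <= 32 * M1 ^+ 2 / rho by rewrite mulr_ge0// mulr_ge0// sqr_ge0.
  move: (H1 w) (R2 w) (R5 w) => x1 x2 x5 h5 h2 h1.
  by rewrite addr_ge0 ?mulr_ge0// addr_ge0 ?(mulr_ge0 c0 h)// addr_ge0// mulr_ge0.
have G20 : {ae P, forall w, 0 <= G2 w}.
  apply: (aeS H3ae) => w h; rewrite /G2.
  have := R40 w; have := H70 w; move: (H7 w) (R4 w) => x7 x4 h7 h4.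
  by rewrite addr_ge0 ?(mulr_ge0 ri0 h7)// addr_ge0// mulr_ge0// mulr_ge0.
have m1 := markov_E ip1 (fun w => normr_ge0 _) t0.
have m2 := markov_E ip2 (fun w => normr_ge0 _) (_ : 0 < 4^-1).
have m3 := markov_E i6 R60 (_ : 0 < 16^-1).
rewrite (ep _ iG1 G10) in m1; rewrite (ep _ iG2 G20) in m2.
have key : {ae P, forall w, t + 32 * rho * U < theta (vh w - u) ->
    [\/ t < p1 w, 4^-1 < p2 w | 16^-1 < R6 w]}.
  have aem := all_sites (fun k => model (lex_site k)).
  apply: (aeS2 aeVM aem) => w hV hm big.
  have := @realization_bound R d n m p J (X ^~ w) (Y ^~ w) rho D n0 m0 mp hD rho0 mn beta zeta lam (fun k => e (lex_site k) w)
    beta0 M M1 smn sbeta (ltW M0) sz one lam0 (fun k => (hV k).1) (fun k => (hV k).2) hm (fun k => eM _ _).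
  move=> rb.
  have [|s1] := ltP t (p1 w); first by move=> ?; apply: Or31.
  have [|s2] := ltP 4^-1 (p2 w); first by move=> ?; apply: Or32.
  have [|s3] := ltP 16^-1 (R6 w); first by move=> ?; apply: Or33.
  have s3' : Num.sqrt (R6 w) <= 4^-1.
    rewrite (_ : 4^-1 = Num.sqrt 16^-1 :> R); first exact: ler_wsqrtr.
    by rewrite (_ : 16^-1 = 4^-1 ^+ 2 :> R) ?sqrtr_sqr ?ger0_norm//; field.
  have sm : 2 * H3 w / rho + 2 * R4 w / rho + Num.sqrt (R6 w) + H7 w / rho <= 2^-1.
    have -> : 2 * H3 w / rho + 2 * R4 w / rho + Num.sqrt (R6 w) + H7 w / rho = G2 w + Num.sqrt (R6 w).
      by rewrite /G2; ring.
    rewrite (_ : 2^-1 = 4^-1 + 4^-1 :> R); last by field.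
    by rewrite lerD// (le_trans (ler_norm _) s2).
  have rb' : theta (vh w - u) <= 8 * H1 w + 64 * R2 w + 32 * M1 ^+ 2 * H3 w / rho + 8 * R5 w + 32 * rho * U.
    exact: (rb sm).
  have := lt_le_trans big rb'.
  have -> : 8 * H1 w + 64 * R2 w + 32 * M1 ^+ 2 * H3 w / rho + 8 * R5 w + 32 * rho * U = G1 w + 32 * rho * U.
    by rewrite /G1; ring.
  by rewrite ltrD2r => /lt_le_trans/(_ (le_trans (ler_norm _) s1)); rewrite ltxx.
have mv : mmx (fun w => vh w - u).
  apply: mmxD; last exact: mmx_cst.
  apply: beta_hat_vec_measurable => // k j; apply: jm_at => //.
  by rewrite /= in_itv/= (knot_ge0 _ p0) (knot_le1 _ p0).
have mset (f : Omega -> R) c : measurable_fun setT f -> measurable [set w | c < f w].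
  move=> mf; rewrite (_ : [set w | _] = f @^-1` `]c, +oo[%classic).
    by rewrite -[_ @^-1` _]setTI; exact: mf.
  by apply/seteqP; split=> w /=; rewrite in_itv/= andbT.
have mp1 := mset _ t (itg_meas ip1); have mp2 := mset _ 4^-1 (itg_meas ip2).
have mp3 := mset _ 16^-1 (itg_meas i6).
apply: (@le_trans _ _ (P ([set w | t < p1 w] `|` ([set w | 4^-1 < p2 w] `|` [set w | 16^-1 < R6 w])))).
  have mU : measurable ([set w | t < p1 w] `|` ([set w | 4^-1 < p2 w] `|` [set w | 16^-1 < R6 w])).
    by apply: measurableU => //; exact: measurableU.
  apply: ae_le_measure => //; first by apply: (mset (fun w => theta (vh w - u))); exact: theta_measurable.
  by apply: (aeS key) => w h /h[?|?|?]; [left|right; left|right; right].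
apply: (@le_trans _ _ (P [set w | (t < p1 w)%R] + (P [set w | (4^-1 < p2 w)%R] + P [set w | (16^-1 < R6 w)%R]))%E).
  apply: (le_trans (measureU2 _ _ _)) => //; first exact: measurableU.
  by apply: leeD => //; apply: measureU2.
rewrite !EFinD; apply: leeD; last apply: leeD.
- by apply: (le_trans m1); rewrite lee_fin ler_wpM2r// invr_ge0 ltW.
- by apply: (le_trans (m2 _)) => //; rewrite lee_fin ler_wpM2r.
- by apply: (le_trans (m3 _)) => //; rewrite lee_fin ler_wpM2r.
Qed.


Local Notation bh w := (beta_hat (X ^~ w) (Y ^~ w) n m rho D).

Let sbh w : sqi mu I (bh w).
Proof.
have sD i : sqi mu I (D i).
  have cD := basis_continuous hD (i := i).
  split.
    by apply: (@measurable_funS _ _ (measurableTypeR R) _ setT) => //; exact: continuous_measurable_fun.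
  apply: itg_cont_seg => t; apply: (@continuous_comp _ _ _ (D i) (fun x => x ^+ 2)); first exact: cD.
  exact: exprn_continuous.
have sc : sqi mu I (fun t => \sum_i spline_coef D (vh w) i 0 * D i t).
  by apply: (sqi_sum mI) => i; exact: sqiZ.
by apply: (eq_sqi _ _ sc) => // t _; rewrite beta_hatE.
Qed.

Variables (i0 : site d) (c : R).
Hypothesis c0 : 0 < c.
(** A bound for the penalty, hence for the squared norm, of the slope error when
    [theta] is at most [c]. *)
Definition level : R := c / rho.
Definition rest_level : R := 2 * (step_cst R m / p%:R * (4 * (level + U))) + 2 * om.
Let ww w := vh w - u.
Let stw w := step (fun j => ww w j 0).
Let rst w t := bh w t - beta t - stw w t.

Let ssw w : sqi mu I (stw w). Proof. exact: sqi_step. Qed.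
Let srst w : sqi mu I (rst w). Proof. by apply: (sqiB mI _ (ssw w)); exact: (sqiB mI (sbh w) sbeta). Qed.

Let qf0 x : 0 <= qf A x x.
Proof. by apply: le_trans (penalty_ge m0 mp hD x); rewrite sumr_ge0// => j _; exact: sqr_ge0. Qed.

Let pR : 0 < p%:R :> R. Proof. by rewrite ltr0n. Qed.

Let theta_penalty w : theta (ww w) <= c -> qf A (ww w) (ww w) / p%:R <= level.
Proof.
rewrite /level ler_pdivlMr// mulrC => h; apply: le_trans h; rewrite /theta_of lerDr.
by apply: sumr_ge0 => a _; rewrite mulr_ge0 ?sqr_ge0.
Qed.

Let theta_ssq w : theta (ww w) <= c -> dot mu I (stw w) (stw w) <= level.
Proof.
move=> h; apply: le_trans (theta_penalty h); apply: le_trans (ssq_penalty m0 mp hD _).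
by rewrite /stw dot_step// /ssq; under eq_bigr do rewrite -expr2.
Qed.

Let theta_rest w : theta (ww w) <= c -> dot mu I (rst w) (rst w) <= rest_level.
Proof.
move=> h; have hq := theta_penalty h.
have sv : sqi mu I (step (fun j => vh w j 0)) by exact: sqi_step.
have su : sqi mu I (step (fun j => u j 0)) by exact: sqi_step.
pose f1 t := bh w t - step (fun j => vh w j 0) t; pose f2 t := beta t - step (fun j => u j 0) t.
have s1 : sqi mu I f1 by exact: (sqiB mI (sbh w) sv).
have s2 : sqi mu I f2 by exact: (sqiB mI sbeta su).
have e12 t : I t -> f1 t - f2 t = rst w t.
  move=> _; rewrite /f1 /f2 /rst /stw /ww.
  rewrite (_ : step (fun j => (vh w - u) j 0) t = step (fun j => vh w j 0) t - step (fun j => u j 0) t); first by ring.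
  by rewrite -stepB; congr (step _ t); apply/funext => j; rewrite [LHS]mxE [X in _ + X]mxE.
have sd := sqiB mI s1 s2; have sp := sqiD mI s1 s2.
have d12 : dot mu I (fun t => f1 t - f2 t) (fun t => f1 t - f2 t) <= 2 * dot mu I f1 f1 + 2 * dot mu I f2 f2.
  have e1 : dot mu I (fun t => f1 t - f2 t) (fun t => f1 t - f2 t) + dot mu I (fun t => f1 t + f2 t) (fun t => f1 t + f2 t) =
      2 * dot mu I f1 f1 + 2 * dot mu I f2 f2.
    rewrite (dotDl mI s1 s2 sp) (dotDr mI s1 s2 s1) (dotDr mI s1 s2 s2) (dotBl mI s1 s2 sd) (dotBr mI s1 s2 s1) (dotBr mI s1 s2 s2).
    by rewrite (dotC mu I f2 f1); ring.
  by rewrite -e1 lerDl dot_ge0.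
rewrite (_ : dot mu I (rst w) (rst w) = dot mu I (fun t => f1 t - f2 t) (fun t => f1 t - f2 t)); last first.
  by apply: eq_dot => t It; rewrite e12.
apply: (le_trans d12); rewrite /rest_level; apply: lerD; rewrite ler_wpM2l//.
apply: (@le_trans _ _ (step_cst R m / p%:R * (2 / p%:R * qf A (vh w) (vh w)))).
  apply: (dot_step_le p0 (sbh w)) => j t /andP[t1 t2].
  rewrite beta_hatE//; apply: (spline_eval_step m0 mp hD).
  by rewrite (ltW t1).
have cst0 : 0 <= step_cst R m / p%:R.
  by rewrite divr_ge0// /step_cst addr_ge0// mulr_ge0// lagrange_cst_ge0.
rewrite ler_wpM2l//.
have q4 : qf A (vh w) (vh w) <= 2 * qf A (ww w) (ww w) + 2 * qf A u u.
  have -> : vh w = ww w + u by rewrite /ww subrK.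
  move: (ww w) => x; have := qf0 (x - u); rewrite !(qfBl, qfBr, qfDl, qfDr).
  move: (qf A x x) (qf A x u) (qf A u x) (qf A u u) => x1 x2 x3 x4; lra.
rewrite (_ : 2 / p%:R * _ = 2 * (qf A (vh w) (vh w) / p%:R)); last by ring.
rewrite (_ : 4 * _ = 2 * (2 * (level + U))); last by ring.
rewrite ler_wpM2l//; apply: (@le_trans _ _ ((2 * qf A (ww w) (ww w) + 2 * qf A u u) / p%:R)).
  by rewrite ler_wpM2r// invr_ge0.
rewrite mulrDl -!mulrA -mulrDr ler_wpM2l// lerD//.
Qed.

Local Notation xb w := (fun t => avg (fun k : 'I_N => V (lex_site k) w t)).

Let prediction_errorE w : (forall k : 'I_N, sqi mu I (V (lex_site k) w)) -> sqi mu I (V i0 w) ->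
  (forall k : 'I_N, Y (lex_site k) w = beta0 + ip beta (X (lex_site k) w) + e (lex_site k) w) ->
  prediction (X ^~ w) (Y ^~ w) n m rho D (X i0 w) - (beta0 + ip beta (X i0 w)) =
  avg (fun k : 'I_N => e (lex_site k) w) + dot mu I (fun t => stw w t + rst w t) (V i0 w) -
  dot mu I (fun t => stw w t + rst w t) (xb w).
Proof.
move=> sg s0 hm.
have sX i : sqi mu I (V i w) -> sqi mu I (X i w).
  by move=> si; apply: (eq_sqi _ _ (sqiD mI si smn)) => // t _; rewrite /centered subrK.
have sXg (k : 'I_N) := sX _ (sg k); have sX0 := sX _ s0.
have sXb : sqi mu I (Xbar (X ^~ w) n) by apply: (sqiZ mI); apply: sqi_sum.
have sxb : sqi mu I (xb w) by apply: (sqiZ mI); apply: sqi_sum.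
have sh : sqi mu I (fun t => bh w t - beta t) by exact: (sqiB mI (sbh w) sbeta).
have YE : Ybar (Y ^~ w) n = beta0 + dot mu I beta (Xbar (X ^~ w) n) + avg (fun k : 'I_N => e (lex_site k) w).
  rewrite /Ybar -/(avg (fun k : 'I_N => Y (lex_site k) w)) (eq_avg hm) !avgD avg_cst//; congr (_ + _ + _).
  rewrite (dotZr mI _ _ sbeta); last by apply: sqi_sum.
  by rewrite (dot_sumr mI _ _ sbeta)// => k; exact: sXg.
rewrite /prediction /beta0_hat YE.
rewrite (_ : dot mu I _ (V i0 w) = dot mu I (fun t => bh w t - beta t) (V i0 w)); last first.
  by apply: eq_dot => // t _; rewrite /rst addrC subrK.
rewrite (_ : dot mu I _ (xb w) = dot mu I (fun t => bh w t - beta t) (xb w)); last first.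
  by apply: eq_dot => // t _; rewrite /rst addrC subrK.
rewrite (dotBr mI sX0 smn sh).
rewrite (_ : dot mu I _ (xb w) = dot mu I (fun t => bh w t - beta t) (fun t => Xbar (X ^~ w) n t - mn t)); last first.
  apply: eq_dot => // t _; rewrite avgB avg_cst//.
rewrite (dotBr mI sXb smn sh) (dotBl mI (sbh w) sbeta sX0) (dotBl mI (sbh w) sbeta sXb).
have ipE f h : ip f h = dot mu I f h by [].
rewrite !ipE; ring.
Qed.


Variable al : R.
Local Notation Z := (fun i => pair_coord (X i) (Y i)).
Hypothesis al0 : 0 <= al.
Hypothesis hal : (alpha_mix P (sigma_field Z [set i0]) (sigma_field Z (@grid d n)) <= al%:E)%E.

Local Notation Zc := (fun ik : site d * option (@unit_interval R) => Z ik.1 ik.2).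
Local Notation Tg := (sigma_space (@grid d n `*` setT) Zc).
Local Notation T0 := (sigma_space ([set i0] `*` setT) Zc).

Let knI (j : 'I_p) : 0 <= (knot p j.+1 : R) <= 1.
Proof. by rewrite (knot_ge0 _ p0) (knot_le1 _ p0). Qed.
Let kI (j : 'I_p) : I (knot p j.+1). Proof. by rewrite /= in_itv/=. Qed.

Let mZ (L : set (site d)) (ik : site d * option (@unit_interval R)) : (L `*` setT) ik -> measurable_fun setT (Zc ik).
Proof.
case: ik => i [[t t01]|] _ /=; last exact: mY.
by apply: (jm_at (t := t)) => //; rewrite /= in_itv.
Qed.

Let coordX (L : set (site d)) i (j : 'I_p) : L i ->
  measurable_fun (setT : set (sigma_space (L `*` setT) Zc)) (X i ^~ (knot p j.+1)).
Proof.
move=> Li; pose t : @unit_interval R := exist (fun t : R => is_true (0 <= t <= 1)) (knot p j.+1) (knI j).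
exact: (@coord_measurable _ Omega R _ (L `*` setT) Zc (i, Some t) (conj Li Logic.I)).
Qed.

Let coordY (L : set (site d)) i : L i -> measurable_fun (setT : set (sigma_space (L `*` setT) Zc)) (Y i).
Proof. by move=> Li; exact: (coord_measurable (i := (i, None)) (F := Zc) (L := L `*` setT)). Qed.

Let mwG : mmx (T := Tg) ww.
Proof.
apply: mmxD; last exact: mmx_cst.
have h := @beta_hat_vec_measurable _ Tg R d n m p X Y rho D m0 mp hD rho0.
apply: h => [k j|k].
  by apply: coordX; exists k.
by apply: coordY; exists k.
Qed.

Definition good_event : set Omega := [set w | theta (ww w) <= c].

Let mgood_T dT (T : measurableType dT) (x : T -> 'cV[R]_p) : mmx x -> measurable [set w | theta (x w) <= c].
Proof.
move=> mx; rewrite (_ : [set w | _] = (fun w => theta (x w)) @^-1` `]-oo, c]%classic).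
  by rewrite -[_ @^-1` _]setTI; exact: (theta_measurable mx).
by apply/seteqP; split=> w /=; rewrite in_itv.
Qed.

Lemma good_event_measurable : measurable good_event.
Proof.
have mw : mmx ww.
  apply: mmxD; last exact: mmx_cst.
  by apply: beta_hat_vec_measurable => // k j; exact: jm_at.
exact: mgood_T.
Qed.

Let ind := \1_good_event : Omega -> R.
Let F a b w := ind w * (coefs zeta (ww w) a * coefs zeta (ww w) b).
Let G a b w := yscore p zeta M (V i0 w) a * yscore p zeta M (V i0 w) b.

Let level0 : 0 < level. Proof. exact: divr_gt0. Qed.

Let FE a b w : `|F a b w| <= level.
Proof.
rewrite /F /ind indicE; case: (boolP (w \in _)) => [/set_mem h|_]; last by rewrite mul0r normr0 ltW.
have ca a' : coefs zeta (ww w) a' ^+ 2 <= level.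
  apply: le_trans (theta_ssq h).
  apply: (le_trans (CS mI (ssw w) (sz a'))); rewrite one eqxx mulr1; exact.
have l0 := ltW level0.
rewrite mul1r normrM -ler_sqr ?nnegrE//.
by rewrite exprMn !real_normK ?num_real// [level ^+ 2]expr2; apply: ler_pM; rewrite ?sqr_ge0.
Qed.

Let GE a b w : `|G a b w| <= M ^+ 2.
Proof. by rewrite normrM expr2; apply: ler_pM => //; apply: clip_le; exact: ltW. Qed.

Let mF : forall a b, measurable_fun (setT : set Tg) (F a b).
Proof.
move=> a b; apply: measurable_funM.
  apply: measurable_indic; exact: (mgood_T mwG).
by apply: measurable_funM; exact: (coefs_measurable mwG).
Qed.

Let mG : forall a b, measurable_fun (setT : set T0) (G a b).
Proof.
have my a : measurable_fun (setT : set T0) (fun w => yscore p zeta M (V i0 w) a).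
  apply: (@yscore_measurable R zeta sz p M _ T0 (V i0)) => j.
  by apply: measurable_funB; [exact: coordX|exact: measurable_cst].
by move=> a b; apply: measurable_funM; exact: my.
Qed.

Let mF' a b : measurable_fun setT (F a b).
Proof. exact: (sigma_space_measurable (mZ (L := @grid d n))). Qed.
Let mG' a b : measurable_fun setT (G a b).
Proof. exact: (sigma_space_measurable (mZ (L := [set i0]))). Qed.

Let iF a b : itg P setT (F a b). Proof. exact: (@itg_bnd _ _ _ P _ level). Qed.
Let iFG a b : itg P setT (fun w => F a b w * G a b w).
Proof.
apply: (@itg_bnd _ _ _ P _ (level * M ^+ 2)); first exact: measurable_funM.
by move=> w; rewrite normrM ler_pM.
Qed.

Let E_FG a b : E (fun w => F a b w * G a b w) <=
  (a == b)%:R * (lam b * E (F a b)) + (level * (2 * M * z) + 4 * al * M ^+ 2 * level).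
Proof.
have M20 : 0 < M ^+ 2 by exact: exprn_gt0.
have hm := mix_E (mZ (L := [set i0])) (mZ (L := @grid d n)) (mG a b) (mF a b) M20 level0 (GE a b) (FE a b) hal.
have hy := E_yscore_prod g0 (jV i0) (@sV i0) (@hK i0) sz one eig p0 (ltW M0) z0 (VM i0) pz a b.
rewrite (eq_rint P (g := fun w => G a b w * F a b w)); last by move=> w _; rewrite mulrC.
have h1 := le_trans (ler_norm _) hm.
have Fl : `|E (F a b)| <= level.
  apply: (le_trans (le_abs_rint measurableT (iF a b))); rewrite -[leRHS](E_cst P).
  by apply: (le_rint measurableT (itg_abs (iF a b)) (itg_cst P level)) => w _; exact: FE.
have h2 : (E (G a b) - (a == b)%:R * lam b) * E (F a b) <= 2 * M * z * level.
  apply: (le_trans (ler_norm _)); rewrite normrM; apply: ler_pM => //.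
move: h1 h2; rewrite mulrBl.
move: (E _) (E (F a b)) (E (G a b)) => x f y.
rewrite (_ : (a == b)%:R * (lam b * f) = (a == b)%:R * lam b * f); last by ring.
rewrite (_ : level * (2 * M * z) = 2 * M * z * level); last by ring.
move: ((a == b)%:R * lam b * f) (2 * M * z * level) (4 * al * M ^+ 2 * level) => x1 x2 x3; lra.
Qed.

Let E_diag : \sum_(a < J) lam a * E (F a a) <= c.
Proof.
have -> : \sum_(a < J) lam a * E (F a a) = E (fun w => \sum_(a < J) lam a * F a a w).
  rewrite rint_sum//; last by move=> a _; exact: (itgZ measurableT _ (iF a a)).
  by apply: eq_bigr => a _; rewrite (rintZ measurableT _ (iF a a)).
rewrite -[leRHS](E_cst P); apply: le_rint => //; [|exact: itg_cst|].
  by apply: itg_sum => // a _; exact: (itgZ measurableT _ (iF a a)).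
move=> w _; rewrite /F /ind indicE; case: (boolP (w \in _)) => [/set_mem h|_]; last first.
  by rewrite big1 ?ltW// => a _; rewrite mul0r mulr0.
apply: le_trans h; rewrite /theta_of -[leLHS]addr0; apply: lerD.
  by apply: ler_sum => a _; rewrite mul1r expr2.
by rewrite mulr_ge0 ?(ltW rho0)// divr_ge0.
Qed.

Let SE w : ind w * (\sum_(a < J) dot mu I (stw w) (zeta a) * yscore p zeta M (V i0 w) a) ^+ 2 =
  \sum_(a < J) \sum_(b < J) F a b w * G a b w.
Proof.
rewrite expr2 big_distrlr/= mulr_sumr; apply: eq_bigr => a _; rewrite mulr_sumr; apply: eq_bigr => b _.
by rewrite /F /G /coefs /stw; ring.
Qed.

Let E_sum : itg P setT (fun w => \sum_(a < J) \sum_(b < J) F a b w * G a b w) /\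
  E (fun w => \sum_(a < J) \sum_(b < J) F a b w * G a b w) <=
  c + J%:R ^+ 2 * (level * (2 * M * z) + 4 * al * M ^+ 2 * level).
Proof.
have i1 (a : 'I_J) : itg P setT (fun w => \sum_(b < J) F a b w * G a b w) by apply: itg_sum.
split; first by apply: itg_sum.
rewrite rint_sum//; under eq_bigr => a _ do rewrite rint_sum//.
set k := level * _ + _.
apply: (@le_trans _ _ (\sum_(a < J) \sum_(b < J) ((a == b :> nat)%:R * (lam b * E (F a b)) + k))).
  by apply: ler_sum => a _; apply: ler_sum => b _; exact: E_FG.
rewrite (eq_bigr (fun a : 'I_J => lam a * E (F a a) + k *+ J)); last first.
  move=> a _; rewrite big_split/= sumr_const card_ord (bigD1 a)//= eqxx mul1r big1 ?addr0// => b.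
  by rewrite -val_eqE/= eq_sym => /negbTE ->; rewrite mul0r.
rewrite big_split/= sumr_const card_ord lerD//.
by rewrite -[leLHS]mulr_natl -[k *+ J]mulr_natl mulrA expr2.
Qed.

Definition prediction_bound : R :=
  3 * (L1 / N%:R) + 6 * rest_level * M ^+ 2 + 24 * level * trace_rest + 24 * level * (J%:R * z ^+ 2) +
  12 * (c + J%:R ^+ 2 * (level * (2 * M * z) + 4 * al * M ^+ 2 * level)) +
  6 * (level + rest_level) * (g 0 * L0 / N%:R).

(** On the good event the squared prediction error is small in mean: the
    estimated coefficients depend on the grid only, so that mixing decouples
    them from the scores of the curve at the new site. *)
Lemma prediction_error_bound :
  (\int[P]_(w in good_event) ((prediction (X ^~ w) (Y ^~ w) n m rho D (X i0 w) - (beta0 + ip beta (X i0 w))) ^+ 2)%:E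
   <= prediction_bound%:E)%E.
Proof.
pose W w := (prediction (X ^~ w) (Y ^~ w) n m rho D (X i0 w) - (beta0 + ip beta (X i0 w))) ^+ 2.
have mW : measurable_fun setT W.
  by apply: measurable_funX; apply: prediction_error_measurable => //; case: sbeta.
have [i1 e1] := E_mean_noise N0 (fun k => me (lex_site k)) M10 (fun k => eM (lex_site k)) e_sum.
have [i2 e2] := E_resid g0 (jV i0) (@sV i0) (@hK i0) sz one eig J.
have [i3 e3 _ _] := E_dist_step g0 (jV i0) (@sV i0) (@hK i0) p0 z0 pz.
have [i4 e4] := E_sum.
have lx := E_mean_curve N0 g0 (fun k => jV (lex_site k)) (fun k => @sV (lex_site k)) hpsi psi_sum.
have [ax i5 _] := l2p_norm lx; have e5 := l2p_normB lx.
have rl0 : 0 <= rest_level.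
  have h1 : 0 <= step_cst R m / p%:R by rewrite divr_ge0// /step_cst addr_ge0// mulr_ge0// lagrange_cst_ge0.
  have h2 : 0 <= 4 * (level + U) by rewrite mulr_ge0// addr_ge0 ?(ltW level0)// divr_ge0.
  apply: addr_ge0; first exact: (mulr_ge0 _ (mulr_ge0 h1 h2)).
  by apply: mulr_ge0 => //; exact: dot_ge0.
have l0 := ltW level0.
pose H w := 3 * avg (fun k : 'I_N => e (lex_site k) w) ^+ 2 + 6 * rest_level * M ^+ 2 +
  24 * level * resid mu I zeta (V i0 w) J + 24 * level * (J%:R * dist_step p (V i0 w)) +
  12 * (\sum_(a < J) \sum_(b < J) F a b w * G a b w) + 6 * (level + rest_level) * dot mu I (xb w) (xb w).
have j1 := itgZ measurableT 3 i1.
have j0 : itg P setT (fun=> 6 * rest_level * M ^+ 2) by exact: itg_cst.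
have j2 := itgZ measurableT (24 * level) i2.
have j3' := itgZ measurableT J%:R i3; have j3 := itgZ measurableT (24 * level) j3'.
have j4 := itgZ measurableT 12 i4; have j5 := itgZ measurableT (6 * (level + rest_level)) i5.
have k1 := itgD measurableT j1 j0; have k2 := itgD measurableT k1 j2.
have k3 := itgD measurableT k2 j3; have k4 := itgD measurableT k3 j4.
have iH : itg P setT H := itgD measurableT k4 j5.
have eH : E H <= prediction_bound.
  rewrite (rintD measurableT k4 j5) (rintD measurableT k3 j4) (rintD measurableT k2 j3) (rintD measurableT k1 j2) (rintD measurableT j1 j0).
  rewrite (rintZ measurableT _ i1) (rintZ measurableT _ i2) (rintZ measurableT _ j3') (rintZ measurableT _ i3) (rintZ measurableT _ i4) (rintZ measurableT _ i5) E_cst e2.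
  rewrite /prediction_bound; apply: lerD; last by rewrite ler_wpM2l// mulr_ge0// addr_ge0.
  apply: lerD; last by rewrite ler_wpM2l.
  have h24 : 0 <= 24 * level by exact: mulr_ge0.
  apply: lerD; last by rewrite (ler_wpM2l h24)// ler_wpM2l.
  by rewrite lerD2r lerD2r ler_wpM2l.
have WH : {ae P, forall w, setT w -> ind w * W w <= H w}.
  have aeVM := all_sites (fun k => VM (lex_site k)).
  have aem := all_sites (fun k => model (lex_site k)).
  apply: (aeS2 aeVM (_ : {ae P, forall w, (sqi mu I (V i0 w) /\ dot mu I (V i0 w) (V i0 w) <= M ^+ 2) /\
     forall k : 'I_N, Y (lex_site k) w = beta0 + ip beta (X (lex_site k) w) + e (lex_site k) w})).
    by apply: (aeS2 (VM i0) aem).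
  move=> w hV [[s0 b0] hm] _.
  have sxb : sqi mu I (xb w) by apply: (sqiZ mI); apply: sqi_sum => // k; have [] := hV k.
  have r0 := resid_ge0 mI sz one J s0; have d0 : 0 <= dist_step p (V i0 w) by exact: dot_ge0.
  have x0 := dot_ge0 mu I (xb w).
  rewrite /H -SE /ind indicE; case: (boolP (w \in _)) => [/set_mem h|_]; last first.
    rewrite !mul0r mulr0 addr0.
    have h1 := sqr_ge0 (avg (fun k : 'I_N => e (lex_site k) w)); have h2 := sqr_ge0 M.
    move: h1 h2 r0 d0 x0 rl0 l0.
    move: (avg _ ^+ 2) (M ^+ 2) (resid _ _ _ _ _) (dist_step _ _) (dot _ _ _ _) rest_level level => x1 x2 x3 x4 x5 x6 x7.
    move=> *; have J0 : 0 <= (J%:R : R) by [].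
    by rewrite !addr_ge0// !mulr_ge0// addr_ge0.
  rewrite !mul1r /W prediction_errorE//; last by move=> k; have [] := hV k.
  have es := @error_split R p J zeta sz one (stw w) (rst w) (V i0 w) (xb w) M level rest_level (avg (fun k : 'I_N => e (lex_site k) w)).
  exact: (es (ltW M0) (ssw w) (srst w) s0 sxb (theta_ssq h) (theta_rest h) b0).
have iW : measurable_fun setT (fun w => (ind w * W w)%:E).
  apply/measurable_EFinP; apply: measurable_funM => //.
  by apply: measurable_indic; exact: good_event_measurable.
apply: (@le_trans _ _ (\int[P]_w (ind w * W w)%:E)%E).
  rewrite integral_mkcond le_eqVlt; apply/orP; left; apply/eqP; apply: eq_integral => w _.
  by rewrite /patch /ind indicE; case: ifP => _; rewrite ?mul1r ?mul0r.
have iI : itg P setT (fun w => ind w * W w).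
  apply: (itg_ae_le measurableT (g := H)) => //; first exact/measurable_EFinP.
  apply: (aeS WH) => w h _; rewrite ger0_norm; first exact: h.
  by rewrite mulr_ge0 ?sqr_ge0// /ind indicE; case: (_ \in _).
rewrite -(EFin_rint measurableT iI) lee_fin; apply: le_trans eH.
exact: (ae_le_rint measurableT iI iH WH).
Qed.

End sample.

(** * Rates *)

(** In the lemmas on rates [N] is the number of sites, [J] the integer part of its
    square root, [T] the effective dimension, [tau] the trace left by the first [J]
    eigenvalues and [z] the discretisation error of the curves. Everything is
    compared with [(N * rho)^-1]. *)

Section rates.
Variable R : realType.
Implicit Types (N b r z S K : R).

Lemma main_rate (N J rho om g0 su z L1 T tau M1 S : R) :
  1 <= N -> 0 <= J -> J <= N -> N <= (J + 1) ^+ 2 -> 0 < rho -> rho <= 1 ->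
  0 <= om -> om * N <= 1 -> 0 <= g0 -> 0 <= su -> 0 <= z -> z * N ^+ 2 <= 1 -> 0 <= L1 ->
  0 <= T -> T <= S ^+ 2 / (2 * Num.sqrt rho) -> tau <= S ^+ 4 / (J + 1) ^+ 3 ->
  8 * (2 * om * g0 + 2 * su * z ^+ 2) + 64 * (2 * L1 / N * (T + J * z ^+ 2 / rho)) +
  32 * M1 ^+ 2 / rho * (3 * (tau + (J + 1) * z ^+ 2)) + 8 * (L1 / N) <=
  (16 * g0 + 16 * su + 64 * L1 * S ^+ 2 + 128 * L1 + 96 * M1 ^+ 2 * (S ^+ 4 + 2) + 8 * L1) * (N * rho)^-1.
Proof.
move=> N1 J0 JN NJ r0 r1 o0 oN g00 su0 z0 zN L10 T0 TS tS.
have N0 : 0 < N by exact: lt_le_trans N1.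
have Nr : 0 < N * rho by exact: mulr_gt0.
rewrite ler_pdivlMr//.
have z2 : z ^+ 2 * N ^+ 4 <= 1.
  have -> : z ^+ 2 * N ^+ 4 = (z * N ^+ 2) ^+ 2 by ring.
  by rewrite expr_le1// mulr_ge0// sqr_ge0.
have z20 : 0 <= z ^+ 2 by exact: sqr_ge0.
have NN : N <= N ^+ 4 by rewrite -[leLHS]expr1 ler_weXn2l.
have NN2 : N ^+ 2 <= N ^+ 4 by rewrite ler_weXn2l.
have zN1 : z ^+ 2 * N <= 1 by apply: le_trans z2; rewrite ler_wpM2l.
have zN2 : z ^+ 2 * N ^+ 2 <= 1 by apply: le_trans z2; rewrite ler_wpM2l.
have zJ : J * z ^+ 2 <= 1 by apply: le_trans zN1; rewrite mulrC ler_wpM2l.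
have J1 : 0 < J + 1 by rewrite ltr_wpDl.
have tN : N * tau <= S ^+ 4.
  apply: (@le_trans _ _ (N * (S ^+ 4 / (J + 1) ^+ 3))); first by rewrite ler_wpM2l// ltW.
  rewrite mulrA ler_pdivrMr ?exprn_gt0// mulrC ler_wpM2l ?exprn_even_ge0//.
  apply: (le_trans NJ); rewrite ler_weXn2l//; lra.
have sr0 : 0 < Num.sqrt rho by rewrite sqrtr_gt0.
have sr1 : Num.sqrt rho <= 1 by rewrite -sqrtr1 ler_wsqrtr.
have rT : rho * T <= S ^+ 2 / 2.
  apply: (@le_trans _ _ (rho * (S ^+ 2 / (2 * Num.sqrt rho)))); first by rewrite ler_wpM2l// ltW.
  rewrite -{1}(sqr_sqrtr (ltW r0)) (_ : _ ^+ 2 * _ = Num.sqrt rho * (S ^+ 2 / 2)); last first.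
    by field; rewrite gt_eqF.
  by rewrite ler_piMl// mulr_ge0 ?sqr_ge0.
pose t1 := 16 * g0 * ((om * N) * rho); pose t2 := 16 * su * ((z ^+ 2 * N) * rho).
pose t3 := 128 * L1 * (rho * T); pose t4 := 128 * L1 * (J * z ^+ 2).
pose t5 := 96 * M1 ^+ 2 * (N * tau + (N * J + N) * z ^+ 2); pose t6 := 8 * L1 * rho.
have -> : (8 * (2 * om * g0 + 2 * su * z ^+ 2) + 64 * (2 * L1 / N * (T + J * z ^+ 2 / rho)) +
  32 * M1 ^+ 2 / rho * (3 * (tau + (J + 1) * z ^+ 2)) + 8 * (L1 / N)) * (N * rho) =
  t1 + t2 + t3 + t4 + t5 + t6.
  by rewrite /t1 /t2 /t3 /t4 /t5 /t6; field; rewrite !gt_eqF.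
have h1 : t1 <= 16 * g0.
  by rewrite ler_piMr ?mulr_ge0// mulr_ile1 ?mulr_ge0// ltW.
have h2 : t2 <= 16 * su.
  by rewrite ler_piMr ?mulr_ge0// mulr_ile1 ?mulr_ge0// ltW.
have h3 : t3 <= 64 * L1 * S ^+ 2.
  by rewrite (_ : 64 * L1 * S ^+ 2 = 128 * L1 * (S ^+ 2 / 2)) ?ler_wpM2l ?mulr_ge0//; field.
have h4 : t4 <= 128 * L1 by rewrite ler_piMr// mulr_ge0.
have h5 : t5 <= 96 * M1 ^+ 2 * (S ^+ 4 + 2).
  have M12 : 0 <= 96 * M1 ^+ 2 by rewrite mulr_ge0// sqr_ge0.
  rewrite /t5 (ler_wpM2l M12)// lerD//.
  apply: (@le_trans _ _ (2 * (z ^+ 2 * N ^+ 2))); last by rewrite -[leRHS]mulr1 ler_wpM2l.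
  rewrite (_ : 2 * _ = 2 * N ^+ 2 * z ^+ 2); last by ring.
  rewrite ler_wpM2r//.
  have : N * J <= N * N by rewrite ler_wpM2l// ltW.
  have : N * 1 <= N * N by rewrite ler_wpM2l// ltW.
  by rewrite expr2; lra.
have h6 : t6 <= 8 * L1 by rewrite ler_piMr ?mulr_ge0.
by rewrite !lerD.
Qed.

Lemma gram_rate (N J rho g0 z tau M L0 S : R) :
  1 <= N -> 0 <= J -> J ^+ 2 <= N -> N <= (J + 1) ^+ 2 -> 0 < rho -> rho^-1 <= 2 * N ->
  0 <= g0 -> 0 <= z -> z * N ^+ 4 <= 1 -> 0 <= M -> 0 <= L0 -> 0 <= tau -> tau <= S ^+ 4 / (J + 1) ^+ 3 ->
  2 / rho * (3 * (tau + (J + 1) * z ^+ 2)) + 2 / rho * (g0 * L0 / N) + rho^-1 * (J ^+ 2 * (2 * M * z)) <=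
  (12 * S ^+ 4 + 48 + 2 * g0 * L0 + 8 * M) * ((J + 1)^-1 + (N * rho)^-1).
Proof.
move=> N1 J0 JN NJ r0 r1 g00 z0 zN M0 L00 tau0 tS.
have N0 : 0 < N by exact: lt_le_trans N1.
have J1 : 0 < J + 1 by rewrite ltr_wpDl.
have i0 : 0 <= (J + 1)^-1 by rewrite invr_ge0 ltW.
have b0 : 0 <= (N * rho)^-1 by rewrite invr_ge0 mulr_ge0// ltW.
have ri0 : 0 <= rho^-1 by rewrite invr_ge0 ltW.
have JN1 : J <= N.
  have [J2|J2] := leP J 1; first exact: le_trans N1.
  by apply: le_trans JN; rewrite expr2 ler_peMl// ltW.
have tN : rho^-1 * tau <= 2 * (S ^+ 4 / (J + 1)).
  apply: (@le_trans _ _ (2 * N * (S ^+ 4 / (J + 1) ^+ 3))); first by apply: ler_pM.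
  rewrite -mulrA ler_wpM2l// mulrA ler_pdivrMr ?exprn_gt0//.
  rewrite (_ : S ^+ 4 / (J + 1) * _ = S ^+ 4 * (J + 1) ^+ 2); last by field; rewrite gt_eqF.
  by rewrite mulrC ler_wpM2l ?exprn_even_ge0.
have Ni : N^-1 <= 2 / (J + 1).
  by rewrite ler_pdivlMr// mulrC ler_pdivrMr//; lra.
have zi : z <= (N ^+ 4)^-1 by rewrite -[leRHS]div1r ler_pdivlMr ?exprn_gt0.
have z1 : z <= 1 by apply: (le_trans zi); rewrite invf_le1 ?exprn_gt0// exprn_ege1.
have z2 : z ^+ 2 <= (N ^+ 4)^-1.
  by apply: le_trans zi; rewrite expr2 ler_piMr.
have zJ : rho^-1 * ((J + 1) * z ^+ 2) <= 8 / (J + 1).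
  apply: (@le_trans _ _ (2 * N * (2 * N * (N ^+ 4)^-1))).
    apply: ler_pM => //; first by rewrite mulr_ge0 ?sqr_ge0// ltW.
    by apply: ler_pM; rewrite ?sqr_ge0 ?(ltW J1)//; lra.
  rewrite (_ : 2 * N * _ = 4 * (N^-1 * N^-1)); last by field; rewrite gt_eqF.
  rewrite (_ : 8 / (J + 1) = 4 * (2 / (J + 1) * 1)); last by rewrite mulr1 mulrA; congr (_ / _); ring.
  by rewrite ler_wpM2l// ler_pM ?invr_ge0 ?(ltW N0)// invf_le1.
have zM : rho^-1 * (J ^+ 2 * (2 * M * z)) <= 8 * M / (J + 1).
  apply: (@le_trans _ _ (2 * N * (N * (2 * M * (N ^+ 4)^-1)))).
    apply: ler_pM => //; first by rewrite mulr_ge0 ?sqr_ge0// !mulr_ge0.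
    by apply: ler_pM; rewrite ?sqr_ge0 ?mulr_ge0// ler_wpM2l// mulr_ge0.
  rewrite (_ : 2 * N * _ = 4 * M * (N^-1 * N^-1)); last by field; rewrite gt_eqF.
  rewrite (_ : 8 * M / (J + 1) = 4 * M * (2 / (J + 1) * 1)); last by rewrite mulr1 mulrA; congr (_ / _); ring.
  by rewrite ler_wpM2l ?mulr_ge0// ler_pM ?invr_ge0 ?(ltW N0)// invf_le1.
have -> : 2 / rho * (3 * (tau + (J + 1) * z ^+ 2)) + 2 / rho * (g0 * L0 / N) + rho^-1 * (J ^+ 2 * (2 * M * z)) =
  6 * (rho^-1 * tau) + 6 * (rho^-1 * ((J + 1) * z ^+ 2)) + 2 * g0 * L0 * (N * rho)^-1 + rho^-1 * (J ^+ 2 * (2 * M * z)).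
  by field; rewrite !gt_eqF.
apply: (@le_trans _ _ ((12 * S ^+ 4 + 48 + 8 * M) * (J + 1)^-1 + 2 * g0 * L0 * (N * rho)^-1)).
  rewrite (_ : (12 * S ^+ 4 + 48 + 8 * M) * (J + 1)^-1 = 6 * (2 * (S ^+ 4 / (J + 1))) + 6 * (8 / (J + 1)) + 8 * M / (J + 1)); last by ring.
  move: tN zJ zM; move: (rho^-1 * tau) (rho^-1 * _) (rho^-1 * _) (S ^+ 4 / _) (8 / _) (8 * M / _) (2 * g0 * L0 * _) => *; lra.
have S40 : 0 <= S ^+ 4 by exact: exprn_even_ge0.
have gL : 0 <= 2 * g0 * L0 by rewrite !mulr_ge0.
have c0 : 0 <= 12 * S ^+ 4 + 48 + 8 * M by move: S40 M0; move: (S ^+ 4) => *; lra.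
rewrite (_ : _ + 48 + 2 * g0 * L0 + _ = (12 * S ^+ 4 + 48 + 8 * M) + 2 * g0 * L0); last by ring.
move: i0 b0 c0 gL; move: (J + 1)^-1 (N * rho)^-1 (12 * S ^+ 4 + 48 + 8 * M) (2 * g0 * L0) => x y c G x0 y0 c0 G0.
have := mulr_ge0 c0 y0; have := mulr_ge0 G0 x0; nra.
Qed.

Lemma score_rate (N J rho C3 T S : R) : 1 <= N -> 0 <= J -> 0 < rho -> 0 <= C3 -> 0 <= T ->
  T <= S ^+ 2 / (2 * Num.sqrt rho) ->
  C3 / N * T ^+ 2 <= C3 * S ^+ 4 * ((J + 1)^-1 + (N * rho)^-1).
Proof.
move=> N1 J0 r0 C0 T0 TS.
have N0 : 0 < N by exact: lt_le_trans N1.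
have J1 : 0 < J + 1 by rewrite ltr_wpDl.
have s0 : 0 < Num.sqrt rho by rewrite sqrtr_gt0.
have T2 : T ^+ 2 <= S ^+ 4 / rho.
  apply: (@le_trans _ _ ((S ^+ 2 / (2 * Num.sqrt rho)) ^+ 2)).
    by rewrite ler_sqr ?nnegrE// (le_trans T0).
  rewrite -[X in _ <= _ / X](sqr_sqrtr (ltW r0)) (_ : (S ^+ 2 / _) ^+ 2 = 4^-1 * (S ^+ 4 / Num.sqrt rho ^+ 2)); last first.
    by field; rewrite gt_eqF.
  by rewrite ler_piMl ?invf_le1 ?ler1n// divr_ge0 ?exprn_even_ge0.
apply: (@le_trans _ _ (C3 / N * (S ^+ 4 / rho))); first by rewrite ler_wpM2l// divr_ge0// ltW.
rewrite (_ : C3 / N * _ = C3 * S ^+ 4 * (N * rho)^-1); last by field; rewrite !gt_eqF.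
have S40 : 0 <= S ^+ 4 by exact: exprn_even_ge0.
have CS : 0 <= C3 * S ^+ 4 by exact: mulr_ge0.
by rewrite (ler_wpM2l CS)// lerDr invr_ge0 ltW.
Qed.

Lemma prediction_rate (N J rho L1 K rl M tau z S al Ca Kr g0 L0 : R) :
  let b := (N * rho)^-1 in let c := K * b in let lv := c / rho in
  1 <= N -> 0 <= J -> J ^+ 2 <= N -> N <= (J + 1) ^+ 2 -> 0 < rho -> rho <= 1 -> rho^-1 <= 2 * N -> b <= 1 ->
  0 <= L1 -> 0 <= K -> 0 <= rl -> rl <= Kr / N -> 0 <= M -> 0 <= tau -> tau <= S ^+ 4 / (J + 1) ^+ 3 ->
  0 <= z -> z * N ^+ 4 <= 1 -> 0 <= al -> al <= Ca / N ^+ 2 -> 0 <= g0 -> 0 <= L0 ->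
  3 * (L1 / N) + 6 * rl * M ^+ 2 + 24 * lv * tau + 24 * lv * (J * z ^+ 2) +
  12 * (c + J ^+ 2 * (lv * (2 * M * z) + 4 * al * M ^+ 2 * lv)) + 6 * (lv + rl) * (g0 * L0 / N) <=
  (3 * L1 + 6 * Kr * M ^+ 2 + 48 * K * S ^+ 4 + 48 * K + 12 * K + 48 * K * M + 96 * Ca * K * M ^+ 2 +
    6 * (K + Kr) * (g0 * L0)) * b.
Proof.
move=> b c lv N1 J0 JN NJ r0 r1 ri b1 L10 K0 rl0 rlK M0 t0 tS z0 zN al0 alC g00 L00.
have N0 : 0 < N by exact: lt_le_trans N1.
have J1 : 0 < J + 1 by rewrite ltr_wpDl.
have b0 : 0 < b by rewrite invr_gt0 mulr_gt0.
have ri0 : 0 <= rho^-1 by rewrite invr_ge0 ltW.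
have JN1 : J <= N.
  have [J2|J2] := leP J 1; first exact: le_trans N1.
  by apply: le_trans JN; rewrite expr2 ler_peMl// ltW.
have Nb : N^-1 <= b by rewrite /b lef_pV2 ?posrE ?mulr_gt0// ler_piMr// ltW.
have Kr0 : 0 <= Kr by have := le_trans rl0 rlK; rewrite pmulr_lge0// invr_gt0.
have rlb : rl <= Kr * b by apply: (le_trans rlK); rewrite ler_wpM2l.
have c0 : 0 <= c by rewrite mulr_ge0// ltW.
have lvN : lv <= c * (2 * N) by rewrite /lv ler_wpM2l.
have lv0 : 0 <= lv by rewrite divr_ge0// ltW.
have lvb : lv / N = c * b by rewrite /lv /b; field; rewrite !gt_eqF.
have cE : c = K * b by [].
clearbody lv; clearbody c; clearbody b.
have zi : z <= (N ^+ 4)^-1 by rewrite -[leRHS]div1r ler_pdivlMr ?exprn_gt0.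
have z1 : z <= 1 by apply: (le_trans zi); rewrite invf_le1 ?exprn_gt0// exprn_ege1.
have z2 : z ^+ 2 <= (N ^+ 4)^-1.
  by apply: le_trans zi; rewrite expr2 ler_piMr.
have z20 : 0 <= z ^+ 2 by exact: sqr_ge0.
have J20 : 0 <= J ^+ 2 by exact: sqr_ge0.
have M20 : 0 <= M ^+ 2 by exact: sqr_ge0.
have bl0 := ltW b0.
have h1 : 3 * (L1 / N) <= 3 * L1 * b by rewrite -mulrA ler_wpM2l// ler_wpM2l.
have h2 : 6 * rl * M ^+ 2 <= 6 * Kr * M ^+ 2 * b.
  rewrite (_ : 6 * Kr * M ^+ 2 * b = 6 * (Kr * b) * M ^+ 2); last by ring.
  by rewrite ler_wpM2r ?sqr_ge0// ler_wpM2l.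
have h3 : 24 * lv * tau <= 48 * K * S ^+ 4 * b.
  apply: (@le_trans _ _ (24 * (c * (2 * N)) * (S ^+ 4 / (J + 1) ^+ 3))).
    by apply: ler_pM => //; [exact: mulr_ge0|rewrite ler_wpM2l].
  rewrite (_ : 24 * _ * _ = 48 * K * b * S ^+ 4 * (N / (J + 1) ^+ 3)); last by rewrite cE; ring.
  rewrite (_ : 48 * K * S ^+ 4 * b = 48 * K * b * S ^+ 4); last by ring.
  have c1 : 0 <= 48 * K * b * S ^+ 4 by rewrite mulr_ge0 ?exprn_even_ge0// !mulr_ge0// ltW.
  rewrite (ler_piMr c1)// ler_pdivrMr ?exprn_gt0// mul1r.
  by apply: (le_trans NJ); rewrite ler_weXn2l//; lra.
have h4 : 24 * lv * (J * z ^+ 2) <= 48 * K * b.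
  apply: (@le_trans _ _ (24 * (c * (2 * N)) * (N * (N ^+ 4)^-1))).
    by apply: ler_pM; [exact: mulr_ge0|exact: mulr_ge0|rewrite ler_wpM2l|apply: ler_pM].
  rewrite (_ : 24 * _ * _ = 48 * K * b * (N^-1 * N^-1)); last by rewrite cE; field; rewrite gt_eqF.
  rewrite ler_piMr//; first by rewrite !mulr_ge0// ltW.
  apply: mulr_ile1; rewrite ?invr_ge0 ?(ltW N0)// invf_le1//.
have h5 : 12 * (J ^+ 2 * (lv * (2 * M * z))) <= 48 * K * M * b.
  apply: (@le_trans _ _ (12 * (N * (c * (2 * N) * (2 * M * (N ^+ 4)^-1))))).
    rewrite ler_wpM2l//; apply: ler_pM => //; first by rewrite mulr_ge0// mulr_ge0// mulr_ge0.
    apply: ler_pM => //; first by rewrite mulr_ge0// mulr_ge0.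
    by rewrite ler_wpM2l// mulr_ge0.
  rewrite (_ : 12 * _ = 48 * K * M * b * (N^-1 * N^-1)); last by rewrite cE; field; rewrite gt_eqF.
  rewrite ler_piMr//; first by rewrite !mulr_ge0// ltW.
  apply: mulr_ile1; rewrite ?invr_ge0 ?(ltW N0)// invf_le1//.
have h6 : 12 * (J ^+ 2 * (4 * al * M ^+ 2 * lv)) <= 96 * Ca * K * M ^+ 2 * b.
  apply: (@le_trans _ _ (12 * (N * (4 * (Ca / N ^+ 2) * M ^+ 2 * (c * (2 * N)))))).
    rewrite ler_wpM2l//; apply: ler_pM => //; first by rewrite !mulr_ge0.
    by apply: ler_pM => //; [rewrite !mulr_ge0|rewrite ler_wpM2r// ler_wpM2l].
  by rewrite (_ : 12 * _ = 96 * Ca * K * M ^+ 2 * b)//; rewrite cE; field; rewrite gt_eqF.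
have gL : 0 <= g0 * L0 by exact: mulr_ge0.
have h7 : 6 * (lv + rl) * (g0 * L0 / N) <= 6 * (K + Kr) * (g0 * L0) * b.
  rewrite (_ : 6 * (lv + rl) * _ = 6 * (g0 * L0) * ((lv + rl) / N)); last by ring.
  rewrite (_ : 6 * (K + Kr) * _ * b = 6 * (g0 * L0) * ((K + Kr) * b)); last by ring.
  rewrite ler_wpM2l ?mulr_ge0// mulrDl mulrDl lerD//.
    rewrite lvb.
    by rewrite cE ler_piMr// mulr_ge0// ltW.
  apply: le_trans rlb; rewrite ler_piMr// invf_le1//.
have -> : 3 * (L1 / N) + 6 * rl * M ^+ 2 + 24 * lv * tau + 24 * lv * (J * z ^+ 2) +
  12 * (c + J ^+ 2 * (lv * (2 * M * z) + 4 * al * M ^+ 2 * lv)) + 6 * (lv + rl) * (g0 * L0 / N) =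
  3 * (L1 / N) + 6 * rl * M ^+ 2 + 24 * lv * tau + 24 * lv * (J * z ^+ 2) + 12 * c +
  12 * (J ^+ 2 * (lv * (2 * M * z))) + 12 * (J ^+ 2 * (4 * al * M ^+ 2 * lv)) + 6 * (lv + rl) * (g0 * L0 / N) by ring.
have -> : (3 * L1 + 6 * Kr * M ^+ 2 + 48 * K * S ^+ 4 + 48 * K + 12 * K + 48 * K * M + 96 * Ca * K * M ^+ 2 +
    6 * (K + Kr) * (g0 * L0)) * b =
  3 * L1 * b + 6 * Kr * M ^+ 2 * b + 48 * K * S ^+ 4 * b + 48 * K * b + 12 * c + 48 * K * M * b +
  96 * Ca * K * M ^+ 2 * b + 6 * (K + Kr) * (g0 * L0) * b by rewrite cE; ring.
by do 6![apply: lerD => //]; apply: lerD.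
Qed.

End rates.

(** * Smoothness of the slope, and remoteness of the new site *)

Section conversions.
Variable R : realType.
Notation mu := (@lebesgue_measure R).
Local Notation I := (`[0, 1]%classic : set R).
Let mI : measurable (I : set (measurableTypeR R)). Proof. exact: measurable_itv. Qed.

Lemma derivative01_deriv_on (f f' : R -> R) : derivative01 f f' -> deriv_on 0 1 f f'.
Proof.
move=> h t t01 z z0; have /h : t \in `[0, 1] by rewrite in_itv.
move=> /cvgrPdist_le/(_ z z0); rewrite /within /= => hn.
have [dl dl0 hd] : exists2 dl : R, 0 < dl & forall s, `|t - s| < dl -> s != t -> I s -> `|f' t - (f s - f t) / (s - t)| <= z.
  by case: hn => dl /= dl0 hd; exists dl => // s st sn Is; exact: (hd s st sn Is).
exists dl => // s s01 st; have [->|sn] := eqVneq s t; first by rewrite !subrr mulr0 subr0 normr0 mulr0.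
have := hd s; rewrite distrC => /(_ st sn).
have Is : I s by rewrite /= in_itv.
move=> /(_ Is) hz; have st0 : s - t != 0 by rewrite subr_eq0.
rewrite (_ : f s - f t - f' t * (s - t) = - ((f' t - (f s - f t) / (s - t)) * (s - t))); last by field.
by rewrite normrN normrM ler_wpM2r.
Qed.

(** Heine's theorem, in the form needed to sample a function at the knots. *)
Lemma uniform_modulus (f : R -> R) z : 0 < z ->
  (forall t, 0 <= t <= 1 -> forall z : R, 0 < z -> exists2 dl : R, 0 < dl &
    forall s, 0 <= s <= 1 -> `|s - t| < dl -> `|f s - f t| <= z) ->
  exists2 dl : R, 0 < dl & forall s t, 0 <= s <= 1 -> 0 <= t <= 1 -> `|s - t| < dl -> `|f s - f t| <= z.
Proof.
move=> z0 hf.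
have cK : compact I by exact: segment_compact.
pose Q (dl x : R) := I x -> forall s, 0 <= s <= 1 -> `|s - x| < dl -> `|f s - f x| <= z.
have : \forall dl \near 0^'+, I `<=` Q dl.
  apply: (proj1 (compact_near_coveringP I) cK) => x; rewrite /= in_itv/= => Ix.
  have z20 : 0 < z / 2 by exact: divr_gt0.
  have [dl dl0 h] := hf x Ix _ z20.
  exists (ball x (dl / 2), [set e : R | e < dl / 2]) => /=.
    split; first by apply: nbhsx_ballx; exact: divr_gt0.
    by apply: nbhs_right_lt; exact: divr_gt0.
  move=> -[y e] /= [yb ey]; rewrite /Q /= in_itv/= => Iy s Is sy.
  have yx : `|y - x| < dl / 2 by rewrite distrC.
  have sx : `|s - x| < dl.
    rewrite (_ : s - x = (s - y) + (y - x)); last by ring.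
    by apply: (le_lt_trans (ler_normD _ _)); have := lt_trans sy ey; lra.
  have h1 := h s Is sx.
  have h2 : `|y - x| < dl by apply: lt_trans yx _; lra.
  have h3 := h y Iy h2.
  rewrite (_ : f s - f y = (f s - f x) - (f y - f x)); last by ring.
  by apply: (le_trans (ler_normB _ _)); lra.
rewrite near_withinE /= => -[dl /= dl0 hd].
exists (dl / 2); first exact: divr_gt0.
move=> s t s01 t01 st; have dl20 : 0 < dl / 2 by exact: divr_gt0.
have It : I t by rewrite /= in_itv.
apply: (hd (dl / 2) _ dl20 t It It s s01 st) => /=.
by rewrite sub0r normrN gtr0_norm//; lra.
Qed.

Lemma slope_step_error (beta : R -> R) z : 0 < z -> sqi mu I beta ->
  (forall t, 0 <= t <= 1 -> forall z : R, 0 < z -> exists2 dl : R, 0 < dl &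
    forall s, 0 <= s <= 1 -> `|s - t| < dl -> `|beta s - beta t| <= z) ->
  exists P0 : nat, forall p, (P0 <= p)%N -> om p beta <= z.
Proof.
move=> z0 sb cb; have sz0 : 0 < Num.sqrt z by rewrite sqrtr_gt0.
have [dl dl0 h] := uniform_modulus sz0 cb.
exists (Num.truncn dl^-1).+1 => p hp.
have p0 : (0 < p)%N by apply: leq_trans hp.
have pd : p%:R^-1 < dl.
  by rewrite invf_plt ?posrE ?ltr0n//; apply: lt_le_trans (truncnS_gt _) _; rewrite ler_nat.
rewrite /om; apply: (dot_step_le p0 sb) => j t jt.
rewrite !mxE -(sqr_sqrtr (ltW z0)) -real_normK ?num_real// ler_sqr ?nnegrE ?sqrtr_ge0//.
case/andP: jt => j1 j2; apply: h.
- by rewrite (le_trans _ (ltW j1)) ?knot_ge0//= (le_trans j2)// knot_le1.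
- by rewrite knot_ge0//= knot_le1.
- by rewrite distrC ger0_norm ?subr_ge0//; apply: le_lt_trans pd; rewrite -(knot_diff R p j); lra.
Qed.

Lemma partial_sums_bounded (f : nat -> R) m0 : (forall i, (m0 <= i)%N -> 0 <= f i) ->
  (\sum_(m0 <= i <oo) (f i)%:E < +oo)%E -> exists B : R, forall n, \sum_(m0 <= i < n) f i <= B.
Proof.
move=> f0 hs; exists (fine (\sum_(m0 <= i <oo) (f i)%:E)%E) => n.
have h : (\sum_(m0 <= i < n) (f i)%:E <= \sum_(m0 <= i <oo) (f i)%:E)%E.
  by apply: nneseries_lim_ge => i mi _; rewrite lee_fin f0.
rewrite -lee_fin -sumEFin (le_trans h)// fineK// ge0_fin_numE//.
by apply: nneseries_ge0 => i mi _; rewrite lee_fin f0.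
Qed.

End conversions.

Section far_site.
Context dO (Omega : measurableType dO) (R : realType) (P : probability Omega R).
Variables (d : nat) (K : Type) (Z : site d -> K -> Omega -> R) (theta : R) (i0 : nat -> site d).

(** The power [theta] of the distance [n ^ (2 * d / theta)] is the squared number of
    sites. *)
Lemma far_site_mixing : (0 < d)%N -> d%:R < theta -> mixing_rate P Z theta ->
  (forall n, (1 <= n)%N -> (Num.floor (n%:R `^ (2 * d%:R / theta)))%:~R <= delta [set i0 n] (@grid d n) :> R) ->
  exists Ca : R, 0 < Ca /\ exists n1 : nat, forall n, (n1 <= n)%N -> (1 <= n)%N ->
    (alpha_mix P (sigma_field Z [set i0 n]) (sigma_field Z (@grid d n)) <= (Ca / (n ^ d)%:R ^+ 2)%:E)%E.
Proof.
move=> d0 dth /alpha_bound[C [C0 [u0 [u00 hC]]]] H9.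
have th0 : 0 < theta by apply: le_lt_trans dth.
pose k : R := 2 * d%:R / theta.
have k0 : 0 < k by rewrite divr_gt0// mulr_gt0// ltr0n.
exists (C * 2 `^ theta); split; first by rewrite mulr_gt0// powR_gt0.
exists (Num.truncn ((2 * u0) `^ k^-1)).+1 => n n1 n0.
have nR : 1 <= n%:R :> R by rewrite ler1n.
have nk : 2 * u0 <= n%:R `^ k.
  have u2 : 0 <= 2 * u0 by rewrite mulr_ge0// ltW.
  have -> : 2 * u0 = ((2 * u0) `^ k^-1) `^ k.
    by rewrite -powRrM mulVf ?gt_eqF// powRr1.
  apply: ge0_ler_powR; rewrite ?nnegrE ?powR_ge0 ?(ltW k0)//.
  by apply: ltW; apply: lt_le_trans (truncnS_gt _) _; rewrite ler_nat.
have nk1 : 1 <= n%:R `^ k.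
  by rewrite -[leLHS](powRr0 (n%:R : R)) ler_powR// ltW.
pose u : R := (Num.floor (n%:R `^ k))%:~R.
have hu : n%:R `^ k / 2 <= u.
  have f1 := floorD1_gt (n%:R `^ k); have f2 : 1 <= u.
    by rewrite /u -[1]/(1%:~R) ler_int floor_ge_int.
  by move: f1; rewrite intrD -/u; lra.
have u0u : u0 <= u by apply: le_trans hu; lra.
have ud : u <= delta (@grid d n) [set i0 n] by rewrite deltaC; exact: H9.
apply: (le_trans (hC u (i0 n) _ u0u ud)); rewrite lee_fin.
have up : 0 < u by exact: lt_le_trans u0u.
rewrite -mulrA ler_wpM2l ?(ltW C0)//.
have n2 : 0 < (n ^ d)%:R ^+ 2 :> R by rewrite exprn_gt0// ltr0n expn_gt0 n0.
have pu : 0 < 2 `^ theta * u `^ theta by rewrite mulr_gt0 ?powR_gt0.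
rewrite powRN -ler_pdivrMl ?powR_gt0// -invfM lef_pV2 ?posrE//.
have -> : (n ^ d)%:R ^+ 2 = (n%:R `^ k) `^ theta.
  rewrite -powRrM /k mulfVK ?gt_eqF// mulrC powRrM powR_mulrn// -natrX powR_mulrn// natrX.
  by rewrite natrX -!exprM mulnC.
rewrite -powRM ?(ltW up)//; apply: ge0_ler_powR; rewrite ?nnegrE ?powR_ge0 ?(ltW th0)//.
  by rewrite mulr_ge0// ltW.
lra.
Qed.

End far_site.

(** * Markov's inequality for conditional expectations, and elementary bounds *)

Section auxiliary.
Variable R : realType.
Notation mu := (@lebesgue_measure R).
Local Notation I := (`[0, 1]%classic : set R).
Let mI : measurable (I : set (measurableTypeR R)). Proof. exact: measurable_itv. Qed.

Lemma cont01_sqi (f : R -> R) :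
  (forall t, 0 <= t <= 1 -> forall z : R, 0 < z -> exists2 dl : R, 0 < dl &
    forall s, 0 <= s <= 1 -> `|s - t| < dl -> `|f s - f t| <= z) -> sqi mu I f.
Proof.
move=> hf; have m01 : Num.max (0 : R) 1 = 1 by rewrite (max_idPr ler01).
pose c (t : R) := Num.max 0 (Num.min t 1).
have c01 t : 0 <= c t <= 1 by rewrite /c le_max lexx/= ge_max ler01 ge_min lexx orbT.
have cid t : I t -> c t = t.
  by rewrite /= in_itv/= /c => /andP[t0 t1]; rewrite (min_idPl t1) (max_idPr t0).
have clip s t : `|c s - c t| <= `|s - t|.
  have mono x y : x <= y -> 0 <= c y - c x <= y - x.
    rewrite /c => xy; case: (leP x 1) => x1; case: (leP y 1) => y1.
    - by case: (leP 0 x) => x0; case: (leP 0 y) => y0; apply/andP; split; lra.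
    - by case: (leP 0 x) => x0; rewrite m01; apply/andP; split; lra.
    - lra.
    - by rewrite m01; apply/andP; split; lra.
  have [st|ts] := leP s t.
    by have /andP[h1 h2] := mono _ _ st; rewrite distrC (distrC s) !ger0_norm ?subr_ge0//; lra.
  by have /andP[h1 h2] := mono _ _ (ltW ts); rewrite !ger0_norm ?subr_ge0//; lra.
have cF : continuous (fun t => f (c t)).
  move=> t; apply/cvgrPdist_le => z z0; have [dl dl0 h] := hf (c t) (c01 t) z z0.
  exists dl => //= s st; rewrite distrC; apply: h => //.
  by apply: le_lt_trans (clip s t) _; rewrite distrC.
have sF : sqi mu I (fun t => f (c t)).
  split.
    by apply: (@measurable_funS _ _ (measurableTypeR R) _ setT) => //; exact: continuous_measurable_fun.
  apply: itg_cont_seg => t; apply: (@continuous_comp _ _ _ (fun t => f (c t)) (fun x => x ^+ 2)); first exact: cF.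
  exact: exprn_continuous.
by apply: (eq_sqi _ _ sF) => // t It; rewrite cid.
Qed.

Lemma ssq_knots p (beta : R -> R) : (0 < p)%N -> sqi mu I beta ->
  ssq (knot_vec p beta) <= 2 * dot mu I beta beta + 2 * om p beta.
Proof.
move=> p0 sb; set u := knot_vec p beta; pose s := step (fun j => u j 0).
have ss : sqi mu I s by exact: sqi_step.
have -> : ssq u = dot mu I s s by rewrite dot_step// /ssq; under eq_bigr do rewrite expr2.
have s1 := sqiB mI sb ss.
have e1 : dot mu I s s <= 2 * dot mu I beta beta + 2 * dot mu I (fun t => beta t - s t) (fun t => beta t - s t).
  have s2 := sqiB mI ss (sqiZ mI 2 sb).
  have : 0 <= dot mu I (fun t => s t - 2 * beta t) (fun t => s t - 2 * beta t) by exact: dot_ge0.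
  have sb2 := sqiZ mI 2 sb.
  rewrite (dotBl mI ss sb2 s2) (dotBr mI ss sb2 ss) (dotBr mI ss sb2 sb2).
  rewrite (dotZr mI 2 sb ss) (dotZl mI 2 sb sb2) (dotZr mI 2 sb sb) (dotZl mI 2 sb ss).
  rewrite (dotBl mI sb ss s1) (dotBr mI sb ss sb) (dotBr mI sb ss ss) (dotC mu I s beta).
  move: (dot mu I s s) (dot mu I beta s) (dot mu I beta beta) => x y z; lra.
exact: e1.
Qed.

End auxiliary.

Section conditional.
Context dO (Omega : measurableType dO) (R : realType) (P : probability Omega R).

(** On an event [A] of the conditioning sigma-algebra the conditional expectation has
    the same integral as the variable, and Markov's inequality applies; the
    complement of [A] counts only through its probability. *)
Lemma cond_markov (G : set (set Omega)) (W Z : Omega -> \bar R) (A : set Omega) (B p t : R) :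
  (forall A, G A -> measurable A) -> cond_exp_version P G W Z -> G A ->
  (P (~` A) <= p%:E)%E -> (\int[P]_(w in A) W w <= B%:E)%E -> 0 < t ->
  (P [set w | (t%:E < `|Z w|)%E] <= (p + B / t)%:E)%E.
Proof.
move=> mG [mZ Z0 hZ] GA PA hB t0; have mA := mG _ GA.
have mZ' : measurable_fun setT Z by move=> _ C mC; rewrite setTI; exact: mG (mZ _ mC).
pose S := [set w | (t%:E < `|Z w|)%E].
have SE : S = [set w | (t%:E < Z w)%E].
  by apply/seteqP; split=> w; rewrite /S /= gee0_abs.
have mS : measurable S.
  rewrite SE (_ : [set w | _] = setT `&` [set w | (t%:E < Z w)%E]); last by rewrite setTI.
  exact: emeasurable_fun_o_infty.
have h1 : (t%:E * P (A `&` S) <= B%:E)%E.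
  apply: le_trans hB; rewrite -(hZ _ GA) -integral_cst//; last exact: measurableI.
  apply: (@le_trans _ _ (\int[P]_(w in A `&` S) Z w)%E).
    apply: ge0_le_integral => //; first exact: measurableI.
    - by move=> w _; rewrite lee_fin ltW.
    - exact: measurable_funTS.
    - by move=> w [_]; rewrite SE => /ltW.
  apply: ge0_subset_integral => //; [exact: measurableI|exact: measurable_funTS].
have h2 : (P (A `&` S) <= (B / t)%:E)%E.
  have fS : P (A `&` S) \is a fin_num by apply: fin_num_measure; exact: measurableI.
  move: h1; rewrite -(fineK fS) -EFinM !lee_fin => h1.
  by rewrite ler_pdivlMr// mulrC.
apply: (@le_trans _ _ (P (~` A `|` (A `&` S)))).
  apply: le_measure; rewrite ?inE//.
    by apply: measurableU; [exact: measurableC|exact: measurableI].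
  by move=> w Sw; have [Aw|Aw] := pselect (A w); [right|left].
apply: (le_trans (measureU2 _ _ _)); [exact: measurableC|exact: measurableI|].
by rewrite EFinD; apply: leeD.
Qed.

Lemma variance_le (W : Omega -> R) (v : R) : itg P setT W -> itg P setT (fun w => (W w - rint P setT W) ^+ 2) ->
  ('V_P[W] <= v%:E)%E -> rint P setT (fun w => (W w - rint P setT W) ^+ 2) <= v.
Proof.
move=> iW i2 hv; rewrite -lee_fin (EFin_rint measurableT i2); apply: le_trans hv.
rewrite /variance unlock unlock le_eqVlt; apply/orP; left; apply/eqP.
by apply: eq_integral => w _; rewrite /= expr2.
Qed.

End conditional.

Section more_rates.
Variable R : realType.

Lemma rest_rate (N p cst level om K U U1 : R) : 1 <= N -> 0 <= cst -> 0 <= level -> level <= 2 * K * N -> 0 <= U -> U <= U1 ->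
  N ^+ 2 <= p -> 0 <= K -> om * N <= 1 ->
  2 * (cst / p * (4 * (level + U))) + 2 * om <= (8 * cst * (2 * K + U1) + 2) / N.
Proof.
move=> N1 c0 l0 lK U0 U1' pN K0 oN.
have N0 : 0 < N by exact: lt_le_trans N1.
have p0 : 0 < p by apply: lt_le_trans pN; exact: exprn_gt0.
have h1 : level + U <= (2 * K + U1) * N.
  rewrite mulrDl lerD// (le_trans U1')// ler_peMr// (le_trans U0)//.
have h2 : om <= N^-1 by rewrite -[leRHS]div1r ler_pdivlMr.
have -> : (8 * cst * (2 * K + U1) + 2) / N = 8 * cst * ((2 * K + U1) / N) + 2 * N^-1 by ring.
apply: lerD; last by rewrite ler_wpM2l.
rewrite (_ : 2 * _ = 8 * cst * ((level + U) / p)); last by ring.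
have c8 : 0 <= 8 * cst by exact: mulr_ge0.
rewrite (ler_wpM2l c8)// ler_pdivrMr//; apply: (le_trans h1); rewrite -mulrA.
have KU : 0 <= 2 * K + U1 by rewrite addr_ge0 ?mulr_ge0// (le_trans U0).
by rewrite (ler_wpM2l KU)// mulrC ler_pdivlMr// -expr2.
Qed.

End more_rates.

(** * The good event *)

Section model.
Variables (R : realType) (dO : measure_display) (Omega : measurableType dO) (P : probability Omega R).
Variables (d m : nat) (hd : (1 <= d)%N) (hm : (1 <= m)%N).
Variables (X : site d -> Omega -> R -> R) (Y eps : site d -> Omega -> R).
Variables (beta0 : R) (beta : R -> R) (Xgen : Omega -> R -> R) (Ygen : Omega -> R).
Hypotheses (hX : forall i, random_function P (X i)) (hY : forall i, measurable_fun setT (Y i)).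
Hypotheses (heps : forall i, measurable_fun setT (eps i)) (hXgen : random_function P Xgen).
Hypothesis hmodel : forall i, {ae P, forall w, Y i w = beta0 + ip beta (X i w) + eps i w}.
Hypothesis heps_mean : forall i, 'E_P[eps i]%E = 0%:E.
Hypothesis hlaw : forall i, same_law P (pair_coord (X i) (Y i)) (pair_coord Xgen Ygen).
Variables (lam : nat -> R) (zeta : nat -> R -> R).
Hypothesis hlam : cov_eigensystem P Xgen lam zeta.
Variable betam : R -> R.
Hypotheses (H1a : is_nth_derivative01 m beta betam) (H1b : in_L2 betam).
Variable C3 : R.
Hypothesis hC3 : 0 < C3.
Hypothesis H4 : forall n, (1 <= n)%N -> forall j l : nat,
    let c i j w := ip (centered (X i) (mean_fun P Xgen) w) (zeta j) in
    let cgen j w := ip (centered Xgen (mean_fun P Xgen) w) (zeta j) in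
    ('V_P[fun w => ((n ^ d)%:R^-1 *
        \sum_(k < n ^ d) c (lex_site k) j w * c (lex_site k) l w)%R] <=
     (C3 / (n ^ d)%:R)%:E *
       'E_P[fun w => (cgen j w ^+ 2)%R] *
       'E_P[fun w => (cgen l w ^+ 2)%R])%E.
Variable M1 : R.
Hypothesis hM1 : 0 < M1.
Hypothesis H5c : indep_sigma P
              (sigma_field (fun i (_ : unit) => eps i) setT)
              (sigma_field (fun i => fun_coord (X i)) setT).
Hypothesis H5d : {ae P, forall w, (ereal_sup (range (fun i => `|eps i w|%:E)) < M1%:E)%E}.
Variable M2 : R.
Hypotheses (hM2 : 0 < M2) (H7 : forall i, {ae P, forall w, (L2norm (X i w) < M2%:E)%E}).
Variables (g Psi : R -> R).
Hypothesis hg : forall s, s \in `[0, 1] -> 0 < g s.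
Hypothesis hPsi0 : forall s, 0 <= s -> 0 <= Psi s.
Hypothesis hPsi_decr : forall s t, 0 <= s -> s <= t -> Psi t <= Psi s.
Hypothesis H8a : forall i t, t \in `[0, 1] -> (X i)^~ t \in Lfun P 2%:E.
Hypothesis H8b : forall n (k l : 'I_(n ^ d)) t u, t \in `[0, 1] -> u \in `[0, 1] ->
              covariance P ((X (lex_site k))^~ t) ((X (lex_site l))^~ u) =
              (g `|t - u| * Psi (delta [set lex_site k] [set lex_site l]))%:E.
Hypothesis H8c : Psi 0 = 1.
Hypothesis H8d : (\sum_(1 <= t <oo) (t%:R ^+ d.-1 * Psi t%:R)%:E < +oo)%E.
Variables (theta : R) (i0 : nat -> site d).
Hypothesis H9 : forall n, (1 <= n)%N ->
    (Num.floor (n%:R `^ (2 * d%:R / theta)))%:~R <=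
      delta [set i0 n] (@grid d n) :> R.
Hypothesis htheta : d%:R < theta.
Hypotheses (H10a : mixing_rate P (fun i (_ : unit) => eps i) theta)
  (H10b : mixing_rate P (fun i => pair_coord (X i) (Y i)) theta).
Hypothesis H13 : (\sum_(0 <= j <oo) (lam j `^ (4^-1))%:E < +oo)%E.

Notation mu := (@lebesgue_measure R).
Local Notation I := (`[0, 1]%classic : set R).
Local Notation E := (rint P setT).
Local Notation mn := (mean_fun P Xgen).
Local Notation V i := (centered (X i) mn).
Let mI : measurable (I : set (measurableTypeR R)). Proof. exact: measurable_itv. Qed.
Let jX i : jm (X i). Proof. by have [] := hX i. Qed.
Let smn : sqi mu I mn. Proof. by eapply mn_sqi; eassumption. Qed.
Let g00 : 0 <= g 0. Proof. by apply: ltW; eapply g0_gt0; eassumption. Qed.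
Let jV i : jm (V i). Proof. by eapply Xc_jm; eassumption. Qed.
Let sV i t : I t -> sqi P setT (V i ^~ t). Proof. by move=> It; eapply Xc_sqi; eassumption. Qed.
Let hK i t u : I t -> I u -> E (fun w => V i w t * V i w u) = g `|t - u|.
Proof. by move=> It Iu; eapply E_Xc; eassumption. Qed.
Let hKg t u : I t -> I u -> E (fun w => centered Xgen mn w t * centered Xgen mn w u) = g `|t - u|.
Proof. by move=> It Iu; eapply E_Xgc; eassumption. Qed.
Let sVg t : I t -> sqi P setT (centered Xgen mn ^~ t). Proof. by move=> It; eapply Xgc_sqi; eassumption. Qed.
Let jVg : jm (centered Xgen mn). Proof. by eapply Xgc_jm; eassumption. Qed.
Let hKG n (k l : 'I_(n ^ d)) t u : I t -> I u -> E (fun w => V (lex_site k) w t * V (lex_site l) w u) =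
  g `|t - u| * Psi (dist2 (lex_site k) (lex_site l)).
Proof. by move=> It Iu; eapply E_Xc_grid; eassumption. Qed.
Let sz a : sqi mu I (zeta a). Proof. by eapply zeta_sqi; eassumption. Qed.
Let one a b : dot mu I (zeta a) (zeta b) = (a == b)%:R. Proof. by eapply zeta_one; eassumption. Qed.
Let complete f : sqi mu I f -> (forall a, dot mu I f (zeta a) = 0) -> {ae mu, forall t, I t -> f t = 0}.
Proof. by move=> sf f0; eapply zeta_complete; eassumption. Qed.
Let dec a : lam a.+1 <= lam a. Proof. by eapply lam_decr; eassumption. Qed.
Let eig a : {ae mu, forall t, I t -> rint mu I (fun u => zeta a u * g `|t - u|) = lam a * zeta a t}.
Proof. by eapply cov_eig; eassumption. Qed.

Let e i w := clip M1 (eps i w).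
Let me i : measurable_fun setT (e i). Proof. exact: clip_measurable. Qed.
Let eM i w : `|e i w| <= M1. Proof. by apply: clip_le; exact: ltW. Qed.

Let eps_le : {ae P, forall w, forall i, eps i w = e i w}.
Proof.
apply: (aeS H5d) => w h i; rewrite /e clip_id//.
rewrite -lee_fin; apply: le_trans (ltW h); apply: ereal_sup_ubound; by exists i.
Qed.

Let model i : {ae P, forall w, Y i w = beta0 + ip beta (X i w) + e i w}.
Proof. by apply: (aeS2 (hmodel i) eps_le) => w -> ->. Qed.

Let e0 i : E (e i) = 0.
Proof.
have <- : E (eps i) = 0 by have := heps_mean i; rewrite unlock /rint /Rintegral => ->.
by apply: ae_eq_rint => //; apply: (aeS eps_le) => w h _; rewrite h.
Qed.

Let hvar n (a b : nat) : (0 < n)%N ->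
  let f w := avg (fun k : 'I_(n ^ d) => dot mu I (V (lex_site k) w) (zeta a) * dot mu I (V (lex_site k) w) (zeta b)) - (a == b)%:R * lam a in
  itg P setT (fun w => f w ^+ 2) /\ E (fun w => f w ^+ 2) <= C3 / (n ^ d)%:R * lam a * lam b.
Proof.
move=> n0 f; have N0 : (0 < n ^ d)%N by rewrite expn_gt0 n0.
have [M M0 VM] : exists2 M : R, 0 < M & forall i,
  {ae P, forall w, sqi mu I (V i w) /\ dot mu I (V i w) (V i w) <= M ^+ 2}.
  by eapply Xc_bounded; eassumption.
have l2V i : l2p P (V i) (g 0) by apply: (l2pU g00 (jV i) (@sV i) (@hK i)).
pose W w := avg (fun k : 'I_(n ^ d) => dot mu I (V (lex_site k) w) (zeta a) * dot mu I (V (lex_site k) w) (zeta b)).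
have ck (k : 'I_(n ^ d)) c : sqi P setT (fun w => dot mu I (V (lex_site k) w) (zeta c)).
  by have [] := l2p_dot (l2V (lex_site k)) (sz c).
have cM (k : 'I_(n ^ d)) w c : sqi mu I (V (lex_site k) w) -> dot mu I (V (lex_site k) w) (V (lex_site k) w) <= M ^+ 2 ->
    `|dot mu I (V (lex_site k) w) (zeta c)| <= M.
  move=> s b'; rewrite -ler_sqr ?nnegrE ?(ltW M0)// real_normK ?num_real//; apply: le_trans b'.
  by apply: (le_trans (CS mI s (sz c))); rewrite one eqxx mulr1.
have [k|iW eW] := @E_avg _ _ _ P (n ^ d)%N (fun k w => dot mu I (V (lex_site k) w) (zeta a) * dot mu I (V (lex_site k) w) (zeta b)).
  exact: (sqiM_itg measurableT (ck k a) (ck k b)).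
have eW' : E W = (a == b)%:R * lam a.
  rewrite eW -[RHS](avg_cst N0); apply: eq_avg => k.
  rewrite (E_scores g00 (jV _) (@sV _) (@hK _) sz one eig).
  by case: eqVneq => [->|]; rewrite ?mul0r.
have mW : measurable_fun setT W by exact: itg_meas iW.
have i2 : itg P setT (fun w => (W w - E W) ^+ 2).
  apply: (@itg_ae_bnd _ _ _ P _ ((M * M + `|E W|) ^+ 2)).
    by apply: measurable_funX; apply: measurable_funB => //; exact: measurable_cst.
  apply: (aeS (all_sites (fun k : 'I_(n ^ d) => VM (lex_site k)))) => w hw.
  have MM0 : 0 <= M * M by rewrite mulr_ge0// ltW.
  rewrite normrX lerXn2r ?nnegrE ?addr_ge0//.
  apply: (le_trans (ler_normB _ _)); rewrite lerD2r -[leRHS](avg_cst N0).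
  rewrite /W /avg normrM ger0_norm ?invr_ge0// ler_wpM2l ?invr_ge0//.
  apply: (le_trans (ler_norm_sum _ _ _)); apply: ler_sum => k _.
  by have [s b'] := hw k; rewrite normrM; apply: ler_pM => //; exact: cM.
split; first by rewrite /f -eW'.
rewrite /f -eW'; apply: (variance_le iW i2).
have vb : ('E_P[fun w => (ip (centered Xgen mn w) (zeta b) ^+ 2)%R] = (lam b)%:E)%E.
  rewrite -(E_score2 g00 jVg (@sVg) (@hKg) sz one eig b) (EFin_rint measurableT); first by rewrite unlock.
  by have [[_ ?] _] := l2p_dot (l2pU g00 jVg (@sVg) (@hKg)) (sz b).
have va : ('E_P[fun w => (ip (centered Xgen mn w) (zeta a) ^+ 2)%R] = (lam a)%:E)%E.
  rewrite -(E_score2 g00 jVg (@sVg) (@hKg) sz one eig a) (EFin_rint measurableT); first by rewrite unlock.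
  by have [[_ ?] _] := l2p_dot (l2pU g00 jVg (@sVg) (@hKg)) (sz a).
by have := H4 n0 a b; rewrite /= va vb -!EFinM.
Qed.

Let indep M p n (k l : 'I_(n ^ d)) a : 0 < M -> (0 < p)%N ->
  E (fun w => e (lex_site k) w * e (lex_site l) w * (yscore p zeta M (V (lex_site k) w) a * yscore p zeta M (V (lex_site l) w) a)) =
  E (fun w => e (lex_site k) w * e (lex_site l) w) * E (fun w => yscore p zeta M (V (lex_site k) w) a * yscore p zeta M (V (lex_site l) w) a).
Proof.
move=> M0 p0.
have knI (j : 'I_p) : 0 <= (knot p j.+1 : R) <= 1 by rewrite (knot_ge0 _ p0) (knot_le1 _ p0).
pose F := fun ik : site d * unit => (fun i (_ : unit) => eps i) ik.1 ik.2.
pose F' := fun ik : site d * @unit_interval R => (fun i => fun_coord (X i)) ik.1 ik.2.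
have mF i : (setT `*` setT) i -> measurable_fun setT (F i) by move=> _; exact: heps.
have mF' i : (setT `*` setT) i -> measurable_fun setT (F' i).
  by case: i => i [t t01] _; apply: (jm_at (t := t)) => //; rewrite /= in_itv.
have mU : measurable_fun (setT : set (sigma_space (setT `*` setT) F)) (fun w => e (lex_site k) w * e (lex_site l) w).
  by apply: measurable_funM; apply: clip_measurable => //;
    [exact: (@coord_measurable _ Omega R _ (setT `*` setT) F (lex_site k, tt) (conj Logic.I Logic.I))|
     exact: (@coord_measurable _ Omega R _ (setT `*` setT) F (lex_site l, tt) (conj Logic.I Logic.I))].
have my (i : site d) : measurable_fun (setT : set (sigma_space (setT `*` setT) F')) (fun w => yscore p zeta M (V i w) a).
  apply: (@yscore_measurable R zeta sz p M _ (sigma_space (setT `*` setT) F') (V i)) => j.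
  apply: measurable_funB; last exact: measurable_cst.
  pose t : @unit_interval R := exist (fun t : R => is_true (0 <= t <= 1)) (knot p j.+1) (knI j).
  exact: (@coord_measurable _ Omega R _ (setT `*` setT) F' (i, t) (conj Logic.I Logic.I)).
have mV := measurable_funM (my (lex_site k)) (my (lex_site l)).
have M10 : 0 < M1 ^+ 2 by exact: exprn_gt0.
have M20 : 0 < M ^+ 2 by exact: exprn_gt0.
apply: (indep_E mF mF' mU mV M10 M20) => // w.
  by rewrite normrM expr2; apply: ler_pM => //; exact: eM.
by rewrite normrM expr2; apply: ler_pM => //; apply: clip_le; exact: ltW.
Qed.

Let noise_sum : exists L1 : R, forall n (k : 'I_(n ^ d)),
  \sum_(l < n ^ d) `|E (fun w => e (lex_site k) w * e (lex_site l) w)| <= L1.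
Proof.
apply: (noise_cov_sum hd htheta _ H10a hM1 eM _ e0) => // i L Li.
apply: clip_measurable => //.
exact: (@coord_measurable _ Omega R _ (L `*` setT) (fun ik : site d * unit => (fun i (_ : unit) => eps i) ik.1 ik.2) (i, tt) (conj Li Logic.I)).
Qed.

Let curve_sum : exists L0 : R, 0 <= L0 /\ forall n (k : 'I_(n ^ d)),
  \sum_(l < n ^ d) Psi (dist2 (lex_site k) (lex_site l)) <= L0.
Proof.
have [i _|B hB] := @partial_sums_bounded R (fun t => t%:R ^+ d.-1 * Psi t%:R) 1 _ H8d.
  by rewrite mulr_ge0 ?exprn_ge0// hPsi0.
have B0 : 0 <= B by apply: le_trans (hB 0%N); rewrite big_geq.
have Psi00 : 0 <= Psi 0 by rewrite hPsi0.
exists (Psi 0%:R + 2 * d%:R * 3 ^+ d.-1 * B); split.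
  by rewrite addr_ge0// !mulr_ge0.
move=> n k.
have := @grid_sum R d (fun t => Psi t%:R) B n k hd (fun i => hPsi0 (ler0n _ _)) (fun i => hPsi_decr (ler0n _ _) _) hB.
have dd i : (i%:R : R) <= i.+1%:R by rewrite ler_nat.
move=> /(_ dd) h; apply: le_trans h.
by apply: ler_sum => l _; apply: hPsi_decr => //; exact: supdist_dist2.
Qed.

Let eig_sum : exists S : R, forall n, \sum_(a < n) lam a `^ 4^-1 <= S.
Proof.
have [i _|S hS] := @partial_sums_bounded R (fun j => lam j `^ 4^-1) 0 _ H13; first exact: powR_ge0.
by exists S => n; rewrite -(big_mkord xpredT (fun a => lam a `^ 4^-1)).
Qed.

Let beta_cont t : 0 <= t <= 1 -> forall z : R, 0 < z -> exists2 dl : R, 0 < dl &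
    forall s, 0 <= s <= 1 -> `|s - t| < dl -> `|beta s - beta t| <= z.
Proof.
move=> t01 z z0; have [b [b0 bd bm]] := H1a.
have h := deriv_on_cont (derivative01_deriv_on (bd 0%N hm)) t01 z0.
have bE s : 0 <= s <= 1 -> b 0%N s = beta s by move=> s01; apply: b0; rewrite in_itv.
have [dl dl0 hh] := h; exists dl => // s s01 st; rewrite -!bE//; exact: hh.
Qed.

Let sbeta : sqi mu I beta. Proof. exact: cont01_sqi. Qed.

Local Notation bhat n p rho D := (fun w => beta_hat (p := p) (X ^~ w) (Y ^~ w) n m rho D).
Local Notation b0hat n p rho D := (fun w => beta0_hat (p := p) (X ^~ w) (Y ^~ w) n m rho D).
Local Notation W n p rho D := (fun w => (prediction (p := p) (X ^~ w) (Y ^~ w) n m rho D (X (i0 n) w) -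
  (beta0 + ip beta (X (i0 n) w))) ^+ 2).

(** The good event is observable from the estimators: the values of the
    estimated slope at the knots are the coordinates of [beta_hat_vec]. *)
Let good_event_sigma n p J rho (D : 'I_p -> R -> R) c : (0 < n)%N -> (m <= p)%N -> natural_spline_basis m D -> 0 < rho ->
  sigma_of setT (pair_coord (bhat n p rho D) (b0hat n p rho D)) (@good_event _ _ R d n m p J X Y rho D beta lam zeta c).
Proof.
move=> n0 mp hD rho0; have p0 : (0 < p)%N by exact: leq_trans mp.
have knI (j : 'I_p) : 0 <= (knot p j.+1 : R) <= 1 by rewrite (knot_ge0 _ p0) (knot_le1 _ p0).
pose F := pair_coord (bhat n p rho D) (b0hat n p rho D).
pose T := sigma_space setT F.
have mx : mmx (T := T) (fun w => beta_hat_vec (X ^~ w) (Y ^~ w) n m rho D - knot_vec p beta).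
  apply: mmxD; last exact: mmx_cst.
  move=> j i; rewrite (ord1 i).
  pose t : @unit_interval R := exist (fun t : R => is_true (0 <= t <= 1)) (knot p j.+1) (knI j).
  have h := @coord_measurable _ Omega R _ setT F (Some t) Logic.I.
  rewrite (_ : (fun w => _) = F (Some t))//; apply/funext => w.
  by rewrite /F /= /fun_coord /= beta_hatE// (spline_eval_knot hm mp hD).
have mth := theta_measurable m J rho D lam sz mx.
have := mth measurableT _ (measurable_itv `]-oo, c]).
by rewrite setTI (_ : _ @^-1` _ = good_event n m J X Y rho D beta lam zeta c).
Qed.

(** The event is [theta_of (bhat - beta) <= K * b], with [K] equal to [t] plus a
    multiple of the penalty of [beta]. A large [t] makes its complement unlikely, and
    only affects the constant [K4] of the prediction error. The bound [pmin n] on the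
    number of knots makes the discretisation error of the curves at most [N ^- 4] in
    root mean square, and that of the slope at most [N^-1] after squaring, where [N]
    is the number of sites. *)
Theorem good_event_exists : exists K1 K2 : R, exists pmin : nat -> nat, [/\ 0 <= K1, 0 <= K2 &
  forall t, 0 < t -> exists K4 : R, exists n1 : nat, 0 <= K4 /\
  forall n p rho (D : 'I_p -> R -> R), (n1 <= n)%N -> (1 <= n)%N -> (pmin n <= p)%N ->
    natural_spline_basis m D -> 0 < rho -> rho <= 1 -> rho^-1 <= 2 * (n ^ d)%:R ->
    let b := ((n ^ d)%:R * rho)^-1 in b <= 1 -> rho <= 4 * b ->
    let J := Num.truncn (Num.sqrt (n ^ d)%:R : R) in
    exists A, [/\ (m <= p)%N, sigma_of setT (pair_coord (bhat n p rho D) (b0hat n p rho D)) A,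
      (P (~` A) <= (K1 / t + K2 * ((J%:R + 1)^-1 + b))%:E)%E &
      (\int[P]_(w in A) (W n p rho D w)%:E <= (K4 * b)%:E)%E]].
Proof.
have [M M0 VM] : exists2 M : R, 0 < M & forall i,
  {ae P, forall w, sqi mu I (V i w) /\ dot mu I (V i w) (V i w) <= M ^+ 2}.
  by eapply Xc_bounded; eassumption.
have [L1 hL1] := noise_sum; have [L0 [L00 hL0]] := curve_sum; have [S hS] := eig_sum.
have L10 : 0 <= L1.
  have k : 'I_(1 ^ d) by rewrite exp1n; exact: ord0.
  by apply: le_trans (hL1 _ k); exact: sumr_ge0.
have [Ca [Ca0 [n1 hCa]]] := far_site_mixing hd htheta H10b H9.
have [b [bb0 bd bm]] := H1a.
have sbm : sqi mu I (b m).
  have sm : sqi mu I betam by apply/in_L2_sqi.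
  by apply: (eq_sqi _ _ sm) => // t It; rewrite bm.
pose Su := 2 * dot mu I beta beta + 2.
pose U1 := Su + dot mu I (b m) (b m).
have Su0 : 0 <= Su by rewrite addr_ge0// mulr_ge0// dot_ge0.
have U10 : 0 <= U1 by rewrite addr_ge0// dot_ge0.
have [S40 S20] : 0 <= S ^+ 4 /\ 0 <= S ^+ 2 by split; exact: exprn_even_ge0.
have M10 := ltW hM1.
have M1s : 0 <= M1 ^+ 2 by exact: sqr_ge0.
have C30 := ltW hC3.
pose K1 := 16 * g 0 + 16 * Su + 64 * L1 * S ^+ 2 + 128 * L1 + 96 * M1 ^+ 2 * (S ^+ 4 + 2) + 8 * L1.
pose K2a := 12 * S ^+ 4 + 48 + 2 * g 0 * L0 + 8 * M.
pose K2 := K2a / 4^-1 + C3 * S ^+ 4 / 16^-1.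
pose z n : R := ((n ^ d)%:R ^+ 4)^-1.
have /choice[pmin hpmin] : forall n, exists P0, (1 <= n)%N -> forall p, (P0 <= p)%N ->
    [/\ (m <= p)%N, ((n ^ d) ^ 2 <= p)%N, forall s, 0 <= s <= p%:R^-1 -> 2 * (g 0 - g s) <= z n ^+ 2 &
      om p beta * (n ^ d)%:R <= 1].
  move=> n; have [n0|n0] := posnP n; first by exists 0%N; rewrite n0.
  have N0 : 0 < (n ^ d)%:R :> R by rewrite ltr0n expn_gt0 n0.
  have z0 : 0 < z n ^+ 2 by rewrite exprn_gt0// invr_gt0 exprn_gt0.
  have [s0 s00 hs] := cov_continuous0 g00 (jV 0) (@sV 0) (@hK 0) z0.
  have Ni : 0 < ((n ^ d)%:R : R)^-1 by rewrite invr_gt0.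
  have [P1 hP1] := slope_step_error Ni sbeta beta_cont.
  exists (maxn (maxn m ((n ^ d) ^ 2)) (maxn (Num.truncn s0^-1).+1 P1)) => _ p.
  rewrite !geq_max => /andP[/andP[p1 p2] /andP[p3 p4]]; split => //.
    move=> s /andP[sp sq]; apply: hs; rewrite sp/= (le_trans sq)//.
    have p0 : (0 < p)%N by apply: leq_trans p3.
    rewrite invf_ple ?posrE ?ltr0n//; apply: ltW; apply: lt_le_trans (truncnS_gt _) _.
    by rewrite ler_nat.
  by rewrite -ler_pdivlMr// mul1r; exact: hP1.
exists K1, K2, pmin; split.
- have S42 : 0 <= S ^+ 4 + 2 by rewrite addr_ge0.
  by rewrite /K1; do ?[by [] | apply: mulr_ge0 | apply: addr_ge0].
- have h1 : 0 <= K2a.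
    have M0' := ltW M0; by rewrite /K2a; do ?[by [] | apply: mulr_ge0 | apply: addr_ge0].
  by rewrite /K2 addr_ge0// mulr_ge0// mulr_ge0.
move=> t t0; pose K := t + 128 * U1.
have K0 : 0 < K by rewrite ltr_wpDr// mulr_ge0.
have cst0 : 0 <= step_cst R m by rewrite /step_cst addr_ge0// mulr_ge0// lagrange_cst_ge0.
pose Kr := 8 * step_cst R m * (2 * K + U1) + 2.
have Kr0 : 0 <= Kr.
  have h : 0 <= 2 * K + U1 by rewrite addr_ge0// mulr_ge0// ltW.
  by rewrite /Kr addr_ge0// mulr_ge0// mulr_ge0.
pose K4 := 3 * L1 + 6 * Kr * M ^+ 2 + 48 * K * S ^+ 4 + 48 * K + 12 * K + 48 * K * M + 96 * Ca * K * M ^+ 2 +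
    6 * (K + Kr) * (g 0 * L0).
exists K4, n1; split.
  have M20 : 0 <= M ^+ 2 by exact: sqr_ge0.
  have [K0' M0'] := (ltW K0, ltW M0); have Ca0' := ltW Ca0.
  have gL : 0 <= g 0 * L0 by exact: mulr_ge0.
  have hK1 : 0 <= K + Kr by exact: addr_ge0.
  by clearbody K Kr; rewrite /K4; do ?[by [] | apply: mulr_ge0 | apply: addr_ge0].
move=> n p rho D nn1 n0 pp hD rho0 rho1 ri bn b1 rb J.
have [mp Np pz omN] := hpmin n n0 p pp.
have p0 : (0 < p)%N by exact: leq_trans mp.
have N0 : (0 < n ^ d)%N by rewrite expn_gt0 n0.
have NR : 1 <= (n ^ d)%:R :> R by rewrite ler1n.
have NR0 : 0 < (n ^ d)%:R :> R by rewrite ltr0n.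
have bn0 : 0 < bn by rewrite invr_gt0 mulr_gt0.
have z0 : 0 <= z n by rewrite invr_ge0 exprn_ge0.
have zN : z n * (n ^ d)%:R ^+ 4 <= 1 by rewrite mulVf// gt_eqF// exprn_gt0.
have sq0 : 0 <= Num.sqrt (n ^ d)%:R :> R by exact: sqrtr_ge0.
have [J1 J2] : (J%:R : R) ^+ 2 <= (n ^ d)%:R /\ (n ^ d)%:R <= ((J%:R : R) + 1) ^+ 2.
  have s2 : Num.sqrt (n ^ d)%:R ^+ 2 = (n ^ d)%:R :> R by rewrite sqr_sqrtr.
  rewrite -s2 natr1; split; rewrite ler_sqr ?nnegrE//; first by rewrite truncn_le.
  by apply: ltW; exact: truncnS_gt.
have J0 : 0 <= (J%:R : R) by [].
have JN : (J%:R : R) <= (n ^ d)%:R.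
  have [J3|J3] := leP (J%:R : R) 1; first exact: le_trans NR.
  by apply: le_trans J1; rewrite expr2 ler_peMl// ltW.
have hpsi (k l : 'I_(n ^ d)) t' : I t' -> E (fun w => V (lex_site k) w t' * V (lex_site l) w t') =
    g 0 * Psi (dist2 (lex_site k) (lex_site l)).
  by move=> It; rewrite hKG// subrr normr0.
have om0 : 0 <= om p beta by exact: dot_ge0.
have om1 : om p beta <= 1 by apply: le_trans omN; rewrite ler_peMr.
have ssu := ssq_knots p0 sbeta.
have ssu0 : 0 <= ssq (knot_vec p beta) by rewrite mulr_ge0 ?invr_ge0// sumr_ge0// => j _; exact: sqr_ge0.
have ssu1 : ssq (knot_vec p beta) <= Su by apply: (le_trans ssu); rewrite /Su lerD2l; lra.
pose U := qf (penalty_mx m D) (knot_vec p beta) (knot_vec p beta) / p%:R.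
have pR : 0 < p%:R :> R by rewrite ltr0n.
have U0 : 0 <= U by apply: le_trans (ssq_penalty hm mp hD _).
have UU1 : U <= U1.
  rewrite /U ler_pdivrMr//.
  have := @penalty_le R m p D hm mp hD (knot_vec p beta) b (fun k km => derivative01_deriv_on (bd k km)) sbm.
  move=> /(_ _)/le_trans h; apply: h.
    move=> j; rewrite mxE /kvals bb0// in_itv/= (knot_ge0 _ p0) (knot_le1 _ p0)//.
  rewrite /U1 mulrDl [dot _ _ _ _ * _]mulrC lerD2r.
  apply: (@le_trans _ _ (ssq (knot_vec p beta) * p%:R)); last by rewrite ler_wpM2r// ltW.
  by rewrite /ssq mulrC mulrA mulfV ?gt_eqF// mul1r.
have ind (k l : 'I_(n ^ d)) a : E (fun w => e (lex_site k) w * e (lex_site l) w * (yscore p zeta M (V (lex_site k) w) a * yscore p zeta M (V (lex_site l) w) a)) =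
  E (fun w => e (lex_site k) w * e (lex_site l) w) * E (fun w => yscore p zeta M (V (lex_site k) w) a * yscore p zeta M (V (lex_site l) w) a).
  exact: (@indep M p n k l a M0 p0).
have lam0 a : 0 <= lam a by apply: (lam_ge0 g00 (jV 0) (@sV 0) (@hK 0) sz one eig).
have T0 : 0 <= effdim lam J rho.
  by apply: sumr_ge0 => a _; rewrite divr_ge0// addr_ge0// ltW.
have k0 : 'I_(n ^ d) := Ordinal N0.
have TS : effdim lam J rho <= S ^+ 2 / (2 * Num.sqrt rho).
  by apply: (effdim_le N0 g00 (fun k => jV (lex_site k)) (fun k => @sV (lex_site k)) (fun k => @hK (lex_site k)) sz one eig).
have tau0 : 0 <= trace_rest J g lam by apply: (E_resid_ge0 g00 (jV 0) (@sV 0) (@hK 0) sz one eig).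
have tauS : trace_rest J g lam <= S ^+ 4 / (J%:R + 1) ^+ 3.
  by rewrite natr1; apply: (trace_tail g00 (jV 0) (@sV 0) (@hK 0) sz one complete eig J dec hS).
pose c := K * bn; have c0 : 0 < c by exact: mulr_gt0.
exists (good_event n m J X Y rho D beta lam zeta c); split; [by []|exact: good_event_sigma| |].
  have tb0 : 0 < t * bn by exact: mulr_gt0.
  have tail := theta_tail J n0 hm mp hD rho0 smn sbeta jX hY g00 (@sV) (@hK) sz one eig M0 z0 VM pz hpsi (@hL0 n) me M10 eM (@hL1 n) ind (fun a b => @hvar n a b n0) model tb0.
  have sub : ~` good_event n m J X Y rho D beta lam zeta c `<=`
      [set w | (t * bn + 32 * rho * U < theta_of m J rho D zeta lam (beta_hat_vec (X ^~ w) (Y ^~ w) n m rho D - knot_vec p beta))%R].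
    move=> w /=; rewrite /good_event /= => /negP; rewrite -ltNge; apply: le_lt_trans.
    have -> : c = t * bn + 128 * U1 * bn by rewrite /c /K; ring.
    rewrite lerD2l.
    apply: (@le_trans _ _ (32 * (4 * bn) * U1)); last by rewrite le_eqVlt; apply/orP; left; apply/eqP; ring.
    by apply: ler_pM => //; [rewrite mulr_ge0// ltW|rewrite ler_wpM2l].
  have mA : measurable (good_event n m J X Y rho D beta lam zeta c) by apply: good_event_measurable.
  apply: le_trans (le_trans _ tail) _.
    apply: ae_le_measure; [exact: measurableC| |by apply: aeW => w; exact: sub].
    rewrite (_ : [set w | _] = ~` good_event n m J X Y rho D beta lam zeta (t * bn + 32 * rho * U)).
      by apply: measurableC; apply: good_event_measurable.
    by apply/seteqP; split=> w /=; rewrite /good_event /= ltNge => /negP.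
  rewrite lee_fin; apply: lerD.
    rewrite ler_pdivrMr// (_ : K1 / t * (t * bn) = K1 * bn); last by field; rewrite gt_eqF.
    rewrite /main_error -[J.+1%:R]natr1.
    have zN2 : z n * (n ^ d)%:R ^+ 2 <= 1 by apply: le_trans zN; rewrite ler_wpM2l// ler_weXn2l.
    have mr := main_rate M1 NR J0 JN J2 rho0 rho1 om0 omN g00 ssu0 z0 zN2 L10 T0 TS tauS.
    apply: (le_trans mr).
    rewrite ler_wpM2r ?(ltW bn0)// /K1; do 4![rewrite lerD2r]; by rewrite lerD2l ler_wpM2l.
  have -> : K2 * ((J%:R + 1)^-1 + bn) = K2a * ((J%:R + 1)^-1 + bn) / 4^-1 + C3 * S ^+ 4 * ((J%:R + 1)^-1 + bn) / 16^-1.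
    by rewrite /K2; ring.
  apply: lerD.
    rewrite ler_wpM2r// /gram_error -[J.+1%:R]natr1.
    exact: (gram_rate NR J0 J1 J2 rho0 ri g00 z0 zN (ltW M0) L00 tau0 tauS).
  by rewrite ler_wpM2r// /score_error; exact: (score_rate NR J0 rho0 C30 T0 TS).
have al0 : 0 <= Ca / (n ^ d)%:R ^+ 2 by rewrite divr_ge0// ltW.
apply: (le_trans (prediction_error_bound J n0 hm mp hD rho0 smn sbeta jX hY g00 (@sV) (@hK) sz one eig M0 z0 VM pz hpsi (@hL0 n) me M10 eM (@hL1 n) model c0 (hCa n nn1 n0))).
rewrite lee_fin /prediction_bound.
have lv0 : 0 <= level rho c by rewrite divr_ge0// ltW.
have lvK : level rho c <= 2 * K * (n ^ d)%:R.
  apply: (@le_trans _ _ (K * (2 * (n ^ d)%:R))); last by rewrite mulrA [K * 2]mulrC.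
  rewrite /level /c -mulrA ler_wpM2l ?(ltW K0)//; apply: le_trans ri.
  by rewrite ler_piMl// invr_ge0 ltW.
have rl1 : rest_level m rho D beta c <= Kr / (n ^ d)%:R.
  by apply: rest_rate => //; [rewrite -natrX ler_nat|exact: ltW].
have rl0 : 0 <= rest_level m rho D beta c.
  by rewrite /rest_level addr_ge0 ?mulr_ge0// ?divr_ge0// addr_ge0.
exact: (prediction_rate NR J0 J1 J2 rho0 rho1 ri b1 L10 (ltW K0) rl0 rl1 (ltW M0) tau0 tauS z0 zN al0 (lexx _) g00 L00).
Qed.

End model.

(** * Prediction at the new site *)

Lemma rate_powers (R : realType) (x d c s : R) : 1 <= x -> 0 <= d -> 2 <= s -> c + 1 = s ->
  let r := x `^ (- (d * c / s)) in let a := x `^ (- (d / s)) in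
  [/\ x `^ d * r = a^-1, r^-1 <= x `^ d & r * a^-1 <= 1].
Proof.
move=> x1 d0 s2 cs r a; have s0 : 0 < s by lra.
have x0 : x != 0 by rewrite gt_eqF//; lra.
have ai : a^-1 = x `^ (d / s) by rewrite /a -powRN opprK.
have dc : d * c / s = d - d / s by rewrite -cs; field; rewrite cs gt_eqF.
split.
- rewrite ai /r -powRD; last by rewrite x0 implybT.
  by rewrite dc opprB addrC subrK.
- rewrite /r -powRN opprK; apply: ler_powR => //.
  by rewrite dc lerBlDr lerDl divr_ge0// ltW.
- rewrite ai /r -powRD; last by rewrite x0 implybT.
  rewrite -[leRHS](powRr0 x); apply: ler_powR => //; rewrite dc.
  have : d / s * 2 <= d by rewrite mulrAC ler_pdivrMr// ler_wpM2l.
  by move: (d / s) => y; lra.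
Qed.

Theorem theorem2
  (R : realType) (dO : measure_display) (Omega : measurableType dO)
  (P : probability Omega R)
  (d m : nat) (hd : (1 <= d)%N) (hm : (1 <= m)%N)
  (* the spatial functional linear regression model *)
  (X : site d -> Omega -> R -> R) (Y eps : site d -> Omega -> R)
  (beta0 : R) (beta : R -> R) (sigma : R)
  (Xgen : Omega -> R -> R) (Ygen : Omega -> R)
  (hX : forall i, random_function P (X i))
  (hY : forall i, measurable_fun setT (Y i))
  (heps : forall i, measurable_fun setT (eps i))
  (hXgen : random_function P Xgen)
  (hYgen : measurable_fun setT Ygen)
  (hmodel : forall i,
    {ae P, forall w, Y i w = beta0 + ip beta (X i w) + eps i w})
  (heps_mean : forall i, 'E_P[eps i]%E = 0%:E)
  (hsigma : 0 < sigma)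
  (heps_var : forall i, 'V_P[eps i]%E = (sigma ^+ 2)%:E)
  (hlaw : forall i,
    same_law P (pair_coord (X i) (Y i)) (pair_coord Xgen Ygen))
  (* the eigenelements of the covariance operator *)
  (lam : nat -> R) (zeta : nat -> R -> R)
  (hlam : cov_eigensystem P Xgen lam zeta)
  (* (1) *)
  (betam : R -> R)
  (H1 : is_nth_derivative01 m beta betam /\ in_L2 betam)
  (* (2) *)
  (kappa delta1 C1 : R)
  (hkappa : 0 < kappa < 1) (hdelta1 : 0 < delta1) (hC1 : 0 < C1)
  (H2 : forall t s, t \in `[0, 1] -> s \in `[0, 1] ->
    ((1 - delta1)%:E <=
      P [set w | (`|Xgen w t - Xgen w s| <= C1 * `|t - s| `^ kappa)%R])%E)
  (* (3) *)
  (C2 q : R) (hC2 : 0 < C2) (hq : 0 < q < 1)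
  (H3 : forall r, (1 <= r)%N -> exists L : set (R -> R),
    [/\ L2_subspace_dim r L,
        measurable_fun setT (sup_dist2 Xgen L) &
        (\int[P]_w sup_dist2 Xgen L w <= (C2 * r%:R `^ (- (2 * q)))%:E)%E])
  (* (4) *)
  (C3 : R) (hC3 : 0 < C3)
  (H4 : forall n, (1 <= n)%N -> forall j l : nat,
    let c i j w := ip (centered (X i) (mean_fun P Xgen) w) (zeta j) in
    let cgen j w := ip (centered Xgen (mean_fun P Xgen) w) (zeta j) in
    ('V_P[fun w => ((n ^ d)%:R^-1 *
        \sum_(k < n ^ d) c (lex_site k) j w * c (lex_site k) l w)%R] <=
     (C3 / (n ^ d)%:R)%:E *
       'E_P[fun w => (cgen j w ^+ 2)%R] *
       'E_P[fun w => (cgen l w ^+ 2)%R])%E)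
  (* (5) *)
  (M1 : R) (hM1 : 0 < M1)
  (H5 : [/\ strictly_stationary P (fun i (_ : unit) => eps i),
            polynomially_mixing P (fun i (_ : unit) => eps i),
            indep_sigma P
              (sigma_field (fun i (_ : unit) => eps i) setT)
              (sigma_field (fun i => fun_coord (X i)) setT) &
            {ae P, forall w,
              (ereal_sup (range (fun i => `|eps i w|%:E)) < M1%:E)%E}])
  (* (6) *)
  (H6 : strictly_stationary P (fun i => pair_coord (X i) (Y i)) /\
        polynomially_mixing P (fun i => pair_coord (X i) (Y i)))
  (* (7) *)
  (M2 : R) (hM2 : 0 < M2)
  (H7 : forall i, {ae P, forall w, (L2norm (X i w) < M2%:E)%E})
  (* (8) *)
  (g Psi : R -> R)
  (hg : forall s, s \in `[0, 1] -> 0 < g s)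
  (hPsi0 : forall s, 0 <= s -> 0 <= Psi s)
  (hPsi_decr : forall s t, 0 <= s -> s <= t -> Psi t <= Psi s)
  (H8 : [/\ forall i t, t \in `[0, 1] -> (X i)^~ t \in Lfun P 2%:E,
            forall n (k l : 'I_(n ^ d)) t u, t \in `[0, 1] -> u \in `[0, 1] ->
              covariance P ((X (lex_site k))^~ t) ((X (lex_site l))^~ u) =
              (g `|t - u| * Psi (delta [set lex_site k] [set lex_site l]))%:E,
            Psi 0 = 1 &
            (\sum_(1 <= t <oo) (t%:R ^+ d.-1 * Psi t%:R)%:E < +oo)%E])
  (* (9): the non-visited site recedes from the grid as the latter grows *)
  (theta : R) (i0 : nat -> site d)
  (hi0 : forall n, (1 <= n)%N -> ~ @grid d n (i0 n))
  (H9 : forall n, (1 <= n)%N ->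
    (Num.floor (n%:R `^ (2 * d%:R / theta)))%:~R <=
      delta [set i0 n] (@grid d n) :> R)
  (* (10) *)
  (htheta : d%:R < theta)
  (H10 : mixing_rate P (fun i (_ : unit) => eps i) theta /\
         mixing_rate P (fun i => pair_coord (X i) (Y i)) theta)
  (* (13), the part that does not involve [rho] *)
  (H13 : (\sum_(0 <= j <oo) (lam j `^ (4^-1))%:E < +oo)%E)
  (hq2 : 1 < 2 * q) :
  exists pmin : nat -> nat,
  forall (p : nat -> nat) (rho : nat -> R) (D : forall n, 'I_(p n) -> R -> R),
    (forall n, (1 <= n)%N -> (pmin n <= p n)%N) ->
    p @ \oo --> \oo ->
    (forall n, (1 <= n)%N -> natural_spline_basis m (D n)) ->
    (* (11); for [r = 0] the bound [C * r ^ (-2q)] is infinite *)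
    (forall n, (1 <= n)%N -> n%:R ^- (2 * m * d) < rho n) ->
    (exists2 C : R, 0 < C & forall n, (1 <= n)%N ->
      let r := Num.truncn (rho n `^ (- (2 * m%:R + 2 * q + 1)^-1)) in
      {ae P, forall w, exists l : 'I_(p n) -> R,
        [/\ ordered_eigenvalues (gram_mx (fun i => X i w) n (p n)) l,
            forall j, 0 <= l j &
            (1 <= r)%N ->
              \sum_(j < p n | (r <= j)%N) l j <= C * r%:R `^ (- (2 * q))]}) ->
    (* (12) *)
    (fun n => n%:R ^+ d * (p n)%:R `^ (- (2 * kappa)) : R^o) =O_\oo
      (fun=> 1 : R^o) ->
    rho @ \oo --> (0 : R) ->
    (fun n => (n%:R ^+ d * rho n)^-1) @ \oo --> (0 : R) ->
    (* (13) *)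
    (rho : nat -> R^o) ~_\oo
      (fun n => n%:R `^ (- (d%:R * (2 * m%:R + 2 * q + 1) /
                            (2 * m%:R + 2 * q + 2))) : R^o) ->
    forall Z : nat -> Omega -> \bar R,
      (forall n, (1 <= n)%N ->
        let Xn w i := X i w in
        let Yn w i := Y i w in
        let bhat w := beta_hat (Xn w) (Yn w) n m (rho n) (D n) in
        let b0hat w := beta0_hat (Xn w) (Yn w) n m (rho n) (D n) in
        let Yhat w :=
          prediction (Xn w) (Yn w) n m (rho n) (D n) (X (i0 n) w) in
        let Ystar w := beta0 + ip beta (X (i0 n) w) in
        cond_exp_version P (sigma_of setT (pair_coord bhat b0hat))
          (fun w => ((Yhat w - Ystar w) ^+ 2)%:E) (Z n)) ->
      bigO_p P Z
        (fun n => n%:R `^ (- (d%:R / (2 * m%:R + 2 * q + 2)))).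
Proof.
case: H1 => H1a H1b; case: H5 => _ _ H5c H5d; case: H8 => H8a H8b H8c H8d; case: H10 => H10a H10b.
have [K1 [K2 [pmin [K10 K20 hgood]]]] := good_event_exists hd hm hX hY heps hXgen hmodel heps_mean hlaw hlam H1a H1b
  hC3 H4 hM1 H5c H5d hM2 H7 hg hPsi0 hPsi_decr H8a H8b H8c H8d H9 htheta H10a H10b H13.
exists pmin => p rho D hp _ hD hrho _ _ rho_cvg b_cvg /eqaddoP asym Z hZ eps0 eps00.
pose t := 3 * K1 / eps0 + 1.
have t0 : 0 < t by rewrite ltr_wpDl// divr_ge0 ?mulr_ge0// ltW.
have [K4 [n1 [K40 hK4]]] := hgood t t0.
pose M := 6 * K4 / eps0 + 1.
have M0 : 0 < M by rewrite ltr_wpDl// divr_ge0 ?mulr_ge0// ltW.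
exists M => //.
pose eta := eps0 / (6 * (K2 + 1)).
have K21 : 0 < 6 * (K2 + 1) by rewrite mulr_gt0// ltr_wpDl.
have eta0 : 0 < eta by exact: divr_gt0.
have half0 : 0 < 2^-1 :> R by rewrite invr_gt0.
pose rr n : R := n%:R `^ (- (d%:R * (2 * m%:R + 2 * q + 1) / (2 * m%:R + 2 * q + 2))).
have asym' : \forall n \near \oo, `|rho n - rr n| <= 2^-1 * `|rr n| by exact: (asym _ half0).
near=> n.
have nn1 : (n1 <= n)%N by near: n; exact: nbhs_infty_ge.
have n0 : (1 <= n)%N by near: n; exact: nbhs_infty_ge.
have rho_1 : rho n <= 1.
  have : `|0 - rho n| <= 1 by near: n; move/cvgrPdist_le: rho_cvg; apply; exact: ltr01.
  by rewrite sub0r normrN; apply: le_trans; exact: ler_norm.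
have b_small : (n%:R ^+ d * rho n)^-1 <= Num.min 1 eta.
  have : `|0 - (n%:R ^+ d * rho n)^-1| <= Num.min 1 eta.
    by near: n; move/cvgrPdist_le: b_cvg; apply; rewrite lt_min ltr01.
  by rewrite sub0r normrN; apply: le_trans; exact: ler_norm.
have n_eta : eta ^- 2 <= n%:R by near: n; exact: nbhs_infty_ger.
pose s : R := 2 * m%:R + 2 * q + 2.
have : `|rho n - rr n| <= 2^-1 * `|rr n| by near: n; exact: asym'.
rewrite /rr -/s; set r : R := _ `^ _ => rho_r.
have nR : 1 <= n%:R :> R by rewrite ler1n.
have nR0 : 0 < n%:R :> R by rewrite ltr0n.
have r0 : 0 < r by exact: powR_gt0.
have [r_lo r_hi] : r / 2 <= rho n /\ rho n <= 3 / 2 * r.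
  by move: rho_r; rewrite (gtr0_norm r0) ler_norml => /andP[]; move: (rho n) => y h1 h2; split; clear -h1 h2; lra.
have rho0 : 0 < rho n by apply: lt_le_trans r_lo; exact: divr_gt0.
have q0 : 0 < q by case/andP: hq.
have m0 : 0 <= m%:R :> R by [].
have s2 : 2 <= s by rewrite /s; lra.
have s0 : 0 < s by lra.
have NE : (n ^ d)%:R = n%:R `^ d%:R :> R by rewrite natrX powR_mulrn.
pose a : R := n%:R `^ (- (d%:R / s)).
have a0 : 0 < a by exact: powR_gt0.
have nN0 : (n%:R != 0 :> R) by rewrite gt_eqF.
have N0 : 0 < (n ^ d)%:R :> R by rewrite NE powR_gt0.
have cs : 2 * m%:R + 2 * q + 1 + 1 = s by rewrite /s; ring.
have [Nr ri rrN] := rate_powers nR (ler0n R d) s2 cs.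
rewrite -NE -/r -/a in Nr; rewrite -NE -/r in ri; rewrite -/r -/a in rrN.
have rhoi : (rho n)^-1 <= 2 * (n ^ d)%:R.
  apply: (@le_trans _ _ (2 * r^-1)); last by rewrite ler_wpM2l.
  by rewrite -[2 * _](invrK) invfM invrK lef_pV2 ?posrE ?mulr_gt0// mulrC.
pose b : R := ((n ^ d)%:R * rho n)^-1.
have bE : (n%:R ^+ d * rho n)^-1 = b by rewrite /b natrX.
have b0 : 0 < b by rewrite invr_gt0 mulr_gt0.
rewrite bE le_min in b_small; have /andP[b1 b_eta] := b_small.
have b2a : b <= 2 * a.
  rewrite -[2 * a]invrK lef_pV2 ?posrE ?invr_gt0 ?mulr_gt0// invfM -Nr.
  by rewrite mulrCA ler_wpM2l// ?(ltW N0)// mulrC.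
have rho4b : rho n <= 4 * b.
  rewrite /b ler_pdivlMr ?mulr_gt0// mulrCA.
  apply: (@le_trans _ _ ((n ^ d)%:R * (3 / 2 * r * (3 / 2 * r)))).
    by rewrite ler_wpM2l ?(ltW N0)// ler_pM// ltW.
  rewrite (_ : _ * _ = 9 / 4 * (r * ((n ^ d)%:R * r))); last by field.
  by rewrite Nr; move: (r * a^-1) rrN => y hy; clear -hy; lra.
have [A [mpn GA PA WA]] := hK4 n (p n) (rho n) (D n) nn1 n0 (hp n n0) (hD n n0) rho0 rho_1 rhoi b1 rho4b.
set J := Num.truncn _ in PA.
have J_eta : (J%:R + 1 : R)^-1 <= eta.
  have J1 : eta^-1 <= J%:R + 1.
    apply: (@le_trans _ _ (Num.sqrt (n ^ d)%:R)); last by rewrite natr1 ltW// truncnS_gt.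
    rewrite -[eta^-1]ger0_norm ?invr_ge0 ?(ltW eta0)// -sqrtr_sqr ler_wsqrtr// exprVn.
    apply: (le_trans n_eta); rewrite ler_nat.
    by case: (d) hd => // d' _; rewrite expnS leq_pmulr// expn_gt0 n0.
  by rewrite -[leRHS]invrK lef_pV2 ?posrE ?invr_gt0// ltr_wpDl.
have mp : forall i, jm (X i) by move=> i; have [] := hX i.
have Ma0 : 0 < M * a by exact: mulr_gt0.
have mG B : sigma_of setT (pair_coord (fun w => beta_hat (X ^~ w) (Y ^~ w) n m (rho n) (D n))
    (fun w => beta0_hat (X ^~ w) (Y ^~ w) n m (rho n) (D n))) B -> measurable B.
  apply: sigma_of_sub => -[[t' t01]|] _ /=; last by apply: beta0_hat_measurable => //; exact: hD.
  have It : (`[0, 1]%classic : set R) t' by rewrite /= in_itv.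
  by apply: (jm_at (t := t') It); apply: beta_hat_jm => //; exact: hD.
have := cond_markov mG (hZ n n0) GA PA WA Ma0.
rewrite -/a => /le_trans; apply; rewrite lee_fin.
have h1 : K1 / t <= eps0 / 3.
  rewrite ler_pdivrMr// mulrC /t mulrDl mul1r.
  rewrite (_ : 3 * K1 / eps0 * (eps0 / 3) = K1); last by field; rewrite gt_eqF.
  by rewrite lerDl divr_ge0// ltW.
have h2 : K2 * ((J%:R + 1)^-1 + b) <= eps0 / 3.
  apply: (@le_trans _ _ ((K2 + 1) * (eta + eta))).
    have Jb0 : 0 <= (J%:R + 1)^-1 + b by rewrite addr_ge0 ?(ltW b0)// invr_ge0 addr_ge0.
    by apply: ler_pM => //; [rewrite lerDl|exact: lerD].
  have K2p : 0 < K2 + 1 by rewrite ltr_wpDl.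
  by rewrite /eta (_ : (K2 + 1) * _ = eps0 / 3)//; field; rewrite gt_eqF.
have h3 : K4 * b / (M * a) <= eps0 / 3.
  rewrite ler_pdivrMr//; apply: (@le_trans _ _ (K4 * (2 * a))); first by rewrite ler_wpM2l.
  rewrite (_ : eps0 / 3 * (M * a) = (eps0 / 3 * M) * a); last by ring.
  rewrite mulrA ler_wpM2r ?(ltW a0)//.
  rewrite (_ : eps0 / 3 * M = K4 * 2 + eps0 / 3); last by rewrite /M; field; rewrite gt_eqF.
  by rewrite lerDl divr_ge0// ltW.
by move: h1 h2 h3; rewrite -/b; move: (K1 / t) (K2 * _) (K4 * b / _) => x y w h1 h2 h3; clear -h1 h2 h3; lra.
Unshelve. all: end_near.
Qed.
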